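(* Let $R$ be a treeable measure-preserving ergodic equivalence relation of cost $t=C(R)$. Choose any increasing sequence of finite groups $\{e\}=Q_0\subset Q_1\subset Q_2\subset\cdots$ with $|Q_n|\to\infty$ and any non-negative integers $k_0,k_1,\dots$ such that $t=1+\sum_{r=0}^\infty k_r|Q_r|^{-1}$, and let $G=G(\{Q_i\},\{k_i\})$. Then there exists a measure-preserving action of $G$ such that $R=R_G$, the equivalence relation of being in the same $G$-orbit. Thus any such group $G$ is OE-free.
   Context: Definition of $G(\{Q_i\},\{k_i\})$: put $H_n=Q_n\times\mathbb{F}_{k_n}$ ($\mathbb{F}_k$ the free group on $k$ generators), define recursively $G_0=H_0$, $G_{n+1}=G_n *_{Q_n} H_{n+1}$ (amalgamated free product over $Q_n$, viewed in $G_n$ via $Q_n\subset H_n\subset G_n$ and in $H_{n+1}$ via $Q_n\subset Q_{n+1}$), and let $G(\{Q_i\},\{k_i\})=\bigcup_n G_n$. Equivalence relations are countable pmp equivalence relations on a standard probability space. A graphing of $R$ is a countable family of partial measure-preserving isomorphisms generating $R$; it is a treeing if no non-trivial reduced word in it fixes a set of points of positive measure; $R$ is treeable if it has a graphing that is a treeing. The cost of a graphing is the sum of the measures of the domains of its elements, and the cost $C(R)$ is the infimum of the costs of its graphings. A group $G$ is OE-free if for some number $t\in[1,+\infty]$, any ergodic treeable equivalence relation of cost $t$ arises as the orbit equivalence relation of a free pmp action of $G$. *)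

(* Defs.v *)
From HB Require Import structures.
From Stdlib Require Import Relations.
From mathcomp Require Import all_boot all_order all_fingroup all_algebra.
From mathcomp Require Import all_classical all_reals all_analysis.

Set Implicit Arguments.
Unset Strict Implicit.
Unset Printing Implicit Defensive.

Import Order.TTheory GRing.Theory Num.Theory.

Local Open Scope classical_set_scope.

(* A letter (s, true) stands for s and (s, false) for its formal inverse. *)
Definition word (S : Type) := seq (S * bool).

Definition inv_letter (S : Type) (a : S * bool) : S * bool := (a.1, ~~ a.2).

Definition inv_word (S : Type) (w : word S) : word S :=
  rev (map (@inv_letter S) w).

Lemma inv_wordK (S : Type) : involutive (@inv_word S).
Proof.
move=> w; rewrite /inv_word map_rev revK -map_comp -[RHS]map_id.
by apply: eq_map => -[s b]; rewrite /= /inv_letter negbK.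
Qed.

(* Non-triviality of the word is not included. *)
Definition reduced (S : eqType) (w : word S) : bool :=
  sorted (fun a b => b != inv_letter a) w.

Section Presentation.
Variables (S : choiceType) (rel : word S -> word S -> Prop).

Inductive word_eq : word S -> word S -> Prop :=
| word_eq_refl u : word_eq u u
| word_eq_sym u v : word_eq u v -> word_eq v u
| word_eq_trans v u w : word_eq u v -> word_eq v w -> word_eq u w
| word_eq_cat u u' v v' :
    word_eq u u' -> word_eq v v' -> word_eq (u ++ v) (u' ++ v')
| word_eq_cancel a : word_eq [:: a; inv_letter a] [::]
| word_eq_rel u v : rel u v -> word_eq u v.

Let word_eqb (u v : word S) : bool := `[< word_eq u v >].

Let word_eqb_refl : reflexive word_eqb.
Proof. by move=> u; apply/asboolP; exact: word_eq_refl. Qed.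

Let word_eqb_sym : symmetric word_eqb.
Proof. by move=> u v; apply/asboolP/asboolP; exact: word_eq_sym. Qed.

Let word_eqb_trans : transitive word_eqb.
Proof.
by move=> v u w /asboolP uv /asboolP vw; apply/asboolP; exact: word_eq_trans vw.
Qed.

Definition word_equiv : equiv_rel (word S) :=
  EquivRel word_eqb word_eqb_refl word_eqb_sym word_eqb_trans.

(* The group with generators S and relations u = v for rel u v. *)
Definition presented : Type := {eq_quot word_equiv}%qT.
HB.instance Definition _ := Choice.copy presented {eq_quot word_equiv}%qT.
HB.instance Definition _ := EqQuotient.copy presented {eq_quot word_equiv}%qT.

Definition word_class (w : word S) : presented := (\pi w)%qT.
Definition word_repr (x : presented) : word S := generic_quotient.repr x.

Lemma word_classP (u v : word S) : word_class u = word_class v <-> word_eq u v.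
Proof.
split=> [/eqP|uv]; first by rewrite eqmodE => /asboolP.
by apply/eqP; rewrite eqmodE; apply/asboolP.
Qed.

Lemma word_reprK (x : presented) : word_class (word_repr x) = x.
Proof. exact: reprK. Qed.

Lemma word_eq_repr (u : word S) : word_eq (word_repr (word_class u)) u.
Proof. by apply/word_classP; rewrite word_reprK. Qed.

Lemma word_eq_invr (w : word S) : word_eq (w ++ inv_word w) [::].
Proof.
elim: w => [|a w IH]; first exact: word_eq_refl.
rewrite /inv_word /= rev_cons -cats1 catA -cat1s.
apply: word_eq_trans (word_eq_cancel a).
rewrite -[[:: a; _]]/([:: a] ++ ([::] ++ [:: inv_letter a])).
apply: word_eq_cat; first exact: word_eq_refl.
by apply: word_eq_cat => //; exact: word_eq_refl.
Qed.

Lemma word_eq_invl (w : word S) : word_eq (inv_word w ++ w) [::].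
Proof. by rewrite -{2}[w]inv_wordK; exact: word_eq_invr. Qed.

Lemma word_eq_inv (u v : word S) :
  word_eq u v -> word_eq (inv_word u) (inv_word v).
Proof.
move=> uv; apply: (word_eq_trans (v := inv_word u ++ (v ++ inv_word v))).
  rewrite -[X in word_eq X _]cats0.
  apply: word_eq_cat; first exact: word_eq_refl.
  exact/word_eq_sym/word_eq_invr.
rewrite catA -[X in word_eq _ X]cat0s.
apply: word_eq_cat; last exact: word_eq_refl.
apply: word_eq_trans (word_eq_invl u).
by apply: word_eq_cat; [exact: word_eq_refl|exact: word_eq_sym].
Qed.

Definition presented_mul (x y : presented) := word_class (word_repr x ++ word_repr y).
Definition presented_inv (x : presented) := word_class (inv_word (word_repr x)).

Lemma word_class_mul (u v : word S) :
  presented_mul (word_class u) (word_class v) = word_class (u ++ v).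
Proof. by apply/word_classP/word_eq_cat; exact: word_eq_repr. Qed.

Lemma word_class_inv (u : word S) :
  presented_inv (word_class u) = word_class (inv_word u).
Proof. by apply/word_classP/word_eq_inv; exact: word_eq_repr. Qed.

Let presented_mulA : associative presented_mul.
Proof.
move=> x y z; rewrite -(word_reprK x) -(word_reprK y) -(word_reprK z).
by rewrite !word_class_mul catA.
Qed.

Let presented_1mul : left_id (word_class [::]) presented_mul.
Proof. by move=> x; rewrite -(word_reprK x) word_class_mul. Qed.

Let presented_mul1 : right_id (word_class [::]) presented_mul.
Proof. by move=> x; rewrite -(word_reprK x) word_class_mul cats0. Qed.

Let presented_Vmul : left_inverse (word_class [::]) presented_inv presented_mul.
Proof.
move=> x; rewrite -(word_reprK x) word_class_inv word_class_mul.
exact/word_classP/word_eq_invl.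
Qed.

Let presented_mulV : right_inverse (word_class [::]) presented_inv presented_mul.
Proof.
move=> x; rewrite -[LHS]presented_1mul -{1}(presented_Vmul (presented_inv x)).
rewrite -presented_mulA [X in presented_mul _ X]presented_mulA.
by rewrite presented_Vmul presented_1mul presented_Vmul.
Qed.

HB.instance Definition _ := isGroup.Build presented presented_mulA
  presented_1mul presented_mul1 presented_Vmul presented_mulV.

Definition presented_gen (s : S) : presented := word_class [:: (s, true)].

Lemma mul_word_class (u v : word S) :
  (word_class u * word_class v)%g = word_class (u ++ v).
Proof. exact: word_class_mul. Qed.

End Presentation.

Definition free_group (k : nat) : groupType :=
  presented (fun _ _ : word 'I_k => False).

Section Amalgam.
Variables (A B C : groupType).
Variables (f : {multiplicative A -> B}) (g : {multiplicative A -> C}).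

Inductive amalgam_rel : word (B + C) -> word (B + C) -> Prop :=
| amalgam_mull (x y : B) :
    amalgam_rel [:: (inl x, true); (inl y, true)] [:: (inl (x * y)%g, true)]
| amalgam_mulr (x y : C) :
    amalgam_rel [:: (inr x, true); (inr y, true)] [:: (inr (x * y)%g, true)]
| amalgam_glue (a : A) :
    amalgam_rel [:: (inl (f a), true)] [:: (inr (g a), true)].

(* The amalgamated free product B *_A C. *)
Definition amalgam : groupType := presented amalgam_rel.

Definition amalgam_inl (x : B) : amalgam := presented_gen amalgam_rel (inl x).
Definition amalgam_inr (x : C) : amalgam := presented_gen amalgam_rel (inr x).

Let amalgam_inlM : {morph amalgam_inl : x y / (x * y)%g}.
Proof.
move=> x y; rewrite /amalgam_inl /presented_gen mul_word_class.
by apply/word_classP/word_eq_sym/word_eq_rel; exact: amalgam_mull.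
Qed.

Let amalgam_inrM : {morph amalgam_inr : x y / (x * y)%g}.
Proof.
move=> x y; rewrite /amalgam_inr /presented_gen mul_word_class.
by apply/word_classP/word_eq_sym/word_eq_rel; exact: amalgam_mulr.
Qed.

HB.instance Definition _ := isMultiplicative.Build B amalgam amalgam_inl amalgam_inlM.
HB.instance Definition _ := isMultiplicative.Build C amalgam amalgam_inr amalgam_inrM.

End Amalgam.

Section Union.
Variables (G : nat -> groupType) (emb : forall n, {multiplicative G n -> G n.+1}).

Inductive union_rel : word {n & G n} -> word {n & G n} -> Prop :=
| union_mul n (x y : G n) :
    union_rel [:: (Tagged G x, true); (Tagged G y, true)]
              [:: (Tagged G (x * y)%g, true)]
| union_emb n (x : G n) :
    union_rel [:: (Tagged G x, true)] [:: (Tagged G (emb n x), true)].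

(* The colimit of G 0 -> G 1 -> ..., i.e. the union of the G n when the maps
   emb n are injective (as they are for G_n -> G_n *_{Q_n} H_{n+1} below). *)
Definition union_group : groupType := presented union_rel.

End Union.

Definition inj_left (A B : groupType) (a : A) : A * B := (a, 1%g).

Lemma inj_leftM (A B : groupType) : {morph @inj_left A B : x y / (x * y)%g}.
Proof. by move=> x y; congr pair; rewrite mulg1. Qed.

HB.instance Definition _ (A B : groupType) :=
  isMultiplicative.Build A (A * B)%type (@inj_left A B) (@inj_leftM A B).

Section Tower.
Variables (Q : nat -> finGroupType) (iota : forall n, {multiplicative Q n -> Q n.+1}).
Variable k : nat -> nat.

Definition tower_H (n : nat) : groupType := (Q n * free_group (k n))%type.

Definition Q_to_H (n : nat) : {multiplicative Q n -> tower_H n} :=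
  @inj_left (Q n) (free_group (k n)).

Definition Q_to_HS (n : nat) : {multiplicative Q n -> tower_H n.+1} :=
  Q_to_H n.+1 \o iota n.

(* G_n together with the homomorphism H_n -> G_n. *)
Fixpoint tower (n : nat) : {G : groupType & {multiplicative tower_H n -> G}} :=
  match n with
  | 0 => existT (fun G : groupType => {multiplicative tower_H 0 -> G})
           (tower_H 0) idfun
  | m.+1 =>
      let f : {multiplicative Q m -> projT1 (tower m)} :=
        projT2 (tower m) \o Q_to_H m in
      existT (fun G : groupType => {multiplicative tower_H m.+1 -> G})
        (amalgam f (Q_to_HS m)) (@amalgam_inr _ _ _ f (Q_to_HS m))
  end.

Definition tower_G (n : nat) : groupType := projT1 (tower n).

Definition tower_emb (n : nat) : {multiplicative tower_G n -> tower_G n.+1} :=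
  @amalgam_inl _ _ _ (projT2 (tower n) \o Q_to_H n) (Q_to_HS n).

Definition tower_group : groupType := union_group tower_emb.

End Tower.

Section StandardBorel.
Variables (K : realType) (d : measure_display) (T : measurableType d).

(* T is Borel isomorphic to a Polish space P. *)
Definition standard_borel : Prop :=
  exists (P : completePseudoMetricType K) (f : T -> P),
    [/\ hausdorff_space P, @second_countable P, bijective f &
        forall A : set T, measurable A <-> <<s [set U : set P | open U] >> (f @` A)].

End StandardBorel.

(* A Borel isomorphism pi_fun : pi_dom -> pi_im with inverse pi_inv; the values
   of pi_fun off pi_dom and of pi_inv off pi_im are irrelevant. *)
Record partial_iso (d : measure_display) (T : measurableType d) := PartialIso {
  pi_dom : set T ;
  pi_im : set T ;
  pi_fun : T -> T ;
  pi_inv : T -> T ;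
  pi_dom_measurable : measurable pi_dom ;
  pi_im_measurable : measurable pi_im ;
  pi_fun_measurable : measurable_fun pi_dom pi_fun ;
  pi_inv_measurable : measurable_fun pi_im pi_inv ;
  pi_fun_im : forall x, pi_dom x -> pi_im (pi_fun x) ;
  pi_inv_dom : forall y, pi_im y -> pi_dom (pi_inv y) ;
  pi_funK : forall x, pi_dom x -> pi_inv (pi_fun x) = x ;
  pi_invK : forall y, pi_im y -> pi_fun (pi_inv y) = y
}.

Section EquivalenceRelations.
Variables (K : realType) (d : measure_display) (T : measurableType d).
Variable mu : probability T K.
Local Open Scope ereal_scope.

Definition iso_preserving (phi : partial_iso T) : Prop :=
  forall A, measurable A -> A `<=` pi_dom phi -> mu (pi_fun phi @` A) = mu A.

Record pmp_equivalence (E : T -> T -> Prop) : Prop := PmpEquivalence {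
  pmp_equiv : equivalence T E ;
  pmp_measurable : measurable [set p : T * T | E p.1 p.2] ;
  pmp_countable : forall x, countable [set y | E x y] ;
  pmp_preserving : forall phi : partial_iso T,
    (forall x, pi_dom phi x -> E x (pi_fun phi x)) -> iso_preserving phi
}.

Definition ergodic (E : T -> T -> Prop) : Prop :=
  forall A, measurable A -> (forall x y, E x y -> A x -> A y) ->
    mu A = 0 \/ mu A = 1.

(* Countable families are indexed by nat; finite ones are completed by partial
   isomorphisms with empty domain, which affect neither the generated relation,
   nor the cost, nor the treeing condition. *)
Definition generated (Phi : nat -> partial_iso T) : T -> T -> Prop :=
  clos_refl_sym_trans T
    (fun x y => exists2 n, pi_dom (Phi n) x & pi_fun (Phi n) x = y).

(* As always in the measured setting, equality of relations is up to a null set. *)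
Definition ae_same (E F : T -> T -> Prop) : Prop :=
  {ae mu, forall x, forall y, E x y <-> F x y}.

Definition graphing (E : T -> T -> Prop) (Phi : nat -> partial_iso T) : Prop :=
  (forall n, iso_preserving (Phi n)) /\ ae_same E (generated Phi).

(* word_path Phi w x y: the partial map spelled by w (first letter applied
   first) is defined at x and sends x to y. *)
Fixpoint word_path (Phi : nat -> partial_iso T) (w : word nat) (x y : T) : Prop :=
  match w with
  | [::] => x = y
  | (n, true) :: w' => pi_dom (Phi n) x /\ word_path Phi w' (pi_fun (Phi n) x) y
  | (n, false) :: w' => pi_im (Phi n) x /\ word_path Phi w' (pi_inv (Phi n) x) y
  end.

Definition treeing (Phi : nat -> partial_iso T) : Prop :=
  forall w : word nat, w <> [::] -> reduced w ->
    ~ exists A : set T,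
        [/\ measurable A, 0 < mu A & forall x, A x -> word_path Phi w x x].

Definition treeable (E : T -> T -> Prop) : Prop :=
  exists2 Phi, graphing E Phi & treeing Phi.

Definition graphing_cost (Phi : nat -> partial_iso T) : \bar K :=
  \sum_(0 <= n <oo) mu (pi_dom (Phi n)).

Definition cost (E : T -> T -> Prop) : \bar K :=
  ereal_inf [set graphing_cost Phi | Phi in [set Phi | graphing E Phi]].

Record pmp_action (G : groupType) (a : G -> T -> T) : Prop := PmpAction {
  pmp_act1 : forall x, a 1%g x = x ;
  pmp_actM : forall g h x, a (g * h)%g x = a g (a h x) ;
  pmp_act_measurable : forall g, measurable_fun setT (a g) ;
  pmp_act_preserving : forall g A, measurable A -> mu (a g @^-1` A) = mu A
}.

Definition free_action (G : groupType) (a : G -> T -> T) : Prop :=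
  {ae mu, forall x, forall g, a g x = x -> g = 1%g}.

Definition orbit_relation (G : groupType) (a : G -> T -> T) (x y : T) : Prop :=
  exists g, a g x = y.

End EquivalenceRelations.

Definition OE_free (K : realType) (G : groupType) : Prop :=
  exists2 t : \bar K, (1 <= t)%E &
    forall (d : measure_display) (T : measurableType d) (mu : probability T K)
      (E : T -> T -> Prop),
      standard_borel K T -> pmp_equivalence mu E -> ergodic mu E ->
      treeable mu E -> cost mu E = t ->
      exists a : G -> T -> T,
        [/\ pmp_action mu a, free_action mu a & ae_same mu E (orbit_relation a)].

(* Main.v *)
(* Let T be a treeing of R. If an edge (y, x) of a graph that is a forest modulo
   an equivalence relation is replaced by a pair (a, b) with a connected to y and
   b to x off that edge, the result is again such a forest and generates the same
   relation. Sliding the edges of T in this way onto prescribed pairs, one stage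
   for each Q_n, produces increasing finite relations F_n, whose classes are almost
   everywhere identified with Q_n, and decreasing forests E_n modulo F_n. The n-th
   stage moves only small sets and makes F_n nearly equidistributed, so that by
   Borel-Cantelli R is generated by F = U_n F_n, an ergodic orbit relation of a free
   action of U_n Q_n, together with a forest E modulo F. Every point except those
   of the shrinking transversals of the F_n has cost one edge, so E has measure
   C(T) - 1. By Gaboriau's theorem (proved by folding: subdivide the edges of
   another graphing into strands over T; each fold removes one edge and at most one
   vertex, and the forest T is what remains) this is C(R) - 1 = sum_r k_r / |Q_r|.
   Hence E can be cut into pieces matching k_r copies of a fundamental domain of
   Q_r. Since F is ergodic, both ends of each piece can be moved inside F onto the
   fundamental domain, and the Q_r-equivariant extension is a letter commuting with
   Q_r. The action is free because a word fixing a point traces a closed walk in a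
   forest modulo F: the walk backtracks, and the backtracking shortens the word. *)
From Stdlib Require Import Relations List.
From mathcomp Require Import all_boot all_order all_fingroup all_algebra.
From mathcomp Require Import all_classical all_reals all_analysis.
From mathcomp Require Import measurable_realfun lra zify.
Require Import Defs.
Set Implicit Arguments.
Unset Strict Implicit.
Unset Printing Implicit Defensive.
Import Order.TTheory GRing.Theory Num.Theory.
Import numFieldNormedType.Exports.
Local Open Scope classical_set_scope.

(** * Forests modulo an equivalence relation *)

Section Graphs.
Variable T : Type.
Implicit Types F G E : T -> T -> Prop.

(** A treeing need not contain finite subrelations with classes of prescribed size, so these are
    manufactured: each exchange spends one edge on one identification, and the total spent
    telescopes to 1, the measure of the space. Two things could fail in the limit. The edges present
    at every stage might not connect enough: but an edge lost outside the small moved set is lost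
    inside a new class, and a small set breaks few of the finitely many connections inspected at its
    stage. And the limit [F] might not be ergodic: but each member of a countable generating family
    closed under intersections is approximated at infinitely many stages by a set of labels; an
    [F]-invariant set meets all labels equally, so it is independent of that member, hence of
    itself. Edges are symmetric relations and [mass] counts ordered pairs, which explains the
    factors 2. As t is at least 1 there are no atoms, for otherwise a star around an atom would be a
    cheaper graphing. Almost everywhere statements are made to hold on an invariant conull Borel set
    [X], and maps are total, with default values off their domains. *)

Definition conn G : T -> T -> Prop := clos_refl_sym_trans T G.

Definition runion F E : T -> T -> Prop := fun x y => F x y \/ E x y.

Definition rminus E (a b : T) : T -> T -> Prop :=
  fun x y => [/\ E x y, ~ (x = a /\ y = b) & ~ (x = b /\ y = a)].

Definition rsym E := forall x y, E x y -> E y x.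

(** Acyclicity of the graph that [E] induces on the [F]-classes, loops and parallel edges being
    excluded too. Both orientations of (a, b) are deleted because edges are stored symmetrically. *)
Definition bridges F E : Prop :=
  forall a b, E a b -> ~ conn (runion F (rminus E a b)) a b.

Lemma conn_refl G x : conn G x x. Proof. exact: rst_refl. Qed.
Lemma conn_sym G x y : conn G x y -> conn G y x. Proof. exact: rst_sym. Qed.
Lemma conn_trans G y x z : conn G x y -> conn G y z -> conn G x z.
Proof. exact: rst_trans. Qed.
Lemma conn_step G x y : G x y -> conn G x y. Proof. exact: rst_step. Qed.

Lemma conn_sub G G' x y :
  (forall x y, G x y -> conn G' x y) -> conn G x y -> conn G' x y.
Proof.
move=> GG'; elim=> [a b /GG'//|a|a b _ /conn_sym//|a b c _ ab _ bc].
  exact: conn_refl.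
exact: conn_trans ab bc.
Qed.

Lemma conn_mono G G' x y :
  (forall x y, G x y -> G' x y) -> conn G x y -> conn G' x y.
Proof. by move=> GG'; apply: conn_sub => a b /GG'; exact: conn_step. Qed.

Lemma conn_inv (P : T -> Prop) G x y :
  (forall x y, G x y -> (P x <-> P y)) -> conn G x y -> (P x <-> P y).
Proof.
move=> PG; elim=> [a b /PG//|a//|a b _ ->//|a b c _ -> _ ->//].
Qed.

Lemma conn_eqv (H : T -> T -> Prop) G x y : equivalence T H ->
  (forall x y, G x y -> H x y) -> conn G x y -> H x y.
Proof.
case=> Hr Ht Hs GH; elim=> [a b /GH//|//|a b _ /Hs//|a b c _ ab _ bc].
exact: Ht ab bc.
Qed.

Fixpoint walk G (n : nat) (x y : T) : Prop :=
  if n is m.+1 then exists z, (G x z \/ G z x) /\ walk G m z y else x = y.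

Lemma walk_conn G n x y : walk G n x y -> conn G x y.
Proof.
elim: n x => [x /= ->|n IH x [z [xz /IH zy]]]; first exact: conn_refl.
apply: conn_trans zy; case: xz => [|/conn_step/conn_sym//]; exact: conn_step.
Qed.

Lemma walk_cat G n m x y z : walk G n x y -> walk G m y z -> walk G (n + m) x z.
Proof.
elim: n x => [x /= ->//|n IH x [w [xw wy]] yz]; exists w; split=> //.
exact: IH.
Qed.

Lemma walk1 G x y : G x y \/ G y x -> walk G 1 x y.
Proof. by move=> xy; exists y. Qed.

Lemma walk_rev G n x y : walk G n x y -> walk G n y x.
Proof.
elim: n x => [x /= ->//|n IH x [z [xz /IH zy]]].
rewrite -addn1; apply: walk_cat zy _; apply: walk1; case: xz; by [right|left].
Qed.

Lemma connP G x y : conn G x y <-> exists n, walk G n x y.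
Proof.
split=> [|[n /walk_conn//]].
elim=> [a b ab|a|a b _ [n ab]|a b c _ [n ab] _ [m bc]].
- by exists 1%N; apply: walk1; left.
- by exists 0%N.
- by exists n; exact: walk_rev.
- by exists (n + m)%N; exact: walk_cat bc.
Qed.

(** A connection can be shortened until it crosses the added edge at most once; the last two cases
    are the two directions. *)
Lemma conn_add1 G a b u v :
  conn (runion G (fun x y => x = a /\ y = b)) u v ->
  [\/ conn G u v, conn G u a /\ conn G b v | conn G u b /\ conn G a v].
Proof.
elim=> [x y [xy|[-> ->]]|x|x y _ H|x y z _ H1 _ H2].
- by apply: Or31; exact: conn_step.
- by apply: Or32; split; exact: conn_refl.
- by apply: Or31; exact: conn_refl.
- case: H => [/conn_sym|[/conn_sym ? /conn_sym ?]|[/conn_sym ? /conn_sym ?]].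
  + by move=> ?; apply: Or31.
  + by apply: Or33.
  + by apply: Or32.
- case: H1 => [xy|[xa by_]|[xb ay]]; case: H2 => [yz|[ya bz]|[yb az]].
  + by apply: Or31; exact: conn_trans xy yz.
  + by apply: Or32; split=> //; exact: conn_trans xy ya.
  + by apply: Or33; split=> //; exact: conn_trans xy yb.
  + by apply: Or32; split=> //; exact: conn_trans by_ yz.
  + by apply: Or32.
  + by apply: Or31; exact: conn_trans xa az.
  + by apply: Or33; split=> //; exact: conn_trans ay yz.
  + by apply: Or31; exact: conn_trans xb bz.
  + by apply: Or33.
Qed.

Lemma conn_fin F (E : T -> T -> Prop) x y : conn (runion F E) x y ->
  exists2 l : seq (T * T), (forall e, In e l -> E e.1 e.2) &
    conn (runion F (fun a b => In (a, b) l)) x y.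
Proof.
elim=> [a b [ab|ab]|a|a b _ [l lE ab]|a b c _ [l lE ab] _ [m mE bc]].
- by exists [::] => //; apply: conn_step; left.
- exists [:: (a, b)]; first by move=> e [<-|[]].
  by apply: conn_step; right; left.
- by exists [::] => //; exact: conn_refl.
- by exists l => //; exact: conn_sym.
- exists (l ++ m); first by move=> e /(@in_app_or _ l m) [/lE|/mE].
  apply: (conn_trans (y := b)).
    apply: conn_mono ab => u v [|uv]; [by left|right].
    by apply: in_or_app; left.
  apply: conn_mono bc => u v [|uv]; [by left|right].
  by apply: in_or_app; right.
Qed.

Lemma conn_lim (G : nat -> T -> T -> Prop) x y :
  (forall k x y, G k x y -> G k.+1 x y) ->
  conn (fun a b => exists k, G k a b) x y -> exists k, conn (G k) x y.
Proof.
move=> Gk.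
have Gle k m a b : (k <= m)%N -> G k a b -> G m a b.
  by move=> /subnK <-; elim: (m - k)%N => // j IH /IH; exact: Gk.
elim=> [a b [k ab]|a|a b _ [k ab]|a b c _ [k ab] _ [m bc]].
- by exists k; exact: conn_step.
- by exists 0%N; exact: conn_refl.
- by exists k; exact: conn_sym.
- exists (maxn k m); apply: (conn_trans (y := b)).
    by apply: conn_mono ab => u v; apply: Gle; exact: leq_maxl.
  by apply: conn_mono bc => u v; apply: Gle; exact: leq_maxr.
Qed.

Lemma bridges_mono F E F' E' :
  (forall x y, F' x y -> conn F x y) -> (forall x y, E' x y -> E x y) ->
  bridges F E -> bridges F' E'.
Proof.
move=> FF EE br a b /EE ab c; apply: (br a b ab).
apply: conn_sub c => x y [/FF|[/EE xy n1 n2]].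
  by apply: conn_mono => u v; left.
by apply: conn_step; right; split.
Qed.

(* In a forest the edges used by two connections have a common sub-connection. *)
Lemma conn_cap F E E1 E2 x y : bridges F E -> rsym E2 ->
  (forall x y, E1 x y -> E x y) -> (forall x y, E2 x y -> E x y) ->
  conn (runion F E1) x y -> conn (runion F E2) x y ->
  conn (runion F (fun a b => E1 a b /\ E2 a b)) x y.
Proof.
move=> br sE2 s1 s2 c1 c2; set E12 := fun a b => _.
have [l lE] := conn_fin c1.
suff main (l' : seq (T * T)) : (forall e, In e l' -> E1 e.1 e.2) ->
  conn (runion (runion F E12) (fun a b => In (a, b) l')) x y ->
  conn (runion F E12) x y.
  move=> cl; apply: (main l) => //; apply: conn_mono cl => a b [|]; last by right.
  by left; left.
elim: l' {l lE} => [_|[a b] l IH lE c].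
  by apply: conn_mono => u v [//|[]].
have lE' e : In e l -> E1 e.1 e.2 by move=> el; apply: lE; right.
have abE1 : E1 a b by apply: (lE (a, b)); left.
have [abE2|nabE2] := pselect (E2 a b).
  apply: IH => //; apply: conn_mono c => u v [|[[<- <-]|]]; first by left.
    by left; right.
  by right.
have [/= abl|nabl] := pselect (In (a, b) l \/ In (b, a) l).
  apply: IH => //; apply: conn_sub c => u v [uv|[[<- <-]|uv]].
  - by apply: conn_step; left.
  - case: abl => [abl|bal]; first by apply: conn_step; right.
    by apply: conn_sym; apply: conn_step; right.
  - by apply: conn_step; right.
have /conn_add1 : conn (runion (runion (runion F E12) (fun a b => In (a, b) l))
   (fun x y => x = a /\ y = b)) x y.
  apply: conn_mono c => u v [|[[<- <-]|uv]]; [by left; left|by right|].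
  by left; right.
have sub u v : conn (runion (runion F E12) (fun a b => In (a, b) l)) u v ->
    conn (runion F (rminus E a b)) u v.
  apply: conn_mono => {}u {}v [[uv|[uv1 uv2]]|uv]; first by left.
    right; split; first exact: s1.
      by move=> [ua vb]; apply: nabE2; rewrite -ua -vb.
    by move=> [ub va]; apply: nabE2; rewrite -ub -va; exact: sE2.
  right; split; first by apply: s1; exact: (lE' (u, v)).
    by move=> [ua vb]; apply: nabl; left; rewrite -ua -vb.
  by move=> [ub va]; apply: nabl; right; rewrite -ub -va.
have c2' : conn (runion F (rminus E a b)) x y.
  apply: conn_mono c2 => u v [uv|uv]; [by left|right; split; first exact: s2].
    by move=> [ua vb]; apply: nabE2; rewrite -ua -vb.
  by move=> [ub va]; apply: nabE2; rewrite -ub -va; exact: sE2.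
(* In the last two cases the connection crosses (a, b), and its remaining parts together with the
   second connection, which avoids this edge, form a detour around it. *)
case=> [c3|[/sub xa /sub by_]|[/sub xb /sub ay]]; first exact: IH.
- exfalso; apply: (br a b (s1 _ _ abE1)).
  apply: conn_trans (conn_sym xa) _; apply: conn_trans c2' _; exact: conn_sym.
- exfalso; apply: (br a b (s1 _ _ abE1)).
  apply: conn_trans ay _; apply: conn_trans (conn_sym c2') _; exact: xb.
Qed.

(** * Exchanging edges of a forest for identifications *)

Section Swap.
Variables (F E : T -> T -> Prop) (W : T -> T -> T -> T -> Prop).
Hypotheses (sE : rsym E) (brE : bridges F E).
(** [W a b y x] is read: the edge (y, x) is traded for the identification of [a] with [b].
    Accordingly [S] collects the traded edges, in both orientations. *)
Let S x y := exists a b, W a b x y \/ W a b y x.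
Let E' x y := E x y /\ ~ S x y.
Hypothesis W_edge : forall a b y x, W a b y x -> E y x.
Hypothesis W_conn : forall a b y x, W a b y x ->
  conn (runion F E') a y /\ conn (runion F E') b x.
Hypothesis W_inj : forall a b y x a' b' y' x', W a b y x -> W a' b' y' x' ->
  (y = y' /\ x = x') \/ (y = x' /\ x = y') -> a = a' /\ b = b'.

Let pl (l : seq (T * T * T * T)) a b := exists y x, In (a, b, y, x) l.
Let el (l : seq (T * T * T * T)) u v :=
  exists a b, In (a, b, u, v) l \/ In (a, b, v, u) l.
Let Wl (l : seq (T * T * T * T)) :=
  forall a b y x, In (a, b, y, x) l -> W a b y x.

(* Exchanging one bridge (y, x) for (a, b) keeps all the other edges bridges:
   if removing e separated a from b, then e together with the connections
   a ~ y and b ~ x would have been a detour around (y, x). *)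
Let swap_list l : Wl l -> forall u v, E u v -> ~ el l u v ->
  ~ conn (runion (runion F (pl l)) (rminus (fun x y => E x y /\ ~ el l x y) u v)) u v.
Proof.
elim: l => [_ u v uv _ c|[[[a b] y] x] l IH Wql].
  apply: (brE uv); apply: conn_mono c => p q [[pq|[? [? []]]]|[[pq _] n1 n2]].
    by left.
  by right; split.
have Wq : W a b y x by apply: Wql; left.
have {}IH := IH (fun _ _ _ _ h => Wql _ _ _ _ (or_intror h)).
(* If an entry of the tail already trades this edge, it does so for the same pair by [W_inj], and
   the head of the list is redundant. *)
have [[a' [b' abl]]|nel] := pselect (el l y x).
  have [eqa eqb] : a = a' /\ b = b'.
    case: abl => abl; apply: (W_inj Wq (Wql _ _ _ _ (or_intror abl))); by [left|right].
  move=> u v uv nuv c; apply: (IH u v uv).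
    by move=> [c1 [c2 h]]; apply: nuv; exists c1, c2; case: h => h; [left|right]; right.
  apply: conn_mono c => p q [[pq|[y1 [x1 [[<- <- _ _]|h]]]]|[[pq npq] n1 n2]].
  - by left; left.
  - by left; right; rewrite eqa eqb; case: abl => abl; eexists; eexists; exact: abl.
  - by left; right; exists y1, x1.
  - right; split=> //; split=> // -[c1 [c2 h]]; apply: npq; exists c1, c2.
    by case: h => h; [left|right]; right.
have yxE : E y x := W_edge Wq.
move=> u v uv nuv c.
set H := runion (runion F (pl l)) (rminus (fun x y => E x y /\ ~ el l x y) y x).
set He := runion (runion F (pl l)) (rminus (fun p q => E p q /\
  ~ el ((a, b, y, x) :: l) p q) u v).
have sub0 p q : conn (runion F E') p q -> conn H p q.
  apply: conn_mono => {}p {}q [pq|[pq nS]]; first by left; left.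
  right; split.
  - split=> // -[c1 [c2 h]]; apply: nS; exists c1, c2.
    by case: h => h; [left|right]; apply: Wql; right.
  - by move=> [eqp eqq]; apply: nS; exists a, b; left; rewrite eqp eqq.
  - by move=> [eqp eqq]; apply: nS; exists a, b; right; rewrite eqp eqq.
have sub1 p q : conn He p q -> conn H p q.
  apply: conn_mono => {}p {}q [pq|[[pq npq] _ _]]; first by left.
  right; split.
  - split=> // -[c1 [c2 h]]; apply: npq; exists c1, c2.
    by case: h => h; [left|right]; right.
  - by move=> [eqp eqq]; apply: npq; exists a, b; left; left; rewrite eqp eqq.
  - by move=> [eqp eqq]; apply: npq; exists a, b; right; left; rewrite eqp eqq.
have uvH : conn H u v.
  apply: conn_step; right; split.
  - split=> // -[c1 [c2 h]]; apply: nuv; exists c1, c2.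
    by case: h => h; [left|right]; right.
  - by move=> [eqp eqq]; apply: nuv; exists a, b; left; left; rewrite eqp eqq.
  - by move=> [eqp eqq]; apply: nuv; exists a, b; right; left; rewrite eqp eqq.
have [ay bx] := W_conn Wq.
have {}ay := sub0 _ _ ay; have {}bx := sub0 _ _ bx.
have yx : ~ conn H y x := IH y x yxE nel.
have /conn_add1 : conn (runion He (fun x y => x = a /\ y = b)) u v.
  apply: conn_mono c => p q [[pq|[y1 [x1 [[<- <- _ _]|h]]]]|[[pq npq] n1 n2]].
  - by left; left; left.
  - by right.
  - by left; left; right; exists y1, x1.
  - by left; right; split.
case=> [c1|[/sub1 ua /sub1 bv]|[/sub1 ub /sub1 av]].
- apply: (IH u v uv).
    by move=> [c3 [c2 h]]; apply: nuv; exists c3, c2; case: h => h; [left|right]; right.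
  apply: conn_mono c1 => p q [|[[pq npq] n1 n2]]; first by left.
  right; split=> //; split=> // -[c1 [c2 h]]; apply: npq; exists c1, c2.
  by case: h => h; [left|right]; right.
- apply: yx; apply: conn_trans (conn_sym ay) _; apply: conn_trans (conn_sym ua) _.
  by apply: conn_trans uvH _; apply: conn_trans (conn_sym bv) _.
- apply: yx; apply: conn_trans (conn_sym ay) _; apply: conn_trans av _.
  by apply: conn_trans (conn_sym uvH) _; apply: conn_trans ub _.
Qed.

(** A detour uses only finitely many of the new identifications, so finite lists of trades
    suffice. *)
Lemma swap_bridges :
  bridges (runion F (fun a b => exists y x, W a b y x)) E'.
Proof.
move=> u v [uv nuv] c.
have {c} /conn_fin[l lW c] : conn (runion (runion F (rminus E' u v))
    (fun a b => exists y x, W a b y x)) u v.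
  by apply: conn_mono c => p q [[pq|pq]|pq]; [left; left|right|left; right].
have [m mW lm] : exists2 m, Wl m & forall a b, In (a, b) l -> pl m a b.
  elim: l lW {c} => [_|[a b] l IH lW]; first by exists [::].
  have [m mW lm] := IH (fun e h => lW e (or_intror h)).
  have [y [x abyx]] := lW (a, b) (or_introl erefl).
  exists ((a, b, y, x) :: m); first by move=> c d e f [[<- <- <- <-]//|]; exact: mW.
  move=> c d [[<- <-]|/lm [y' [x' h]]]; first by exists y, x; left.
  by exists y', x'; right.
apply: (swap_list mW uv).
  move=> [a [b h]]; apply: nuv; exists a, b.
  by case: h => /mW; [left|right].
apply: conn_mono c => p q [[pq|[[pq npq] n1 n2]]|/lm pq].
- by left; left.
- right; split=> //; split=> // -[c1 [c2 h]]; apply: npq; exists c1, c2.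
  by case: h => /mW; [left|right].
- by left; right.
Qed.

End Swap.

(** * Closed walks in a forest *)

Fixpoint chain F E (x : T) (es : seq (T * T)) (x' : T) : Prop :=
  if es is e :: es' then [/\ conn F x e.1, E e.1 e.2 & chain F E e.2 es' x']
  else conn F x x'.

Lemma chain_cat F E x es1 es2 x' : chain F E x (es1 ++ es2) x' <->
  exists2 z, chain F E x es1 z & chain F E z es2 x'.
Proof.
elim: es1 x => [x|e es1 IH x] /=.
  split=> [|[z xz]]; first by exists x => //; exact: conn_refl.
  case: es2 => [|e es2] /=; first exact: conn_trans xz.
  by case=> ze ? ?; split=> //; exact: conn_trans xz ze.
split=> [[xe ee /IH [z ez zx]]|[z [xe ee ez] zx]]; first by exists z.
by split=> //; apply/IH; exists z.
Qed.

Lemma chain_conn F E a b x es x' :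
  (forall e, In e es -> ~ (e = (a, b) \/ e = (b, a))) ->
  chain F E x es x' -> conn (runion F (rminus E a b)) x x'.
Proof.
have FG u v : conn F u v -> conn (runion F (rminus E a b)) u v.
  by apply: conn_mono => {}u {}v; left.
elim: es x => [x _ /FG//|e es IH x nes /= [/FG xe ee /IH ex]].
apply: conn_trans xe _; apply: conn_trans (ex _); last first.
  by move=> e' he'; apply: nes; right.
have ne := nes e (or_introl erefl).
apply: conn_step; right; split=> //; move: ne; case: (e) => [u v] /= ne [? ?]; subst.
  by apply: ne; left.
by apply: ne; right.
Qed.

(** The first edge (a, b) is a bridge, so a closed chain must cross it again. The first return
    crosses it from [b] to [a]; in between lies a shorter closed chain at [b], which is empty or
    backtracks by induction. *)
Lemma chain_backtrack F E x es x' : bridges F E -> rsym E ->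
  chain F E x es x' -> conn F x x' -> es <> [::] ->
  exists es1 a b es2, es = es1 ++ (a, b) :: (b, a) :: es2.
Proof.
move=> br sE; have [n] := ubnP (size es); elim: n es x x' => // n IH [//|[a b] es] x x'.
rewrite /= ltnS => sz [xa ab bx'] xx' _.
have FG u v : conn F u v -> conn (runion F (rminus E a b)) u v.
  by apply: conn_mono => {}u {}v; left.
have [h|nh] := pselect (forall e, In e es -> ~ (e = (a, b) \/ e = (b, a))).
  exfalso; apply: (br a b ab); apply: conn_sym; apply: conn_trans (chain_conn h bx') _.
  by apply: FG; apply: conn_trans (conn_sym xx') xa.
have [l1 [e [l2 [eqes nl1 he]]]] : exists l1 e l2, [/\ es = l1 ++ e :: l2,
    forall e, In e l1 -> ~ (e = (a, b) \/ e = (b, a)) & e = (a, b) \/ e = (b, a)].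
  elim: (es) nh => [[]//|e l IHl nh].
  have [he|ne] := pselect (e = (a, b) \/ e = (b, a)).
    by exists [::], e, l; split.
  have [|l1 [e' [l2 [-> h1 h2]]]] := IHl.
    by move=> h; apply: nh => e' [<-//|/h].
  by exists (e :: l1), e', l2; split=> // e'' [<-//|/h1].
subst es; have /chain_cat[z bz /= [ze ee _]] := bx'.
(* A next crossing from [a] to [b] would be preceded by a connection from [b] to [a] that avoids the
   edge. *)
case: he => eqe; subst e; rewrite /= in ze ee.
  exfalso; apply: (br a b ab); apply: conn_sym; apply: conn_trans (chain_conn nl1 bz) _.
  exact: FG.
case: l1 nl1 bz sz {bx' nh} => [|e1 l1] nl1 bz sz; first by exists [::], a, b, l2.
have szl : (size (e1 :: l1) < n)%N.
  by move: sz; rewrite size_cat; apply: leq_ltn_trans; exact: leq_addr.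
have cb : conn F b b by exact: conn_refl.
have bb : chain F E b (e1 :: l1) b.
  have := (chain_cat F E b (e1 :: l1) [::] b).2; rewrite cats0; apply.
  by exists z.
have [//|m1 [p [q [m2 eqm]]]] := IH _ _ _ szl bb cb.
by exists ((a, b) :: m1), p, q, (m2 ++ (b, a) :: l2); rewrite eqm -catA.
Qed.

End Graphs.

Lemma conn_first_exit T (G : T -> T -> Prop) (P : T -> Prop) a z :
  conn G a z -> P a -> ~ P z ->
  exists y x, [/\ conn (fun u v => [/\ G u v, P u & P v]) a y, P y, ~ P x &
    G y x \/ G x y].
Proof.
move=> /connP[n]; elim: n a => [a /= -> //|n IH a [w [aw wz]] Pa nPz].
have [Pw|nPw] := pselect (P w); last by exists a, w; split=> //; exact: conn_refl.
have [y [x [wy Py nPx yx]]] := IH w wz Pw nPz; exists y, x; split=> //.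
apply: conn_trans wy; case: aw => aw; first by apply: conn_step.
by apply: conn_sym; apply: conn_step.
Qed.

(** * Countable Borel equivalence relations *)

Section MeasurablePredicates.
Context {d} {U : measurableType d}.
Implicit Types P Q : U -> Prop.

Lemma mnot P : measurable [set u | P u] -> measurable [set u | ~ P u].
Proof. exact: measurableC. Qed.

Lemma mand P Q : measurable [set u | P u] -> measurable [set u | Q u] ->
  measurable [set u | P u /\ Q u].
Proof. exact: measurableI. Qed.

Lemma mor P Q : measurable [set u | P u] -> measurable [set u | Q u] ->
  measurable [set u | P u \/ Q u].
Proof. exact: measurableU. Qed.

Lemma mprop (p : Prop) : measurable [set _ : U | p].
Proof.
have [h|h] := pselect p.
  by rewrite (_ : [set _ | _] = setT)//; apply/seteqP; split.
by rewrite (_ : [set _ | _] = set0)//; apply/seteqP; split.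
Qed.

Lemma mimp P Q : measurable [set u | P u] -> measurable [set u | Q u] ->
  measurable [set u | P u -> Q u].
Proof.
move=> mP mQ; rewrite (_ : [set u | _] = [set u | ~ P u \/ Q u]).
  by apply: mor => //; exact: mnot.
apply/seteqP; split=> u /=; last by case.
by move=> h; have [/h|] := pselect (P u); [right|left].
Qed.

Lemma mexn (P : nat -> U -> Prop) : (forall n, measurable [set u | P n u]) ->
  measurable [set u | exists n, P n u].
Proof.
move=> mP; rewrite (_ : [set u | _] = \bigcup_n [set u | P n u]).
  exact: bigcupT_measurable.
by apply/seteqP; split=> u [n]; [exists n|move=> _ ?; exists n].
Qed.

Lemma malln (P : nat -> U -> Prop) : (forall n, measurable [set u | P n u]) ->
  measurable [set u | forall n, P n u].
Proof.
move=> mP; rewrite (_ : [set u | _] = \bigcap_n [set u | P n u]).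
  exact: bigcapT_measurable.
by apply/seteqP; split=> u h n; [move=> _; exact: h|exact: (h n I)].
Qed.

Lemma mex (I : countType) (P : I -> U -> Prop) :
  (forall i, measurable [set u | P i u]) -> measurable [set u | exists i, P i u].
Proof.
move=> mP; rewrite (_ : [set u | _] =
    [set u | exists n, if unpickle n is Some i then P i u else False]).
  by apply: mexn => n; case: unpickle => [i|]; [exact: mP|exact: mprop].
apply/seteqP; split=> u /= [i h]; first by exists (pickle i); rewrite pickleK.
by move: h; case: unpickle => // j; exists j.
Qed.

Lemma mall (I : countType) (P : I -> U -> Prop) :
  (forall i, measurable [set u | P i u]) -> measurable [set u | forall i, P i u].
Proof.
move=> mP; rewrite (_ : [set u | _] = [set u | ~ exists i, ~ P i u]).
  by apply: mnot; apply: mex => i; apply: mnot.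
apply/seteqP; split=> u /= h; first by case=> i; apply; exact: h.
by move=> i; apply: contrapT => hi; apply: h; exists i.
Qed.

Lemma mset {d'} {V : measurableType d'} (A : set V) (g : U -> V) :
  measurable A -> measurable_fun setT g -> measurable [set u | A (g u)].
Proof. by move=> mA mg; rewrite -[X in measurable X]setTI; exact: mg. Qed.

Lemma mfst {d1 d2} {V1 : measurableType d1} {V2 : measurableType d2}
  (g : U -> V1 * V2) : measurable_fun setT g -> measurable_fun setT (fun u => (g u).1).
Proof. by move=> mg; apply: measurableT_comp mg; exact: measurable_fst. Qed.

Lemma msnd {d1 d2} {V1 : measurableType d1} {V2 : measurableType d2}
  (g : U -> V1 * V2) : measurable_fun setT g -> measurable_fun setT (fun u => (g u).2).
Proof. by move=> mg; apply: measurableT_comp mg; exact: measurable_snd. Qed.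

Lemma mlt (K : realType) (f g : U -> K) : measurable_fun setT f ->
  measurable_fun setT g -> measurable [set u | (f u < g u)%R].
Proof.
move=> mf mg; rewrite (_ : [set u | _] = [set: U] `&` [set u | (f u < g u)%R]).
  rewrite (_ : [set u | _] = (fun u => (f u < g u)%R) @^-1` [set true]).
    by apply: (measurable_fun_ltr mf mg).
  by apply/seteqP; split.
by rewrite setTI.
Qed.

End MeasurablePredicates.

Definition mrel d (T : measurableType d) (G : T -> T -> Prop) :=
  measurable [set p : T * T | G p.1 p.2].

Lemma mrelP d (T : measurableType d) (G : T -> T -> Prop)
    d' (U : measurableType d') (g1 g2 : U -> T) :
  mrel G -> measurable_fun setT g1 -> measurable_fun setT g2 ->
  measurable [set u | G (g1 u) (g2 u)].
Proof.
move=> mG m1 m2; apply: (mset (g := fun u => (g1 u, g2 u)) mG).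
exact: measurable_fun_pair.
Qed.

(* A countable Borel equivalence relation with its invariant measure: total
   Borel maps [enum_fun n] enumerate the classes. [enum_key] is a Borel injection
   into the reals; it makes the diagonal Borel and orders the space. *)
Record enumrel (K : realType) d (T : measurableType d) (mu : probability T K) :=
  EnumRel {
  enum_key : T -> K;
  enum_fun : nat -> T -> T;
  enum_key_meas : measurable_fun setT enum_key;
  enum_key_inj : injective enum_key;
  enum_key01 : forall x, (0 <= enum_key x <= 1)%R;
  enum_fun_meas : forall n, measurable_fun setT (enum_fun n);
  enum_fun0 : forall x, enum_fun 0%N x = x;
  enum_fun_sym : forall n x, exists m, enum_fun m (enum_fun n x) = x;
  enum_fun_trans : forall n m x, exists k, enum_fun k x = enum_fun m (enum_fun n x);
  enum_fun_image : forall n C, measurable C -> {in C &, injective (enum_fun n)} ->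
    measurable (enum_fun n @` C) /\ mu (enum_fun n @` C) = mu C
}.

Section EnumRelTheory.
Context {K : realType} {d : measure_display} {T : measurableType d}.
Context {mu : probability T K} (r : enumrel mu).
Local Notation f := (enum_fun r).
Local Notation h := (enum_key r).

Definition rel_of (x y : T) : Prop := exists n, f n x = y.
Local Notation R := rel_of.

Lemma rel_refl x : R x x. Proof. by exists 0%N; exact: enum_fun0. Qed.
Lemma rel_sym x y : R x y -> R y x.
Proof. by case=> n <-; exact: enum_fun_sym. Qed.
Lemma rel_trans y x z : R x y -> R y z -> R x z.
Proof. by case=> n <- [m <-]; exact: enum_fun_trans. Qed.
Lemma rel_fun n x : R x (f n x). Proof. by exists n. Qed.
Lemma rel_equiv : equivalence T R.
Proof.
split; [exact: rel_refl|move=> x y z; exact: rel_trans|move=> x y; exact: rel_sym].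
Qed.

Lemma key_eq x y : h x = h y -> x = y. Proof. exact: enum_key_inj. Qed.

Section U.
Context {d'} {U : measurableType d'}.

Lemma men n (g : U -> T) : measurable_fun setT g -> measurable_fun setT (fun u => f n (g u)).
Proof. by move=> mg; apply: measurableT_comp mg; exact: enum_fun_meas. Qed.

Lemma mkey (g : U -> T) : measurable_fun setT g -> measurable_fun setT (fun u => h (g u)).
Proof. by move=> mg; apply: measurableT_comp mg; exact: enum_key_meas. Qed.

Lemma mkeylt (g1 g2 : U -> T) : measurable_fun setT g1 -> measurable_fun setT g2 ->
  measurable [set u | (h (g1 u) < h (g2 u))%R].
Proof. by move=> m1 m2; apply: mlt; exact: mkey. Qed.

Lemma meq (g1 g2 : U -> T) : measurable_fun setT g1 -> measurable_fun setT g2 ->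
  measurable [set u | g1 u = g2 u].
Proof.
move=> m1 m2; rewrite (_ : [set u | _] =
  [set u | ~ (h (g1 u) < h (g2 u))%R /\ ~ (h (g2 u) < h (g1 u))%R]).
  by apply: mand; apply: mnot; exact: mkeylt.
apply/seteqP; split=> u /=; first by move=> ->; rewrite ltxx.
by move=> [/negP h1 /negP h2]; apply: key_eq; apply/eqP; rewrite eq_le !leNgt h1 h2.
Qed.

Lemma mR (g1 g2 : U -> T) : measurable_fun setT g1 -> measurable_fun setT g2 ->
  measurable [set u | R (g1 u) (g2 u)].
Proof. by move=> m1 m2; apply: mexn => n; apply: meq => //; exact: men. Qed.

Lemma mexR (g : U -> T) (Q : U -> T -> Prop) :
  (forall u y, Q u y -> R (g u) y) ->
  (forall n, measurable [set u | Q u (f n (g u))]) ->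
  measurable [set u | exists y, Q u y].
Proof.
move=> QR mQ; rewrite (_ : [set u | _] = [set u | exists n, Q u (f n (g u))]).
  exact: mexn.
apply/seteqP; split=> u /= [y]; last by move=> ?; exists (f y (g u)).
by move=> Qu; have [n e] := QR u y Qu; exists n; rewrite e.
Qed.

Lemma mfun_graph (g0 g : U -> T) : measurable_fun setT g0 ->
  (forall u, R (g0 u) (g u)) ->
  (forall n, measurable [set u | f n (g0 u) = g u]) -> measurable_fun setT g.
Proof.
move=> m0 Rg mg _ A mA; rewrite setTI.
rewrite (_ : _ @^-1` _ = [set u | exists n, f n (g0 u) = g u /\ A (f n (g0 u))]).
  apply: mexn => n; apply: mand => //; apply: mset => //; exact: men.
apply/seteqP; split=> u /=; last by case=> n [->].
by move=> Ag; have [n e] := Rg u; exists n; rewrite e.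
Qed.

(** Borel uniformization with countable sections: the first index whose point satisfies [Q] depends
    on [u] in a Borel way. The default [g u] makes the selection total and keeps it in the class. *)
Lemma mpick (g : U -> T) (Q : U -> T -> Prop) : measurable_fun setT g ->
  (forall u y, Q u y -> R (g u) y) ->
  (forall n, measurable [set u | Q u (f n (g u))]) ->
  exists s : U -> T, [/\ measurable_fun setT s, forall u, R (g u) (s u),
    forall u, (exists y, Q u y) -> Q u (s u) &
    forall u, ~ (exists y, Q u y) -> s u = g u].
Proof.
move=> mg QR mQ.
have ex u : (exists y, Q u y) -> exists n, `[< Q u (f n (g u)) >].
  by move=> [y Qy]; have [n e] := QR u y Qy; exists n; apply/asboolP; rewrite e.
pose s u := if pselect (exists y, Q u y) is left p then f (ex_minn (ex u p)) (g u) else g u.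
have sR u : R (g u) (s u).
  rewrite /s; case: pselect => [p|_]; [exact: rel_fun|exact: rel_refl].
have sQ u : (exists y, Q u y) -> Q u (s u).
  move=> p; rewrite /s; case: pselect => // p'.
  by case: ex_minnP => n /asboolP.
have sN u : ~ (exists y, Q u y) -> s u = g u by move=> p; rewrite /s; case: pselect.
exists s; split=> //; apply: (mfun_graph mg) => // n.
rewrite (_ : [set u | _] = [set u |
   (exists k, (Q u (f k (g u)) /\ forall j, (j < k)%N -> ~ Q u (f j (g u))) /\
      f n (g u) = f k (g u))
   \/ ((~ exists y, Q u y) /\ f n (g u) = g u)]).
  apply: mor; last first.
    apply: mand; last by apply: meq => //; exact: men.
    by apply: mnot; apply: (mexR QR).
  apply: mexn => k; apply: mand; last by apply: meq; exact: men.
  apply: mand => //; apply: malln => j; apply: mimp; first exact: mprop.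
  exact: mnot.
apply/seteqP; split=> u /=.
  rewrite /s; case: pselect => [p|]; last by right.
  case: ex_minnP => k /asboolP Qk kmin e; left; exists k; split=> //.
  by split=> // j jk /asboolP/kmin; rewrite leqNgt jk.
case=> [[k [[Qk kmin] ->]]|[p ->]]; last by rewrite sN.
rewrite /s; case: pselect => [p|]; last by case; exists (f k (g u)).
case: ex_minnP => j /asboolP Qj jmin; congr (f _ _).
apply/eqP; rewrite eqn_leq; apply/andP; split; last by apply: jmin; apply/asboolP.
by rewrite leqNgt; apply/negP => /kmin.
Qed.

End U.

(** [A] splits according to the first index [n] with [f n x = g x]. On each part [g] agrees with an
    enumerating map, and injectivity of [g] keeps the images of the parts disjoint. *)
Lemma inj_image (A : set T) (g : T -> T) : measurable A -> measurable_fun setT g ->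
  {in A &, injective g} -> (forall x, A x -> R x (g x)) ->
  measurable (g @` A) /\ mu (g @` A) = mu A.
Proof.
move=> mA mg ginj gR.
pose C n := [set x | A x /\ (f n x = g x /\ forall m, (m < n)%N -> f m x <> g x)].
have mid : measurable_fun setT (fun x : T => x) by exact: measurable_id.
have mC n : measurable (C n).
  apply: mand => //; apply: mand; first by apply: meq => //; exact: men.
  apply: malln => m; apply: mimp; first exact: mprop.
  by apply: mnot; apply: meq => //; exact: men.
have UC : A = \bigcup_n C n.
  apply/seteqP; split=> x; last by case=> n _ [].
  move=> Ax; have ex : exists n, `[< f n x = g x >].
    by have [n e] := gR x Ax; exists n; apply/asboolP.
  exists (ex_minn ex) => //; case: ex_minnP => n /asboolP e nmin.
  by split=> //; split=> // m mn /asboolP/nmin; rewrite leqNgt mn.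
have tC : trivIset setT C.
  apply/trivIsetP => i j _ _ ij; apply/seteqP; split=> // x [[_ [ei hi]] [_ [ej hj]]].
  have [ltij|ltji|eij] := ltngtP i j; [exact: (hj i)|exact: (hi j)|].
  by move: ij; rewrite eij eqxx.
have CA n x : C n x -> A x by case.
have gC n : g @` (C n) = f n @` (C n).
  by apply/seteqP; split=> y [x Cx <-]; exists x => //; case: Cx => _ [].
have CI n : measurable (g @` C n) /\ mu (g @` C n) = mu (C n).
  rewrite gC; apply: enum_fun_image => // x y /set_mem Cx /set_mem Cy.
  case: (Cx) => Ax [-> _]; case: (Cy) => Ay [-> _]; apply: ginj; exact/mem_set.
have gU : g @` A = \bigcup_n (g @` C n) by rewrite {1}UC image_bigcup.
have tg : trivIset setT (fun n => g @` C n).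
  apply/trivIsetP => i j _ _ ij; apply/seteqP; split=> // y [[x Cx ex] [z Cz ez]].
  have xz : x = z.
    apply: ginj; rewrite ?inE; [exact: CA Cx|exact: CA Cz|by rewrite ex ez].
  move/trivIsetP : tC => /(_ i j I I ij) /seteqP[+ _] => /(_ x); apply.
  by split=> //; rewrite xz.
have mg' : measurable (\bigcup_n (g @` C n)).
  by apply: bigcupT_measurable => n; have [] := CI n.
split; first by rewrite gU.
rewrite gU measure_semi_bigcup//; last by move=> n; have [] := CI n.
rewrite UC measure_semi_bigcup// -?UC//.
by apply: eq_eseriesr => n _; have [] := CI n.
Qed.

Implicit Types F G : T -> T -> Prop.

Lemma mrel_dom G : mrel G -> (forall x y, G x y -> R x y) ->
  measurable [set x | exists y, G x y].
Proof.
move=> mG GR; have mid : measurable_fun setT (fun x : T => x) by exact: measurable_id.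
by apply: (mexR GR) => n; apply: (mrelP mG) => //; exact: men.
Qed.

Lemma mrel_tr G : mrel G -> mrel (fun x y => G y x).
Proof.
by move=> mG; apply: (mrelP mG); [exact: measurable_snd|exact: measurable_fst].
Qed.

Lemma mrel_ran G : mrel G -> (forall x y, G x y -> R x y) ->
  measurable [set y | exists x, G x y].
Proof.
move=> mG GR; apply: (mrel_dom (mrel_tr mG)) => x y /GR; exact: rel_sym.
Qed.

Lemma pbij_measure G : mrel G -> (forall x y, G x y -> R x y) ->
  (forall x y y', G x y -> G x y' -> y = y') ->
  (forall x x' y, G x y -> G x' y -> x = x') ->
  mu [set y | exists x, G x y] = mu [set x | exists y, G x y].
Proof.
move=> mG GR Gf Gi.
have mid : measurable_fun setT (fun x : T => x) by exact: measurable_id.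
have [s [ms sR sG _]] := mpick mid GR
  (fun n => mrelP mG mid (men n mid)).
rewrite -(inj_image (mrel_dom mG GR) ms _ _).2//.
  congr (mu _); apply/seteqP; split=> y /=.
    by move=> [x Gxy]; exists x; [exists y|apply: (Gf x) => //; apply: sG; exists y].
  by move=> [x [z Gxz] <-]; exists x; apply: sG; exists z.
move=> x y; rewrite !inE /= => /sG Gx /sG Gy e; apply: (Gi x y (s y)) => //.
by rewrite -e.
Qed.

Lemma mrelI F G : mrel F -> mrel G -> mrel (fun x y => F x y /\ G x y).
Proof. exact: mand. Qed.
Lemma mrelU F G : mrel F -> mrel G -> mrel (runion F G).
Proof. exact: mor. Qed.
Lemma mrelN G : mrel G -> mrel (fun x y => ~ G x y).
Proof. exact: mnot. Qed.
Lemma mrel_rel : mrel R.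
Proof. by apply: mR; [exact: measurable_fst|exact: measurable_snd]. Qed.
(** A connection is a walk of some length that stays in one class, so each of its vertices can be
    quantified through the enumeration. *)
Lemma mconn {d'} {U : measurableType d'} (G : U -> T -> T -> Prop) :
  (forall u x y, G u x y -> R x y) ->
  measurable [set p : U * T * T | G p.1.1 p.1.2 p.2] ->
  measurable [set p : U * T * T | conn (G p.1.1) p.1.2 p.2].
Proof.
move=> GR mG.
rewrite (_ : [set p | _] = [set p | exists n, walk (G p.1.1) n p.1.2 p.2]); last first.
  by apply/seteqP; split=> p /= /connP.
apply: mexn; elim=> [|n IH] /=.
  by apply: meq; [apply: msnd; exact: measurable_fst|exact: measurable_snd].
apply: (mexR (g := fun p : U * T * T => p.1.2)).
  by move=> p y [[/GR//|/GR/rel_sym//]].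
move=> m.
have m12 : measurable_fun setT (fun p : U * T * T => p.1.2).
  by apply: msnd; exact: measurable_fst.
have m11 : measurable_fun setT (fun p : U * T * T => p.1.1).
  by apply: mfst; exact: measurable_fst.
apply: mand.
  apply: mor.
    apply: (mset (g := fun p : U * T * T => (p.1.1, p.1.2, f m p.1.2)) mG).
    by apply: measurable_fun_pair; [exact: measurable_fun_pair|exact: men].
  apply: (mset (g := fun p : U * T * T => (p.1.1, f m p.1.2, p.1.2)) mG).
  by apply: measurable_fun_pair => //; apply: measurable_fun_pair => //; exact: men.
apply: (mset (g := fun p : U * T * T => (p.1.1, f m p.1.2, p.2)) IH).
apply: measurable_fun_pair; last exact: measurable_snd.
by apply: measurable_fun_pair => //; exact: men.
Qed.

Lemma conn_rel G x y : (forall x y, G x y -> R x y) -> conn G x y -> R x y.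
Proof. by move=> GR; apply: conn_eqv; [exact: rel_equiv|]. Qed.

Lemma mrel_conn G : (forall x y, G x y -> R x y) -> mrel G -> mrel (conn G).
Proof.
move=> GR mG; have := @mconn _ T (fun _ => G) (fun _ => GR).
have mG' : measurable [set p : T * T * T | G p.1.2 p.2].
  by apply: (mrelP mG); [apply: msnd; exact: measurable_fst|exact: measurable_snd].
move=> /(_ mG') mc.
apply: (mset (g := fun p : T * T => (p.1, p.1, p.2)) mc).
apply: measurable_fun_pair; last exact: measurable_snd.
by apply: measurable_fun_pair; exact: measurable_fst.
Qed.

End EnumRelTheory.

Ltac mfun := repeat first [ assumption | exact: measurable_id
  | exact: measurable_fst | exact: measurable_snd | exact: measurable_cst
  | exact: enum_fun_meas | exact: enum_key_meas
  | apply: men | apply: mkey | apply: mfst | apply: msnd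
  | apply: measurable_fun_pair ].

(** * The mass of a subrelation *)

Section Prob.
Context {K : realType} {d : measure_display} {T : measurableType d}.
Context (mu : probability T K).
Local Open Scope ring_scope.

Definition prm (A : set T) : K := fine (mu A).
Local Notation pr := prm.

Lemma mu_le (A B : set T) : measurable A -> measurable B -> A `<=` B ->
  (mu A <= mu B)%E.
Proof. by move=> mA mB AB; apply: le_measure; rewrite ?inE. Qed.

Lemma mu_le1 (A : set T) : measurable A -> (mu A <= 1)%E.
Proof. exact: probability_le1. Qed.

Lemma mu_fin (A : set T) : measurable A -> mu A \is a fin_num.
Proof. by move=> mA; exact: fin_num_measure. Qed.

Lemma prE (A : set T) : measurable A -> mu A = (pr A)%:E.
Proof. by move=> mA; rewrite /prm fineK// mu_fin. Qed.

Lemma pr_ge0 (A : set T) : 0 <= pr A. Proof. exact: fine_ge0. Qed.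

Lemma pr_le (A B : set T) : measurable A -> measurable B -> A `<=` B -> pr A <= pr B.
Proof. by move=> mA mB AB; rewrite -lee_fin -!prE//; exact: mu_le. Qed.

Lemma pr_setT : pr setT = 1. Proof. by rewrite /prm probability_setT. Qed.

Lemma pr_le1 (A : set T) : measurable A -> pr A <= 1.
Proof. by move=> mA; rewrite -lee_fin -prE//; exact: mu_le1. Qed.

Lemma pr_set0 : pr set0 = 0. Proof. by rewrite /prm measure0. Qed.

Lemma prU (A B : set T) : measurable A -> measurable B -> A `&` B = set0 ->
  pr (A `|` B) = pr A + pr B.
Proof.
by move=> mA mB AB; rewrite /prm measureU// fineD// mu_fin.
Qed.

Lemma prU_le (A B : set T) : measurable A -> measurable B ->
  pr (A `|` B) <= pr A + pr B.
Proof.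
move=> mA mB; rewrite (_ : A `|` B = A `|` (B `\` A)); last by rewrite setUDr setDv setD0.
rewrite prU//; last 2 first.
- exact: measurableD.
- by rewrite setDE setICA setICr setI0.
by rewrite lerD2l; apply: pr_le => //; exact: measurableD.
Qed.

Lemma prD (A B : set T) : measurable A -> measurable B -> B `<=` A ->
  pr (A `\` B) = pr A - pr B.
Proof.
move=> mA mB BA; rewrite -{2}(setDUK BA) prU//; first by rewrite addrAC subrr add0r.
  exact: measurableD.
by rewrite setDE setICA setICr setI0.
Qed.

Lemma prC (A : set T) : measurable A -> pr (~` A) = 1 - pr A.
Proof. by move=> mA; rewrite -setTD prD// pr_setT. Qed.

Lemma pr_null (A B : set T) : measurable A -> measurable B -> A `<=` B -> pr B = 0 -> pr A = 0.
Proof.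
move=> mA mB AB B0; apply/eqP; rewrite eq_le pr_ge0 andbT -B0; exact: pr_le.
Qed.

Lemma pr_bigcup0 (F : nat -> set T) : (forall n, measurable (F n)) ->
  (forall n, pr (F n) = 0) -> pr (\bigcup_n F n) = 0.
Proof.
move=> mF F0; have mU : measurable (\bigcup_n F n) by exact: bigcupT_measurable.
have : mu.-negligible (\bigcup_n F n).
  apply: negligible_bigcup => k; have e : mu (F k) = 0%E by rewrite prE// F0.
  exact/negligibleP.
by rewrite negligibleP// /prm => ->.
Qed.

Lemma prD0 (A N : set T) : measurable A -> measurable N -> pr N = 0 ->
  pr (A `\` N) = pr A.
Proof.
move=> mA mN N0; apply/eqP; rewrite eq_le; apply/andP; split.
  apply: pr_le => //; exact: measurableD.
have := prU_le (measurableD mA mN) mN; rewrite N0 addr0; apply: le_trans.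
apply: pr_le => //; first by apply: measurableU => //; exact: measurableD.
by move=> x Ax; have [Nx|nNx] := pselect (N x); [right|left].
Qed.

Lemma pr_bigcup_lim (F : nat -> set T) : (forall n, measurable (F n)) ->
  (forall n, F n `<=` F n.+1) -> (pr (F n)) @[n --> \oo] --> pr (\bigcup_n F n).
Proof.
move=> mF ndF; have mU : measurable (\bigcup_n F n) by exact: bigcupT_measurable.
apply: fine_cvg; rewrite -prE//; apply: nondecreasing_cvg_mu => //.
by apply/nondecreasing_seqP => n; apply/subsetPset; exact: ndF.
Qed.

Lemma pr_bigcap_lim (F : nat -> set T) : (forall n, measurable (F n)) ->
  (forall n, F n.+1 `<=` F n) -> (pr (F n)) @[n --> \oo] --> pr (\bigcap_n F n).
Proof.
move=> mF niF; have mU : measurable (\bigcap_n F n) by exact: bigcapT_measurable.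
apply: fine_cvg; rewrite -prE//; apply: nonincreasing_cvg_mu => //.
  by rewrite ltey_eq mu_fin.
by apply/nonincreasing_seqP => n; apply/subsetPset; exact: niF.
Qed.

Lemma pr_bigcup_small (F : nat -> set T) (e : K) : (forall n, measurable (F n)) ->
  (forall n, F n `<=` F n.+1) -> 0 < e ->
  exists n, pr (\bigcup_n F n) - e < pr (F n).
Proof.
move=> mF ndF e0; have /cvgrPdist_lt/(_ e e0)[N _ /(_ N (leqnn N))] := pr_bigcup_lim mF ndF.
move=> h; exists N; move: h; rewrite /= ltr_norml => /andP[_]; lra.
Qed.

Lemma pr_bigcap_small (F : nat -> set T) (e : K) : (forall n, measurable (F n)) ->
  (forall n, F n.+1 `<=` F n) -> 0 < e ->
  exists n, pr (F n) < pr (\bigcap_n F n) + e.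
Proof.
move=> mF ndF e0; have /cvgrPdist_lt/(_ e e0)[N _ /(_ N (leqnn N))] := pr_bigcap_lim mF ndF.
move=> h; exists N; move: h; rewrite /= ltr_norml => /andP[]; lra.
Qed.

Lemma pr_bigsetU_le (I : Type) (s : seq I) (F : I -> set T) (c : K) :
  (forall i, measurable (F i)) -> (forall i, pr (F i) <= c) ->
  pr (\big[setU/set0]_(i <- s) F i) <= c *+ size s.
Proof.
move=> mF Fc; elim: s => [|i s IH]; first by rewrite big_nil pr_set0.
rewrite big_cons mulrS; apply: (le_trans (prU_le _ _)); last exact: lerD.
  by [].
exact: bigsetU_measurable.
Qed.

End Prob.

Section Mass.
Local Open Scope ring_scope.
Context {K : realType} {d : measure_display} {T : measurableType d}.
Context {mu : probability T K} (r : enumrel mu).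
Local Notation f := (enum_fun r).
Local Notation R := (rel_of r).
Local Notation pr := (prm mu).
Implicit Types G H : T -> T -> Prop.

Definition first_at n x := forall m, (m < n)%N -> f m x <> f n x.

Definition level_set G n := [set x | G x (f n x) /\ first_at n x].

Lemma mfirst_at n : measurable [set x | first_at n x].
Proof.
apply: malln => m; apply: mimp; first exact: mprop.
by apply: mnot; apply: (meq r); mfun.
Qed.

Lemma mlevel_set G n : mrel G -> measurable (level_set G n).
Proof.
move=> mG; apply: mand; last exact: mfirst_at.
by apply: mrelP => //; mfun.
Qed.

Lemma first_atP x y : R x y -> exists2 n, f n x = y & first_at n x.
Proof.
move=> [n e]; have ex : exists n, `[< f n x = y >] by exists n; apply/asboolP.
exists (ex_minn ex); case: ex_minnP => k /asboolP ek kmin //.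
by move=> j jk; rewrite ek => /asboolP/kmin; rewrite leqNgt jk.
Qed.

Lemma first_at_inj n m x : first_at n x -> first_at m x -> f n x = f m x -> n = m.
Proof.
move=> hn hm e; have [ltnm|ltmn|//] := ltngtP n m.
- by have := hm n ltnm.
- by case: (hn m ltmn).
Qed.

(* The integral over [x] of the number of [y] with [G x y], for [G] inside the
   relation. *)
Definition mass G : \bar K := (\sum_(n <oo) mu (level_set G n))%E.

Lemma mass_ge0 G : (0 <= mass G)%E.
Proof. by apply: nneseries_ge0 => n _. Qed.

Lemma eq_mass G H : (forall x y, R x y -> (G x y <-> H x y)) -> mass G = mass H.
Proof.
move=> GH; apply: eq_eseriesr => n _; congr (mu _).
have [gh hg] : (forall x, G x (f n x) -> H x (f n x)) /\ (forall x, H x (f n x) -> G x (f n x)).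
  by split=> x; apply GH; exact: rel_fun.
by apply/seteqP; split=> x [Gx ?]; split=> //; [exact: gh|exact: hg].
Qed.

Lemma mass_bigU (F : nat -> T -> T -> Prop) : (forall i, mrel (F i)) ->
  (forall i j x y, F i x y -> F j x y -> i = j) ->
  mass (fun x y => exists i, F i x y) = (\sum_(i <oo) mass (F i))%E.
Proof.
move=> mF dF; rewrite /mass nneseries_interchange//.
apply: eq_eseriesr => n _; rewrite -measure_semi_bigcup; last 1 first.
- by apply: bigcupT_measurable => i; exact: mlevel_set.
- congr (mu _); apply/seteqP; split=> x.
    by move=> [[i Fi] ?]; exists i.
  by move=> [i _ [Fi ?]]; split=> //; exists i.
- by move=> i; exact: mlevel_set.
- apply/trivIsetP => i j _ _ ij; apply/seteqP; split=> // x [[Fi _] [Fj _]].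
  by move: ij; rewrite (dF _ _ _ _ Fi Fj) eqxx.
Qed.

Lemma massU G H : mrel G -> mrel H -> (forall x y, G x y -> H x y -> False) ->
  mass (runion G H) = (mass G + mass H)%E.
Proof.
move=> mG mH dGH; rewrite /mass -nneseriesD//; apply: eq_eseriesr => n _.
rewrite -measureU; [|exact: mlevel_set|exact: mlevel_set|].
  congr (mu _); apply/seteqP; split=> x; first by move=> [[|] ?]; [left|right].
  by move=> [[? ?]|[? ?]]; split=> //; [left|right].
by apply/seteqP; split=> // x [[Gx _] [Hx _]]; exact: dGH Hx.
Qed.

Lemma mass_fun G : mrel G -> (forall x y, G x y -> R x y) ->
  (forall x y y', G x y -> G x y' -> y = y') ->
  mass G = mu [set x | exists y, G x y].
Proof.
move=> mG GR Gf; rewrite /mass -measure_semi_bigcup.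
- congr (mu _); apply/seteqP; split=> x; first by move=> [n _ [Gx _]]; exists (f n x).
  by move=> [y Gxy]; have [n e hn] := first_atP (GR _ _ Gxy); exists n; rewrite /level_set/= ?e.
- by move=> n; exact: mlevel_set.
- apply/trivIsetP => i j _ _ ij; apply/seteqP; split=> // x [[Gi hi] [Gj hj]].
  by move: ij; rewrite (first_at_inj hi hj) ?eqxx//; exact: Gf Gj.
- by apply: bigcupT_measurable => i; exact: mlevel_set.
Qed.

(** The relation is partitioned into countably many partial Borel bijections in the manner of
    Feldman and Moore: [k] codes the first index leading from [x] to [y] and the first one leading
    back. *)
Definition piece k x y := exists n m, [/\ k = pickle (n, m), f n x = y, first_at n x,
  f m y = x & first_at m y].

Lemma mrel_piece k : mrel (piece k).
Proof.
have m1 := @measurable_fst _ _ T T; have m2 := @measurable_snd _ _ T T.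
apply: mexn => n; apply: mexn => m.
rewrite (_ : [set u | _] = [set u : T * T | k = pickle (n, m) /\ (f n u.1 = u.2 /\
   (first_at n u.1 /\ (f m u.2 = u.1 /\ first_at m u.2)))]); last first.
  by apply/seteqP; split=> u; [case=> *; do !split|move=> [? [? [? [? ?]]]]].
apply: mand; first exact: mprop.
apply: mand; first by apply: (meq r) => //; mfun.
apply: mand; first exact: (mset (mfirst_at n)).
apply: mand; first by apply: (meq r) => //; mfun.
exact: (mset (mfirst_at m)).
Qed.

Lemma pieceP x y : R x y -> exists k, piece k x y.
Proof.
move=> xy; have [n en hn] := first_atP xy; have [m em hm] := first_atP (rel_sym xy).
by exists (pickle (n, m)), n, m.
Qed.

Lemma piece_fun k x y y' : piece k x y -> piece k x y' -> y = y'.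
Proof.
move=> [n [m [-> <- _ _ _]]] [n' [m' [e <- _ _ _]]].
by have [-> _] := pcan_inj pickleK e.
Qed.

Lemma piece_inj k x x' y : piece k x y -> piece k x' y -> x = x'.
Proof.
move=> [n [m [-> _ _ <- _]]] [n' [m' [e _ _ <- _]]].
by have [_ ->] := pcan_inj pickleK e.
Qed.

Lemma piece_uniq i j x y : piece i x y -> piece j x y -> i = j.
Proof.
move=> [n [m [-> en hn em hm]]] [n' [m' [-> en' hn' em' hm']]].
by rewrite (first_at_inj hn hn') ?en ?en'// (first_at_inj hm hm') ?em ?em'.
Qed.

Lemma mass_pieces G : mrel G -> (forall x y, G x y -> R x y) ->
  mass G = (\sum_(k <oo) mu [set x | exists y, G x y /\ piece k x y])%E.
Proof.
move=> mG GR; rewrite (eq_mass (H := fun x y => exists k, G x y /\ piece k x y)).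
  rewrite mass_bigU.
  - apply: eq_eseriesr => k _; apply: mass_fun.
    + by apply: mrelI => //; exact: mrel_piece.
    + by move=> x y [/GR].
    + by move=> x y y' [_ h1] [_]; exact: piece_fun.
  - by move=> i; apply: mrelI => //; exact: mrel_piece.
  - by move=> i j x y [_ h1] [_ h2]; exact: piece_uniq h2.
move=> x y xy; split=> [Gxy|[k []//]].
by have [k ?] := pieceP xy; exists k.
Qed.

(** The mass transport principle: [G] is cut into partial bijections, each having domain and range
    of equal measure. *)
Lemma mass_tr G : mrel G -> (forall x y, G x y -> R x y) ->
  mass (fun x y => G y x) = mass G.
Proof.
move=> mG GR; have mGt := mrel_tr mG.
have GtR x y : G y x -> R x y by move=> /GR/rel_sym.
rewrite (mass_pieces mG GR).
rewrite (eq_mass (H := fun x y => exists k, G y x /\ piece k y x)); last first.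
  move=> x y xy; split=> [Gyx|[k []//]].
  by have [k ?] := pieceP (rel_sym xy); exists k.
rewrite mass_bigU; last 2 first.
- by move=> i; apply: mrelI => //; exact: (mrel_tr (mrel_piece i)).
- by move=> i j x y [_ h1] [_ h2]; exact: piece_uniq h2.
apply: eq_eseriesr => k _; rewrite mass_fun; last 3 first.
- by apply: mrelI => //; exact: (mrel_tr (mrel_piece k)).
- by move=> x y [/GtR].
- by move=> x y y' [_ h1] [_]; exact: piece_inj.
apply: (pbij_measure (r := r) (G := fun x y => G x y /\ piece k x y)).
- by apply: mrelI => //; exact: mrel_piece.
- by move=> x y [/GR].
- by move=> x y y' [_ h1] [_]; exact: piece_fun.
- by move=> x x' y [_ h1] [_]; exact: piece_inj.
Qed.

Definition invariant_set (A : set T) := forall x y, R x y -> A x -> A y.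

Definition sat (A : set T) := [set x | exists y, R x y /\ A y].

Lemma sat_inv A : invariant_set (sat A).
Proof.
move=> x y xy [z [xz Az]]; exists z; split=> //; exact: rel_trans (rel_sym xy) xz.
Qed.

Lemma sub_sat A : A `<=` sat A.
Proof. by move=> x Ax; exists x; split=> //; exact: rel_refl. Qed.

Lemma msat A : measurable A -> measurable (sat A).
Proof.
move=> mA; apply: (mexR (r := r) (g := fun x => x)); first by move=> x y [].
move=> n; apply: mand; first by apply: mR => //; mfun.
by apply: (mset mA); mfun.
Qed.

(** The saturation is a countable union, over the pieces, of sets in measure preserving bijection
    with subsets of [A]. *)
Lemma sat_null A : measurable A -> pr A = 0 -> pr (sat A) = 0.
Proof.
move=> mA A0; pose G x y := R x y /\ A y.
have mG : mrel G.
  by apply: mrelI; [exact: mrel_rel|apply: (mset mA); exact: measurable_snd].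
have mp k : measurable [set x | exists y, G x y /\ piece k x y].
  apply: (mrel_dom (r := r)); last by move=> x y [[]].
  by apply: mrelI => //; exact: mrel_piece.
apply: (pr_null (B := \bigcup_k [set x | exists y, G x y /\ piece k x y])).
- exact: msat.
- exact: bigcupT_measurable.
- by move=> x [y [xy Ay]]; have [k p] := pieceP xy; exists k => //; exists y.
apply: pr_bigcup0 => // k.
have := pbij_measure (r := r) (G := fun x y => G x y /\ piece k x y).
have mGp : mrel (fun x y => G x y /\ piece k x y) by apply: mrelI => //; exact: mrel_piece.
have GpR x y : G x y /\ piece k x y -> R x y by case=> [[]].
move=> /(_ mGp GpR); rewrite /prm => <-.
- apply: (pr_null (B := A)) => //; first exact: (mrel_ran (r := r) mGp).
  by move=> y [x [[]]].
- by move=> x y y' [_ h1] [_]; exact: piece_fun.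
- by move=> x x' y [_ h1] [_]; exact: piece_inj.
Qed.

(** Removing the saturation of a null set is the way in which almost everywhere statements become
    statements on an invariant set. *)
Lemma conull_invariant (N : set T) : measurable N -> pr N = 0 ->
  exists X : set T, [/\ measurable X, invariant_set X, pr (~` X) = 0 & X `<=` ~` N].
Proof.
move=> mN N0; exists (~` sat N); split.
- by apply: measurableC; exact: msat.
- by move=> x y xy nx sy; apply: nx; apply: sat_inv sy; exact: rel_sym.
- by rewrite setCK; exact: sat_null.
- by move=> x nx Nx; apply: nx; exact: sub_sat.
Qed.

End Mass.

(** * Cutting sets into pieces of prescribed measure *)

(** Both sides are the length of the overlap of the intervals [s, s + a) and [c, c + b), measured
    from [s] on the left and from [c] on the right. *)
Lemma overlap_length (K : realType) (s c a b : K) : (0 <= a -> 0 <= b ->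
  Num.max 0 (Num.min (c + b - s) a) - Num.max 0 (Num.min (c - s) a) =
  Num.max 0 (Num.min (s + a - c) b) - Num.max 0 (Num.min (s - c) b))%R.
Proof.
move=> a0 b0.
case: (leP (c + b - s)%R a) => ?; case: (leP (c - s)%R a) => ?;
case: (leP (s + a - c)%R b) => ?; case: (leP (s - c)%R b) => ?;
repeat (match goal with |- context[Order.max 0%R ?x] => case: (leP 0%R x) => ? end); lra.
Qed.

Section Cut.
Context {K : realType} {d : measure_display} {T : measurableType d}.
Context {mu : probability T K} (r : enumrel mu).
Local Open Scope ring_scope.
Local Notation h := (enum_key r).
Local Notation pr := (prm mu).
Hypothesis atomless : forall x : T, pr [set x] = 0.

Let mlow (A : set T) t : measurable A -> measurable (A `&` [set x | h x < t]).
Proof.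
move=> mA; apply: measurableI => //; apply: mlt; first exact: enum_key_meas.
exact: measurable_cst.
Qed.

Lemma meas_point (x : T) : measurable [set x].
Proof.
rewrite (_ : [set x] = [set y | y = x]); last by apply/seteqP; split.
by apply: (meq r); mfun.
Qed.

Lemma pr_low_mono (A : set T) s t : measurable A -> s <= t ->
  pr (A `&` [set x | h x < s]) <= pr (A `&` [set x | h x < t]).
Proof.
move=> mA st; apply: pr_le; [exact: mlow|exact: mlow|].
by move=> x [Ax /= hs]; split=> //=; exact: lt_le_trans st.
Qed.

(** The measure of the part of [A] below a level depends continuously on the level, because a level
    set of the key has at most one point and points are null. So the infimum [t] of the levels
    reaching [c] gives exactly [c]. *)
Lemma cut (A : set T) c : measurable A -> 0 < c -> c <= pr A ->
  exists t, pr (A `&` [set x | h x < t]) = c /\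
    forall s, s < t -> pr (A `&` [set x | h x < s]) < c.
Proof.
move=> mA c0 cA; pose S := [set t | c <= pr (A `&` [set x | h x < t])].
(* Keys are at most 1, so level 2 captures all of [A]. *)
have S2 : S 2.
  rewrite /S /= (_ : _ `&` _ = A) //; apply/seteqP; split=> [x []//|x Ax].
  split=> //=; have /andP[_] := enum_key01 r x; lra.
have lbS : has_lbound S.
  exists 0 => t St; rewrite leNgt; apply/negP => t0; move: St.
  rewrite /S /= (_ : _ `&` _ = set0) ?pr_set0; last first.
    apply/seteqP; split=> // x [_ /=]; have /andP[] := enum_key01 r x; lra.
  by rewrite leNgt c0.
have hiS : has_inf S by split; [exists 2|].
pose t := inf S.
have below s : s < t -> pr (A `&` [set x | h x < s]) < c.
  move=> st; rewrite ltNge; apply/negP => Ss.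
  by have := ge_inf lbS Ss; rewrite leNgt st.
have above s : t < s -> c <= pr (A `&` [set x | h x < s]).
  move=> ts; have st0 : 0 < s - t by rewrite subr_gt0.
  have [u Su] := inf_adherent st0 hiS; rewrite -/t => us.
  apply: (le_trans Su); apply: pr_low_mono => //; lra.
exists t; split=> //; apply/eqP; rewrite eq_le; apply/andP; split.
  rewrite leNgt; apply/negP => ct.
  pose F n := A `&` [set x | h x < t - n.+1%:R^-1].
  have mF n : measurable (F n) by exact: mlow.
  have UF : A `&` [set x | h x < t] = \bigcup_n F n.
    apply/seteqP; split=> x; last first.
      move=> [n _ [Ax /= hx]]; split=> //=; apply: (lt_trans hx).
      by rewrite ltrBlDr ltrDl invr_gt0.
    move=> [Ax /= hx]; have := ltr_add_invr hx => -[n hn]; exists n => //; split=> //=.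
    by rewrite ltrBrDr.
  have ndF n : F n `<=` F n.+1.
    move=> x [Ax /= hx]; split=> //=; apply: (lt_le_trans hx).
    by rewrite lerD2l lerN2 lef_pV2 ?posrE// ler_nat.
  have e0 : 0 < pr (A `&` [set x | h x < t]) - c by lra.
  have [n] := pr_bigcup_small mu mF ndF e0; rewrite -UF.
  have : pr (F n) < c by apply: below; rewrite ltrBlDr ltrDl invr_gt0.
  lra.
pose F n := A `&` [set x | h x < t + n.+1%:R^-1].
have mF n : measurable (F n) by exact: mlow.
have niF n : F n.+1 `<=` F n.
  move=> x [Ax /= hx]; split=> //=; apply: (lt_le_trans hx).
  by rewrite lerD2l lef_pV2 ?posrE// ler_nat.
have IF : \bigcap_n F n `<=` (A `&` [set x | h x < t]) `|` [set x | h x = t].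
  move=> x Fx; have [Ax _] := Fx 0%N I.
  have [hx|hx|hx] := ltgtP (h x) t; [by left|exfalso|by right].
  have [n hn] := ltr_add_invr hx; have [_ /= hx'] := Fx n I.
  by have := lt_trans hx' hn; rewrite ltxx.
have mt : measurable [set x | h x = t].
  rewrite (_ : [set x | _] = h @^-1` [set t]); last by apply/seteqP; split.
  by rewrite -[X in measurable X]setTI; exact: enum_key_meas.
have t0 : pr [set x | h x = t] = 0.
  have [[x hx]|nx] := pselect (exists x, h x = t).
    rewrite (_ : [set _ | _] = [set x]) ?atomless//; apply/seteqP; split=> y /=.
      by move=> hy; apply: (enum_key_inj (e := r)); rewrite hy.
    by move=> ->.
  rewrite (_ : [set _ | _] = set0) ?pr_set0//.
  by apply/seteqP; split=> // x hx; apply: nx; exists x.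
rewrite leNgt; apply/negP => ct.
have e0 : 0 < c - pr (A `&` [set x | h x < t]) by lra.
have [n] := pr_bigcap_small mu mF niF e0.
have : c <= pr (F n) by apply: above; rewrite ltrDl invr_gt0.
have : pr (\bigcap_n F n) <= pr (A `&` [set x | h x < t]) + 0.
  rewrite -t0; apply: le_trans (prU_le mu _ _); [|exact: mlow|exact: mt].
  apply: pr_le => //; first exact: bigcapT_measurable.
  by apply: measurableU => //; exact: mlow.
lra.
Qed.

Definition cdf (A : set T) (x : T) : K := pr (A `&` [set y | h y < h x]).

Lemma cdf_lt (A : set T) c : measurable A -> 0 < c -> c <= pr A -> exists t,
  [set x | cdf A x < c] = [set x | h x < t] /\ pr (A `&` [set x | h x < t]) = c.
Proof.
move=> mA c0 cA; have [t [ct lt_t]] := cut mA c0 cA; exists t; split=> //.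
apply/seteqP; split=> x /=; last exact: lt_t.
move=> xc; rewrite ltNge; apply/negP => th; move: xc.
by rewrite ltNge -ct => /negP; apply; exact: pr_low_mono.
Qed.

Lemma cdf_ge0 A x : 0 <= cdf A x. Proof. exact: pr_ge0. Qed.

Lemma cdf_le A x : measurable A -> cdf A x <= pr A.
Proof. by move=> mA; apply: pr_le => //; exact: mlow. Qed.

Lemma mcdf A c : measurable A -> measurable [set x | cdf A x < c].
Proof.
move=> mA; have [c0|c0] := lerP c 0.
  rewrite (_ : [set x | _] = set0) //; apply/seteqP; split=> // x /=.
  by rewrite ltNge (le_trans c0)// cdf_ge0.
have [cA|cA] := lerP c (pr A).
  have [t [-> _]] := cdf_lt mA c0 cA.
  by apply: mlt; [exact: enum_key_meas|exact: measurable_cst].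
rewrite (_ : [set x | _] = setT) //; apply/seteqP; split=> // x _ /=.
by apply: le_lt_trans cA; exact: cdf_le.
Qed.

(** [cdf A] carries the measure on [A] to Lebesgue measure on the interval from 0 to [pr A]; cutting
    at its values therefore gives exact measures. *)
Lemma pr_cdf A c : measurable A ->
  pr (A `&` [set x | cdf A x < c]) = Num.max 0 (Num.min c (pr A)).
Proof.
move=> mA; have A0 := pr_ge0 mu A; have [c0|c0] := lerP c 0.
  rewrite (_ : _ `&` _ = set0); last first.
    apply/seteqP; split=> // x [_ /=].
    by rewrite ltNge (le_trans c0)// cdf_ge0.
  by rewrite pr_set0; case: (leP c (pr A)) => ?; case: leP => ?; lra.
have [cA|cA] := lerP c (pr A).
  by have [t [-> ->]] := cdf_lt mA c0 cA; case: leP => //; lra.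
have sub x : A x -> x \in A by rewrite inE.
have [A00|A00] := eqVneq (pr A) 0.
  have -> : pr (A `&` [set x | cdf A x < c]) = 0.
    by apply: (pr_null _ mA) => //; apply: measurableI => //; exact: mcdf.
  by rewrite A00; case: leP.
have Ap : 0 < pr A by rewrite lt_neqAle eq_sym A00.
have [t [e1 e2]] := cdf_lt mA Ap (lexx _).
have -> : Num.max 0 (pr A) = pr A by case: leP; lra.
apply/eqP; rewrite eq_le; apply/andP; split.
  by apply: pr_le => //; apply: measurableI => //; exact: mcdf.
rewrite -{1}e2 -e1; apply: pr_le.
- by apply: measurableI => //; exact: mcdf.
- by apply: measurableI => //; exact: mcdf.
- by move=> x [Ax /= xA]; split=> //=; exact: lt_trans cA.
Qed.

Lemma divide (A : set T) c : measurable A -> 0 <= c -> c <= pr A ->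
  exists B, [/\ measurable B, B `<=` A & pr B = c].
Proof.
move=> mA c0 cA; exists (A `&` [set x | cdf A x < c]); split.
- by apply: measurableI => //; exact: mcdf.
- by move=> x [].
- by rewrite pr_cdf//; case: (leP c (pr A)) => ?; case: leP => ?; lra.
Qed.

Lemma slice_measure (A : set T) a b : measurable A -> a <= b ->
  pr (A `&` [set x | a <= cdf A x < b]) =
  Num.max 0 (Num.min b (pr A)) - Num.max 0 (Num.min a (pr A)).
Proof.
move=> mA ab; rewrite -!pr_cdf// -prD.
- congr (pr _); apply/seteqP; split=> x /=.
    by move=> [Ax /andP[xa xb]]; split=> // -[_]; rewrite ltNge xa.
  move=> [[Ax xb] nx]; split=> //; rewrite xb andbT leNgt; apply/negP => xa.
  exact: nx.
- by apply: measurableI => //; exact: mcdf.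
- by apply: measurableI => //; exact: mcdf.
- by move=> x [Ax /= xa]; split=> //=; exact: lt_le_trans ab.
Qed.

Lemma mslice (A : set T) a b : measurable A ->
  measurable (A `&` [set x | a <= cdf A x < b]).
Proof.
move=> mA; rewrite (_ : _ `&` _ =
  (A `&` [set x | cdf A x < b]) `\` [set x | cdf A x < a]); last first.
  apply/seteqP; split=> x /=.
    by move=> [Ax /andP[xa xb]]; split=> //; apply/negP; rewrite -leNgt.
  by move=> [[Ax xb] /negP]; rewrite -leNgt => ->; rewrite xb.
by apply: measurableD; [apply: measurableI => //|]; exact: mcdf.
Qed.

Lemma chop (A : set T) (e : K) : measurable A -> 0 < e ->
  exists n (B : nat -> set T), [/\ forall i, measurable (B i),
    forall i, B i `<=` A, forall i, (i < n)%N -> pr (B i) = e,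
    trivIset setT B & pr A - e *+ n < e /\
      pr (A `\` \bigcup_(i in [set i | (i < n)%N]) B i) = pr A - e *+ n].
Proof.
move=> mA e0.
(* The least such [n] is the integral part of [pr A / e], which leaves a remainder below [e]. *)
have ex : exists n, pr A < e *+ n.+1.
  have := archi_boundP (divr_ge0 (pr_ge0 mu A) (ltW e0)).
  set n := Num.bound _ => hn; exists n.
  rewrite -mulr_natr mulrC -ltr_pdivrMr//; apply: (lt_le_trans hn).
  by rewrite ler_nat.
exists (ex_minn ex); case: ex_minnP => n hn nmin.
have nA : e *+ n <= pr A.
  case: n hn nmin => [|n] hn nmin; first by rewrite mulr0n pr_ge0.
  by rewrite leNgt; apply/negP => /nmin; rewrite ltnn.
pose B i := A `&` [set x | e *+ i <= cdf A x < e *+ i.+1].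
have lee i j : (i <= j)%N -> e *+ i <= e *+ j.
  by move=> ij; rewrite ler_pMn2l.
have tB : trivIset setT B.
  apply/trivIsetP => i j _ _; rewrite neq_ltn => ij.
  apply/seteqP; split=> // x [[_ /andP[xi xi']] [_ /andP[xj xj']]].
  by case/orP: ij => /lee le1; lra.
have UB : \bigcup_(i in [set i | (i < n)%N]) B i = A `&` [set x | cdf A x < e *+ n].
  apply/seteqP; split=> x.
    move=> [i /= ilt [Ax /andP[_ xi]]]; split=> //=; apply: (lt_le_trans xi).
    exact: lee.
  move=> [Ax /= xn].
  have ex' : exists i, cdf A x < e *+ i by exists n.
  have [i xi imin] := ex_minnP ex'.
  case: i xi imin => [|i] xi imin.
    by have := cdf_ge0 A x; rewrite leNgt -(mulr0n e) xi.
  exists i => /=; first by exact: imin.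
  split=> //=; rewrite xi andbT leNgt; apply/negP => /imin; by rewrite ltnn.
exists B; split=> //.
- by move=> i; exact: mslice.
- by move=> i x [].
- move=> i ilt; rewrite slice_measure//; last exact: lee.
  have := lee _ _ ilt; have i0 : 0 <= e *+ i by rewrite mulrn_wge0// ltW.
  rewrite mulrS => ?; case: (leP (e + e *+ i) _) => ?; last lra.
  by case: (leP (e *+ i) _) => ?; case: leP => ?; case: leP => ?; lra.
- split; first by move: hn; rewrite mulrS; lra.
  rewrite UB prD//; last by apply: measurableI => //; exact: mcdf.
  rewrite pr_cdf//; congr (_ - _); have : 0 <= e *+ n by rewrite mulrn_wge0// ltW.
  by case: (leP (e *+ n) _) => ? ?; case: leP => ?; lra.
Qed.

(** The sets [A p] are laid end to end on the half line by means of [cdf], and so are the sets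
    [B q]; the pieces with indices (p, q) come from the overlap of the p-th interval of the first
    row with the q-th of the second. *)
Lemma refine_partition (A B : nat -> set T) :
  (forall p, measurable (A p)) -> (forall q, measurable (B q)) ->
  (\sum_(p <oo) mu (A p))%E = (\sum_(q <oo) mu (B q))%E ->
  exists A' B' : nat -> nat -> set T,
  [/\ forall p q, [/\ measurable (A' p q), measurable (B' p q),
        A' p q `<=` A p, B' p q `<=` B q & pr (A' p q) = pr (B' p q)],
      forall p q q' x, A' p q x -> A' p q' x -> q = q',
      forall p p' q x, B' p q x -> B' p' q x -> p = p',
      forall p, pr (A p `\` \bigcup_q A' p q) = 0 &
      forall q, pr (B q `\` \bigcup_p B' p q) = 0].
Proof.
move=> mA mB eAB.
pose S (A : nat -> set T) p := \sum_(i < p) pr (A i).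
pose sl (A B : nat -> set T) p q :=
  A p `&` [set x | S B q - S A p <= cdf (A p) x < S B q.+1 - S A p].
have SS C p : S C p.+1 = S C p + pr (C p) by rewrite /S big_ord_recr.
have S_mono C p q : (p <= q)%N -> S C p <= S C q.
  move=> /subnK <-; elim: (q - p)%N => // n IH; rewrite addSn SS.
  by apply: (le_trans IH); rewrite lerDl pr_ge0.
have disj C D p q q' x : sl C D p q x -> sl C D p q' x -> q = q'.
  move=> [_ /= /andP[h1 h2]] [_ /= /andP[h3 h4]].
  by case: (ltngtP q q') => [/(S_mono D) lt|/(S_mono D) lt|//]; exfalso; clear eAB; lra.
have msl C D p q : (forall p, measurable (C p)) -> measurable (sl C D p q).
  by move=> mC; exact: mslice.
have S_lim C : (forall p, measurable (C p)) -> forall v,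
    (forall q, S C q <= v) -> (\sum_(q <oo) mu (C q) <= v%:E)%E.
  move=> mC v Sv; apply: lime_le; first exact: is_cvg_nneseries.
  apply: nearW => n; rewrite big_mkord; under eq_bigr do rewrite prE//.
  by rewrite sumEFin lee_fin; exact: Sv.
have S_sum C : (forall p, measurable (C p)) -> forall p,
    ((S C p)%:E <= \sum_(q <oo) mu (C q))%E.
  move=> mC p; apply: le_trans (nneseries_lim_ge p _) => //.
  by rewrite big_mkord -sumEFin; under eq_bigr do rewrite -prE//.
have cover C D : (forall p, measurable (C p)) -> (forall p, measurable (D p)) ->
    (\sum_(p <oo) mu (C p))%E = (\sum_(q <oo) mu (D q))%E ->
    forall p, pr (C p `\` \bigcup_q sl C D p q) = 0.
  move=> mC mD eCD p.
  have mcd : measurable (C p `&` [set x | cdf (C p) x < pr (C p)]).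
    by apply: measurableI => //; exact: mcdf.
  apply: (pr_null (B := C p `\` (C p `&` [set x | cdf (C p) x < pr (C p)]))).
  - apply: measurableD => //; apply: bigcupT_measurable => q; exact: msl.
  - exact: measurableD.
  - move=> x [Cx nx]; split=> // -[_ /= xp]; apply: nx.
    (* The position of [x] is below the total length of the row of [C], which equals that of the row
       of [D], hence below some partial sum of the latter. *)
    have [q0 xq0] : exists q, S C p + cdf (C p) x < S D q.
      apply: contrapT => nq.
      have : (\sum_(q <oo) mu (D q) <= (S C p + cdf (C p) x)%:E)%E.
        apply: S_lim => // q; rewrite leNgt; apply/negP => qq; apply: nq.
        by exists q.
      rewrite -eCD => /(le_trans (S_sum C mC p.+1)); rewrite lee_fin SS; clear eCD eAB; lra.
    have ex : exists q, S C p + cdf (C p) x < S D q by exists q0.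
    have [q xq qmin] := ex_minnP ex.
    case: q xq qmin => [|q] xq qmin.
      have := cdf_ge0 (C p) x; have := S_mono C 0%N p isT.
      by move: xq; rewrite /S !big_ord0; clear eCD eAB; lra.
    exists q => //; clear eCD eAB; split=> //=; apply/andP; split; last lra.
    rewrite leNgt; apply/negP => xq'; have : S C p + cdf (C p) x < S D q by lra.
    by move=> /qmin; rewrite ltnn.
  - clear eCD eAB; rewrite prD// ?pr_cdf//.
    have := pr_ge0 mu (C p); case: (leP (pr (C p)) (pr (C p))) => [_|]; last lra.
    by case: leP; lra.
exists (sl A B), (fun p q => sl B A q p); split.
- move=> p q; split; [exact: msl|exact: msl|by move=> x []|by move=> x []|].
  rewrite !slice_measure//; last 2 first.
  + by rewrite lerD2r; exact: S_mono.
  + by rewrite lerD2r; exact: S_mono.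
  by rewrite !SS; apply: overlap_length; exact: pr_ge0.
- exact: disj.
- by move=> p p' q x; exact: disj.
- exact: cover.
- by move=> q; apply: cover.
Qed.

End Cut.

(** * Sliding edges *)

(** The third component of the decoded triple is forgotten, so every pair of indices recurs beyond
    any bound and a greedy procedure can retry it. *)
Definition decode_pair (k : nat) : nat * nat :=
  if @unpickle (nat * nat * nat)%type k is Some (n, m, _) then (n, m) else (0, 0)%N.

Lemma injective_unbounded (g : nat -> nat) N : injective g -> exists j, (N <= g j)%N.
Proof.
move=> gi; apply: contrapT => ng.
have lt j : (g j < N)%N by rewrite ltnNge; apply/negP => h; apply: ng; exists j.
pose gg (i : 'I_N.+1) : 'I_N := Ordinal (lt i).
have : injective gg by move=> i j [] /gi /val_inj.
by move=> /leq_card; rewrite !card_ord ltnn.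
Qed.

Lemma decode_pair_often n m N : exists2 k, (N <= k)%N & decode_pair k = (n, m).
Proof.
have [|j hj] := @injective_unbounded (fun j => pickle (n, m, j)) N.
  by move=> i j /(pcan_inj pickleK)[].
by exists (pickle (n, m, j)) => //; rewrite /decode_pair pickleK.
Qed.

Section Skeleton.
Context {K : realType} {d : measure_display} {T : measurableType d}.
Context {mu : probability T K} (r : enumrel mu).
Local Open Scope ring_scope.
Local Notation f := (enum_fun r).
Local Notation R := (rel_of r).
Local Notation pr := (prm mu).
Implicit Types (X A B : set T) (b : T -> T) (E : T -> T -> Prop).

Definition feq b : T -> T -> Prop := fun x y => b x = b y.

(* [b] retracts the space onto a transversal of the equivalence relation
   [feq b]; modulo [feq b] the graph [E] is a forest spanning the classes of the
   ambient relation. *)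
Record skeleton X b E : Prop := Skeleton {
  sk_meas : measurable X;
  sk_inv : invariant_set r X;
  sk_conull : pr (~` X) = 0;
  sk_retr_meas : measurable_fun setT b;
  sk_retr_rel : forall x, R x (b x);
  sk_retr_idem : forall x, b (b x) = b x;
  sk_edge_meas : mrel E;
  sk_edge_sym : rsym E;
  sk_edge_rel : forall x y, E x y -> R x y;
  sk_gen : forall x y, X x -> R x y -> conn (runion (feq b) E) x y;
  sk_bridges : bridges (feq b) E
}.

Definition ergodic_rel := forall A, measurable A -> invariant_set r A -> pr A = 0 \/ pr A = 1.

(** The saturation of [B] is conull by ergodicity, so almost every point of [A] has a companion in
    [B]. *)
Lemma ergodic_meet A B : ergodic_rel -> measurable A -> measurable B ->
  0 < pr A -> 0 < pr B -> forall X, measurable X -> pr (~` X) = 0 ->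
  exists x y, [/\ A x, B y, R x y & X x].
Proof.
move=> erg mA mB A0 B0 X mX X0.
have full C : measurable C -> 0 < pr C -> pr (~` sat r C) = 0.
  move=> mC C0; rewrite prC; last exact: msat.
  have [e|->] := erg (sat r C) (msat r mC) (sat_inv (r := r) (A := C)); last by rewrite subrr.
  have := pr_null mC (msat r mC) (sub_sat r (A := C)) e; lra.
have full_inv : pr (A `\` (~` X `|` ~` sat r B)) = pr A.
  apply: prD0 => //.
    by apply: measurableU; apply: measurableC => //; exact: msat.
  have m1 := measurableC mX; have m2 := measurableC (msat r mB).
  apply/eqP; rewrite eq_le pr_ge0 andbT; apply: (le_trans (prU_le mu m1 m2)).
  by rewrite X0 (full _ mB B0) addr0.
have [[x [Ax nx]]|ne] := pselect (exists x, (A `\` (~` X `|` ~` sat r B)) x).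
  have [y [xy By]] : sat r B x by apply: contrapT => h; apply: nx; right.
  by exists x, y; split=> //; apply: contrapT => h; apply: nx; left.
have e : A `\` (~` X `|` ~` sat r B) = set0.
  by apply/seteqP; split=> // x hx; apply: ne; exists x.
by move: full_inv; rewrite e pr_set0; lra.
Qed.

(** * Sliding edges onto pairs from two sets of equal measure *)

Section Slide.
Variables (X A B : set T) (b : T -> T) (E : T -> T -> Prop).
Hypotheses (erg : ergodic_rel) (skel : skeleton X b E).
Hypotheses (mA : measurable A) (mB : measurable B) (prAB : pr A = pr B).
Hypotheses (Ab : forall x, A x -> b x = x) (Bb : forall x, B x -> b x = x).
Hypothesis AB0 : forall x, A x -> B x -> False.

Implicit Types M S : T -> T -> Prop.
(** [M] is the matching of [A] with [B] made so far and [S] the edges given up for it. In [enter]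
    the point [a] reaches [y] without visiting an unmatched [B]-class, and the edge (y, x) then
    enters the class of the unmatched [z]. So [a] is connected to [y], and [z] to [x], off this
    edge, which may be traded for the identification of [a] with [z]. *)
Let unA M a := A a /\ ~ exists z, M a z.
Let unB M z := B z /\ ~ exists a, M a z.
Let rest S x y := [/\ E x y, ~ S x y & ~ S y x].
Let far M S x y := [/\ [\/ feq b x y, M x y | rest S x y], ~ unB M (b x) & ~ unB M (b y)].
Let enter M S a z y x := [/\ unA M a, unB M z & conn (far M S) a y] /\
  [/\ rest S y x, b x = z & ~ unB M (b y)].
Let move_at n m M S a z y x := [/\ f n a = z, f m z = a & enter M S a z y x].

(** All moves belonging to one pair of indices are made at once. They do not compete for points,
    since [f n] and [f m] make [a] and [z] determine each other. *)
Fixpoint slide_state k : (T -> T -> Prop) * (T -> T -> Prop) :=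
  if k is j.+1 then
    let: (M, L) := slide_state j in let: (n, m) := decode_pair j in
    (runion M (fun a z => exists y x, move_at n m M L a z y x),
     runion L (fun x y => exists a z, move_at n m M L a z y x))
  else ((fun _ _ => False), (fun _ _ => False)).

Let M_ k := (slide_state k).1.
Let S_ k := (slide_state k).2.
Let step k a z y x :=
  move_at (decode_pair k).1 (decode_pair k).2 (M_ k) (S_ k) a z y x.

Let MS k : M_ k.+1 = runion (M_ k) (fun a z => exists y x, step k a z y x).
Proof. by rewrite /step /M_ /S_ /=; case: slide_state => M S; case: decode_pair. Qed.

Let SS k : S_ k.+1 = runion (S_ k) (fun x y => exists a z, step k a z y x).
Proof. by rewrite /step /M_ /S_ /=; case: slide_state => M S; case: decode_pair. Qed.

Let M_dom k a z : M_ k a z -> [/\ A a, B z & R a z].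
Proof.
elim: k => // k IH; rewrite MS => -[/IH//|[y [x [e _ [[[Aa _] [Bz _] _] _]]]]].
by split=> //; rewrite -e; exact: rel_fun.
Qed.

Let S_dom k x y : S_ k x y -> E x y.
Proof.
elim: k => // k IH; rewrite SS => -[/IH//|[a [z [_ _ [_ [[h _ _] _ _]]]]]].
exact: (sk_edge_sym skel).
Qed.

Let S_matched k x y : S_ k x y -> exists a, M_ k a (b x).
Proof.
elim: k => // k IH; rewrite SS MS => -[/IH[a h]|[a [z h]]]; first by exists a; left.
by exists a; right; exists y, x; case: (h) => _ _ [_ [_ -> _]].
Qed.

Let M_le k j a z : (k <= j)%N -> M_ k a z -> M_ j a z.
Proof. by move=> /subnK <-; elim: (j - k)%N => // i IH /IH; rewrite addSn MS; left. Qed.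

Let S_le k j x y : (k <= j)%N -> S_ k x y -> S_ j x y.
Proof. by move=> /subnK <-; elim: (j - k)%N => // i IH /IH; rewrite addSn SS; left. Qed.

Let unB_le k j z : (k <= j)%N -> unB (M_ j) z -> unB (M_ k) z.
Proof. by move=> kj [Bz nz]; split=> // -[a h]; apply: nz; exists a; exact: M_le h. Qed.

Let farR k x y : far (M_ k) (S_ k) x y -> R x y.
Proof.
move=> [[e|/M_dom[]//|[/(sk_edge_rel skel)//]] _ _].
apply: rel_trans (sk_retr_rel skel x) _; rewrite e; apply: rel_sym; exact: (sk_retr_rel skel).
Qed.

Let stepR k a z y x : step k a z y x -> [/\ R a z, R a y & R y x].
Proof.
move=> [e _ [[_ _ c] [[h _ _] _ _]]]; split.
- by rewrite -e; exact: rel_fun.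
- apply: conn_rel c; exact: farR.
- exact: (sk_edge_rel skel).
Qed.

Let M_fun k a z z' : M_ k a z -> M_ k a z' -> z = z'.
Proof.
elim: k => // k IH; rewrite MS => -[h|[y [x h]]] [h'|[y' [x' h']]].
- exact: IH h'.
- by case: h' => _ _ [[[_ n] _ _] _]; case: n; exists z.
- by case: h => _ _ [[[_ n] _ _] _]; case: n; exists z'.
- by case: h => <- _ _; case: h' => <- _ _.
Qed.

Let M_inj k a a' z : M_ k a z -> M_ k a' z -> a = a'.
Proof.
elim: k => // k IH; rewrite MS => -[h|[y [x h]]] [h'|[y' [x' h']]].
- exact: IH h'.
- by case: h' => _ _ [[_ [_ n] _] _]; case: n; exists a.
- by case: h => _ _ [[_ [_ n] _] _]; case: n; exists a'.
- by case: h => _ <- _; case: h' => _ <- _.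
Qed.

Let mfix1 : measurable_fun setT (fun p : T * T => b p.1).
Proof. by apply: measurableT_comp; [exact: sk_retr_meas skel|mfun]. Qed.

Let mb d' (U : measurableType d') (g : U -> T) :
  measurable_fun setT g -> measurable_fun setT (fun u => b (g u)).
Proof. by move=> mg; apply: measurableT_comp mg; exact: sk_retr_meas skel. Qed.

Let munB k d' (U : measurableType d') (g : U -> T) : mrel (M_ k) ->
  measurable_fun setT g -> measurable [set u | unB (M_ k) (g u)].
Proof.
move=> mM mg; apply: mand; first exact: (mset mB).
apply: mnot; apply: (mset (A := [set z | exists a, M_ k a z])) mg.
by apply: (mrel_ran (r := r) mM) => x y /M_dom[].
Qed.

Let mrest k d' (U : measurableType d') (g1 g2 : U -> T) : mrel (S_ k) ->
  measurable_fun setT g1 -> measurable_fun setT g2 ->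
  measurable [set u | rest (S_ k) (g1 u) (g2 u)].
Proof.
move=> mS m1 m2; rewrite (_ : [set u | _] = [set u | E (g1 u) (g2 u) /\
  (~ S_ k (g1 u) (g2 u) /\ ~ S_ k (g2 u) (g1 u))]).
  apply: mand; first exact: (mrelP (sk_edge_meas skel)).
  by apply: mand; apply: mnot; apply: (mrelP mS).
by apply/seteqP; split=> u /=; [case|move=> [? []]].
Qed.

Let mfar k : mrel (M_ k) -> mrel (S_ k) -> mrel (far (M_ k) (S_ k)).
Proof.
move=> mM mS; rewrite /mrel (_ : [set u | _] = [set u : T * T |
  ((b u.1 = b u.2 \/ (M_ k u.1 u.2 \/ rest (S_ k) u.1 u.2)) /\
   (~ unB (M_ k) (b u.1) /\ ~ unB (M_ k) (b u.2)))]).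
  apply: mand.
    apply: mor; first by apply: (meq r); apply: mb; mfun.
    by apply: mor; [apply: (mrelP mM)|apply: mrest]; mfun.
  by apply: mand; apply: mnot; apply: munB => //; apply: mb; mfun.
apply/seteqP; split=> u /=.
  by move=> [h ? ?]; split=> //; case: h; [left|right; left|right; right].
by move=> [[h|[h|h]] [? ?]]; split=> //; [exact: Or31|exact: Or32|exact: Or33].
Qed.

Let mstep k : mrel (M_ k) -> mrel (S_ k) ->
  forall d' (U : measurableType d') (g1 g2 g3 g4 : U -> T),
  measurable_fun setT g1 -> measurable_fun setT g2 -> measurable_fun setT g3 ->
  measurable_fun setT g4 ->
  measurable [set u | step k (g1 u) (g2 u) (g3 u) (g4 u)].
Proof.
move=> mM mS d' U g1 g2 g3 g4 m1 m2 m3 m4.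
set n := (decode_pair k).1; set m := (decode_pair k).2.
rewrite (_ : [set u | _] = [set u | (f n (g1 u) = g2 u /\ f m (g2 u) = g1 u) /\
  (((A (g1 u) /\ ~ exists z, M_ k (g1 u) z) /\
   (unB (M_ k) (g2 u) /\ conn (far (M_ k) (S_ k)) (g1 u) (g3 u))) /\
   (rest (S_ k) (g3 u) (g4 u) /\ (b (g4 u) = g2 u /\ ~ unB (M_ k) (b (g3 u)))))]).
  apply: mand; first by apply: mand; apply: (meq r) => //; exact: men.
  apply: mand.
    apply: mand.
      apply: mand; first exact: (mset mA).
      apply: mnot; apply: (mset (A := [set a | exists z, M_ k a z])) m1.
      by apply: (mrel_dom (r := r) mM) => x y /M_dom[].
    apply: mand; first exact: munB.
    by apply: mrelP => //; apply: (mrel_conn (r := r)); [exact: farR|exact: mfar].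
  apply: mand; first exact: mrest.
  apply: mand; first by apply: (meq r) => //; exact: mb.
  by apply: mnot; apply: munB => //; exact: mb.
apply/seteqP; split=> u /=.
  by move=> [? ? [[? ? ?] [? ? ?]]].
by move=> [[? ?] [[? [? ?]] [? [? ?]]]].
Qed.

Let mMS k : mrel (M_ k) /\ mrel (S_ k).
Proof.
elim: k => [|k [mM mS]]; first by split; exact: mprop.
rewrite MS SS; split; apply: mrelU => //.
- apply: (mexR (r := r) (g := fun u : T * T => u.1)).
    by move=> u y [x /stepR[]].
  move=> i; apply: (mexR (r := r) (g := fun u : T * T => f i u.1)).
    by move=> u x /stepR[].
  by move=> j; apply: mstep => //; mfun.
- apply: (mexR (r := r) (g := fun u : T * T => u.2)).
    by move=> u a [z /stepR[_ /rel_sym]].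
  move=> i; apply: (mexR (r := r) (g := fun u : T * T => f i u.2)).
    by move=> u z /stepR[].
  by move=> j; apply: mstep => //; mfun.
Qed.

Let restE k x y : rest (S_ k.+1) x y <->
  rest (S_ k) x y /\ ~ (exists a z, step k a z x y \/ step k a z y x).
Proof.
rewrite SS; split.
  move=> [Exy n1 n2]; split.
    by split=> // h; [apply: n1|apply: n2]; left.
  by move=> [a [z [h|h]]]; [apply: n2|apply: n1]; right; exists a, z.
move=> [[Exy n1 n2] nst]; split=> // -[//|[a [z h]]]; apply: nst; exists a, z; by [right|left].
Qed.

Let step_unB k a z y x : step k a z y x -> unB (M_ k) (b x) /\ ~ unB (M_ k) (b y).
Proof. by move=> [_ _ [[_ h _] [_ -> h']]]. Qed.

Let rest_sym S : rsym (rest S).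
Proof. by move=> x y [/(sk_edge_sym skel) ? ? ?]. Qed.

Let far_next k u v : far (M_ k) (S_ k) u v ->
  runion (runion (feq b) (M_ k)) (fun x y => rest (S_ k) x y /\
    ~ exists a z, step k a z x y \/ step k a z y x) u v.
Proof.
move=> [[h|h|h] nu nv]; [by left; left|by left; right|right; split=> //].
by move=> [a [z [/step_unB[]|/step_unB[]]]].
Qed.

Let slide_bridges k : bridges (runion (feq b) (M_ k)) (rest (S_ k)).
Proof.
elim: k => [|k IH].
  apply: bridges_mono (sk_bridges skel) => x y; last by case.
  by case=> // h; exact: conn_step.
have W_edge a z y x : step k a z y x -> rest (S_ k) y x by case=> _ _ [_ []].
have brW := swap_bridges IH W_edge.
have {}brW : bridges (runion (runion (feq b) (M_ k)) (fun a z => exists y x, step k a z y x))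
   (fun x y => rest (S_ k) x y /\ ~ exists a z, step k a z x y \/ step k a z y x).
  apply: brW.
  - move=> a z y x st; split.
      have [_ _ [[_ _ c] _]] := st; apply: conn_mono c => u v; exact: far_next.
    apply: conn_step; left; left; have [_ _ [[_ [Bz _] _] [_ e _]]] := st.
    by rewrite /feq e Bb.
  - move=> a z y x a' z' y' x' st st' [[ey ex]|[ey ex]].
      have [e1 e2 [_ [_ e3 _]]] := st; have [e1' e2' [_ [_ e3' _]]] := st'.
      have zz : z = z' by rewrite -e3 -e3' ex.
      by split=> //; rewrite -e2 -e2' zz.
    (* An edge is never traded in both orientations: only the end that is entered lies in an
       unmatched class. *)
    by have [h1 _] := step_unB st; have [_] := step_unB st'; rewrite -ex.
apply: bridges_mono brW => x y.
  rewrite MS => -[h|[h|h]]; apply: conn_step; [by left; left|by left; right|by right].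
by move=> /restE.
Qed.

(** A matched [B]-class is entered through a single edge: two edges entering it in the same step
    would be reached from the same [a] and close a cycle. This makes the number of spent edges equal
    to the number of matched points. *)
Let S_uniq k x y x' y' : S_ k x y -> S_ k x' y' -> b x = b x' -> x = x' /\ y = y'.
Proof.
elim: k => // k IH; rewrite SS.
have contra u v u' v' : S_ k u v -> (exists a z, step k a z v' u') -> b u = b u' -> False.
  move=> /S_matched[a h] [a' [z' /step_unB[[_ n] _]]] e; apply: n; exists a; by rewrite -e.
move=> [h|h] [h'|h'] e; [exact: IH|by case: (contra _ _ _ _ h h' e)
  |by case: (contra _ _ _ _ h' h (esym e))|].
move: h h' => [a [z st]] [a' [z' st']].
have [ea ez] : a = a' /\ z = z'.
  have [e1 e2 [_ [_ e3 _]]] := st; have [e1' e2' [_ [_ e3' _]]] := st'.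
  have zz : z = z' by rewrite -e3 -e3'.
  by split=> //; rewrite -e2 -e2' zz.
subst a' z'; apply: contrapT => ne.
have [_ _ [[_ _ c] [re _ _]]] := st; have [_ _ [[_ _ c'] [re' _ _]]] := st'.
have [ux ny] := step_unB st; have [ux' ny'] := step_unB st'.
apply: (slide_bridges re').
have sub u v : conn (far (M_ k) (S_ k)) u v ->
    conn (runion (runion (feq b) (M_ k)) (rminus (rest (S_ k)) y' x')) u v.
  apply: conn_mono => {}u {}v [[h|h|h] nu nv]; [by left; left|by left; right|].
  by right; split=> // -[eu ev]; [apply: nv; rewrite ev|apply: nu; rewrite eu].
apply: conn_trans (conn_sym (sub _ _ c')) _; apply: conn_trans (sub _ _ c) _.
apply: (conn_trans (y := x)); last by apply: conn_step; left; left.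
apply: conn_step; right; split=> //.
  by move=> [ey ex]; apply: ne.
by move=> [ey ex]; apply: ny; rewrite ey.
Qed.

Let Moo a z := exists k, M_ k a z.
Let Soo x y := exists k, S_ k x y.
Let E' := rest Soo.

Let Moo_fun a z z' : Moo a z -> Moo a z' -> z = z'.
Proof.
move=> [k h] [j h']; apply: (M_fun (k := maxn k j) (a := a)).
  exact: M_le (leq_maxl _ _) h.
exact: M_le (leq_maxr _ _) h'.
Qed.

Let Moo_inj a a' z : Moo a z -> Moo a' z -> a = a'.
Proof.
move=> [k h] [j h']; apply: (M_inj (k := maxn k j) (z := z)).
  exact: M_le (leq_maxl _ _) h.
exact: M_le (leq_maxr _ _) h'.
Qed.

Let Moo_dom a z : Moo a z -> [/\ A a, B z & R a z].
Proof. by move=> [k /M_dom]. Qed.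

Let mMoo : mrel Moo.
Proof. by apply: mexn => k; exact: (mMS k).1. Qed.

Let mSoo : mrel Soo.
Proof. by apply: mexn => k; exact: (mMS k).2. Qed.

Let unBoo k z : unB Moo z -> unB (M_ k) z.
Proof. by move=> [Bz nz]; split=> // -[a h]; apply: nz; exists a, k. Qed.

Let unAoo k z : unA Moo z -> unA (M_ k) z.
Proof. by move=> [Bz nz]; split=> // -[a h]; apply: nz; exists a, k. Qed.

Let E'_rest k x y : E' x y -> rest (S_ k) x y.
Proof. by move=> [? n1 n2]; split=> // h; [apply: n1|apply: n2]; exists k. Qed.

Let E'_bridges : bridges (runion (feq b) Moo) E'.
Proof.
move=> x y exy c.
have [k ck] : exists k, conn (runion (runion (feq b) (M_ k)) (rminus E' x y)) x y.
  apply: conn_lim.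
    move=> k u v [[h|h]|h]; [by left; left| |by right].
    by left; right; exact: M_le h.
  apply: conn_mono c => u v [[h|[k h]]|h]; [by exists 0%N; left; left| |].
    by exists k; left; right.
  by exists 0%N; right.
apply: (slide_bridges (k := k) (E'_rest k exy)).
apply: conn_mono ck => u v [|[h n1 n2]]; first by left.
by right; split=> //; exact: E'_rest.
Qed.

(* Later moves only remove edges into classes that are still unmatched, so the
   connections used by a move survive. *)
Let far_E' k u v : far (M_ k) (S_ k) u v -> runion (runion (feq b) Moo) E' u v.
Proof.
move=> [[h|h|[Euv n1 n2]] nu nv]; [by left; left|by left; right; exists k|right].
have kill x y j : S_ j x y -> ~ S_ k x y -> unB (M_ k) (b x).
  elim: j => // j IH; rewrite SS => -[h nk|[a [z h]] nk]; first exact: IH.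
  have [kj|jk] := leqP k j.
    by apply: (unB_le kj); have [] := step_unB h.
  by case: nk; apply: (S_le jk); rewrite SS; right; exists a, z.
by split=> // -[j h]; [apply: nu|apply: nv]; apply: kill h _.
Qed.

Let gen_oo x y : X x -> R x y -> conn (runion (runion (feq b) Moo) E') x y.
Proof.
move=> Xx xy; apply: conn_sub (sk_gen skel Xx xy) => u v [h|h].
  by apply: conn_step; left; left.
have removed u' v' : Soo u' v' -> conn (runion (runion (feq b) Moo) E') u' v'.
  move=> [k]; elim: k => // k IH; rewrite SS => -[/IH//|[a [z st]]].
  have [_ _ [[_ [Bz _] c] [_ e _]]] := st.
  apply: (conn_trans (y := z)); first by apply: conn_step; left; left; rewrite /feq e Bb.
  apply: (conn_trans (y := a)).
    apply: conn_sym; apply: conn_step; left; right; exists k.+1; rewrite MS.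
    by right; exists v', u'.
  apply: conn_mono c => p q; exact: far_E'.
have [h1|n1] := pselect (Soo u v); first exact: removed.
have [h2|n2] := pselect (Soo v u); first by apply: conn_sym; exact: removed.
by apply: conn_step; right; split.
Qed.

Let munBoo : measurable [set z | unB Moo z].
Proof.
apply: mand => //; apply: mnot.
by apply: (mrel_ran (r := r) mMoo) => x y /Moo_dom[].
Qed.

Let munAoo : measurable [set z | unA Moo z].
Proof.
apply: mand => //; apply: mnot.
by apply: (mrel_dom (r := r) mMoo) => x y /Moo_dom[].
Qed.

Let mdomM : measurable [set a | exists z, Moo a z].
Proof. by apply: (mrel_dom (r := r) mMoo) => x y /Moo_dom[]. Qed.
Let mranM : measurable [set z | exists a, Moo a z].
Proof. by apply: (mrel_ran (r := r) mMoo) => x y /Moo_dom[]. Qed.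

Let pr_domM : pr [set z | exists a, Moo a z] = pr [set a | exists z, Moo a z].
Proof.
by congr fine; apply: (pbij_measure (r := r) mMoo) => // x y /Moo_dom[].
Qed.

Let pr_unA : pr [set a | unA Moo a] = pr A - pr [set a | exists z, Moo a z].
Proof.
rewrite -prD//.
by move=> a [z /Moo_dom[]].
Qed.

Let pr_unB : pr [set z | unB Moo z] = pr B - pr [set z | exists a, Moo a z].
Proof.
rewrite -prD//.
by move=> z [a /Moo_dom[]].
Qed.

(** Otherwise ergodicity gives unmatched [a] and [z] in one class. A connection from [a] to [z] has
    a first edge into an unmatched [B]-class, and the part before it is already available at some
    finite stage. When the right pair of indices recurs after that stage, the move is possible and
    matches [a]. *)
Let unB_null : pr [set z | unB Moo z] = 0.
Proof.
apply: contrapT => ne0; have n0 : pr [set z | unB Moo z] != 0 by apply/eqP.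
have B0 : 0 < pr [set z | unB Moo z] by rewrite lt_neqAle eq_sym n0 pr_ge0.
have A0 : 0 < pr [set a | unA Moo a] by rewrite pr_unA prAB -pr_domM -pr_unB.
have [a [z [ua uz az Xa]]] := ergodic_meet erg munAoo munBoo A0 B0
  (sk_meas skel) (sk_conull skel).
have nBa : ~ unB Moo (b a).
  by case: ua => Aa _; rewrite Ab// => -[/(AB0 Aa)].
have [|y [x [c ny ux yx]]] := conn_first_exit (P := fun z => ~ unB Moo (b z))
    (gen_oo Xa az) nBa.
  by apply; case: (uz) => Bz _; rewrite Bb.
have {}ux : unB Moo (b x) by apply: contrapT.
have nM u v : Moo u v -> ~ unB Moo (b u) /\ ~ unB Moo (b v).
  move=> h; have [Au Bv _] := Moo_dom h; rewrite Ab// Bb//; split=> [[/(AB0 Au)]//|[_]].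
  by apply; exists u.
have {}yx : E' y x.
  case: yx => -[[h|h]|h].
  - by case: ny; rewrite h.
  - by have [] := nM _ _ h.
  - by [].
  - by case: ny; rewrite -h.
  - by have [] := nM _ _ h.
  - exact: rest_sym.
pose N k u v := [/\ [\/ feq b u v, M_ k u v | E' u v], ~ unB (M_ k) (b u) & ~ unB (M_ k) (b v)].
have N_le k j u v : (k <= j)%N -> N k u v -> N j u v.
  move=> kj [h nu nv]; split.
  - by case: h => h; [exact: Or31|apply: Or32; exact: M_le h|exact: Or33].
  - by move=> /(unB_le kj).
  - by move=> /(unB_le kj).
have unB_lim z' : ~ unB Moo z' -> exists k, ~ unB (M_ k) z'.
  have [Bz' n|nBz' _] := pselect (B z'); last by exists 0%N => -[].
  have [a' [k h]] : exists a, Moo a z' by apply: contrapT => h; apply: n.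
  by exists k => -[_]; apply; exists a'.
have [k1 c1] : exists k, conn (N k) a y.
  apply: conn_lim; first by move=> k u v; exact: N_le.
  apply: conn_mono c => u v [h /unB_lim[ku hu] /unB_lim[kv hv]].
  have [km hm] : exists k, [\/ feq b u v, M_ k u v | E' u v].
    case: h => [[h|[k h]]|h]; [exists 0%N; exact: Or31|exists k; exact: Or32|exists 0%N; exact: Or33].
  exists (maxn km (maxn ku kv)); split.
  - case: hm => hm; [exact: Or31|apply: Or32|exact: Or33].
    by apply: M_le hm; exact: leq_maxl.
  - by move=> h'; apply: hu; apply: unB_le h'; rewrite !leq_max leqnn orbT.
  - by move=> h'; apply: hv; apply: unB_le h'; rewrite !leq_max leqnn !orbT.
have [k2 ny2] := unB_lim _ ny.
have ax : R a (b x).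
  have ay : R a y.
    apply: conn_rel c1 => u v [[e|/M_dom[]//|[/(sk_edge_rel skel)//]] _ _].
    apply: rel_trans (sk_retr_rel skel u) _; rewrite e; apply: rel_sym; exact: (sk_retr_rel skel).
  apply: rel_trans ay _; apply: rel_trans (sk_retr_rel skel x).
  by case: yx => /(sk_edge_rel skel).
have [n en] := ax; have [m em] := rel_sym ax.
have [k hk ek] := decode_pair_often n m (maxn k1 k2).
have k1k : (k1 <= k)%N by apply: leq_trans hk; exact: leq_maxl.
have k2k : (k2 <= k)%N by apply: leq_trans hk; exact: leq_maxr.
case: (ua) => _; apply; exists (b x), k.+1; rewrite MS; right; exists y, x.
rewrite /step ek /=; split=> //; split; split.
- exact: unAoo.
- exact: unBoo.
- apply: conn_mono c1 => u v /(N_le _ _ _ _ k1k)[h nu nv]; split=> //.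
  by case: h => h; [exact: Or31|exact: Or32|apply: Or33; exact: E'_rest].
- exact: E'_rest.
- by [].
- by move=> /(unB_le k2k).
Qed.

Let unA_null : pr [set z | unA Moo z] = 0.
Proof. by rewrite pr_unA prAB -pr_domM -pr_unB unB_null. Qed.

(** The new retraction sends the class of a matched [z] to its partner in [A]. [O] orients each lost
    edge out of the class that was entered through it, so the domain of [O] has the measure of
    [B]. *)
Lemma slide : exists X' b' E'' (O : T -> T -> Prop),
  [/\ skeleton X' b' E'', X' `<=` X, forall x y, E'' x y -> E x y &
   [/\ forall x, b' (b x) = b' x,
       forall x, ~ B (b x) -> b' x = b x,
       forall x, X' x -> B (b x) -> A (b' x),
       forall x y, X' x -> B x -> B y -> b' x = b' y -> x = y &
       forall a, X' a -> A a -> exists2 z, B z & b' z = a] /\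
   [/\ mrel O, forall x y, O x y -> E x y,
       forall x y y', O x y -> O x y' -> y = y',
       pr [set x | exists y, O x y] = pr B &
       forall x y, E x y /\ ~ E'' x y <-> O x y \/ O y x] /\
       forall x y, O x y -> ~ O y x].
Proof.
have mU : measurable ([set z | unA Moo z] `|` [set z | unB Moo z]) by exact: measurableU.
have U0 : pr ([set z | unA Moo z] `|` [set z | unB Moo z]) = 0.
  apply/eqP; rewrite eq_le pr_ge0 andbT; apply: le_trans (prU_le mu munAoo munBoo) _.
  by rewrite unA_null unB_null addr0.
have [X0 [mX0 iX0 cX0 sX0]] := conull_invariant r mU U0.
(* [pb] is [b] followed by the matching read from [B] to [A]; classes that are not matched as
   elements of [B] keep their base point. *)
pose pb x := if pselect (exists a, Moo a (b x)) is left p then projT1 (cid p) else b x.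
have pbP x a : Moo a (b x) -> pb x = a.
  move=> h; rewrite /pb; case: pselect => [p|]; last by case; exists a.
  by case: cid => a' h' /=; exact: Moo_inj h' h.
have pbN x : ~ (exists a, Moo a (b x)) -> pb x = b x by rewrite /pb; case: pselect.
have pb_cases x : (exists2 a, Moo a (b x) & pb x = a) \/ pb x = b x.
  have [[a h]|n] := pselect (exists a, Moo a (b x)); last by right; exact: pbN.
  by left; exists a => //; exact: pbP.
have pb_b x y : b x = b y -> pb x = pb y.
  move=> e; have [[a h]|n] := pselect (exists a, Moo a (b x)).
    by rewrite (pbP _ _ h); apply/esym/pbP; rewrite -e.
  by rewrite pbN// pbN// -e.
have bb x : b (b x) = b x by exact: (sk_retr_idem skel).
have pbR x : R x (pb x).
  case: (pb_cases x) => [[a h ->]| ->]; last exact: (sk_retr_rel skel).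
  by apply: rel_trans (sk_retr_rel skel x) _; apply: rel_sym; case: (Moo_dom h).
have pbA a : A a -> pb a = a.
  move=> Aa; case: (pb_cases a) => [[a' h _]| ->]; last exact: Ab.
  by move: h; rewrite Ab// => /Moo_dom[_ /(AB0 Aa)].
have pb_idem x : pb (pb x) = pb x.
  case: (pb_cases x) => [[a h ->]|e]; first by apply: pbA; case: (Moo_dom h).
  by rewrite {1}e; apply: pb_b.
have mpb : measurable_fun setT pb.
  apply: (mfun_graph (r := r) (g0 := fun x => x)) => // n.
  rewrite (_ : [set u | _] = [set x | Moo (f n x) (b x) \/
     ((~ exists a, Moo a (b x)) /\ f n x = b x)]).
    have mbx : measurable_fun setT (fun x => b x) := sk_retr_meas skel.
    apply: mor; first by apply: (mrelP mMoo) => //; mfun.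
    apply: mand; last by apply: (meq r) => //; mfun.
    by apply: mnot; apply: (mset mranM).
  apply/seteqP; split=> x /=.
    case: (pb_cases x) => [[a h ->]|e] e'; first by left; rewrite e'.
    have [[a h]|nh] := pselect (exists a, Moo a (b x)).
      by left; rewrite e' (pbP _ _ h).
    by right; split=> //; rewrite e' e.
  by move=> [/pbP->//|[n1 ->]]; rewrite pbN.
have feq_conn x y : feq pb x y -> conn (runion (feq b) Moo) x y.
  have c z : conn (runion (feq b) Moo) z (pb z).
    apply: (conn_trans (y := b z)); first by apply: conn_step; left; rewrite /feq bb.
    case: (pb_cases z) => [[a h ->]| ->]; last exact: conn_refl.
    by apply: conn_sym; apply: conn_step; right.
  by move=> e; apply: conn_trans (c x) _; rewrite e; exact: conn_sym.
have mE' : mrel E'.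
  rewrite /mrel (_ : [set u | _] = [set u : T * T | E u.1 u.2 /\
    (~ Soo u.1 u.2 /\ ~ Soo u.2 u.1)]).
    apply: mand; first exact: sk_edge_meas skel.
    by apply: mand; apply: mnot => //; exact: (mrel_tr mSoo).
  by apply/seteqP; split=> u /=; [case|move=> [? []]].
have SooP x y : Soo x y -> exists a, Moo a (b x).
  by move=> [k /S_matched[a h]]; exists a, k.
have Soo_uniq x y x' y' : Soo x y -> Soo x' y' -> b x = b x' -> x = x' /\ y = y'.
  move=> [k h] [j h']; apply: (S_uniq (k := maxn k j)).
    exact: S_le (leq_maxl _ _) h.
  exact: S_le (leq_maxr _ _) h'.
have SooE x y : Soo x y -> E x y by move=> [k /S_dom].
exists (X `&` X0), pb, E', Soo; split.
- split.
  + apply: measurableI => //; exact: sk_meas skel.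
  + by move=> x y xy [Xx X0x]; split; [exact: (sk_inv skel) Xx|exact: iX0 X0x].
  + rewrite setCI; apply/eqP; rewrite eq_le pr_ge0 andbT.
    apply: le_trans (prU_le mu _ _) _; try by apply: measurableC => //; exact: sk_meas skel.
    by rewrite cX0 (sk_conull skel) addr0.
  + exact: mpb.
  + exact: pbR.
  + exact: pb_idem.
  + exact: mE'.
  + exact: rest_sym.
  + by move=> x y [/(sk_edge_rel skel)].
  + move=> x y [Xx _] xy; apply: conn_mono (gen_oo Xx xy) => u v [[h|h]|h].
    * by left; apply: pb_b.
    * left; have [Au Bv _] := Moo_dom h; rewrite /feq pbA//.
      by apply/esym/pbP; rewrite Bb.
    * by right.
  + by apply: bridges_mono E'_bridges.
- by move=> x [].
- by move=> x y [].
split; last split.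
- split.
  + by move=> x; apply: pb_b.
  + by move=> x nB; apply: pbN => -[a /Moo_dom[]].
  + move=> x [Xx X0x] Bx; case: (pb_cases x) => [[a h ->]|e].
      by case: (Moo_dom h).
    exfalso; have [|] := pselect (exists a, Moo a (b x)).
      by move=> [a h]; move: (pbP _ _ h); rewrite e => ea; case: (Moo_dom h) => /AB0; rewrite ea.
    move=> nh; apply: (sX0 (b x)); last by right.
    exact: iX0 (sk_retr_rel skel x) X0x.
  + move=> x y [Xx X0x] Bx By e.
    have hB z : B z -> X0 z -> exists a, Moo a z.
      by move=> Bz X0z; apply: contrapT => n; apply: (sX0 z X0z); right.
    have X0y : X0 y.
      apply: (iX0 x) X0x; apply: rel_trans (pbR x) _; rewrite e; apply: rel_sym; exact: pbR.
    have [a h] := hB _ Bx X0x; have [a' h'] := hB _ By X0y.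
    have ea : pb x = a by apply: pbP; rewrite Bb.
    have ea' : pb y = a' by apply: pbP; rewrite Bb.
    by subst a a'; rewrite e in h; exact: Moo_fun h h'.
  + move=> a [Xa X0a] Aa.
    have [z h] : exists z, Moo a z.
      by apply: contrapT => n; apply: (sX0 a X0a); left.
    have [_ Bz _] := Moo_dom h; exists z => //; apply: pbP; by rewrite Bb.
- split=> //.
  + by move=> x y y' h h'; have [] := Soo_uniq _ _ _ _ h h' erefl.
  (* [H] is a bijection between the tails of the lost edges and the matched points of [B]. *)
  + pose H x z := z = b x /\ exists y, Soo x y.
    have mH : mrel H.
      apply: mand; first by apply: (meq r); [mfun|exact: mfix1].
      apply: (mset (A := [set x | exists y, Soo x y])); last by mfun.
      by apply: (mrel_dom (r := r) mSoo) => x y /SooE/(sk_edge_rel skel).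
    have -> : pr B = pr [set z | exists a, Moo a z].
      by move: unB_null; rewrite pr_unB; lra.
    rewrite (_ : [set x | exists y, Soo x y] = [set x | exists z, H x z]); last first.
      by apply/seteqP; split=> x [z]; [exists (b x); split=> //; exists z|case].
    rewrite /prm -(pbij_measure (r := r) mH); last 3 first.
    * by move=> x z [-> _]; exact: (sk_retr_rel skel).
    * by move=> x z z' [-> _] [->].
    * by move=> x x' z [-> [y h]] [e [y' h']]; have [] := Soo_uniq _ _ _ _ h h' e.
    congr (fine (mu _)); apply/seteqP; split=> z.
      by move=> [x [-> [y /SooP]]].
    move=> [a [k]]; elim: k => // k IH; rewrite MS => -[/IH//|[y [x st]]].
    exists x; split; first by case: st => _ _ [_ [_ -> _]].
    by exists y, k.+1; rewrite SS; right; exists a, z.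
  + move=> x y; split=> [[Exy nE']|].
      have [h|n1] := pselect (Soo x y); first by left.
      by right; apply: contrapT => n2; apply: nE'; split.
    by move=> [h|h]; (split; [|by case]); [exact: SooE|exact/(sk_edge_sym skel)/SooE].
- move=> x y [k h] [j h'].
  have {h} h := S_le (leq_maxl k j) h; have {h'} := S_le (leq_maxr k j) h'.
  move: (maxn k j) h => i; elim: i => // i IH; rewrite SS => -[h|[a [z st]]] [h'|[a' [z' st']]].
  + exact: IH.
  + by have [_ _ [_ [[_ n _] _ _]]] := st'; apply: n.
  + by have [_ _ [_ [[_ n _] _ _]]] := st; apply: n.
  + by have [h1 h2] := step_unB st; have [h3 h4] := step_unB st'.
Qed.

End Slide.
End Skeleton.

(** * Families of slides, and contraction of cells *)

Section SkeletonMoves.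
Context {K : realType} {d : measure_display} {T : measurableType d}.
Context {mu : probability T K} (r : enumrel mu).
Local Open Scope ring_scope.
Local Notation f := (enum_fun r).
Local Notation R := (rel_of r).
Local Notation pr := (prm mu).
Implicit Types (X A B : set T) (b : T -> T) (E O : T -> T -> Prop).

(* [O] orients the edges of [E] that are missing from [E']. *)
Definition oriented_loss E E' O :=
  [/\ mrel O, forall x y, O x y -> ~ O y x &
      forall x y, E x y /\ ~ E' x y <-> O x y \/ O y x].

Lemma oriented_loss_trans E E1 E2 L1 L2 :
  (forall x y, E1 x y -> E x y) -> (forall x y, E2 x y -> E1 x y) -> rsym E1 ->
  oriented_loss E E1 L1 -> oriented_loss E1 E2 L2 ->
  (forall x y, L1 x y -> L2 x y -> False) /\ oriented_loss E E2 (runion L1 L2).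
Proof.
move=> s1 s2 sym1 [m1 a1 e1] [m2 a2 e2].
have nL1 x y : L1 x y -> ~ E1 x y by move=> h; have [] := (e1 x y).2 (or_introl h).
have L2E x y : L2 x y -> E1 x y by move=> h; have [] := (e2 x y).2 (or_introl h).
split; first by move=> x y /nL1 h /L2E.
split.
- exact: mrelU.
- move=> x y [h|h] [h'|h'].
  + exact: a1 h'.
  + by apply: (nL1 _ _ h); apply: sym1; exact: L2E.
  + by apply: (nL1 _ _ h'); apply: sym1; exact: L2E.
  + exact: a2 h'.
- move=> x y; split.
    move=> [Exy n2]; have [h|h] := pselect (E1 x y).
      by have [|] := (e2 x y).1 (conj h n2); [left; right|right; right].
    by case: ((e1 x y).1 (conj Exy h)) => ?; [left; left|right; left].
  move=> [[h|h]|[h|h]].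
  + by have [? n] := (e1 x y).2 (or_introl h); split=> // /s2.
  + by have [? n] := (e2 x y).2 (or_introl h); split=> //; exact: s1.
  + by have [? n] := (e1 x y).2 (or_intror h); split=> // /s2.
  + by have [? n] := (e2 x y).2 (or_intror h); split=> //; exact: s1.
Qed.

(** One [slide] for each index, always onto the same [A]. Earlier slides move neither [A] nor the
    sets still to be moved, so the hypotheses persist, and every slide costs mass [pr A]. *)
Lemma slides (erg : ergodic_rel r) (I : eqType) (B : I -> set T) A (s : seq I) X b E :
  skeleton r X b E -> measurable A -> (forall i, measurable (B i)) ->
  (forall i, pr (B i) = pr A) -> (forall x, A x -> b x = x) ->
  (forall i x, B i x -> b x = x) ->
  (forall i x, i \in s -> A x -> B i x -> False) ->
  (forall i j x, B i x -> B j x -> i = j) -> uniq s ->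
  exists X' b' E' O,
  [/\ skeleton r X' b' E', X' `<=` X, forall x y, E' x y -> E x y &
   [/\ forall x, b' (b x) = b' x,
       forall x, (forall i, i \in s -> ~ B i (b x)) -> b' x = b x,
       forall i x, i \in s -> X' x -> B i (b x) -> A (b' x),
       forall i x y, i \in s -> X' x -> B i x -> B i y -> b' x = b' y -> x = y &
       forall i a, i \in s -> X' a -> A a -> exists2 z, B i z & b' z = a] /\
   [/\ oriented_loss E E' O, mass r O = (pr A *+ size s)%:E &
       pr [set x | exists y, O x y] <= pr A *+ size s] /\
       forall x y, O x y -> E x y].
Proof.
move=> skel mA mB prB Ab Bb + BB.
elim: s => [_ _|i s IH AB' /= /andP[nis us]].
  exists X, b, E, (fun _ _ => False); split=> //; split; last split.
  - split=> //; exact: sk_retr_idem skel.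
  - split=> //=.
    + by split=> //; [exact: mprop|move=> x y; split=> [[]|[]]].
    + rewrite /mass eseries0// => n _ _; apply/eqP; rewrite (_ : level_set _ _ _ = set0) ?measure0//.
      by apply/seteqP; split=> // x [].
    + by rewrite (_ : [set x | _] = set0) ?pr_set0//; apply/seteqP; split=> // x [].
  - by [].
have [X1 [b1 [E1 [L1 [sk1 X1X E1E [[bb1 nB1 A1 inj1 sur1] [[loss1 mass1 dom1] L1E]]]]]]] := IH (fun j x js => AB' j x (@mem_behead _ (i :: s) j js)) us.
have AB j x : j \in i :: s -> A x -> B j x -> False by exact: AB'.
have AB0 j x : j \in s -> A x -> B j x -> False by move=> js; apply: AB; rewrite inE js orbT.
have ABi x : A x -> B i x -> False by apply: AB; rewrite inE eqxx.
have Ab1 x : A x -> b1 x = x.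
  by move=> Ax; rewrite nB1 ?Ab// => j js; exact: AB0 Ax.
have Bib1 x : B i x -> b1 x = x.
  move=> Bx; rewrite nB1 ?(Bb _ _ Bx)// => j js Bj.
  by move: nis; rewrite (BB _ _ _ Bx Bj) js.
have [X2 [b2 [E2 [L2 [sk2 X2X1 E2E1 [[bb2 nB2 A2 inj2 sur2] [[mO2 L2E f2 dom2 loss2] a2]]]]]]] :=
  slide erg sk1 mA (mB i) (esym (prB i)) Ab1 Bib1 ABi.
have loss2' : oriented_loss E1 E2 L2 by split.
have [disj loss] := oriented_loss_trans E1E E2E1 (sk_edge_sym sk1) loss1 loss2'.
have b2b1 x : A (b1 x) -> b2 x = b1 x.
  by move=> Ab1x; apply: nB2 => Bx; exact: ABi Ab1x Bx.
have [mO1 _ _] := loss1.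
have OR x y : L1 x y -> R x y by move=> /L1E/(sk_edge_rel skel).
have OR2 x y : L2 x y -> R x y by move=> /L2E/(sk_edge_rel sk1).
exists X2, b2, E2, (runion L1 L2); split=> //.
- by move=> x /X2X1/X1X.
- by move=> x y /E2E1/E1E.
split; last split.
- split.
  + by move=> x; rewrite -bb2 bb1 bb2.
  + move=> x nBx; have e1 : b1 x = b x.
      by apply: nB1 => j js; apply: nBx; rewrite inE js orbT.
    by rewrite -e1; apply: nB2; rewrite e1; apply: nBx; rewrite inE eqxx.
  + move=> j x; rewrite inE => /orP[/eqP ->|js] Xx Bx.
      have e1 : b1 x = b x.
        by apply: nB1 => k ks Bk; move: nis; rewrite (BB _ _ _ Bx Bk) ks.
      by apply: A2 => //; rewrite e1.
    have h : A (b1 x) by apply: (A1 j) => //; exact: X2X1.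
    by rewrite b2b1.
  + move=> j x y; rewrite inE => /orP[/eqP ->|js] Xx Bx By e; first exact: inj2 e.
    have Xy : X2 y.
      apply: (sk_inv sk2) Xx; apply: rel_trans (sk_retr_rel sk2 x) _.
      by rewrite e; apply: rel_sym; exact: (sk_retr_rel sk2).
    have hx : A (b1 x) by apply: (A1 j) => //; [exact: X2X1|rewrite (Bb _ _ Bx)].
    have hy : A (b1 y) by apply: (A1 j) => //; [exact: X2X1|rewrite (Bb _ _ By)].
    by move: e; rewrite !b2b1// => e; apply: (inj1 j) e => //; exact: X2X1.
  + move=> j a; rewrite inE => /orP[/eqP ->|js] Xa Aa; first exact: sur2.
    have [z Bz e] := sur1 j a js (X2X1 _ Xa) Aa; exists z => //.
    by rewrite b2b1 ?e.
- split=> //.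
  + rewrite massU// mass1 (mass_fun (r := r)) // prE; last exact: (mrel_dom (r := r)).
    by rewrite dom2 prB -EFinD mulrSr.
  + rewrite (_ : [set x | _] = [set x | exists y, L1 x y] `|` [set x | exists y, L2 x y]).
      apply: (le_trans (prU_le mu _ _)); try exact: (mrel_dom (r := r)).
      by rewrite dom2 prB /= mulrSr lerD2r.
    by apply/seteqP; split=> x; [move=> [y [h|h]]; [left|right]; exists y|
      move=> [[y h]|[y h]]; exists y; [left|right]].
- by move=> x y [/L1E//|/L2E/E1E].
Qed.

Lemma skeleton_shrink X X0 b E : skeleton r X b E -> measurable X0 ->
  invariant_set r X0 -> pr (~` X0) = 0 -> skeleton r (X `&` X0) b E.
Proof.
case=> h1 h2 h3 h4 h5 h6 h7 h8 h9 h10 h11 m0 i0 c0; split=> //.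
- exact: measurableI.
- by move=> x y xy [/(h2 _ _ xy) ? /(i0 _ _ xy)].
- rewrite setCI; apply/eqP; rewrite eq_le pr_ge0 andbT.
  apply: (le_trans (prU_le mu _ _)); try exact: measurableC.
  by rewrite h3 c0 addr0.
- by move=> x y [Xx _]; exact: h10.
Qed.

Section Absorb.
Variables (X : set T) (b : T -> T) (E : T -> T -> Prop) (skel : skeleton r X b E).
Variables (Y G : set T) (px py root : T -> T) (lev : T -> nat).
Hypotheses (mY : measurable Y) (mG : measurable G).
Hypotheses (mpx : measurable_fun setT px) (mpy : measurable_fun setT py)
  (mroot : measurable_fun setT root).
Hypothesis G_fix : forall x, G x -> b x = x.
Hypothesis G_edge : forall x, G x -> ~ Y x ->
  [/\ b (px x) = x, E (px x) (py x), G (b (py x)), root (b (py x)) = root x &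
      (lev (b (py x)) < lev x)%N].
Hypothesis G_root : forall x, G x -> Y x -> root x = x.

Let root_G x : G x -> [/\ G (root x), Y (root x) & R x (root x)].
Proof.
have [n] := ubnP (lev x); elim: n x => // n IH x ltn Gx.
have [Yx|nY] := pselect (Y x); first by rewrite G_root//; split=> //; exact: rel_refl.
have [e1 e2 e3 e4 e5] := G_edge Gx nY; have [|//|h1 h2 h3] := IH (b (py x)).
  by rewrite -ltnS; apply: leq_ltn_trans ltn.
rewrite -e4; split=> //; apply: rel_trans h3; apply: rel_trans (sk_retr_rel skel (py x)).
apply: rel_trans (sk_edge_rel skel e2); rewrite -{1}e1; apply: rel_sym.
exact: (sk_retr_rel skel).
Qed.

Let b1 x := if pselect (G (b x)) then root (b x) else b x.
Let O x y := exists2 u, x = px u & [/\ y = py u, G u & ~ Y u].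
Let E1 x y := [/\ E x y, ~ O x y & ~ O y x].

Let b1G x : G (b x) -> b1 x = root (b x). Proof. by rewrite /b1; case: pselect. Qed.
Let b1N x : ~ G (b x) -> b1 x = b x. Proof. by rewrite /b1; case: pselect. Qed.
Let bb x : b (b x) = b x := sk_retr_idem skel x.

Let b1b x : b1 (b x) = b1 x. Proof. by rewrite /b1 bb. Qed.

Let b1R x : R x (b1 x).
Proof.
have [Gx|nG] := pselect (G (b x)); last by rewrite b1N//; exact: (sk_retr_rel skel).
rewrite b1G//; apply: rel_trans (sk_retr_rel skel x) _; by have [] := root_G Gx.
Qed.

Let mb1 : measurable_fun setT b1.
Proof.
have mb : measurable_fun setT (fun x => b x) := sk_retr_meas skel.
have mrb : measurable_fun setT (fun x => root (b x)) by apply: measurableT_comp mb.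
apply: (mfun_graph (r := r) (g0 := fun x => x)) => // n.
rewrite (_ : [set u | _] = [set x | (G (b x) /\ f n x = root (b x)) \/
     (~ G (b x) /\ f n x = b x)]).
  apply: mor; apply: mand; try by apply: (meq r) => //; mfun.
    exact: (mset mG).
  by apply: mnot; exact: (mset mG).
apply/seteqP; split=> x /=.
  have [Gx|nG] := pselect (G (b x)); first by rewrite b1G//; left.
  by rewrite b1N//; right.
by move=> [[Gx ->]|[nG ->]]; [rewrite b1G|rewrite b1N].
Qed.

Let OE x y : O x y -> E x y.
Proof. by move=> [u -> [-> Gu nY]]; have [] := G_edge Gu nY. Qed.

Let Ou x y : O x y -> [/\ G (b x), ~ Y (b x), x = px (b x) & y = py (b x)].
Proof. by move=> [u -> [-> Gu nY]]; have [-> ] := G_edge Gu nY. Qed.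

Let mO : mrel O.
Proof.
have mb : measurable_fun setT (fun u : T * T => b u.1).
  by apply: measurableT_comp; [exact: sk_retr_meas skel|mfun].
rewrite /mrel (_ : [set u | _] = [set u : T * T | (G (b u.1) /\ ~ Y (b u.1)) /\
   (u.1 = px (b u.1) /\ u.2 = py (b u.1))]).
  apply: mand.
    by apply: mand; [exact: (mset mG)|apply: mnot; exact: (mset mY)].
  by apply: mand; apply: (meq r); mfun; apply: measurableT_comp mb.
apply/seteqP; split=> u /=; first by move=> /Ou[].
by move=> [[Gu nY] [e1 e2]]; exists (b u.1).
Qed.

Let O_lev x y : O x y -> (lev (b y) < lev (b x))%N.
Proof. by move=> /Ou[Gx nY e1 ->]; have [] := G_edge Gx nY. Qed.

Let b1_conn x : conn (runion (feq b) O) x (b1 x).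
Proof.
have [Gx|nG] := pselect (G (b x)); last first.
  by rewrite b1N//; apply: conn_step; left; rewrite /feq bb.
rewrite b1G//; have [n] := ubnP (lev (b x)); elim: n x Gx => // n IH x Gx ltn.
apply: (conn_trans (y := b x)); first by apply: conn_step; left; rewrite /feq bb.
have [Yx|nY] := pselect (Y (b x)); first by rewrite G_root//; exact: conn_refl.
have [e1 e2 e3 e4 e5] := G_edge Gx nY.
apply: (conn_trans (y := px (b x))); first by apply: conn_step; left; rewrite /feq bb e1.
apply: (conn_trans (y := py (b x))); first by apply: conn_step; right; exists (b x).
rewrite -e4; apply: IH => //; rewrite -ltnS; exact: leq_ltn_trans ltn.
Qed.

(** The edge from [px x] to [py x] joins the class of [x] to that of its parent, which has smaller
    level. Contracting these edges merges each class of [G] into its root; one edge is lost per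
    non-root point, and lost edges lie inside the new classes. *)
Lemma absorb : exists b' E' O',
  [/\ skeleton r X b' E', forall x y, E' x y -> E x y &
   [/\ forall x, b' (b x) = b' x, forall x, ~ G (b x) -> b' x = b x &
       forall x, G (b x) -> b' x = root (b x)] /\
   [/\ oriented_loss E E' O', mass r O' = (pr (G `\` Y))%:E,
       forall x y, O' x y -> b' x = b' y & forall x y, O' x y -> E x y]].
Proof.
have mGY : measurable (G `\` Y) by exact: measurableD.
have mE1 : mrel E1.
  rewrite /mrel (_ : [set u | _] = [set u : T * T | E u.1 u.2 /\
    (~ O u.1 u.2 /\ ~ O u.2 u.1)]).
    apply: mand; first exact: sk_edge_meas skel.
    by apply: mand; apply: mnot => //; exact: (mrel_tr mO).
  by apply/seteqP; split=> u /=; [case|move=> [? []]].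
have b1idem x : b1 (b1 x) = b1 x.
  have [Gx|nG] := pselect (G (b x)); last by rewrite (b1N nG) b1b b1N.
  have [Gr Yr _] := root_G Gx; rewrite (b1G Gx).
  by rewrite b1G (G_fix Gr)//; exact: G_root.
have Ob1 x y : O x y -> b1 x = b1 y.
  move=> /Ou[Gx nY e1 e2]; have [h1 h2 h3 h4 h5] := G_edge Gx nY.
  by rewrite (b1G Gx) e2 (b1G h3) h4.
exists b1, E1, O; split; [|by move=> x y []|split].
- split=> //.
  + exact: sk_meas skel.
  + exact: sk_inv skel.
  + exact: sk_conull skel.
  + by move=> x y [/(sk_edge_sym skel)].
  + by move=> x y [/(sk_edge_rel skel)].
  + move=> x y Xx xy; apply: conn_mono (sk_gen skel Xx xy) => u v [h|h].
      by left; rewrite /feq -[b1 u]b1b h b1b.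
    have [h1|n1] := pselect (O u v); first by left; exact: Ob1.
    have [h2|n2] := pselect (O v u); first by left; apply/esym; exact: Ob1.
    by right.
  + move=> x y exy c; have [Exy n1 n2] := exy; apply: (sk_bridges skel Exy).
    apply: conn_sub c => u v [h|[[Euv m1 m2] n3 n4]]; last by apply: conn_step; right.
    have c z : conn (runion (feq b) (rminus E x y)) z (b1 z).
      apply: conn_mono (b1_conn z) => p q [|Opq]; [by left|right; split; first exact: OE].
        by move=> [ep eq']; apply: n1; rewrite -ep -eq'.
      by move=> [ep eq']; apply: n2; rewrite -ep -eq'.
    by apply: conn_trans (c u) _; rewrite h; exact: conn_sym.
- by split.
- split=> //.
  + split=> // [x y /O_lev h /O_lev|x y]; first by rewrite ltnNge ltnW.
    split=> [[Exy nE]|].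
      have [h|n] := pselect (O x y); first by left.
      by right; apply: contrapT => n'; apply: nE.
    by move=> [h|h]; (split; [|by case]); [exact: OE|exact/(sk_edge_sym skel)/OE].
  + rewrite (mass_fun mO); last 2 first.
    * by move=> x y /OE/(sk_edge_rel skel).
    * by move=> x y y' /Ou[_ _ _ ->] /Ou[_ _ _ ->].
    have ipx : {in G `\` Y &, injective px}.
      move=> x y; rewrite !inE => -[Gx nYx] [Gy nYy] e.
      have [<- _ _ _ _] := G_edge Gx nYx; have [<- _ _ _ _] := G_edge Gy nYy.
      by rewrite e.
    have pxR x : (G `\` Y) x -> R x (px x).
      move=> [Gx nY]; have [e _ _ _ _] := G_edge Gx nY; rewrite -{1}e.
      by apply: rel_sym; exact: (sk_retr_rel skel).
    rewrite -prE// -(inj_image mGY mpx ipx pxR).2; congr (mu _).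
    apply/seteqP; split=> x; first by move=> [y [u -> [_ Gu nYu]]]; exists u.
    by move=> [u [Gu nYu] <-]; exists (py u), u.
Qed.

End Absorb.
End SkeletonMoves.

(** * Voronoi cells and labellings *)

Section Voronoi.
Context {K : realType} {d : measure_display} {T : measurableType d}.
Context {mu : probability T K} (r : enumrel mu).
Local Open Scope ring_scope.
Local Notation f := (enum_fun r).
Local Notation R := (rel_of r).
Local Notation pr := (prm mu).
Variables (X : set T) (b : T -> T) (E : T -> T -> Prop) (Y : set T).
Hypotheses (erg : ergodic_rel r) (skel : skeleton r X b E).
Hypotheses (mY : measurable Y) (Yb : forall x, Y x -> b x = x) (Y0 : 0 < pr Y).

Let mb d' (U : measurableType d') (g : U -> T) :
  measurable_fun setT g -> measurable_fun setT (fun u => b (g u)).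
Proof. by move=> mg; apply: measurableT_comp mg; exact: sk_retr_meas skel. Qed.

Let bR x y : b x = b y -> R x y.
Proof.
move=> e; apply: rel_trans (sk_retr_rel skel x) _; rewrite e; apply: rel_sym.
exact: (sk_retr_rel skel).
Qed.

(** At most [n] edges, counted modulo [feq b], separate the class of [x] from [Y]. *)
Fixpoint near n (x : T) : Prop :=
  if n is m.+1 then near m x \/ exists z, b z = b x /\ exists y, E z y /\ near m y
  else Y (b x).

Let near_le n m x : (n <= m)%N -> near n x -> near m x.
Proof. by move=> /subnK <-; elim: (m - n)%N => // k IH /IH; left. Qed.

Let near_b n x y : b x = b y -> near n x -> near n y.
Proof.
elim: n => [|n IH] /= e; first by rewrite e.
by move=> [h|[z [ez h]]]; [left; exact: IH|right; exists z; rewrite ez].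
Qed.

Let mnear n : measurable [set x | near n x].
Proof.
elim: n => [|n IH] /=; first by apply: (mset mY); apply: mb; mfun.
apply: mor => //; apply: (mexR (r := r) (g := fun x => x)).
  by move=> x z [/esym/bR].
move=> i; apply: mand; first by apply: (meq r); apply: mb; mfun.
apply: (mexR (r := r) (g := f i)); first by move=> x y [/(sk_edge_rel skel)].
move=> j; apply: mand; last by apply: (mset IH); mfun.
by apply: (mrelP (sk_edge_meas skel)); mfun.
Qed.

Let nearer y x := exists n, near n y /\ ~ near n x.

Let mnearer d' (U : measurableType d') (g1 g2 : U -> T) :
  measurable_fun setT g1 -> measurable_fun setT g2 ->
  measurable [set u | nearer (g1 u) (g2 u)].
Proof.
move=> m1 m2; apply: mexn => n; apply: mand; first exact: (mset (mnear n)).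
by apply: mnot; exact: (mset (mnear n)).
Qed.

Let X1 := X `&` sat r Y.

Let X1_near x : X1 x -> exists n, near n x.
Proof.
move=> [Xx [y [xy Yy]]]; have c := sk_gen skel Xx xy.
suff /iffRL : (exists n, near n x) <-> (exists n, near n y).
  by apply; exists 0%N; rewrite /= Yb.
apply: (conn_inv (P := fun z => exists n, near n z)) c => u v [e|Euv].
  by split=> -[n h]; exists n; exact: near_b h.
by split=> -[n h]; exists n.+1; right; [exists v|exists u]; split=> //;
  [exists u|exists v]; split=> //; exact: (sk_edge_sym skel).
Qed.

Let step x z := b z = b x /\ exists y, E z y /\ nearer y x.

Let step_ex x : X1 x -> ~ Y (b x) -> exists z, step x z.
Proof.
move=> X1x nY; have := X1_near X1x => -[n]; elim: n => // n IH.
have [h _|nh] := pselect (near n x); first exact: IH.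
move=> [//|[z [ez [y [Ezy hy]]]]]; exists z; split=> //; exists y; split=> //.
by exists n.
Qed.

Let lev x := if pselect (exists n, `[< near n x >]) is left p then ex_minn p else 0%N.

Let lev_nearer y x : (exists n, near n x) -> nearer y x -> (lev y < lev x)%N.
Proof.
move=> hx [n [hy nx]].
have levy : (lev y <= n)%N.
  rewrite /lev; case: pselect => // p; case: ex_minnP => m _ mmin.
  by apply: mmin; apply/asboolP.
apply: leq_ltn_trans levy _; rewrite /lev; case: pselect => [p|]; last first.
  by case: hx => k h; case; exists k; apply/asboolP.
case: ex_minnP => m /asboolP hm _; rewrite ltnNge; apply/negP => mn.
by apply: nx; exact: near_le hm.
Qed.

(** A transversal point outside [Y] points along an edge to a class nearer to [Y], and following
    parents it arrives at its root. [Tm J] truncates the cells to bounded positions relative to the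
    root. It is closed under parents and exhausts the cells as [J] grows, which leaves only finitely
    many types of cells to be distinguished. *)
Lemma voronoi : exists (X1 : set T) (px py root : T -> T) (lev : T -> nat)
    (Tm : nat -> set T),
  [/\ skeleton r X1 b E, X1 `<=` X, [/\ measurable_fun setT px,
     measurable_fun setT py, measurable_fun setT root & forall J, measurable (Tm J)] &
  [/\ forall x, X1 x -> b x = x -> ~ Y x ->
        [/\ b (px x) = x, E (px x) (py x), (lev (b (py x)) < lev x)%N &
            root (b (py x)) = root x],
      forall x, Y x -> root x = x,
      forall x, X1 x -> b x = x -> Y (root x),
      forall x, R x (root x) &
   [/\ forall J x, Tm J x -> Tm J.+1 x, forall x, X1 x -> b x = x -> exists J, Tm J x,
      forall J x, Tm J x -> exists2 j, (j <= J)%N & f j (root x) = x,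
      forall J x, X1 x -> b x = x -> ~ Y x -> Tm J x -> Tm J (b (py x)) &
      forall J x, Y x -> Tm J x]]].
Proof.
have mX1 : measurable X1 by apply: measurableI; [exact: sk_meas skel|exact: msat].
have iX1 : invariant_set r X1.
  by move=> x y xy [Xx sx]; split; [exact: (sk_inv skel) Xx|exact: sat_inv sx].
have cX1 : pr (~` X1) = 0.
  have sY : pr (~` sat r Y) = 0.
    rewrite prC; last exact: msat.
    have [e|->] := erg (msat r mY) (sat_inv (r := r) (A := Y)); last by rewrite subrr.
    by move: Y0; rewrite (pr_null mY (msat r mY) (sub_sat r (A := Y)) e) ltxx.
  rewrite /X1 setCI; apply/eqP; rewrite eq_le pr_ge0 andbT.
  apply: (le_trans (prU_le mu _ _)); try apply: measurableC.
  - exact: sk_meas skel.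
  - exact: msat.
  - by rewrite sY (sk_conull skel) addr0.
have sk1 : skeleton r X1 b E.
  case: (skel) => h1 h2 h3 h4 h5 h6 h7 h8 h9 h10 h11; split=> //.
  by move=> x y [Xx _]; exact: h10.
have mid : measurable_fun setT (fun x : T => x) by exact: measurable_id.
have [px [mpx pxR pxQ pxN]] : exists s : T -> T, [/\ measurable_fun setT s,
    forall u, R u (s u), forall u, (exists y, step u y) -> step u (s u) &
    forall u, ~ (exists y, step u y) -> s u = u].
  apply: mpick => //; first by move=> x z [/esym/bR].
  move=> i; apply: mand; first by apply: (meq r); apply: mb; mfun.
  apply: (mexR (r := r) (g := f i)); first by move=> x y [/(sk_edge_rel skel)].
  move=> j; apply: mand; last by apply: mnearer; mfun.
  by apply: (mrelP (sk_edge_meas skel)); mfun.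
have [py [mpy pyR pyQ pyN]] : exists s : T -> T, [/\ measurable_fun setT s,
    forall u, R (px u) (s u),
    forall u, (exists y, E (px u) y /\ nearer y u) -> E (px u) (s u) /\ nearer (s u) u &
    forall u, ~ (exists y, E (px u) y /\ nearer y u) -> s u = px u].
  apply: mpick => //; first by move=> x z [/(sk_edge_rel skel)].
  move=> i; apply: mand; last by apply: mnearer; mfun.
  by apply: (mrelP (sk_edge_meas skel)); mfun.
have edge x : X1 x -> b x = x -> ~ Y x ->
    [/\ b (px x) = x, E (px x) (py x) & (lev (b (py x)) < lev x)%N].
  move=> X1x bx nY; have [|e1 h] := pxQ x; first by apply: step_ex => //; rewrite bx.
  have [e2 h2] := pyQ x h; rewrite e1 bx; split=> //.
  apply: lev_nearer; first exact: X1_near.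
  case: h2 => n [hn nn]; exists n; split=> //.
  by apply: near_b hn; rewrite (sk_retr_idem skel).
pose par x := if pselect (Y x) then x else b (py x).
have parY x : Y x -> par x = x by rewrite /par; case: pselect.
have parN x : ~ Y x -> par x = b (py x) by rewrite /par; case: pselect.
have parR x : R x (par x).
  have [Yx|nY] := pselect (Y x); first by rewrite parY//; exact: rel_refl.
  rewrite parN//; apply: rel_trans (pxR x) _; apply: rel_trans (pyR x) _.
  exact: (sk_retr_rel skel).
have mpar : measurable_fun setT par.
  have mbpy : measurable_fun setT (fun x => b (py x)) by exact: mb.
  apply: (mfun_graph (r := r) (g0 := fun x => x)) => // n.
  rewrite (_ : [set u | _] = [set x | (Y x /\ f n x = x) \/ (~ Y x /\ f n x = b (py x))]).
    apply: mor; apply: mand; try by apply: (meq r) => //; mfun.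
      exact: mY.
    exact: mnot.
  apply/seteqP; split=> x /=.
    have [Yx|nY] := pselect (Y x); first by rewrite parY//; left.
    by rewrite parN//; right.
  by move=> [[Yx ->]|[nY ->]]; [rewrite parY|rewrite parN].
pose anc i x := iter i par x.
have manc i : measurable_fun setT (anc i).
  elim: i => [|i IH] //.
  by rewrite (_ : anc i.+1 = par \o anc i)//; exact: measurableT_comp.
have ancR i x : R x (anc i x).
  by elim: i => [|i IH]; [exact: rel_refl|apply: rel_trans IH _; exact: parR].
have ancS i x : anc i.+1 x = anc i (par x) by rewrite /anc iterSr.
have ancY i j x : Y (anc i x) -> Y (anc j x) -> anc i x = anc j x.
  have le a c : (a <= c)%N -> Y (anc a x) -> anc c x = anc a x.
    move=> /subnK <- Ya; elim: (c - a)%N => // k IH.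
    by rewrite addSn {1}/anc iterS -/(anc _ x) IH parY.
  by case/orP: (leq_total i j) => /le h Yi Yj; [rewrite h|rewrite -h].
pose Q x y := Y y /\ exists i, anc i x = y.
have [root [mroot rootR rootQ rootN]] : exists s : T -> T, [/\ measurable_fun setT s,
    forall u, R u (s u), forall u, (exists y, Q u y) -> Q u (s u) &
    forall u, ~ (exists y, Q u y) -> s u = u].
  apply: mpick => //; first by move=> x y [_ [i <-]].
  move=> n; apply: mand; first by apply: (mset mY); mfun.
  by apply: mexn => i; apply: (meq r) => //; mfun.
have Quniq x y z : Q x y -> Q x z -> y = z.
  by move=> [Yy [i ei]] [Yz [j ej]]; rewrite -ei -ej; apply: ancY; rewrite ?ei ?ej.
have rootY x : Y x -> root x = x.
  move=> Yx; have Qx : Q x x by split=> //; exists 0%N.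
  by apply: (Quniq x) => //; apply: rootQ; exists x.
have rex x : X1 x -> b x = x -> exists y, Q x y.
  have [n] := ubnP (lev x); elim: n x => // n IH x ltn X1x bx.
  have [Yx|nY] := pselect (Y x); first by exists x; split=> //; exists 0%N.
  have [e1 e2 e3] := edge x X1x bx nY.
  have [||| y [Yy [i e]]] := IH (b (py x)).
  - by rewrite -ltnS; apply: leq_ltn_trans ltn.
  - by rewrite -parN//; apply: iX1 X1x; exact: parR.
  - exact: (sk_retr_idem skel).
  by exists y; split=> //; exists i.+1; rewrite ancS parN.
have root_par x : ~ Y x -> (exists y, Q (par x) y) -> root (par x) = root x.
  move=> nY [y Qy]; have [Yy [i e]] := Qy.
  have Qx : Q x y by split=> //; exists i.+1; rewrite ancS.
  rewrite (Quniq _ _ _ (rootQ _ (ex_intro _ y Qy)) Qy).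
  by rewrite (Quniq _ _ _ (rootQ _ (ex_intro _ y Qx)) Qx).
(* All ancestors of [x], not only [x], must be among the first [J + 1] companions of the root; this
   makes [Tm J] closed under parents. *)
pose Tm J := [set x | forall i, exists j, (j <= J)%N /\ f j (root x) = anc i x].
exists X1, px, py, root, lev, Tm; split=> //.
- by move=> x [].
- split=> // J; apply: malln => i; apply: mexn => j; apply: mand; first exact: mprop.
  by apply: (meq r) => //; mfun.
have next x : X1 x -> b x = x -> ~ Y x -> exists y, Q (par x) y.
  move=> X1x bx nY; apply: rex; first by apply: iX1 X1x; exact: parR.
  by rewrite parN// (sk_retr_idem skel).
split=> //.
- move=> x X1x bx nY; have [e1 e2 e3] := edge x X1x bx nY; split=> //.
  by rewrite -parN//; apply: root_par => //; exact: next.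
- by move=> x X1x bx; have [] := rootQ _ (rex x X1x bx).
split.
- by move=> J x h i; have [j [hj e]] := h i; exists j; split=> //; exact: leqW.
- move=> x X1x bx; have [n] := ubnP (lev x); elim: n x X1x bx => // n IH x X1x bx ltn.
  have [Yx|nY] := pselect (Y x).
    exists 0%N => i; exists 0%N; split=> //; rewrite rootY// enum_fun0.
    by elim: i => // i IHi; rewrite ancS parY.
  have [e1 e2 e3] := edge x X1x bx nY.
  have [||| J hJ] := IH (b (py x)).
  - by rewrite -parN//; apply: iX1 X1x; exact: parR.
  - exact: (sk_retr_idem skel).
  - by rewrite -ltnS; apply: leq_ltn_trans ltn.
  have [j0 ej0] := rel_sym (rootR x).
  exists (maxn J j0) => -[|i]; first by exists j0; split=> //; exact: leq_maxr.
  have [j [hj e]] := hJ i; exists j; split; first by apply: (leq_trans hj); exact: leq_maxl.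
  rewrite ancS parN// -e; congr (f j _).
  by rewrite -parN//; apply/esym/root_par => //; exact: next.
- by move=> J x h; have [j [hj e]] := h 0%N; exists j.
- move=> J x X1x bx nY h i; have [j [hj e]] := h i.+1; exists j; split=> //.
  by rewrite -parN// root_par//; [rewrite e ancS|exact: next].
- move=> J x Yx i; exists 0%N; split=> //; rewrite enum_fun0 rootY//.
  by elim: i => // i IH; rewrite ancS parY.
Qed.

End Voronoi.

(** * Labellings of the classes *)

Section Labels.
Context {K : realType} {d : measure_display} {T : measurableType d}.
Context {mu : probability T K} (r : enumrel mu).
Local Open Scope ring_scope.
Local Notation R := (rel_of r).
Local Notation pr := (prm mu).

(* Over each point of the transversal there is exactly one point of the class
   with any given label. *)
Record labelling (Q : finType) (X : set T) (b : T -> T) (l : T -> Q) : Prop := Labelling {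
  lab_meas : forall q, measurable [set x | l x = q];
  lab_ex : forall x q, X x -> exists2 y, b y = b x & l y = q;
  lab_inj : forall x y, X x -> X y -> b x = b y -> l x = l y -> x = y
}.

(** For a fixed label, [b] restricts to a bijection from the sheet over [W] onto [W]. *)
Lemma pr_label1 (Q : finType) X b E (l : T -> Q) (W : set T) q :
  skeleton r X b E -> labelling X b l -> measurable W -> W `<=` X ->
  (forall x, W x -> b x = x) ->
  measurable [set x | (X x /\ W (b x)) /\ l x = q] /\
  pr [set x | (X x /\ W (b x)) /\ l x = q] = pr W.
Proof.
move=> skel lab mW WX Wb.
have mbw : measurable [set x | W (b x)] by apply: (mset mW); exact: sk_retr_meas skel.
have mF : measurable [set x | (X x /\ W (b x)) /\ l x = q].
  apply: mand; last exact: lab_meas lab q.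
  by apply: mand => //; exact: sk_meas skel.
split=> //; have bx x : R x (b x) by exact: (sk_retr_rel skel).
have inj : {in [set x | (X x /\ W (b x)) /\ l x = q] &, injective b}.
  move=> x y; rewrite !inE /= => -[[Xx _] lx] [[Xy _] ly] bxy.
  by apply: (lab_inj lab) => //; rewrite lx ly.
have [_ h] := inj_image mF (sk_retr_meas skel) inj (fun x _ => bx x).
rewrite /prm -h; congr (fine (mu _)); apply/seteqP; split=> x.
  by move=> [y [[Xy Wy] _] <-].
move=> Wx; have Xx := WX x Wx; have [y ey ly] := lab_ex lab q Xx.
exists y; last by rewrite ey Wb.
split=> //; split; last by rewrite ey Wb.
apply: (sk_inv skel) Xx; rewrite -(Wb x Wx) -ey; apply: rel_sym; exact: bx.
Qed.

Lemma pr_label_set (Q : finType) X b E (l : T -> Q) (W : set T) (V : {set Q}) :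
  skeleton r X b E -> labelling X b l -> measurable W -> W `<=` X ->
  (forall x, W x -> b x = x) ->
  measurable [set x | (X x /\ W (b x)) /\ l x \in V] /\
  pr [set x | (X x /\ W (b x)) /\ l x \in V] = pr W *+ #|V|.
Proof.
move=> skel lab mW WX Wb.
have h q := pr_label1 q skel lab mW WX Wb.
have -> : [set x | (X x /\ W (b x)) /\ l x \in V] =
    \big[setU/set0]_(q <- enum V) [set x | (X x /\ W (b x)) /\ l x = q].
  apply/seteqP; split=> x.
    by move=> [h1 h2]; rewrite -(bigcup_seq (enum V)); exists (l x) => //=; rewrite mem_enum.
  by rewrite -(bigcup_seq (enum V)); move=> [q /= + [h1 e]]; rewrite mem_enum -e.
split; first by apply: bigsetU_measurable => q _; have [] := h q.
suff main (s : seq Q) : uniq s ->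
    pr (\big[setU/set0]_(q <- s) [set x | (X x /\ W (b x)) /\ l x = q]) = pr W *+ size s.
  by rewrite main ?enum_uniq// -cardE.
elim: s => [|q s IH] /=; first by rewrite big_nil pr_set0.
move=> /andP[qs us]; have [m1 e1] := h q; rewrite big_cons prU//; last 2 first.
- by apply: bigsetU_measurable => q' _; have [] := h q'.
- apply/seteqP; split=> // x [[_ lx]]; rewrite -(bigcup_seq s) => -[q' /= q's [_ lx']].
  by move: qs; rewrite -lx lx' q's.
by rewrite e1 IH// mulrS.
Qed.

Lemma pr_label (Q : finType) X b E (l : T -> Q) (W : set T) :
  skeleton r X b E -> labelling X b l -> measurable W -> W `<=` X ->
  (forall x, W x -> b x = x) ->
  pr [set x | X x /\ W (b x)] = pr W *+ #|Q|.
Proof.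
move=> skel lab mW WX Wb; rewrite -cardsT.
have [_ <-] := pr_label_set ([set: Q]%SET) skel lab mW WX Wb.
by congr pr; apply/seteqP; split=> x; [move=> h; rewrite /= inE|case].
Qed.

End Labels.

(** * Coarsening a finite subrelation *)

Lemma pr_bigU (K : realType) d (T : measurableType d) (mu : probability T K)
    (I : choiceType) (s : seq I) (F : I -> set T) :
  (forall i, measurable (F i)) -> (forall i j x, F i x -> F j x -> i = j) ->
  uniq s -> prm mu (\big[setU/set0]_(i <- s) F i) = (\sum_(i <- s) prm mu (F i))%R.
Proof.
move=> mF dF; elim: s => [_|i s IH /= /andP[ns us]]; first by rewrite !big_nil pr_set0.
rewrite !big_cons prU//; first by rewrite IH.
  exact: bigsetU_measurable.
apply/seteqP; split=> // x [Fi]; rewrite -(bigcup_seq s) => -[j /= js Fj].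
by move: ns; rewrite (dF _ _ _ Fi Fj) js.
Qed.

Lemma hom1 (G H : groupType) (f : {multiplicative G -> H}) : f 1%g = 1%g.
Proof. by apply: (@mulgI _ (f 1%g)); rewrite -gmulfM !mulg1. Qed.

Lemma homV (G H : groupType) (f : {multiplicative G -> H}) x : f x^-1%g = (f x)^-1%g.
Proof. by apply: (@mulgI _ (f x)); rewrite -gmulfM !mulgV hom1. Qed.

(** By Lagrange, [P] has as many elements as the image of [Q] has right cosets. Each element of [P]
    is sent to a representative of the coset with the same rank in the enumerations. *)
Lemma coset_labels (Q Q' : finGroupType) (iota : {multiplicative Q -> Q'})
    (V : finType) (P : pred V) : injective iota -> (#|P| * #|Q| = #|Q'|)%N ->
  exists c : V -> Q', (forall q', exists q s, P s /\ q' = (iota q * c s)%g) /\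
    forall q s q1 s1, P s -> P s1 -> (iota q * c s = iota q1 * c s1)%g ->
      q = q1 /\ s = s1.
Proof.
move=> iotaI cardP; pose H0 := iota @: [set: Q]%SET.
have gH : group_set H0.
  apply/group_setP; split; first by apply/imsetP; exists 1%g; rewrite ?inE ?hom1.
  move=> x y /imsetP[q _ ->] /imsetP[q1 _ ->]; apply/imsetP; exists (q * q1)%g => //.
  by rewrite gmulfM.
pose H := group gH.
have cH : #|H| = #|Q| by rewrite /= card_imset// cardsT.
have cR : #|rcosets H [set: Q']%SET| = #|P|.
  have sH : H \subset [set: Q']%SET by apply/fintype.subsetP => x _; rewrite inE.
  have := @Lagrange _ [set: Q']%G H sH; rewrite /indexg => h.
  have : (#|H| * #|rcosets H [set: Q']%SET| = #|P| * #|Q|)%N by rewrite h cardP cardsT.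
  rewrite cH [(#|P| * _)%N]mulnC => /eqP; rewrite eqn_mul2l => /orP[|/eqP//].
  by rewrite -leqn0 leqNgt; have -> : (0 < #|Q|)%N by apply/card_gt0P; exists 1%g.
pose rc := enum (rcosets H [set: Q']%SET).
have szrc : size rc = #|P| by rewrite -cardE.
pose c s := repr (nth finset.set0 rc (index s (enum P))).
have rcP s : P s -> nth finset.set0 rc (index s (enum P)) \in rcosets H [set: Q']%SET.
  move=> Ps; rewrite -mem_enum; apply: mem_nth.
  by rewrite -/rc szrc cardE index_mem mem_enum.
have cP s : P s -> (H :* c s)%g = nth finset.set0 rc (index s (enum P)).
  move=> Ps; have /rcosetsP[x _ e] := rcP s Ps; rewrite /c e; exact: rcoset_repr.
exists c; split.
  move=> q'; have q'R : (H :* q')%g \in rcosets H [set: Q']%SET.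
    by apply/rcosetsP; exists q'; rewrite ?inE.
  have iq : (index (H :* q')%g rc < #|P|)%N by rewrite -szrc index_mem mem_enum.
  have [s0 _] : exists s0 : V, P s0.
    have /card_gt0P[s0 Ps0] : (0 < #|P|)%N by exact: leq_ltn_trans (leq0n _) iq.
    by exists s0.
  pose s := nth s0 (enum P) (index (H :* q')%g rc).
  have sE : s \in enum P by apply: mem_nth; rewrite -cardE.
  have Ps : P s by move: sE; rewrite mem_enum.
  have e : (H :* c s)%g = (H :* q')%g.
    rewrite cP// index_uniq ?enum_uniq//; last by rewrite -cardE.
    by rewrite nth_index// mem_enum.
  have : q' \in (H :* c s)%g by rewrite e rcoset_refl.
  by move=> /rcosetP[h /imsetP[q _ ->] ->]; exists q, s.
move=> q s q1 s1 Ps Ps1 e.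
have eH : (H :* c s)%g = (H :* c s1)%g.
  apply: rcoset_eqP; apply/rcosetP; exists (iota (q^-1 * q1))%g.
    by apply/imsetP; exists (q^-1 * q1)%g.
  by rewrite gmulfM -mulgA -e homV mulKg.
have ss : s = s1.
  move: eH; rewrite !cP// => /eqP; rewrite nth_uniq ?enum_uniq ?szrc ?cardE ?index_mem ?mem_enum//.
  move=> /eqP ei; rewrite -(@nth_index _ s s (enum P)) ?mem_enum// ei.
  by rewrite nth_index ?mem_enum.
by split=> //; move: e; rewrite ss => /mulIg/iotaI.
Qed.

Lemma hom_card_dvd (Q Q' : finGroupType) (iota : {multiplicative Q -> Q'}) :
  injective iota -> (#|Q| %| #|Q'|)%N.
Proof.
move=> iotaI; pose H0 := iota @: [set: Q]%SET.
have gH : group_set H0.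
  apply/group_setP; split; first by apply/imsetP; exists 1%g; rewrite ?inE ?hom1.
  move=> x y /imsetP[q _ ->] /imsetP[q1 _ ->]; apply/imsetP; exists (q * q1)%g => //.
  by rewrite gmulfM.
have : (#|group gH| %| #|[set: Q']%G|)%N.
  by apply: cardSg; apply/fintype.subsetP => x _; rewrite inE.
by rewrite /= card_imset// !cardsT.
Qed.

(* The skeleton and its labelling are coarsened from [Q] to [Q']. Up to the set
   [C] no edge is lost except inside the new classes, and [U] is nearly a union
   of label sets. *)
Record coarsening (K : realType) d (T : measurableType d) (mu : probability T K)
    (r : enumrel mu) (Q Q' : finGroupType) (iota : Q -> Q')
    (X : set T) (b : T -> T) (E : T -> T -> Prop) (l : T -> Q)
    (X' : set T) (b' : T -> T) (E' : T -> T -> Prop) (l' : T -> Q')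
    (U C : set T) (e1 e2 : K) : Prop := Coarsening {
  co_skel : skeleton r X' b' E';
  co_sub : X' `<=` X;
  co_edge : forall x y, E' x y -> E x y;
  co_lab : labelling X' b' l';
  co_retr : forall x, b' (b x) = b' x;
  co_equiv : forall x y, X' x -> X' y -> b x = b y ->
    (l' y * (l' x)^-1)%g = iota (l y * (l x)^-1)%g;
  co_loss : exists O, [/\ oriented_loss E E' O,
    mass r O = ((#|Q|%:R)^-1 - (#|Q'|%:R)^-1)%:E &
    forall x y, O x y -> b' x = b' y \/ C x];
  co_small_meas : measurable C;
  co_small : (prm mu C <= e1)%R;
  co_approx : exists W : {set Q'}, measurable [set x | X' x /\ ~ (U x <-> l' x \in W)] /\
    (prm mu [set x | X' x /\ ~ (U x <-> l' x \in W)] <= e2)%R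
}.

(** * One stage: from classes labelled by Q to classes labelled by Q' *)

Section Stage.
Context {K : realType} {d : measure_display} {T : measurableType d}.
Context {mu : probability T K} (r : enumrel mu).
Local Open Scope ring_scope.
Local Notation f := (enum_fun r).
Local Notation R := (rel_of r).
Local Notation pr := (prm mu).
Hypothesis atomless : forall x : T, pr [set x] = 0.
Variables (Q : finGroupType) (X : set T) (b : T -> T) (E : T -> T -> Prop) (l : T -> Q).
Variables (delta : K) (U : set T).
Hypotheses (erg : ergodic_rel r) (skel : skeleton r X b E) (lab : labelling X b l).
Hypotheses (delta0 : 0 < delta) (mU : measurable U).

Let mb d' (V : measurableType d') (g : V -> T) :
  measurable_fun setT g -> measurable_fun setT (fun u => b (g u)).
Proof. by move=> mg; apply: measurableT_comp mg; exact: sk_retr_meas skel. Qed.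

Let bR x y : b x = b y -> R x y.
Proof.
move=> e; apply: rel_trans (sk_retr_rel skel x) _; rewrite e; apply: rel_sym.
exact: (sk_retr_rel skel).
Qed.

Let D := [set x | X x /\ b x = x].

Let mD : measurable D.
Proof.
by apply: mand; [exact: sk_meas skel|apply: (meq r); [apply: mb|]; mfun].
Qed.

Let cQ0 : 0 < (#|Q|%:R : K).
Proof. by rewrite ltr0n; apply/card_gt0P; exists 1%g. Qed.

Lemma pr_transversal : pr D = (#|Q|%:R)^-1.
Proof.
have h := pr_label skel lab mD.
have := h (fun x => @proj1 _ _) (fun x => @proj2 _ _).
rewrite (_ : [set x | X x /\ D (b x)] = X); last first.
  apply/seteqP; split=> x; first by case.
  move=> Xx; split=> //; split; last exact: (sk_retr_idem skel).
  exact: (sk_inv skel) (sk_retr_rel skel x) Xx.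
have -> : pr X = 1.
  by have := sk_conull skel; rewrite prC; [lra|exact: sk_meas skel].
move=> e; apply: (mulIf (lt0r_neq0 cQ0)).
by rewrite /= mulVf ?lt0r_neq0// mulr_natr -e.
Qed.

Section Cells.
Variables (Y X1 : set T) (px py root : T -> T) (lev : T -> nat) (Tm : nat -> set T) (J : nat).
Hypotheses (mY : measurable Y) (YD : Y `<=` D).
Hypotheses (sk1 : skeleton r X1 b E) (X1X : X1 `<=` X).
Hypotheses (mpx : measurable_fun setT px) (mpy : measurable_fun setT py)
  (mroot : measurable_fun setT root) (mTm : measurable (Tm J)).
Hypothesis edge : forall x, X1 x -> b x = x -> ~ Y x ->
  [/\ b (px x) = x, E (px x) (py x), (lev (b (py x)) < lev x)%N &
      root (b (py x)) = root x].
Hypothesis rootY : forall x, Y x -> root x = x.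
Hypothesis root_in : forall x, X1 x -> b x = x -> Y (root x).
Hypothesis rootR : forall x, R x (root x).
Hypothesis Tm_root : forall x, Tm J x -> exists2 j, (j <= J)%N & f j (root x) = x.
Hypothesis Tm_next : forall x, X1 x -> b x = x -> ~ Y x -> Tm J x -> Tm J (b (py x)).
Hypothesis Tm_Y : forall x, Y x -> Tm J x.
Variable eps : K.
Hypothesis Tm_eps : pr ((D `&` X1) `\` Tm J) <= eps.

Let D1 := D `&` X1.
(** The type of a root [y] records, for each position [j] up to [J], whether [f j y] belongs to its
    truncated cell and, if so, which labels over it carry a point of [U]. There are finitely many
    types, and over the cells [U] can be read off from type, position and label. *)
Let tau := {ffun 'I_J.+1 -> option {set Q}}.
Let posn y (j : nat) := [/\ Tm J (f j y), root (f j y) = y, b (f j y) = f j y &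
  forall i, (i < j)%N -> f i y <> f j y].
Let patt y j q := exists z, b z = f j y /\ (l z = q /\ U z).
Let tauf y : tau := [ffun j : 'I_J.+1 => if `[< posn y j >]
  then Some (finset (fun q => `[< patt y j q >])) else None].

Let mposn j : measurable [set y | posn y j].
Proof.
rewrite (_ : [set y | _] = [set y | (Tm J (f j y) /\ root (f j y) = y) /\
   (b (f j y) = f j y /\ forall i, (i < j)%N -> f i y <> f j y)]).
  apply: mand.
    apply: mand; first by apply: (mset mTm); mfun.
    by apply: (meq r); [apply: measurableT_comp mroot _; mfun|mfun].
  apply: mand; first by apply: (meq r); [apply: mb|]; mfun.
  by apply: malln => i; apply: mimp; [exact: mprop|apply: mnot; apply: (meq r); mfun].
by apply/seteqP; split=> y /=; [case|move=> [[? ?] [? ?]]].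
Qed.

Let mpatt j q : measurable [set y | patt y j q].
Proof.
apply: (mexR (r := r) (g := f j)).
  by move=> y z [e _]; apply: rel_trans (sk_retr_rel skel (f j y)) _;
    rewrite -e (sk_retr_idem skel); apply: rel_sym; exact: (sk_retr_rel skel).
move=> i; apply: mand; first by apply: (meq r); [apply: mb|]; mfun.
apply: mand; last by apply: (mset mU); mfun.
by apply: (mset (lab_meas lab q)); mfun.
Qed.

Let mtauf t : measurable [set y | tauf y = t].
Proof.
rewrite (_ : [set y | _] = [set y | forall j : 'I_J.+1,
   if t j is Some A then posn y j /\ (forall q, patt y j q <-> q \in A) else ~ posn y j]).
  apply: mall => j; case: (t j) => [A|]; last by apply: mnot; exact: mposn.
  apply: mand; first exact: mposn; apply: mall => q.
  have [qA|qA] := boolP (q \in A).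
    by apply: mand; apply: mimp; by [exact: mprop|exact: mpatt].
  by apply: mand; apply: mimp; by [exact: mprop|exact: mpatt].
apply/seteqP; split=> y /=.
  move=> <- j; rewrite ffunE; case: asboolP => // p; split=> // q.
  by rewrite inE; split=> [h|/asboolP//]; apply/asboolP.
move=> h; apply/ffunP => j; rewrite ffunE; have := h j; case: (t j) => [A|].
  move=> [p hq]; case: asboolP => // _; congr Some; apply/setP => q; rewrite inE.
  by apply/asboolP/idP => /hq.
by case: asboolP.
Qed.

Variables (Q' : finGroupType) (iota : {multiplicative Q -> Q'}).
Hypothesis iotaI : injective iota.
Let eta : K := (#|Q'|%:R)^-1.
Hypothesis eta_small : eta *+ (#|{: tau}| * J.+1) <= eps.

Let eta0 : 0 < eta.
Proof. by rewrite invr_gt0 ltr0n; apply/card_gt0P; exists 1%g. Qed.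

Let Zt t := (Y `&` X1) `&` [set y | tauf y = t].
Let mZt t : measurable (Zt t).
Proof. by apply: measurableI => //; apply: measurableI => //; exact: sk_meas sk1. Qed.

Section Chopped.
Variables (nn : tau -> nat) (BB : tau -> nat -> set T).
Hypothesis BBP : forall t, [/\ forall i, measurable (BB t i),
    forall i, BB t i `<=` Zt t, forall i, (i < nn t)%N -> pr (BB t i) = eta,
    trivIset setT (BB t) &
    pr (Zt t `\` \bigcup_(i in [set i | (i < nn t)%N]) BB t i) < eta].

Let Z := [set y | exists t : tau, exists i, (i < nn t)%N /\ BB t i y].
Let mBB t i : measurable (BB t i). Proof. by have [h _ _ _ _] := BBP t; exact: h. Qed.
Let mZ : measurable Z.
Proof.
by apply: mex => t; apply: mexn => i; apply: mand; [exact: mprop|exact: mBB].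
Qed.

Let BB_Zt t i y : BB t i y -> Zt t y.
Proof. by have [_ h _ _ _] := BBP t; exact: h. Qed.

Let ZY y : Z y -> Y y.
Proof. by move=> [t [i [_ /BB_Zt[[]]]]]. Qed.

Let G := D1 `&` (Tm J `&` [set x | Z (root x)]).
Let mD1 : measurable D1. Proof. by apply: measurableI => //; exact: sk_meas sk1. Qed.
Let mG : measurable G.
Proof. by apply: measurableI => //; apply: measurableI => //; exact: (mset mZ). Qed.

Let W0 := D1 `\` G.
Let mW0 : measurable W0. Proof. exact: measurableD. Qed.

Section Chopped0.
Variables (n0 : nat) (B0 : nat -> set T).
Hypothesis B0P : [/\ forall i, measurable (B0 i),
    forall i, B0 i `<=` W0, forall i, (i < n0)%N -> pr (B0 i) = eta,
    trivIset setT B0 &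
    pr (W0 `\` \bigcup_(i in [set i | (i < n0)%N]) B0 i) < eta].
Let mB0 i : measurable (B0 i). Proof. by have [h _ _ _ _] := B0P; exact: h. Qed.
Let B0W i : B0 i `<=` W0. Proof. by have [_ h _ _ _] := B0P; exact: h. Qed.

(** A node is a set of measure [eta], made of roots of one type or of points outside the retained
    cells. Its sheets are its translates to the positions allowed by the type. All valid sheets are
    disjoint and of measure [eta]; they will be indexed by the cosets of [Q] in [Q']. *)
Let node := ({t : tau & 'I_(nn t)} + 'I_n0)%type.
Let N (i : node) : set T :=
  match i with inl (existT t k) => BB t k | inr k => B0 k end.
Let valid (s : node * 'I_J.+1) : bool :=
  match s.1 with inl (existT t k) => t s.2 != None | inr _ => s.2 == ord0 end.
Let S (s : node * 'I_J.+1) : set T := [set x | exists2 y, N s.1 y & f s.2 y = x].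

Let mN i : measurable (N i).
Proof. by case: i => [[t k]|k]; [exact: mBB|exact: mB0]. Qed.

Let prN i : pr (N i) = eta.
Proof.
case: i => [[t k]|k] /=; first by have [_ _ h _ _] := BBP t; apply: h.
by have [_ _ h _ _] := B0P; apply: h.
Qed.

Let G_Z x : G x -> Z (root x). Proof. by case=> _ []. Qed.
Let Z_G y : Z y -> G y.
Proof.
move=> Zy; have Yy := ZY Zy; split; last by split; [exact: Tm_Y|rewrite /= rootY].
by split; [exact: YD|case: Zy => t [i [_ /BB_Zt[[]]]]].
Qed.

Let N_D1 i y : N i y -> D1 y.
Proof.
case: i => [[t k]|k] /=; last by move=> /B0W[].
by move=> /BB_Zt[[/YD]].
Qed.

Let N_cases i y : N i y -> (Z y /\ exists t k, i = inl (existT _ t k) /\ tauf y = t) \/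
  (W0 y /\ exists k, i = inr k).
Proof.
case: i => [[t k]|k] /= h; [left|right].
  split; first by exists t, k; split.
  by exists t, k; split=> //; case: (BB_Zt h).
by split; [exact: B0W h|exists k].
Qed.

Let N_disj i j y : N i y -> N j y -> i = j.
Proof.
move=> Ni Nj; have [[Zi [t [k [ei ti]]]]|[Wi [k ei]]] := N_cases Ni;
have [[Zj [t' [k' [ej tj]]]]|[Wj [k' ej]]] := N_cases Nj; subst i j.
- subst t; subst t'; congr (inl (existT _ _ _)); apply/val_inj.
  have [_ _ _ /trivIsetP h _] := BBP (tauf y); apply: contrapT => /eqP ne.
  by have /seteqP[+ _] := h k k' I I ne; move/(_ y); apply.
- by case: Wj => _ []; exact: Z_G.
- by case: Wi => _ []; exact: Z_G.
- congr inr; apply/val_inj.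
  have [_ _ _ /trivIsetP h _] := B0P; apply: contrapT => /eqP ne.
  by have /seteqP[+ _] := h k k' I I ne; move/(_ y); apply.
Qed.

(* A point of a sheet determines its node, its position and its node point. *)
Let S_in s y : valid s -> N s.1 y ->
  (Z y /\ posn y s.2 /\ G (f s.2 y)) \/ (W0 y /\ s.2 = ord0 /\ f s.2 y = y).
Proof.
case: s => i j /= v Ni; have [[Zy [t [k [ei ty]]]]|[Wy [k ei]]] := N_cases Ni; subst i.
  left; move: v; rewrite /valid /= -ty ffunE; case: asboolP => // p _; split=> //; split=> //.
  case: p => p1 p2 p3 p4; have [[[Xy _] X1y] _] := Z_G Zy; split.
    split; last by apply: (sk_inv sk1) X1y; exact: rel_fun.
    by split=> //; apply: (sk_inv skel) Xy; exact: rel_fun.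
  by split=> //; rewrite /= p2.
by right; move: v; rewrite /valid /= => /eqP ->; rewrite enum_fun0.
Qed.

Let S_uniq s s' y y' : valid s -> valid s' -> N s.1 y -> N s'.1 y' ->
  f s.2 y = f s'.2 y' -> s = s' /\ y = y'.
Proof.
move=> v v' Ny Ny' e.
have [[Zy [[p1 p2 p3 p4] Gy]]|[Wy [ej ey]]] := S_in v Ny;
have [[Zy' [[p1' p2' p3' p4'] Gy']]|[Wy' [ej' ey']]] := S_in v' Ny'.
- have eyy : y = y' by rewrite -p2 e p2'.
  subst y'; split=> //; move: (N_disj Ny Ny') e p4 p4'; case: s s' {v v' Ny Ny' p1 p2 p3 p1' p2' p3' Gy Gy'}
    => [i j] [i' j'] /= -> e p4 p4'; congr pair; apply/val_inj.
  by have [lt|lt|//] := ltngtP j j'; [case: (p4' _ lt)|case: (p4 _ lt)].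
- by case: Wy' => _ []; rewrite -ey' -e.
- by case: Wy => _ []; rewrite -ey e.
- have eyy : y = y' by rewrite -ey e ey'.
  subst y'; split=> //; move: (N_disj Ny Ny') ej ej'; case: s s' {v v' Ny Ny' e ey ey'}
    => [i j] [i' j'] /= -> -> ->. by [].
Qed.

Let mS s : measurable (S s).
Proof.
rewrite (_ : S s = [set x | exists y, N s.1 y /\ f s.2 y = x]); last first.
  by apply/seteqP; split=> x; [case=> y; exists y|case=> y []; exists y].
apply: (mexR (r := r) (g := fun x => x)); first by move=> x y [_ <-]; apply: rel_sym; exact: rel_fun.
move=> i; apply: mand; first by apply: (mset (mN _)); mfun.
by apply: (meq r); mfun.
Qed.

Let prS s : valid s -> pr (S s) = eta.
Proof.
move=> v; rewrite -(prN s.1) (_ : S s = f s.2 @` N s.1).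
  have inj : {in N s.1 &, injective (f s.2)}.
    by move=> x y /set_mem Nx /set_mem Ny e; have [] := S_uniq v v Nx Ny e.
  have [_ h] := inj_image (r := r) (mN s.1) (enum_fun_meas r s.2) inj (fun x _ => rel_fun r s.2 x).
  by rewrite /prm h.
by apply/seteqP; split=> x [y]; exists y.
Qed.

Let L0 := W0 `\` \bigcup_(i in [set i | (i < n0)%N]) B0 i.
Let mL0 : measurable L0.
Proof. by apply: measurableD => //; apply: bigcup_measurable => i _. Qed.

Let cover x : D1 x -> ~ L0 x -> exists2 s, valid s & S s x.
Proof.
move=> D1x nL; have [Gx|nG] := pselect (G x).
  have [t [k [hk Bk]]] := G_Z Gx; set y := root x in Bk *.
  have [_ [Tx _]] := Gx; have [j0 j0J ej0] := Tm_root Tx.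
  have ex : exists j, `[< f j y = x >] by exists j0; apply/asboolP.
  have [j /asboolP ej jmin] := ex_minnP ex.
  have jJ : (j < J.+1)%N by rewrite ltnS; apply: leq_trans (jmin j0 _) j0J; apply/asboolP.
  have ty : tauf y = t by case: (BB_Zt Bk).
  have p : posn y j.
    split; rewrite ?ej//; first by case: (D1x) => -[].
    by move=> i ij /asboolP/jmin; rewrite leqNgt ij.
  exists (inl (existT _ t (Ordinal hk)), Ordinal jJ) => /=.
    by rewrite /valid /= -ty ffunE /=; case: asboolP.
  by exists y.
have [i hi Bi] : (\bigcup_(i in [set i | (i < n0)%N]) B0 i) x.
  by apply: contrapT => n; apply: nL.
exists (inr (Ordinal hi), ord0); first by rewrite /valid.
by exists x => //; rewrite /= enum_fun0.
Qed.

Let prD1 : pr D1 = (#|Q|%:R)^-1.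
Proof.
rewrite -pr_transversal -(prD0 mD (measurableC (sk_meas sk1)) (sk_conull sk1)).
by congr (prm mu _); apply/seteqP; split=> x; [move=> [? ?]; split=> //; apply|
  move=> [? h]; split=> //; exact: contrapT].
Qed.

Let S_D1 s x : valid s -> S s x -> D1 x.
Proof.
move=> v [y Ny <-]; have [[_ [_ [h _]]]|[[h _] [_ ->]]] := S_in v Ny; exact: h.
Qed.

Let S_nL0 s x : valid s -> S s x -> ~ L0 x.
Proof.
move=> v [y Ny <-]; have [[_ [_ h]]|[_ [ej ->]]] := S_in v Ny; first by move=> [[_]].
move=> [Wy]; apply; move: v Ny; case: s ej => [[[t k]|k] j] /= ->.
  by move=> _ h; case: Wy => _ []; apply: Z_G; exists t, k; split.
by move=> _ h; exists k => /=.
Qed.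

Let S' s := if valid s then S s else set0.

Let mS' s : measurable (S' s).
Proof. by rewrite /S'; case: ifP => // _; exact: mS. Qed.

Let S'_uniq s s' x : S' s x -> S' s' x -> s = s'.
Proof.
rewrite /S'; case: ifP => // v [y Ny ey]; case: ifP => // v' [y' Ny' ey'].
by have [] := S_uniq v v' Ny Ny' (etrans ey (esym ey')).
Qed.

Let D1_split : pr D1 = eta *+ #|valid| + pr L0.
Proof.
have mU' : measurable (\big[setU/set0]_(s <- enum {: node * 'I_J.+1}) S' s).
  exact: bigsetU_measurable.
have eU x : (\big[setU/set0]_(s <- enum {: node * 'I_J.+1}) S' s) x <->
    exists2 s, valid s & S s x.
  rewrite -(bigcup_seq (enum _)); split.
    by move=> [s _]; rewrite /S'; case: ifP => // v h; exists s.
  by move=> [s v h]; exists s; [rewrite /= mem_enum|rewrite /S' v].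
rewrite (_ : D1 = \big[setU/set0]_(s <- enum {: node * 'I_J.+1}) S' s `|` L0).
  rewrite prU//; last first.
    by apply/seteqP; split=> // x [/eU[s v h]]; exact: S_nL0 h.
  congr (_ + _); rewrite pr_bigU ?enum_uniq// big_enum /=.
  rewrite (eq_bigr (fun s => if valid s then eta else 0)); last first.
    by move=> s _; rewrite /S'; case: ifP => [v|_]; [exact: prS|exact: pr_set0].
  by rewrite -big_mkcond /= sumr_const.
apply/seteqP; split=> x.
  move=> D1x; have [h|h] := pselect (L0 x); first by right.
  by left; apply/eU; exact: cover.
by move=> [/eU[s v h]|[[]//]]; exact: S_D1 h.
Qed.

(** The transversal has measure [1 / #|Q|], an integral multiple of [eta] by Lagrange. The sheets
    use up a multiple of [eta] and leave less than [eta], so the remainder [L0] is null and the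
    number of sheets is the index of [Q] in [Q']. *)
Let card_valid : (#|valid| * #|Q| = #|Q'|)%N /\ pr L0 = 0.
Proof.
have L0eta : pr L0 < eta by have [_ _ _ _ h] := B0P.
have /dvdnP[m em] := hom_card_dvd iotaI.
have cQ'0 : 0 < (#|Q'|%:R : K) by rewrite ltr0n; apply/card_gt0P; exists 1%g.
have : eta *+ m = eta *+ #|valid| + pr L0.
  rewrite -D1_split prD1 -[LHS]mulr_natr /eta em natrM invfM mulrAC mulVf ?mul1r//.
  by apply: lt0r_neq0; rewrite ltr0n lt0n; apply/eqP => m0;
    move: cQ'0; rewrite em m0 mul0n ltxx.
move=> e; have L00 := pr_ge0 mu L0.
have vm : (#|valid| <= m)%N by rewrite -(ler_pMn2l eta0) e lerDl.
have mv : (m < #|valid|.+1)%N by rewrite -(ltr_pMn2l eta0) e mulrSr ltrD2l.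
have evm : m = #|valid| by apply/eqP; rewrite eqn_leq vm -ltnS mv.
split; first by rewrite -evm em.
by move: e; rewrite evm => /eqP; rewrite addrC -subr_eq subrr => /eqP.
Qed.

Let UN := \big[setU/set0]_(i <- enum {: node}) N i.
Let UNP x : UN x <-> exists i, N i x.
Proof.
rewrite /UN -(bigcup_seq (enum _)); split; first by move=> [i _ h]; exists i.
by move=> [i h]; exists i => //=; rewrite mem_enum.
Qed.
Let mUN : measurable UN. Proof. exact: bigsetU_measurable. Qed.

Let prUN : pr UN = eta *+ #|{: node}|.
Proof.
rewrite /UN pr_bigU ?enum_uniq//.
by rewrite (eq_bigr (fun _ => eta)) // big_enum /= sumr_const.
Qed.

(** Up to the null set [L0], a point of the transversal is either a non-root of a retained cell or
    lies in a node. *)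
Let prD1N : pr D1 = pr (G `\` Y) + pr UN.
Proof.
have mGY : measurable (G `\` Y) by exact: measurableD.
have mGU : measurable (G `\` Y `|` UN) by exact: measurableU.
rewrite -prU//; last first.
  apply/seteqP; split=> // x [[Gx nY] /UNP[i Ni]].
  by case: (N_cases Ni) => [[/ZY]|[[]]].
rewrite -(prD0 mGU mL0 card_valid.2) -(prD0 mD1 mL0 card_valid.2).
congr (prm mu _); apply/seteqP; split=> x [h nL]; split=> //.
  have [s v [y Ny e]] := cover h nL.
  have [[Zy [p Gf]]|[Wy [ej ey]]] := S_in v Ny.
    have [Yx|nY] := pselect (Y x); last by left; split=> //; rewrite -e.
    have xy : root x = y by rewrite -e; case: p.
    by right; apply/UNP; exists s.1; rewrite -(rootY Yx) xy.
  by right; apply/UNP; exists s.1; rewrite -e ey.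
case: h => [[[]//]|/UNP[i Ni]]; exact: N_D1 Ni.
Qed.

(** One [eps] bounds the points beyond the truncation. The other bounds the cells whose roots were
    left over by chopping: less than [eta] of roots for each type, each with at most [J + 1]
    positions. *)
Let prW0 : pr W0 <= eps + eps.
Proof.
pose Lf := (Y `&` X1) `\` Z.
have mLf : measurable Lf.
  by apply: measurableD => //; apply: measurableI => //; exact: sk_meas sk1.
have prLf : pr Lf <= eta *+ #|{: tau}|.
  pose F t := Zt t `\` \bigcup_(i in [set i | (i < nn t)%N]) BB t i.
  have mF t : measurable (F t).
    by apply: measurableD => //; apply: bigcup_measurable => i _.
  have Fe t : pr (F t) <= eta by have [_ _ _ _ h] := BBP t; exact: ltW.
  have := pr_bigsetU_le (enum {: tau}) mF Fe; rewrite -cardE; apply: le_trans.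
  apply: pr_le => //; first exact: bigsetU_measurable.
  move=> y [Yy nZ]; rewrite -(bigcup_seq (enum _)); exists (tauf y) => /=.
    by rewrite mem_enum.
  by split=> // -[i hi Bi]; apply: nZ; exists (tauf y), i.
pose Lj (j : 'I_J.+1) := [set x | D1 x /\ (f j (root x) = x /\ Lf (root x))].
have mLj j : measurable (Lj j).
  apply: mand => //; apply: mand; last exact: (mset mLf).
  by apply: (meq r); [exact: men|mfun].
have prLj j : pr (Lj j) <= eta *+ #|{: tau}|.
  apply: le_trans prLf.
  have inj : {in Lj j &, injective root}.
    by move=> x y /set_mem[_ [ex _]] /set_mem[_ [ey _]] e; rewrite -ex e ey.
  have [mI h] := inj_image (mLj j) mroot inj (fun x _ => rootR x).
  rewrite -[X in X <= _]/(fine _) -h; apply: pr_le => // x [y [_ [_ h']] <-]; exact: h'.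
have mB : measurable (D1 `\` Tm J) by exact: measurableD.
have mU' : measurable (\big[setU/set0]_(j <- enum {: 'I_J.+1}) Lj j).
  exact: bigsetU_measurable.
apply: (le_trans (pr_le (B := (D1 `\` Tm J) `|`
    \big[setU/set0]_(j <- enum {: 'I_J.+1}) Lj j) mu mW0 _ _)).
- exact: measurableU.
- move=> x [D1x nG]; have [Tx|nT] := pselect (Tm J x); last by left.
  right; rewrite -(bigcup_seq (enum _)); have [j jJ ej] := Tm_root Tx.
  have jJ' : (j < J.+1)%N by rewrite ltnS.
  exists (Ordinal jJ'); first by rewrite /= mem_enum.
  split=> //; split=> //; have [[Xx bx] X1x] := D1x; split.
    by split; [exact: root_in|apply: (sk_inv sk1) X1x; exact: rootR].
  by move=> Zx; apply: nG; split.
apply: (le_trans (prU_le mu mB mU')); apply: lerD => //.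
apply: (le_trans (pr_bigsetU_le _ mLj prLj)).
by rewrite -cardE card_ord -mulrnA.
Qed.

(** Contracting the cells to their roots leaves, up to a null set, the union of the nodes as
    transversal; all nodes are then slid onto one of them, [N i0], of measure [1 / #|Q'|]. The new
    label of [x] combines its old label with the coset attached to the sheet that contains [b x]. *)
Lemma stage_nodes : exists X' b' E' (l' : T -> Q') C,
  coarsening r iota X b E l X' b' E' l' U C (pr Y + (eps + eps)) ((eps + eps) *+ #|Q|).
Proof.
have [c [c_ex c_inj]] := coset_labels iotaI card_valid.1.
(* The target node is arbitrary; one exists because the number of sheets is positive. *)
have [i0 _] : exists i : node, true.
  apply: contrapT => ne; have : pr UN = 0.
    rewrite (_ : UN = set0) ?pr_set0//; apply/seteqP; split=> // x /UNP[i _].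
    by apply: ne; exists i.
  rewrite prUN => /eqP; rewrite mulrn_eq0 (gt_eqF eta0) orbF => /eqP c0.
  have /card_gt0P[s _] : (0 < #|valid|)%N.
    rewrite lt0n; apply/eqP => v0; have := card_valid.1; rewrite v0 mul0n => e.
    have : (0 < #|Q'|)%N by apply/card_gt0P; exists 1%g.
    by rewrite -e ltnn.
  by apply: ne; exists s.1.
have G_fix x : G x -> b x = x by case=> [[[]]].
have G_edge x : G x -> ~ Y x ->
  [/\ b (px x) = x, E (px x) (py x), G (b (py x)), root (b (py x)) = root x &
      (lev (b (py x)) < lev x)%N].
  move=> Gx nY; have [[[Xx bx] X1x] [Tx Zx]] := Gx.
  have [e1 e2 e3 e4] := edge X1x bx nY.
  have xb : R x (b (py x)).
    apply: rel_trans (sk_retr_rel skel (py x)); apply: rel_trans (sk_edge_rel skel e2).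
    by rewrite -{1}e1; apply: rel_sym; exact: (sk_retr_rel skel).
  split=> //; split; first split.
  - by split; [exact: (sk_inv skel) xb Xx|exact: (sk_retr_idem skel)].
  - exact: (sk_inv sk1) xb X1x.
  - by split; [exact: Tm_next|rewrite /= e4].
have [b1 [E1 [P1 [sk2 E1E [[b1b b1N b1G] [loss1 mass1 P1b P1E]]]]]] :=
  absorb sk1 mY mG mpx mpy mroot G_fix G_edge (fun x _ Yx => rootY Yx).
have [X0 [mX0 iX0 cX0 sX0]] := conull_invariant r mL0 card_valid.2.
have sk3 := skeleton_shrink sk2 mX0 iX0 cX0.
have b1n i y : N i y -> b1 y = y.
  move=> Ny; have by_ : b y = y by case: (N_D1 Ny) => -[].
  have [[Zy _]|[[_ nG] _]] := N_cases Ny.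
    by rewrite b1G by_ ?rootY//; [exact: ZY|exact: Z_G].
  by rewrite b1N by_.
pose s := [seq i <- enum {: node} | i != i0].
have us : uniq s by rewrite filter_uniq// enum_uniq.
have sE i : (i \in s) = (i != i0) by rewrite mem_filter mem_enum andbT.
have prNi i : pr (N i) = pr (N i0) by rewrite !prN.
have dis i x : i \in s -> N i0 x -> N i x -> False.
  by rewrite sE => /eqP ne h1 h2; apply: ne; exact: N_disj h2 h1.
have [X' [b' [E' [P2 [sk4 X'X E'E [[b'b1 nB inA injB surB] [[loss2 mass2 dom2] P2E]]]]]]] :=
  slides erg sk3 (mN i0) mN prNi (b1n i0) b1n dis N_disj us.
have b'b x : b' (b x) = b' x by rewrite -b'b1 b1b b'b1.
have b'i0 y : N i0 y -> b' y = y.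
  move=> Ny; rewrite nB (b1n _ _ Ny)// => i; rewrite sE => /eqP ne Niy.
  by apply: ne; exact: N_disj Niy Ny.
have b'in i y : X' y -> N i y -> N i0 (b' y).
  move=> Xy Ny; have [e|ne] := eqVneq i i0; first by rewrite b'i0 -e.
  by apply: (inA i) => //; [rewrite sE|rewrite (b1n _ _ Ny)].
have b1S t y : valid t -> N t.1 y -> b1 (f t.2 y) = y.
  move=> v Ny; have [[Zy [[p1 p2 p3 p4] Gf]]|[Wy [ej ey]]] := S_in v Ny.
    by rewrite b1G p3.
  by rewrite ey (b1n _ _ Ny).
have bS t y : valid t -> N t.1 y -> b (f t.2 y) = f t.2 y.
  move=> v Ny; have [[Zy [[p1 p2 p3 p4] Gf]]|[Wy [ej ey]]] := S_in v Ny; first by [].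
  by rewrite ey; case: (N_D1 Ny) => -[].
have locate x : X' x -> exists t y, [/\ valid t, N t.1 y, f t.2 y = b x & b' x = b' y].
  move=> X'x; have [X1x X0x] : (X1 `&` X0) x by exact: X'X.
  have xb := sk_retr_rel skel x.
  have D1b : D1 (b x).
    split; last exact: (sk_inv sk1) xb X1x.
    split; last exact: (sk_retr_idem skel).
    by apply: X1X; exact: (sk_inv sk1) xb X1x.
  have nL : ~ L0 (b x) by apply: sX0; exact: iX0 xb X0x.
  have [t v [y Ny e]] := cover D1b nL; exists t, y; split=> //.
  by rewrite -b'b -e -b'b1 b1S.
have t0 : node * 'I_J.+1 by split; [exact: i0|exact: ord0].
pose sh x := odflt t0 [pick t | valid t & `[< S t x >]].
have shP t x : valid t -> S t x -> sh x = t.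
  move=> v Sx; rewrite /sh; case: pickP => [t' /andP[v' /asboolP Sx']|/(_ t)].
    have [y Ny e] := Sx; have [y' Ny' e'] := Sx'.
    by have [-> _] := S_uniq v' v Ny' Ny (etrans e' (esym e)).
  by rewrite v /= => /asboolP.
pose l' x := (iota (l x) * c (sh (b x)))%g.
have msh t : measurable [set x | sh (b x) = t].
  have mSb t' : measurable [set x | S t' (b x)] by apply: (mset (mS t')); apply: mb; mfun.
  rewrite (_ : [set x | _] = [set x | (valid t /\ S t (b x)) \/
     ((~ exists t', valid t' /\ S t' (b x)) /\ t0 = t)]).
    apply: mor; first by apply: mand => //; exact: mprop.
    apply: mand; last exact: mprop.
    by apply: mnot; apply: mex => t'; apply: mand => //; exact: mprop.
  apply/seteqP; split=> x /=.
    have [[t' [v' St']]|n] := pselect (exists t', valid t' /\ S t' (b x)).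
      by rewrite (shP t')// => <-; left.
    move=> H; right; split=> //; move: H; rewrite /sh; case: pickP => // t' /andP[v' /asboolP h].
    by case: n; exists t'.
  move=> [[v St]|[n <-]]; first exact: shP.
  rewrite /sh; case: pickP => // t' /andP[v' /asboolP h].
  by case: n; exists t'.
have lab' : labelling X' b' l'.
  split.
  - move=> q'; rewrite (_ : [set x | _] = [set x | exists q, exists t,
      (l x = q /\ sh (b x) = t) /\ (iota q * c t)%g = q']).
      apply: mex => q; apply: mex => t; apply: mand; last exact: mprop.
      by apply: mand; [exact: lab_meas lab q|exact: msh].
    by apply/seteqP; split=> x /=; [move=> e; exists (l x), (sh (b x))|
      move=> [q [t [[<- <-] <-]]]].
  - move=> x q' X'x; have [q [t [v ->]]] := c_ex q'.
    have [t1 [y1 [v1 Ny1 e1 e2]]] := locate x X'x.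
    have xb' := sk_retr_rel sk4 x.
    have Xy1 : X' y1.
      apply: (sk_inv sk4) X'x; apply: rel_trans xb' _; rewrite e2; apply: rel_sym.
      exact: (sk_retr_rel sk4).
    have Aa : N i0 (b' x) by rewrite e2; exact: b'in Ny1.
    have Xa : X' (b' x) by exact: (sk_inv sk4) xb' X'x.
    have [z Nz ez] : exists2 z, N t.1 z & b' z = b' x.
      have [e|ne] := eqVneq t.1 i0; first by exists (b' x); rewrite ?e ?(sk_retr_idem sk4).
      by apply: surB => //; rewrite sE.
    have Xdz : X (f t.2 z).
      have Xz : X' z.
        apply: (sk_inv sk4) Xa; apply: rel_sym; rewrite -ez; exact: (sk_retr_rel sk4).
      have [+ _] := X'X _ Xz; move=> /X1X; apply: (sk_inv skel); exact: rel_fun.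
    have [y ey ly] := lab_ex lab q Xdz; rewrite (bS t z v Nz) in ey.
    exists y; first by rewrite -b'b ey -b'b1 b1S.
    by rewrite /l' ly ey; congr (_ * c _)%g; apply: shP => //; exists z.
  - move=> x y X'x X'y e el.
    have [t1 [y1 [v1 Ny1 e1 e2]]] := locate x X'x.
    have [t3 [y3 [v3 Ny3 e3 e4]]] := locate y X'y.
    have sx : sh (b x) = t1 by apply: shP => //; exists y1.
    have sy : sh (b y) = t3 by apply: shP => //; exists y3.
    move: el; rewrite /l' sx sy => /(c_inj _ _ _ _ v1 v3)[el et]; subst t3.
    have Xy1 : X' y1.
      apply: (sk_inv sk4) X'x; apply: rel_trans (sk_retr_rel sk4 x) _; rewrite e2.
      by apply: rel_sym; exact: (sk_retr_rel sk4).
    have eyy : y1 = y3.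
      have e' : b' y1 = b' y3 by rewrite -e2 -e4.
      have [ei|ne] := eqVneq t1.1 i0.
        by rewrite -et in Ny3; rewrite ei in Ny1 Ny3; rewrite -(b'i0 _ Ny1) -(b'i0 _ Ny3).
      by rewrite -et in Ny3; apply: (injB t1.1) e' => //; rewrite sE.
    have [Xx _] := X'X _ X'x; have [Xy _] := X'X _ X'y.
    by apply: (lab_inj lab) => //; [exact: X1X|exact: X1X|rewrite -e1 -e3 eyy -et].
have s1 x y : E1 x y -> E x y by exact: E1E.
have s2 x y : E' x y -> E1 x y by exact: E'E.
have [disj loss] := oriented_loss_trans s1 s2 (sk_edge_sym sk2) loss1 loss2.
have [mP1 _ _] := loss1; have [mP2 _ _] := loss2.
exists X', b', E', l', [set x | exists y, P2 x y]; split=> //.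
- by move=> x /X'X[/X1X].
- by move=> x y /s2/s1.
- move=> x y X'x X'y e; rewrite /l' e invMg mulgA -[(_ * c _ * _)%g]mulgA mulgV mulg1.
  by rewrite gmulfM homV.
- exists (runion P1 P2); split=> //; last first.
    move=> x y [/P1b e|h]; last by right; exists y.
    by left; rewrite -b'b1 e b'b1.
  (* The contraction loses one edge per non-root and the slides lose [eta] for each node but one; by
     [prD1N] this makes [1 / #|Q| - eta]. *)
  rewrite massU// mass1 mass2 -EFinD; congr EFin.
  have := prD1N; rewrite prD1 prUN => ->.
  have -> : (#|{: node}| = (size s).+1)%N.
    have pm : perm_eq (enum {: node}) (i0 :: s).
      apply: uniq_perm; first exact: enum_uniq.
        by rewrite /= us andbT sE eqxx.
      by move=> i; rewrite mem_enum in_cons sE orbN.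
    by rewrite cardE (perm_size pm).
  by rewrite prN mulrS -/eta; lra.
- by apply: (mrel_dom (r := r)) => // x y /P2E/(sk_edge_rel sk2).
(* The exceptional set consists of the tails of slid edges. Its measure is at most that of all nodes
   together, whose points are roots in [Y] or lie in [W0]. *)
- apply: (le_trans dom2); rewrite prN.
  have szs : (size s <= #|{: node}|)%N by rewrite cardE size_filter count_size.
  apply: (@le_trans _ _ (eta *+ #|{: node}|)); first by rewrite ler_pMn2l.
  rewrite -prUN; apply: (@le_trans _ _ (pr Y + pr W0)); last by rewrite lerD2l.
  apply: (le_trans _ (prU_le mu mY mW0)); apply: pr_le => //; first exact: measurableU.
  move=> x /UNP[i Ni]; case: (N_cases Ni) => [[/ZY]|[]]; [by left|by right].
(* The labels that the type of the sheet predicts to lie in [U]. Nodes outside the cells predict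
   nothing, so errors may occur over [W0]. *)
pose W : {set Q'} := finset (fun q' => [exists q, exists t, [&& valid t,
  q' == (iota q * c t)%g &
  match t.1 with inl (existT p k) => if p t.2 is Some A then q \in A else false
  | inr _ => false end]]).
exists W.
have merr : measurable [set x | X' x /\ ~ (U x <-> l' x \in W)].
  apply: mand; first exact: sk_meas sk4.
  apply: mnot; apply: mand; apply: mimp => //.
    rewrite (_ : [set u | _] = [set x | exists q', l' x = q' /\ q' \in W]).
      by apply: mex => q'; apply: mand; [exact: lab_meas lab' q'|exact: mprop].
    by apply/seteqP; split=> x /=; [exists (l' x)|move=> [q' [->]]].
  rewrite (_ : [set u | _] = [set x | exists q', l' x = q' /\ q' \in W]).
    by apply: mex => q'; apply: mand; [exact: lab_meas lab' q'|exact: mprop].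
  by apply/seteqP; split=> x /=; [exists (l' x)|move=> [q' [->]]].
split=> //.
have W0X : W0 `<=` X by move=> x [[[]]].
have W0b x : W0 x -> b x = x by move=> [[[]]].
have prWQ := pr_label skel lab mW0 W0X W0b.
apply: (@le_trans _ _ (pr W0 *+ #|Q|)); last by rewrite lerMn2r prW0 orbT.
rewrite -prWQ; apply: pr_le => //.
  by apply: mand; [exact: sk_meas skel|apply: (mset mW0); apply: mb; mfun].
move=> x [X'x nU]; have [X1x X0x] := X'X _ X'x; split; first exact: X1X.
apply: contrapT => nW; apply: nU.
have [t [y [v Ny e1 e2]]] := locate x X'x.
have sx : sh (b x) = t by apply: shP => //; exists y.
have [[Zy [p Gf]]|[Wy [ej ey]]] := S_in v Ny; last by case: nW; rewrite -e1 ey.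
have Xx := X1X X1x.
have Upatt : U x <-> patt y t.2 (l x).
  split; first by move=> Ux; exists x; rewrite e1.
  move=> [z [ez [lz Uz]]]; rewrite (lab_inj lab (x := x) (y := z))//.
    apply: (sk_inv skel) Xx; apply: bR; by rewrite ez e1.
  by rewrite ez e1.
rewrite Upatt; have [[Zy' [p' [k [ei ty]]]]|[[_ nG] _]] := N_cases Ny; last by case: nG; exact: Z_G.
have tj : p' t.2 = Some (finset (fun q => `[< patt y t.2 q >])).
  by rewrite -ty ffunE; case: asboolP.
rewrite inE; split.
  move=> h; apply/existsP; exists (l x); apply/existsP; exists t.
  by rewrite v /l' sx eqxx /= ei tj inE; apply/asboolP.
move=> /existsP[q /existsP[t' /and3P[v' /eqP e]]].
move: e; rewrite /l' sx => /(c_inj _ _ _ _ v v')[<- <-].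
by rewrite ei tj inE => /asboolP.
Qed.

End Chopped0.

Lemma stage_absorbed : exists X' b' E' (l' : T -> Q') C,
  coarsening r iota X b E l X' b' E' l' U C (pr Y + (eps + eps)) ((eps + eps) *+ #|Q|).
Proof.
have [n0 [B0 [h1 h2 h3 h4 [h5 h6]]]] := chop r atomless mW0 eta0.
by apply: (@stage_nodes n0 B0); split=> //; rewrite h6.
Qed.

End Chopped.

Lemma stage_cells : exists X' b' E' (l' : T -> Q') C,
  coarsening r iota X b E l X' b' E' l' U C (pr Y + (eps + eps)) ((eps + eps) *+ #|Q|).
Proof.
have /choice[nn /choice[BB BBP]] := fun t => chop r atomless (mZt t) eta0.
apply: (@stage_absorbed nn BB) => t; have [h1 h2 h3 h4 [h5 h6]] := BBP t.
by split=> //; rewrite h6.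
Qed.

End Cells.

(** The order of choices matters: a small set of roots [Y] determines the cells, then [J] is taken
    large enough for the truncation, and only then, the number of types being known, is [#|Q'|]
    required to be large. *)
Lemma stage : exists M : nat, forall (Q' : finGroupType) (iota : {multiplicative Q -> Q'}),
  injective iota -> (M <= #|Q'|)%N -> exists X' b' E' (l' : T -> Q') C,
  coarsening r iota X b E l X' b' E' l' U C delta delta.
Proof.
(* Dividing by [#|Q|] compensates for the number of labels over each point of [W0], so that the
   approximation error becomes [delta / 2]. *)
pose e := delta / 4 / #|Q|%:R.
have e0 : 0 < e by rewrite !divr_gt0.
have q1 : 1 <= (#|Q|%:R : K) by rewrite ler1n -(ltr0n K).
have D0 : 0 < pr D by rewrite pr_transversal invr_gt0.
pose c := Num.min (delta / 4) (pr D).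
have c0 : 0 < c by rewrite lt_min D0 andbT divr_gt0.
have cD : c <= pr D by rewrite ge_min lexx orbT.
have [Y [mY YD prY]] := divide r atomless mD (ltW c0) cD.
have Y0 : 0 < pr Y by rewrite prY.
have Yb x : Y x -> b x = x by move=> /YD[].
have [X1 [px [py [root [lev [Tm [sk1 X1X [mpx mpy mroot mTm]
  [edge rootY root_in rootR [TmS Tm_ex Tm_root Tm_next Tm_Y]]]]]]]]] :=
  voronoi erg skel mY Yb Y0.
have [J HJ] : exists J, pr ((D `&` X1) `\` Tm J) <= e.
  have mF J : measurable ((D `&` X1) `\` Tm J).
    by apply: measurableD => //; apply: measurableI => //; exact: sk_meas sk1.
  have [|J hJ] := pr_bigcap_small mu mF _ e0.
    by move=> J x [Dx nT]; split=> // /TmS.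
  exists J; apply: ltW; apply: (lt_le_trans hJ).
  rewrite (_ : \bigcap_J _ = set0) ?pr_set0 ?add0r//; apply/seteqP; split=> // x h.
  have [[[_ bx] X1x] _] := h 0%N I; have [J' hJ'] := Tm_ex x X1x bx.
  by have [_] := h J' I.
(* The number of pieces of measure below [eta] that chopping may waste, one for each type and
   position. *)
pose n := (#|{ffun 'I_J.+1 -> option {set Q}}| * J.+1)%N.
exists (Num.bound (n%:R / e)).+1 => Q' iota iotaI hM.
have small : (#|Q'|%:R)^-1 *+ n <= e.
  have hn := archi_boundP (divr_ge0 (ler0n K n) (ltW e0)).
  have hQ : n%:R / e <= #|Q'|%:R.
    by apply: (le_trans (ltW hn)); rewrite ler_nat; exact: ltnW.
  have Q'0 : 0 < (#|Q'|%:R : K) by rewrite ltr0n; apply: leq_trans hM.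
  by rewrite -[X in X <= _]mulr_natl ler_pdivrMr// mulrC -ler_pdivrMr.
have [X' [b' [E' [l' [C co]]]]] := stage_cells mY YD sk1 X1X mpx mpy mroot (mTm J)
  edge rootY root_in rootR (Tm_root J) (Tm_next J) (Tm_Y J) HJ iotaI small.
exists X', b', E', l', C; case: co => h1 h2 h3 h4 h5 h6 h7 h8 h9 [W [mW hW]].
have eq' : e * #|Q|%:R = delta / 4 by rewrite /e divfK// gt_eqF.
have e4 : e <= delta / 4.
  by rewrite -eq' ler_peMr// ltW.
split=> //.
- apply: (le_trans h9); have : c <= delta / 4 by rewrite ge_min lexx.
  by rewrite prY; lra.
- exists W; split=> //; apply: (le_trans hW).
  by rewrite -mulr_natr mulrDl eq'; lra.
Qed.

End Stage.

Definition half_pow (K : realType) (k : nat) : K := (1 / (2 ^ k.+1)%:R)%R.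

Lemma half_pow_gt0 (K : realType) k : (0 < half_pow K k)%R.
Proof. by rewrite divr_gt0// ltr0n expn_gt0. Qed.

Lemma half_pow_small (K : realType) (e : K) : (0 < e)%R ->
  exists N, forall k, (N <= k)%N -> (half_pow K k <= e)%R.
Proof.
move=> e0; exists (Num.bound e^-1) => k hk.
have h1 := archi_boundP (ltW (_ : 0 < e^-1)%R).
have {}h1 : (e^-1 < (Num.bound e^-1)%:R)%R by apply: h1; rewrite invr_gt0.
rewrite /half_pow ler_pdivrMr ?ltr0n ?expn_gt0// -ler_pdivrMl// mulr1.
apply: (le_trans (ltW h1)); rewrite ler_nat; apply: (leq_trans hk).
by apply: ltnW; apply: leq_trans (ltn_expl k.+1 _).
Qed.

(** * Small sets break few connections *)

Section BorelCantelli.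
Context {K : realType} {d : measure_display} {T : measurableType d}.
Context {mu : probability T K} (r : enumrel mu).
Local Open Scope ring_scope.
Local Notation f := (enum_fun r).
Local Notation R := (rel_of r).
Local Notation pr := (prm mu).

Lemma limsup_null (F : nat -> set T) : (forall k, measurable (F k)) ->
  (forall k, pr (F k) <= half_pow K k) ->
  measurable (lim_sup_set F) /\ pr (lim_sup_set F) = 0.
Proof.
move=> mF Fk; split.
  by apply: bigcapT_measurable => n; apply: bigcup_measurable => k _.
rewrite /prm lim_sup_set_cvg0//; apply: (@le_lt_trans _ _ (1%:E)); last by rewrite ltry.
apply: (@le_trans _ _ (\sum_(i <oo) (1 / (2 ^ i.+1)%:R)%:E)%E); last first.
  exact: (epsilon_trick0 xpredT ler01).
apply: lee_nneseries => // n _; have e : mu (F n) = (pr (F n))%:E by exact: prE.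
have h : ((pr (F n))%:E <= (half_pow K n)%:E)%E by rewrite lee_fin; exact: Fk.
by rewrite -e in h.
Qed.

Definition avoiding (C : set T) (E : T -> T -> Prop) : T -> T -> Prop :=
  fun x y => [/\ E x y, ~ C x & ~ C y].

Definition broken (b : T -> T) E (X C : set T) (k : nat) := [set x | X x /\
  exists i, (i < k)%N /\ ~ conn (runion (feq b) (avoiding C E)) x (f i x)].

Section Broken.
Variables (X : set T) (b : T -> T) (E : T -> T -> Prop) (k : nat).
Hypothesis skel : skeleton r X b E.

Let bR x y : feq b x y -> R x y.
Proof.
move=> e; apply: rel_trans (sk_retr_rel skel x) _; rewrite e; apply: rel_sym.
exact: (sk_retr_rel skel).
Qed.

Lemma mbroken C : measurable C -> measurable (broken b E X C k).
Proof.
move=> mC; apply: mand; first exact: sk_meas skel.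
apply: mexn => i; apply: mand; first exact: mprop.
apply: mnot; apply: mrelP; [|exact: measurable_id|exact: enum_fun_meas].
have mb d' (V : measurableType d') (g : V -> T) :
    measurable_fun setT g -> measurable_fun setT (fun u => b (g u)).
  by move=> mg; apply: measurableT_comp mg; exact: sk_retr_meas skel.
apply: (mrel_conn (r := r)).
  by move=> x y [/bR//|[/(sk_edge_rel skel)]].
apply: mrelU; first by apply: (meq r); apply: mb; mfun.
rewrite /mrel (_ : [set p | _] = [set p : T * T | E p.1 p.2 /\ (~ C p.1 /\ ~ C p.2)]).
  apply: mand; first exact: sk_edge_meas skel.
  by apply: mand; apply: mnot; apply: (mset mC); mfun.
by apply/seteqP; split=> p /=; [case|move=> [? []]].
Qed.

Lemma broken_mono C C' : C `<=` C' -> broken b E X C k `<=` broken b E X C' k.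
Proof.
move=> CC x [Xx [i [ik n]]]; split=> //; exists i; split=> // c; apply: n.
apply: conn_mono c => u v [h|[h1 h2 h3]]; [by left|right; split=> //].
  by move=> /CC.
by move=> /CC.
Qed.

(* Absolute continuity: each point uses finitely many edges to reach its first [k]
   companions, so a sufficiently small set meets these edges at few points. *)
Lemma broken_small (e : K) : 0 < e -> exists2 delta, 0 < delta &
  forall C, measurable C -> pr C <= delta -> pr (broken b E X C k) <= e.
Proof.
move=> e0; apply: contrapT => none.
have ex j : exists C, [/\ measurable C, pr C <= half_pow K j & e < pr (broken b E X C k)].
  apply: contrapT => n; apply: none; exists (half_pow K j); first exact: half_pow_gt0.
  move=> C mC hC; rewrite leNgt; apply/negP => h; apply: n; by exists C.
have [F HF] := choice ex.
have mF j : measurable (F j) by have [] := HF j.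
have [mL L0] := limsup_null mF (fun j => let: And3 _ h _ := HF j in h).
(* The tails [C j] decrease to the limit superior of the [F j], which is null; a point broken for
   all of them has a companion in it. *)
pose C j := \bigcup_(i >= j) F i.
have mC j : measurable (C j) by apply: bigcup_measurable => i _.
have niC i j : (i <= j)%N -> C j `<=` C i.
  by move=> ij x [m /= hm Fm]; exists m => //=; exact: leq_trans hm.
have mB j : measurable (broken b E X (C j) k) by exact: mbroken.
have niB j : broken b E X (C j.+1) k `<=` broken b E X (C j) k.
  by apply: broken_mono; apply: niC.
have Be j : e < pr (broken b E X (C j) k).
  have [_ _ h] := HF j; apply: (lt_le_trans h); apply: pr_le => //; first exact: mbroken.
  by apply: broken_mono => x Fx; exists j => //=.
have mI : measurable (\bigcap_j broken b E X (C j) k) by exact: bigcapT_measurable.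
have I0 : pr (\bigcap_j broken b E X (C j) k) = 0.
  apply: (pr_null mI (msat r mL)); last exact: sat_null.
  move=> x Bx; apply: contrapT => nsx.
  have out y : R x y -> exists j, ~ C j y.
    move=> xy; apply: contrapT => n; apply: nsx; exists y; split=> // j _.
    by apply: contrapT => nj; apply: n; exists j.
  have [Xx _] := Bx 0%N I.
  pose H j u v := runion (feq b) (avoiding (C j) E) u v.
  have Hmono i j u v : (i <= j)%N -> H i u v -> H j u v.
    move=> ij [h|[h1 h2 h3]]; [by left|right; split=> // h; [apply: h2|apply: h3]];
      exact: niC ij _ h.
  have allc y : R x y -> exists j, conn (H j) x y.
    move=> xy; apply: conn_lim; first by move=> j u v; apply: Hmono.
    have c := sk_gen skel Xx xy.
    suff main u v : conn (runion (feq b) E) u v -> R x u ->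
        conn (fun a c => exists j, H j a c) u v.
      by apply: main => //; exact: rel_refl.
    move=> /connP[n]; elim: n u => [u /= -> _|n IH u [w [uw wv]] xu]; first exact: conn_refl.
    have xw : R x w.
      apply: rel_trans xu _; case: uw => -[h|h]; first exact: bR.
      - exact: (sk_edge_rel skel).
      - by apply: rel_sym; exact: bR.
      - by apply: rel_sym; exact: (sk_edge_rel skel).
    apply: conn_trans (IH w wv xw).
    have [j1 n1] := out u xu; have [j2 n2] := out w xw.
    have m1 : ~ C (maxn j1 j2) u by move=> h; apply: n1; exact: niC (leq_maxl _ _) _ h.
    have m2 : ~ C (maxn j1 j2) w by move=> h; apply: n2; exact: niC (leq_maxr _ _) _ h.
    case: uw => -[h|h].
    - by apply: conn_step; exists 0%N; left.
    - by apply: conn_step; exists (maxn j1 j2); right.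
    - by apply: conn_sym; apply: conn_step; exists 0%N; left.
    - by apply: conn_sym; apply: conn_step; exists (maxn j1 j2); right.
  have [J hJ] : exists J, forall i, (i < k)%N -> conn (H J) x (f i x).
    elim: (k) => [|m [J hJ]]; first by exists 0%N.
    have [J' hJ'] := allc (f m x) (rel_fun r m x); exists (maxn J J') => i.
    rewrite ltnS leq_eqVlt => /orP[/eqP ->|/hJ h].
      by apply: conn_mono hJ' => u v; apply: Hmono; exact: leq_maxr.
    by apply: conn_mono h => u v; apply: Hmono; exact: leq_maxl.
  by have [_ [i [/hJ h]]] := Bx J I; apply.
have [n] := pr_bigcap_small mu mB niB e0; rewrite I0 add0r => h.
by have := lt_trans h (Be n); rewrite ltxx.
Qed.

End Broken.
End BorelCantelli.

(** * The limit of the stages *)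

Section Upto.
Variables (Q : nat -> finGroupType) (iota : forall n, {multiplicative Q n -> Q n.+1}).

(* The inclusion of [Q n] into [Q m] for [n <= m]; junk otherwise. *)
Fixpoint upto n m : Q n -> Q m :=
  match n =P m with
  | ReflectT e => fun q => eq_rect n Q q m e
  | ReflectF _ => if m is m'.+1 then fun q => @iota m' (@upto n m' q) else fun _ => 1%g
  end.

Arguments upto : clear implicits.

Lemma upto_id n q : upto n n q = q.
Proof. by case: n q => [|n] q /=; case: eqP => // e; rewrite (eq_axiomK e). Qed.

Lemma uptoS n m q : (n <= m)%N -> upto n m.+1 q = @iota m (upto n m q).
Proof. by move=> nm /=; case: eqP => // e; move: nm; rewrite {1}e ltnn. Qed.

Lemma upto_trans n m p q : (n <= m)%N -> (m <= p)%N ->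
  upto m p (upto n m q) = upto n p q.
Proof.
move=> nm; elim: p => [|p IH].
  by rewrite leqn0 => /eqP ->; rewrite upto_id.
rewrite leq_eqVlt => /orP[/eqP ->|mp]; first by rewrite upto_id.
rewrite ltnS in mp; by rewrite !uptoS ?IH//; exact: leq_trans mp.
Qed.

Lemma uptoM n m : (n <= m)%N -> {morph upto n m : x y / (x * y)%g}.
Proof.
elim: m => [|m IH] nm x y.
  by move: nm; rewrite leqn0 => /eqP e; move: x y; rewrite e => x y; rewrite !upto_id.
move: nm; rewrite leq_eqVlt => /orP[/eqP e|nm]; first by move: x y; rewrite e => x y; rewrite !upto_id.
by rewrite !uptoS// IH// gmulfM.
Qed.

Hypothesis iota_inj : forall n, injective (@iota n).

Lemma upto_inj n m : (n <= m)%N -> injective (upto n m).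
Proof.
elim: m => [|m IH] nm x y.
  by move: nm; rewrite leqn0 => /eqP e; move: x y; rewrite e => x y; rewrite !upto_id.
move: nm; rewrite leq_eqVlt => /orP[/eqP e|nm]; first by move: x y; rewrite e => x y; rewrite !upto_id.
by rewrite !uptoS// => /iota_inj; exact: IH.
Qed.

(** The same inclusion indexed by the difference, which makes it a composite of bundled
    homomorphisms, as [stage] demands. *)
Fixpoint up n j : {multiplicative Q n -> Q (j + n)} :=
  if j is j'.+1 then @iota (j' + n) \o up n j' else idfun.

Lemma upE n j q : up n j q = upto n (j + n) q.
Proof.
elim: j => [|j IH]; first by rewrite -[(0 + n)%N]/n upto_id.
by rewrite -[(j.+1 + n)%N]/(j + n).+1 uptoS ?leq_addl// -IH.
Qed.

Lemma up_inj n j : injective (up n j).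
Proof. by move=> x y; rewrite !upE; apply: upto_inj; exact: leq_addl. Qed.

End Upto.
Arguments upto {Q} iota n m q.
Arguments up {Q} iota n j.

(* The hyperfinite subrelation [F] is the orbit relation of a free action on [X]
   of the union of the [Q n]; the ambient relation is generated by [F] and a
   graph [E] that is a forest modulo [F]. *)
Record tower_skeleton (K : realType) d (T : measurableType d) (mu : probability T K)
    (r : enumrel mu) (Q : nat -> finGroupType)
    (iota : forall n, {multiplicative Q n -> Q n.+1})
    (X : set T) (F E : T -> T -> Prop) (act : forall n, Q n -> T -> T) : Prop :=
  TowerSkeleton {
  ts_meas : measurable X;
  ts_inv : invariant_set r X;
  ts_conull : prm mu (~` X) = 0%R;
  ts_equiv : equivalence T F;
  ts_rel : forall x y, F x y -> rel_of r x y;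
  ts_F_meas : mrel F;
  ts_erg : forall A, measurable A -> (forall x y, F x y -> A x -> A y) ->
    prm mu A = 0%R \/ prm mu A = 1%R;
  ts_edge_meas : mrel E;
  ts_edge_sym : rsym E;
  ts_edge_rel : forall x y, E x y -> rel_of r x y;
  ts_gen : forall x y, X x -> rel_of r x y -> conn (runion F E) x y;
  ts_bridges : bridges F E;
  ts_act_meas : forall n q, measurable_fun setT (act n q);
  ts_act_rel : forall n q x, F x (act n q x);
  ts_act1 : forall n x, X x -> act n 1%g x = x;
  ts_actM : forall n q q' x, X x -> act n (q * q')%g x = act n q (act n q' x);
  ts_act_iota : forall n q x, X x -> act n.+1 (@iota n q) x = act n q x;
  ts_act_free : forall n q x, X x -> act n q x = x -> q = 1%g;
  ts_act_trans : forall x y, X x -> F x y -> exists n q, act n q x = y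
}.

Section Limit.
Context {K : realType} {d : measure_display} {T : measurableType d}.
Context {mu : probability T K} (r : enumrel mu).
Local Open Scope ring_scope.
Local Notation f := (enum_fun r).
Local Notation R := (rel_of r).
Local Notation pr := (prm mu).
Hypothesis atomless : forall x : T, pr [set x] = 0.
Hypothesis erg : ergodic_rel r.
Variables (Q : nat -> finGroupType) (iota : forall n, {multiplicative Q n -> Q n.+1}).
Hypothesis Q0 : #|Q 0%N| = 1%N.
Hypothesis iota_inj : forall n, injective (@iota n).
Hypothesis Q_infty : forall M : nat, exists n0, forall n, (n0 <= n)%N -> (M <= #|Q n|)%N.
Variable Us : nat -> set T.
Hypothesis mUs : forall n, measurable (Us n).
Hypothesis UsT : Us 0%N = setT.
Hypothesis UsI : forall n m, exists p, Us n `&` Us m = Us p.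
Hypothesis Us_gen : @measurable _ T = <<s range Us >>.

Record stage_state := StageState {
  st_n : nat; st_X : set T; st_b : T -> T; st_E : T -> T -> Prop; st_l : T -> Q st_n }.

Arguments st_l : clear implicits.

Definition stage_valid s :=
  skeleton r (st_X s) (st_b s) (st_E s) /\ labelling (st_X s) (st_b s) (st_l s).

Definition stage_step k s s' C :=
  (st_n s < st_n s')%N /\
  coarsening r (upto iota (st_n s) (st_n s')) (st_X s) (st_b s) (st_E s) (st_l s)
    (st_X s') (st_b s') (st_E s') (st_l s') (Us (decode_pair k).1) C
    (half_pow K k) (half_pow K k) /\
  pr (broken r (st_b s) (st_E s) (st_X s) C k) <= half_pow K k.

Lemma stage_next k s : stage_valid s -> exists s', exists C, stage_step k s s' C.
Proof.
case=> sk lab; have [d1 d10 d1P] := broken_small k sk (half_pow_gt0 K k).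
(* Small enough for the error bounds of this stage and for the moved set to break few
   connections. *)
have d0 : 0 < Num.min (half_pow K k) d1 by rewrite lt_min half_pow_gt0 d10.
have [M HM] := stage atomless erg sk lab d0 (mUs (decode_pair k).1).
have [n0 Hn0] := Q_infty M.
(* Going up [n0.+1] steps reaches a group that is large enough and ensures a strict increase of the
   index. *)
have [||X' [b' [E' [l' [C co]]]]] := HM _ (up iota (st_n s) n0.+1).
- exact: up_inj.
- by apply: Hn0; apply: leq_trans (leq_addr _ _).
have md1 : Num.min (half_pow K k) d1 <= half_pow K k by rewrite ge_min lexx.
have md2 : Num.min (half_pow K k) d1 <= d1 by rewrite ge_min lexx orbT.
exists (@StageState (n0.+1 + st_n s)%N X' b' E' l'), C; split; last split => /=.
- by rewrite /= -addn1 addnC leq_add2r.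
- case: co => h1 h2 h3 h4 h5 h6 h7 h8 h9 [W [mW hW]]; split=> //.
  + by move=> x y Xx Xy e; rewrite h6// upE.
  + exact: le_trans h9 md1.
  + by exists W; split=> //; exact: le_trans hW md1.
- by apply: d1P; [exact: co_small_meas co|exact: le_trans (co_small co) md2].
Qed.

Lemma stage_sequence s0 : stage_valid s0 -> exists s C, s 0%N = s0 /\
  forall k, stage_valid (s k) /\ stage_step k (s k) (s k.+1) (C k).
Proof.
move=> v0.
have /choice[G HG] : forall ks : nat * stage_state, exists p : stage_state * set T,
    stage_valid ks.2 -> stage_step ks.1 ks.2 p.1 p.2.
  move=> [k s] /=; have [v|nv] := pselect (stage_valid s); last by exists (s, set0).
  by have [s' [C h]] := stage_next k v; exists (s', C).
pose s := fix s k := if k is k'.+1 then (G (k', s k')).1 else s0.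
have vs k : stage_valid (s k).
  elim: k => [//|k IH]; have [_ [co _]] := HG (k, s k) IH.
  by split; [exact: co_skel co|exact: co_lab co].
exists s, (fun k => (G (k, s k)).2); split=> // k; split=> //.
exact: (HG (k, s k) (vs k)).
Qed.

(** * The limit relation and the limit forest *)

Section Sequence.
Variables (s : nat -> stage_state) (C : nat -> set T).
Hypothesis s0 : st_n (s 0%N) = 0%N.
Hypothesis sP : forall k, stage_valid (s k) /\ stage_step k (s k) (s k.+1) (C k).

Local Notation N k := (st_n (s k)).
Local Notation X k := (st_X (s k)).
Local Notation b k := (st_b (s k)).
Local Notation E k := (st_E (s k)).
Local Notation l k := (st_l (s k)).

Let sk k : skeleton r (X k) (b k) (E k). Proof. by have [[]] := sP k. Qed.
Let lab k : labelling (X k) (b k) (l k). Proof. by have [[]] := sP k. Qed.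
Let co k : coarsening r (upto iota (N k) (N k.+1)) (X k) (b k) (E k) (l k)
    (X k.+1) (b k.+1) (E k.+1) (l k.+1) (Us (decode_pair k).1) (C k)
    (half_pow K k) (half_pow K k).
Proof. by have [_ [_ []]] := sP k. Qed.

Let N_ge k : (k <= N k)%N.
Proof.
by elim: k => // k IH; apply: leq_ltn_trans IH _; have [_ []] := sP k.
Qed.

Let N_mono i k : (i <= k)%N -> (N i <= N k)%N.
Proof.
move=> /subnK <-; elim: (k - i)%N => // j IH; apply: (leq_trans IH).
by rewrite addSn; apply: ltnW; have [_ []] := sP (j + i).
Qed.

Let X_le i k : (i <= k)%N -> X k `<=` X i.
Proof.
by move=> /subnK <-; elim: (k - i)%N => // j IH x /(co_sub (co (j + i)))/IH.
Qed.

Let E_le i k x y : (i <= k)%N -> E k x y -> E i x y.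
Proof.
by move=> /subnK <-; elim: (k - i)%N => // j IH /(co_edge (co (j + i)))/IH.
Qed.

Let b_next k x y : b k x = b k y -> b k.+1 x = b k.+1 y.
Proof. by move=> e; rewrite -(co_retr (co k)) e (co_retr (co k)). Qed.

Let b_le i k x y : (i <= k)%N -> b i x = b i y -> b k x = b k y.
Proof. by move=> /subnK <- e; elim: (k - i)%N => // j IH; exact: b_next. Qed.

Let mb k d' (U : measurableType d') (g : U -> T) :
  measurable_fun setT g -> measurable_fun setT (fun u => b k (g u)).
Proof. by move=> mg; apply: measurableT_comp mg; exact: sk_retr_meas (sk k). Qed.

Let bR k x y : b k x = b k y -> R x y.
Proof.
move=> e; apply: rel_trans (sk_retr_rel (sk k) x) _; rewrite e; apply: rel_sym.
exact: (sk_retr_rel (sk k)).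
Qed.

Let F x y := exists k, b k x = b k y.
Let Eoo x y := forall k, E k x y.
Let bad := lim_sup_set (fun k => broken r (b k) (E k) (X k) (C k) k).

Let bad0 : measurable bad /\ pr bad = 0.
Proof.
apply: limsup_null => k; last by have [_ [_ []]] := sP k.
by apply: mbroken; [exact: sk|exact: co_small_meas (co k)].
Qed.

Let F_equiv : equivalence T F.
Proof.
split; first by move=> x; exists 0%N.
- move=> x y z [k e] [j e']; exists (maxn k j).
  by rewrite (b_le (leq_maxl k j) e) (b_le (leq_maxr k j) e').
- by move=> x y [k e]; exists k.
Qed.

Let Eoo_bridges : bridges F Eoo.
Proof.
move=> x y exy c.
have [k ck] : exists k, conn (runion (feq (b k)) (rminus Eoo x y)) x y.
  apply: conn_lim; first by move=> k u v [/b_next h|h]; [left|right].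
  by apply: conn_mono c => u v [[k h]|h]; [exists k; left|exists 0%N; right].
apply: (sk_bridges (sk k) (exy k)); apply: conn_mono ck => u v [h|[h n1 n2]].
  by left.
by right; split.
Qed.

(** Beyond some stage [x] is not broken any more, so every later stage has a connection from [x] to
    [y] avoiding the moved set [C k]. By [conn_cap] the edges it shares with the previous connection
    suffice, and those of them that get lost lie inside a new class. Thus all stages manage with
    edges from one finite list [P], and the members of [P] that ever disappear are gone after
    finitely many stages. *)
Let gen x y : (forall k, X k x) -> ~ bad x -> R x y -> conn (runion F Eoo) x y.
Proof.
move=> Xx nbad [i iy].
have [n0 Hn0] : exists n0, forall k, (n0 <= k)%N -> ~ broken r (b k) (E k) (X k) (C k) k x.
  apply: contrapT => none; apply: nbad => n _; apply: contrapT => nn; apply: none.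
  by exists n => k nk h; apply: nn; exists k.
pose k0 := maxn n0 i.+1.
pose A k := avoiding (C k) (E k).
have cA k : (k0 <= k)%N -> conn (runion (feq (b k)) (A k)) x y.
  move=> k0k; apply: contrapT => nc.
  apply: (Hn0 k); first by apply: leq_trans k0k; exact: leq_maxl.
  split; [exact: Xx|exists i; rewrite iy; split=> //].
  by apply: leq_trans k0k; exact: leq_maxr.
have [P PA cP] := conn_fin (cA k0 (leqnn _)).
pose PE k u v := In (u, v) P /\ E k u v.
have cPE j : conn (runion (feq (b (j + k0))) (PE (j + k0)%N)) x y.
  elim: j => [|j IH].
    by apply: conn_mono cP => u v [|uv]; [left|right; split=> //; have [] := PA _ uv].
  set k := (j + k0)%N in IH *; have [L [[_ _ lossP] _ Lb]] := co_loss (co k).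
  have sA : rsym (A k) by move=> u v [/(sk_edge_sym (sk k))].
  have := conn_cap (sk_bridges (sk k)) sA (fun u v => @proj2 _ _)
    (fun u v h => let: And3 a _ _ := h in a) IH (cA k (leq_addl _ _)).
  apply: conn_mono => u v [/b_next h|[[uvP Euv] [_ nCu nCv]]]; first by left.
  have [h|n] := pselect (E k.+1 u v); first by right.
  left; case: ((lossP u v).1 (conj Euv n)) => /Lb[] // e; exact: esym.
have [j hj] : exists j, forall u v, In (u, v) P -> E (j + k0) u v -> Eoo u v.
  elim: (P) => [|[a c] P' [j IH]]; first by exists 0%N.
  have [hE|nE] := pselect (Eoo a c).
    by exists j => u v [[<- <-]//|]; exact: IH.
  have [i' ni'] : exists i', ~ E i' a c by apply/existsNP.
  exists (maxn j i') => u v [[<- <-] h|uv h].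
    by case: ni'; apply: E_le h; apply: leq_trans (leq_maxr j i') (leq_addr _ _).
  by apply: IH => //; apply: E_le h; rewrite leq_add2r leq_maxl.
apply: conn_mono (cPE j) => u v [e|[uvP Euv]]; first by left; exists (j + k0)%N.
by right; exact: hj.
Qed.

Let mE k : mrel (E k) := sk_edge_meas (sk k).
Let mEoo : mrel Eoo. Proof. by apply: malln => k; exact: mE. Qed.

Let dec k : K := (#|Q (N k)|%:R)^-1.

Let dec_cvg : dec k @[k --> \oo] --> (0 : K).
Proof.
apply/cvgrPdist_le => e e0; pose M := (Num.bound e^-1).+1.
have [n0 Hn0] := Q_infty M; exists n0 => // k /= hk.
have hM : (M <= #|Q (N k)|)%N by apply: Hn0; exact: leq_trans (N_ge k).
have e1 : 0 <= e^-1 by rewrite invr_ge0 ltW.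
have h := archi_boundP e1.
have hQ : e^-1 <= #|Q (N k)|%:R.
  by apply: (le_trans (ltW h)); rewrite ler_nat; apply: leq_trans hM.
rewrite sub0r normrN ger0_norm ?invr_ge0 ?ler0n// /dec -[leRHS]invrK lef_pV2//.
  by rewrite posrE; apply: lt_le_trans hQ; rewrite invr_gt0.
by rewrite posrE invr_gt0.
Qed.

(** The losses telescope from [1 / #|Q 0|], which is 1, down to 0; the factor 2 counts both
    orientations of an edge. *)
Let mass_loss : mass r (E 0%N) = (mass r Eoo + 2%:E)%E.
Proof.
pose D k x y := E k x y /\ ~ E k.+1 x y.
have mD k : mrel (D k) by apply: mrelI => //; apply: mrelN.
have dD i k x y : D i x y -> D k x y -> i = k.
  have lt i' k' : (i' < k')%N -> D i' x y -> D k' x y -> False.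
    by move=> h [_ n] [e _]; apply: n; exact: E_le e.
  move=> hi hk; have [h|h|//] := ltngtP i k; [by case: (lt _ _ h hi hk)|by case: (lt _ _ h hk hi)].
have massD k : mass r (D k) = (2 * (dec k - dec k.+1))%:E.
  have [L [[mL aL lossP] mm Lb]] := co_loss (co k).
  have LR x y : L x y -> R x y.
    by move=> h; have [h' _] := (lossP x y).2 (or_introl h); exact: (sk_edge_rel (sk k)) h'.
  have -> : mass r (D k) = mass r (runion L (fun x y => L y x)).
    by apply: eq_mass => x y _; exact: lossP.
  rewrite massU//; last exact: mrel_tr.
  by rewrite (mass_tr mL LR) mm -EFinD mulrDl mul1r.
have -> : mass r (E 0%N) = mass r (runion Eoo (fun x y => exists k, D k x y)).
  apply: eq_mass => x y _; split.
    move=> h0; have [h|nh] := pselect (Eoo x y); first by left.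
    right; apply: contrapT => nD; apply: nh => k; elim: k => // k IH.
    by apply: contrapT => nE; apply: nD; exists k.
  by move=> [//|[k [h _]]]; exact: E_le h.
rewrite massU//; last 2 first.
- exact: mexn.
- by move=> x y h [k [_ n]]; exact: n.
congr (_ + _)%E; rewrite mass_bigU//.
under eq_eseriesr => k _ do rewrite massD.
apply/cvg_lim => //.
rewrite (_ : (fun n => _) = EFin \o (fun n => 2 * (1 - dec n))).
  apply/cvg_EFin; first by near=> n.
  have e2 : 2 * (1 - 0) = 2 :> K by rewrite subr0 mulr1.
  have h : (2 * (1 - dec n)) @[n --> \oo] --> (2 * (1 - 0) : K).
    by apply: cvgM; [exact: cvg_cst|apply: cvgB => //; exact: cvg_cst].
  by rewrite e2 in h.
apply/funext => n /=; rewrite sumEFin; congr EFin.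
rewrite -mulr_sumr; congr (2 * _).
elim: n => [|n IH]; first by rewrite big_nil /dec s0 Q0 invr1 subrr.
by rewrite big_nat_recr//= IH addrA subrK.
Unshelve. all: by end_near. Qed.

(** An [F]-invariant set is a union of classes of [feq (b k)], and on [X k] each class contains
    every label exactly once. *)
Let equidistributed k (A : set T) (W : {set Q (N k)}) : measurable A ->
  (forall x y, F x y -> A x -> A y) ->
  measurable [set x | (X k x /\ A x) /\ l k x \in W] /\
  pr [set x | (X k x /\ A x) /\ l k x \in W] * #|Q (N k)|%:R = pr A * #|W|%:R.
Proof.
move=> mA FA; pose A1 := [set x | (X k x /\ A x) /\ b k x = x].
have mX : measurable (X k) := sk_meas (sk k).
have mA1 : measurable A1.
  apply: mand; first exact: mand.
  by apply: (meq r); [apply: mb|]; mfun.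
have A1X : A1 `<=` X k by move=> x [[]].
have A1b x : A1 x -> b k x = x by case.
have FB x : F x (b k x) by exists k; rewrite (sk_retr_idem (sk k)).
have eA1 x : X k x /\ A1 (b k x) <-> X k x /\ A x.
  split=> [[Xx [[_ Ab] _]]|[Xx Ax]]; split=> //.
    by apply: FA Ab; case: F_equiv => _ _; apply.
  split; last exact: (sk_retr_idem (sk k)).
  by split; [exact: (sk_inv (sk k)) (sk_retr_rel (sk k) x) Xx|exact: FA (FB x) Ax].
have eW : [set x | (X k x /\ A x) /\ l k x \in W] =
    [set x | (X k x /\ A1 (b k x)) /\ l k x \in W].
  by apply/seteqP; split=> x [/eA1 h hW]; split=> //; apply/eA1.
have [mW prW] := pr_label_set W (sk k) (lab k) mA1 A1X A1b.
have prA := pr_label (sk k) (lab k) mA1 A1X A1b.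
have e : pr [set x | X k x /\ A1 (b k x)] = pr A.
  rewrite (_ : [set x | _] = A `\` ~` X k).
    by apply: prD0 => //; [exact: measurableC|exact: sk_conull (sk k)].
  apply/seteqP; split=> x; first by move=> /eA1[? ?]; split.
  by move=> [Ax /contrapT Xx]; apply/eA1.
rewrite eW; split; first exact: mW.
by rewrite prW -e prA -[pr A1 *+ #|W|]mulr_natr -[pr A1 *+ #|Q (N k)|]mulr_natr mulrAC.
Qed.

Let pr_le_small (A B Z1 Z2 : set T) : measurable A -> measurable B -> measurable Z1 ->
  measurable Z2 -> pr Z2 = 0 -> A `<=` B `|` (Z1 `|` Z2) -> pr A <= pr B + pr Z1.
Proof.
move=> mA mB m1 m2 e2 sub; have m12 : measurable (Z1 `|` Z2) by exact: measurableU.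
apply: (le_trans (pr_le mu mA (measurableU _ _ mB m12) sub)).
apply: (le_trans (prU_le mu mB m12)); rewrite lerD2l.
by apply: (le_trans (prU_le mu m1 m2)); rewrite e2 addr0.
Qed.

(** [Us n] is treated at infinitely many stages, each time being close to a set of labels, and sets
    of labels are independent of every [F]-invariant set. *)
Let pr_cond n (A : set T) : measurable A -> (forall x y, F x y -> A x -> A y) ->
  pr (A `&` Us n) = pr A * pr (Us n).
Proof.
move=> mA FA; set p := pr A.
have p1 : p <= 1 by exact: pr_le1.
have p0 : 0 <= p by exact: pr_ge0.
have close k : (decode_pair k).1 = n ->
    `|pr (A `&` Us n) - p * pr (Us n)| <= 2 * half_pow K k.
  move=> dk; have [W [mW hW]] := co_approx (co k); rewrite dk in mW hW.
  set B := [set x | _] in mW hW.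
  have [mV eV] := equidistributed W mA FA.
  have [mV1 eV1] := equidistributed W (measurableT : measurable [set: T]) (fun _ _ _ _ => I).
  set V := [set x | _] in mV eV; set V1 := [set x | _] in mV1 eV1.
  have mX : measurable (~` X k.+1) := measurableC (sk_meas (sk k.+1)).
  have X0 : pr (~` X k.+1) = 0 := sk_conull (sk k.+1).
  have mAU : measurable (A `&` Us n) by exact: measurableI.
  have cQ : 0 < (#|Q (N k.+1)|%:R : K) by rewrite ltr0n; apply/card_gt0P; exists 1%g.
  have VV : pr V = p * pr V1.
    apply: (mulIf (lt0r_neq0 cQ)).
    by rewrite eV -mulrA eV1 pr_setT mul1r.
  have decomp Z x : (Z x -> X k.+1 x -> B x) -> Z x -> (B `|` ~` X k.+1) x.
    move=> h Zx; have [Xx|nX] := pselect (X k.+1 x); [left; exact: h|by right].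
  have h1 : pr (A `&` Us n) <= pr V + pr B.
    apply: (pr_le_small mAU mV mW mX X0) => x [Ax Ux].
    have [Vx|nV] := pselect (V x); [by left|right].
    apply: (decomp (Us n)) => // _ Xx; split=> // -[/(_ Ux) lW _]; exact: nV.
  have h2 : pr V <= pr (A `&` Us n) + pr B.
    apply: (pr_le_small mV mAU mW mX X0) => x [[Xx Ax] lW].
    have [Ux|nU] := pselect (Us n x); [by left|right; left].
    by split=> // -[_ /(_ lW)].
  have h3 : pr (Us n) <= pr V1 + pr B.
    apply: (pr_le_small (mUs n) mV1 mW mX X0) => x Ux.
    have [Vx|nV] := pselect (V1 x); [by left|right].
    apply: (decomp (Us n)) => // _ Xx; split=> // -[/(_ Ux) lW _]; exact: nV.
  have h4 : pr V1 <= pr (Us n) + pr B.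
    apply: (pr_le_small mV1 (mUs n) mW mX X0) => x [[Xx _] lW].
    have [Ux|nU] := pselect (Us n x); [by left|right; left].
    by split=> // -[_ /(_ lW)].
  have b0 := pr_ge0 mu B.
  have h3' : p * pr (Us n) <= p * pr V1 + pr B.
    apply: (le_trans (ler_wpM2l p0 h3)); rewrite mulrDr lerD2l ler_piMl//.
  have h4' : p * pr V1 <= p * pr (Us n) + pr B.
    apply: (le_trans (ler_wpM2l p0 h4)); rewrite mulrDr lerD2l ler_piMl//.
  clear dk; rewrite ler_norml; apply/andP; split; lra.
apply/eqP; rewrite -subr_eq0 -normr_eq0 eq_le normr_ge0 andbT.
apply/ler_addgt0Pl => e e0; rewrite addr0.
have [j hj] := half_pow_small (e := e / 2) (divr_gt0 e0 (ltr0n K 2)).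
have [k kj dk] := decode_pair_often n 0 j.
apply: (le_trans (close k _)); first by rewrite dk.
have := hj k kj; clear kj dk hj; lra.
Qed.

(** The restriction of the measure to [A] and its multiple by [pr A] agree on a generating family
    closed under intersections. So they agree on [A] itself, and [pr A] equals its square. *)
Let F_erg (A : set T) : measurable A -> (forall x y, F x y -> A x -> A y) ->
  pr A = 0 \/ pr A = 1.
Proof.
move=> mA FA; set p := pr A.
have p0 : 0 <= p by exact: pr_ge0.
pose m1 := mrestr mu mA; pose m2 := mscale (NngNum p0) mu.
have e : m1 A = m2 A.
  apply: (measure_unique (range Us) (fun _ => setT)) => //.
  - by move=> _ _ [n _ <-] [m _ <-]; have [q ->] := UsI n m; exists q.
  - by move=> _; exists 0%N.
  - by rewrite bigcup_const.
  - move=> _ [n _ <-]; change (mu (Us n `&` A) = (p%:E * mu (Us n))%E); rewrite setIC.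
    have -> : mu (A `&` Us n) = (pr (A `&` Us n))%:E by apply: prE; exact: measurableI.
    by rewrite pr_cond// EFinM -(prE mu (mUs n)).
  - move=> _; change (mu (setT `&` A) < +oo)%E; rewrite setTI.
    have -> : mu A = p%:E by exact: prE.
    exact: ltry.
have {}e : p = p * p.
  have {}e : mu (A `&` A) = (p%:E * mu A)%E := e.
  move: e; rewrite setIid.
  have -> : mu A = p%:E by exact: prE.
  by rewrite -EFinM => -[].
have /eqP : p * (p - 1) = 0 by rewrite mulrBr mulr1 -e subrr.
by rewrite mulf_eq0 subr_eq0 => /orP[/eqP ->|/eqP ->]; [left|right].
Qed.

(** [Q n] acts on a class by left multiplication of labels. This makes sense at every stage that has
    reached index [n], and by [co_equiv] these stages agree. *)
Let move k n (q : Q n) x y :=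
  b k x = b k y /\ l k y = (upto iota n (N k) q * l k x)%g.

Let move_next k n (q : Q n) x y : (n <= N k)%N -> X k.+1 x -> X k.+1 y ->
  move k q x y -> move k.+1 q x y.
Proof.
move=> nk Xx Xy [e el]; split; first exact: b_next.
have := co_equiv (co k) Xx Xy e; rewrite el mulgK upto_trans//; last exact: N_mono.
by move=> <-; rewrite mulgKV.
Qed.

Let move_le i k n (q : Q n) x y : (i <= k)%N -> (n <= N i)%N -> X k x -> X k y ->
  move i q x y -> move k q x y.
Proof.
move=> /subnK <-; elim: (k - i)%N => // j IH ni Xx Xy h; rewrite addSn.
apply: move_next => //.
  by apply: (leq_trans ni); apply: N_mono; exact: leq_addl.
by apply: IH => //; exact: (X_le (leqnSn (j + i)%N)).
Qed.

Let move_fun k n (q : Q n) x y y' : X k x -> move k q x y -> move k q x y' -> y = y'.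
Proof.
move=> Xx [e el] [e' el']; apply: (lab_inj (lab k)); rewrite ?el ?el' -?e -?e'//.
  exact: (sk_inv (sk k)) (bR e) Xx.
exact: (sk_inv (sk k)) (bR e') Xx.
Qed.

Let move_ex k n (q : Q n) x : X k x -> exists y, move k q x y.
Proof.
move=> Xx; have [y e el] := lab_ex (lab k) (upto iota n (N k) q * l k x)%g Xx.
by exists y; split.
Qed.

Lemma limit_sequence : exists X F E act, tower_skeleton r iota X F E act /\
  mass r (st_E (s 0%N)) = (mass r E + 2%:E)%E.
Proof.
have mXn k : measurable (X k) := sk_meas (sk k).
pose NX := \bigcup_k ~` X k.
have mNX : measurable NX by apply: bigcupT_measurable => k; exact: measurableC.
have NX0 : pr NX = 0.
  by apply: pr_bigcup0 => k; [exact: measurableC|exact: sk_conull (sk k)].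
have [mbad bad0'] := bad0.
have mBN : measurable (NX `|` bad) by exact: measurableU.
have BN0 : pr (NX `|` bad) = 0.
  apply/eqP; rewrite eq_le pr_ge0 andbT; apply: (le_trans (prU_le mu _ _)) => //.
  by rewrite NX0 bad0' addr0.
have [X' [mX' iX' X'0 X'N]] := conull_invariant r mBN BN0.
have X'X k x : X' x -> X k x.
  by move=> /X'N nb; apply: contrapT => nX; apply: nb; left; exists k.
have FR x y : F x y -> R x y by case=> k /bR.
have /choice[g Hg] : forall nq : {n & Q n}, exists a : T -> T,
    [/\ measurable_fun setT a, forall x, F x (a x) &
     forall x, X' x -> move (tag nq) (tagged nq) x (a x)].
  (* Stage [n] can define the action of [Q n] because its index satisfies [n <= N n]. *)
  move=> [n q] /=; pose P x y := X n x /\ move n q x y.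
  have [a [ma aR aP aN]] : exists a : T -> T, [/\ measurable_fun setT a,
      forall u, R u (a u), forall u, (exists y, P u y) -> P u (a u) &
      forall u, ~ (exists y, P u y) -> a u = u].
    apply: mpick; [exact: measurable_id|by move=> x y [_ [/bR]]|move=> i].
    apply: mand; first exact: mXn.
    apply: mand; first by apply: (meq r); apply: mb; mfun.
    rewrite (_ : [set u | _] = [set x | exists p, l n x = p /\
       l n (f i x) = (upto iota n (N n) q * p)%g]).
      apply: mex => p; apply: mand; first exact: lab_meas (lab n) p.
      by apply: (mset (lab_meas (lab n) _)); mfun.
    by apply/seteqP; split=> x /=; [exists (l n x)|move=> [p [->]]].
  exists a; split=> //.
    move=> x; have [ex|nex] := pselect (exists y, P x y).
      by have [_ [e _]] := aP x ex; exists n.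
    by rewrite aN//; exists 0%N.
  move=> x Xx; have [|_ //] := aP x; have [y my] := @move_ex n n q x (X'X n x Xx).
  by exists y; split=> //; exact: X'X.
pose act n (q : Q n) := g (Tagged (fun n => Q n) q).
have act_move n (q : Q n) x : X' x -> move n q x (act n q x).
  by move=> Xx; have [_ _ /(_ x Xx)] := Hg (Tagged (fun n => Q n) q).
have act_F n (q : Q n) x : F x (act n q x).
  by have [_ /(_ x)] := Hg (Tagged (fun n => Q n) q).
have X'F x y : F x y -> X' x -> X' y by move=> /FR; exact: iX'.
have act_unique k n (q : Q n) x y : (n <= N k)%N -> X' x -> move k q x y -> act n q x = y.
  move=> nk Xx h; have Xy : X' y by apply: X'F Xx; exists k; case: h.
  have Xa : X' (act n q x) by exact: X'F (act_F n q x) Xx.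
  apply: (@move_fun (maxn n k) n q x); first exact: X'X.
    by apply: move_le (act_move n q x Xx); [exact: leq_maxl|exact: N_ge|exact: X'X|exact: X'X].
  by apply: move_le h => //; [exact: leq_maxr|exact: X'X|exact: X'X].
exists X', F, Eoo, act; split; last exact: mass_loss.
split=> //.
- by apply: mexn => k; apply: (meq r); apply: mb; mfun.
- by move=> x y h k; exact: (sk_edge_sym (sk k)).
- by move=> x y /(_ 0%N)/(sk_edge_rel (sk 0%N)).
- move=> x y Xx; apply: gen => [k|]; first exact: X'X.
  by move: Xx => /X'N nb bx; apply: nb; right.
- by move=> n q; have [] := Hg (Tagged (fun n => Q n) q).
- move=> n x Xx; apply: (@act_unique n) => //; split=> //.
  have -> : upto iota n (N n) 1%g = 1%g.
    apply: (@mulgI _ (upto iota n (N n) 1%g)); rewrite -uptoM ?mulg1//.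
  by rewrite mul1g.
- move=> n q q' x Xx.
  have h := act_move n q' x Xx.
  have Xa : X' (act n q' x) by exact: X'F (act_F n q' x) Xx.
  have h' := act_move n q _ Xa.
  apply: (@act_unique n) => //; case: h => e el; case: h' => e' el'; split.
    by rewrite e.
  by rewrite el' el uptoM// mulgA.
- move=> n q x Xx; apply: (@act_unique n.+1) => //; have h := act_move n q x Xx.
  have Xa : X' (act n q x) by exact: X'F (act_F n q x) Xx.
  have [e el] := move_next (N_ge n) (X'X _ _ Xx) (X'X _ _ Xa) h.
  split=> //; rewrite el; congr (_ * _)%g.
  have -> : iota n q = upto iota n n.+1 q by rewrite uptoS// upto_id.
  by rewrite !upto_trans.
- move=> n q x Xx e; have [_] := act_move n q x Xx; rewrite e => el.
  have : upto iota n (N n) q = 1%g by apply: (@mulIg _ (l n x)); rewrite mul1g.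
  have e1 : upto iota n (N n) 1%g = 1%g.
    by apply: (@mulgI _ (upto iota n (N n) 1%g)); rewrite -uptoM ?mulg1//.
  by rewrite -e1; apply: upto_inj => //; exact: N_ge.
- move=> x y Xx [k e]; exists (N k), (l k y * (l k x)^-1)%g.
  apply: (@act_unique k) => //; split=> //.
  by rewrite upto_id mulgKV.
Qed.

End Sequence.

Lemma limit_skeleton X0 E0 : skeleton r X0 id E0 ->
  exists X F E act, tower_skeleton r iota X F E act /\
    mass r E0 = (mass r E + 2%:E)%E.
Proof.
(* Initially the classes are points with trivial labels, which is a labelling because [Q 0] is
   trivial. *)
move=> sk; pose s0 := @StageState 0 X0 id E0 (fun _ => 1%g).
have v0 : stage_valid s0.
  split=> //=; split=> //.
  - move=> q; exact: mprop.
  - move=> x q _; exists x => //.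
    have /fintype_le1P h : (#|Q 0%N| <= 1)%N by rewrite Q0.
    exact: (h q 1%g).
have [s [C [e sP]]] := stage_sequence v0.
have := @limit_sequence s C; rewrite e => /(_ erefl sP); exact.
Qed.

End Limit.

(** * Folding strands over a treeing *)

Lemma inv_letterK (S : Type) : involutive (@inv_letter S).
Proof. by case=> s b; rewrite /inv_letter /= negbK. Qed.

Lemma not_reduced_split (S : eqType) (w : word S) : ~~ reduced w ->
  exists w1 a w2, w = w1 ++ a :: inv_letter a :: w2.
Proof.
case: w => // a w; rewrite /reduced /=; elim: w a => // b w IH a /=.
rewrite negb_and negbK => /orP[/eqP ->|/IH[w1 [c [w2 e]]]]; first by exists [::], a, w.
by exists (a :: w1), c, w2; rewrite e.
Qed.

Definition decode (X : countType) (x0 : X) (k : nat) : X :=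
  if @unpickle (X * nat)%type k is Some (x, _) then x else x0.

Lemma decode_often (X : countType) (x0 x : X) N : exists2 k, (N <= k)%N & decode x0 k = x.
Proof.
have [|j hj] := @injective_unbounded (fun j => pickle (x, j)) N.
  by move=> i j /(pcan_inj pickleK)[].
by exists (pickle (x, j)) => //; rewrite /decode pickleK.
Qed.

(** Both sides are integrals of the number of sets containing a point, so a pointwise comparison of
    counts is enough. *)
Lemma count_le (K : realType) d (T : measurableType d) (mu : probability T K)
    (P P' : finType) (A : P -> set T) (B : P' -> set T) (F : set T) :
  (forall p, measurable (A p)) -> (forall p, measurable (B p)) -> measurable F ->
  (forall y, (\sum_p `[< A p y >] + `[< F y >] <= \sum_p `[< B p y >])%N) ->
  (\sum_p prm mu (A p) + prm mu F <= \sum_p prm mu (B p))%R.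
Proof.
move=> mA mB mF le.
have indE (C : set T) y : (indic C y : K) = (`[< C y >] : nat)%:R%R.
  by rewrite indicE; congr (_ %:R)%R; congr nat_of_bool; apply/idP/asboolP; rewrite inE.
have intE (I : finType) (C : I -> set T) : (forall i, measurable (C i)) ->
    ((\sum_i prm mu (C i))%R%:E = \int[mu]_y (\sum_i (indic (C i) y : K)%:E)%E)%E.
  move=> mC; rewrite ge0_integral_sum//.
  - rewrite -sumEFin; apply: eq_bigr => i _; rewrite integral_indic// setIT.
    by apply/esym; exact: prE.
  - by move=> i; apply/measurable_EFinP; exact: measurable_indic.
rewrite -lee_fin EFinD !intE//.
have -> : ((prm mu F)%:E = \int[mu]_y (indic F y : K)%:E)%E.
  by rewrite integral_indic// setIT; apply/esym; exact: prE.
have mS (I : finType) (C : I -> set T) : (forall i, measurable (C i)) ->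
    measurable_fun setT (fun y => (\sum_i (indic (C i) y : K)%:E)%E).
  move=> mC; apply: emeasurable_sum => i; apply/measurable_EFinP.
  exact: measurable_indic.
have mI : measurable_fun setT (fun y => (indic F y : K)%:E).
  by apply/measurable_EFinP; exact: measurable_indic.
rewrite -ge0_integralD//; [|by move=> y _; exact: sume_ge0|exact: mS].
apply: ge0_le_integral => //.
- by move=> y _; apply: adde_ge0 => //; exact: sume_ge0.
- by apply: emeasurable_funD => //; exact: mS.
- exact: mS.
move=> y _; rewrite !sumEFin -EFinD lee_fin indE.
under eq_bigr do rewrite indE; under [leRHS]eq_bigr do rewrite indE.
by rewrite -!natr_sum -natrD ler_nat; exact: le.
Qed.

Lemma sum_asbool (P : finType) (A : P -> Prop) :
  (\sum_p `[< A p >] = #|finset (fun p => `[< A p >])|)%N.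
Proof.
rewrite -sum1_card [RHS]big_mkcond /=; apply: eq_bigr => p _; rewrite inE.
by case: `[< _ >].
Qed.

(** * Paths spelled by words *)

Section Words.
Variables (T : Type) (dm : nat * bool -> set T) (g : nat * bool -> T -> T).

Fixpoint lpath (w : word nat) (x y : T) : Prop :=
  if w is a :: w' then dm a x /\ lpath w' (g a x) y else x = y.

Definition acyclic := forall w x, w <> [::] -> reduced w -> ~ lpath w x x.

Lemma lpath_cat w w' x y : lpath (w ++ w') x y <->
  exists2 z, lpath w x z & lpath w' z y.
Proof.
elim: w x => [|a w IH] x /=; first by split=> [h|[z ->//]]; exists x.
split=> [[ax /IH[z h1 h2]]|[z [ax h1] h2]]; first by exists z.
by split=> //; apply/IH; exists z.
Qed.

Hypothesis g_dom : forall a x, dm a x -> dm (inv_letter a) (g a x).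
Hypothesis gK : forall a x, dm a x -> g (inv_letter a) (g a x) = x.

Lemma lpath_inv w x y : lpath w x y -> lpath (inv_word w) y x.
Proof.
elim: w x => [|a w IH] x /=; first by move=> ->.
move=> [ax /IH h]; rewrite /inv_word /= rev_cons -cats1; apply/lpath_cat.
by exists (g a x) => //=; split; [exact: g_dom|exact: gK].
Qed.

Lemma lpath_reduce w x y : lpath w x y -> exists2 w', reduced w' & lpath w' x y.
Proof.
have [n] := ubnP (size w); elim: n w => // n IH w sz h.
have [rw|/not_reduced_split[w1 [a [w2 e]]]] := boolP (reduced w); first by exists w.
apply: (IH (w1 ++ w2)); first by move: sz; rewrite e !size_cat /= ltnS !addnS => /ltnW.
move: h; rewrite e => /lpath_cat[z h1 /= [az [_ h2]]]; apply/lpath_cat; exists z => //.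
by rewrite gK in h2.
Qed.

Definition step_graph x y := exists a, dm a x /\ g a x = y.

Lemma conn_lpath x y : conn step_graph x y <-> exists w, lpath w x y.
Proof.
split=> [|[w]].
  elim=> [u v [a [au <-]]|u|u v _ [w /lpath_inv h]|u v z _ [w h] _ [w' h']].
  - by exists [:: a].
  - by exists [::].
  - by exists (inv_word w).
  - by exists (w ++ w'); apply/lpath_cat; exists v.
elim: w x => [x /= ->|a w IH x [ax /IH]]; first exact: conn_refl.
by apply: conn_trans; apply: conn_step; exists a.
Qed.

Lemma step_graph_sym : rsym step_graph.
Proof.
move=> x y [a [ax <-]]; exists (inv_letter a).
by split; [exact: g_dom|exact: gK].
Qed.

End Words.

Section Folding.
Context {K : realType} {d : measure_display} {T : measurableType d}.
Context {mu : probability T K} (r : enumrel mu).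
Local Open Scope ring_scope.
Local Notation R := (rel_of r).
Local Notation pr := (prm mu).
Local Notation letter := (nat * bool)%type.
Variables (dm : letter -> set T) (g : letter -> T -> T).
Hypotheses (mdm : forall a, measurable (dm a)) (mg : forall a, measurable_fun setT (g a)).
Hypothesis gR : forall a x, R x (g a x).
Hypothesis g_dom : forall a x, dm a x -> dm (inv_letter a) (g a x).
Hypothesis gK : forall a x, dm a x -> g (inv_letter a) (g a x) = x.

Hypothesis acyc : acyclic dm g.

Local Notation lpath := (lpath dm g).

Section Pieces.
Variables (N M L : nat) (wd : nat -> word nat) (D : nat -> set T).
Hypothesis mD : forall i, measurable (D i).
Hypothesis D_path : forall i x, D i x -> exists y, lpath (wd i) x y.
Hypothesis wd0 : forall i, (0 < size (wd i))%N.
Hypothesis wdL : forall i, (i < N)%N -> (size (wd i) <= L)%N.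
Hypothesis wdM : forall i a, (i < N)%N -> a \in wd i -> (a.1 < M)%N.

Definition pos i j x := foldl (fun x a => g a x) x (take j (wd i)).
Let lt i j : letter := nth (0%N, true) (wd i) j.

Definition piece_graph u v := exists i, [/\ (i < N)%N, D i u & v = pos i (size (wd i)) u].

Hypothesis conn_letter : forall n x, (n < M)%N -> dm (n, true) x ->
  conn piece_graph x (g (n, true) x).

Let pos0 i x : pos i 0 x = x. Proof. by rewrite /pos take0. Qed.

Let posS i j x : (j < size (wd i))%N -> pos i j.+1 x = g (lt i j) (pos i j x).
Proof. by move=> h; rewrite /pos (take_nth (0%N, true) h) foldl_rcons. Qed.

Let lpath_foldl w x y : lpath w x y -> y = foldl (fun x a => g a x) x w.
Proof. by elim: w x => [|a w IH] x /=; [|move=> [_ /IH]]. Qed.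

Let pos_dm i j x : D i x -> (j < size (wd i))%N -> dm (lt i j) (pos i j x).
Proof.
move=> /D_path[y]; rewrite -{1}(cat_take_drop j (wd i)) => /lpath_cat[z /lpath_foldl ez].
by move=> + h; rewrite (drop_nth (0%N, true) h) ez => -[].
Qed.

Let pos_inj i j x y : (j <= size (wd i))%N -> D i x -> D i y -> pos i j x = pos i j y -> x = y.
Proof.
elim: j => [|j IH] h Dx Dy; first by rewrite !pos0.
rewrite !posS// => e; apply: IH => //; first exact: ltnW.
by rewrite -(gK (pos_dm Dx h)) e gK//; exact: pos_dm.
Qed.

Let mpos i j : measurable_fun setT (pos i j).
Proof.
rewrite /pos; elim/last_ind: (take j (wd i)) => [|s a IH]; first exact: measurable_id.
rewrite (_ : (fun x => _) = g a \o (fun x => foldl (fun x a => g a x) x s)).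
  exact: measurableT_comp.
by apply/funext => x /=; rewrite foldl_rcons.
Qed.

Let posR i j x : R x (pos i j x).
Proof.
rewrite /pos; elim/last_ind: (take j (wd i)) => [|s a IH]; first exact: rel_refl.
by rewrite foldl_rcons; apply: rel_trans IH _.
Qed.

Let Pos i j : set T := pos i j @` D i.

Let PosP i j : (j <= size (wd i))%N -> measurable (Pos i j) /\ pr (Pos i j) = pr (D i).
Proof.
move=> h; have inj : {in D i &, injective (pos i j)}.
  by move=> x y; rewrite !inE; exact: pos_inj.
have [m e] := inj_image (mD i) (mpos i j) inj (fun x _ => posR i j x).
by split=> //; rewrite /prm e.
Qed.

(* [Some (i, j)] is the [j]-th interior vertex of the strand of the [i]-th piece;
   the end points of all the strands are [None], the space itself. *)
Let C : finType := option ('I_N.+1 * 'I_L.+1).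
Let vtx i j : C := if (j == 0%N) || (j == size (wd i)) then None
  else Some (inord i, inord j).

Let valid (c : C) y := if c is Some (i, j) then
  [/\ (i < N)%N, (0 < j < size (wd i))%N & Pos i j y] else True.

(** The graph of strands projects to the treeing: over [y], an edge from [c] to [c'] with letter [a]
    lies above the edge from [y] to [g a y]. Both directions of travel along a strand are
    included. *)
Let seg (a : letter) (c c' : C) y := exists i j, ((i < N)%N /\ (j < size (wd i))%N) /\
  ((vtx i j = c /\ (vtx i j.+1 = c' /\ (lt i j = a /\ Pos i j y))) \/
   (vtx i j.+1 = c /\ (vtx i j = c' /\ (inv_letter (lt i j) = a /\ Pos i j.+1 y)))).

Let mPos i j : (j <= size (wd i))%N -> measurable (Pos i j).
Proof. by move=> /PosP[]. Qed.

Let mvalid c : measurable [set y | valid c y].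
Proof.
case: c => [[i j]|]; last exact: mprop.
have [h|h] := pselect ((i < N)%N /\ (0 < j < size (wd i))%N); last first.
  rewrite (_ : [set y | _] = set0) //; apply/seteqP; split=> // y [h1 h2 _]; exact: h.
rewrite (_ : [set y | _] = Pos i j).
  by apply: mPos; case: h => _ /andP[_ /ltnW].
by apply/seteqP; split=> y; [case|case: h].
Qed.

Let mseg a c c' : measurable [set y | seg a c c' y].
Proof.
apply: mexn => i; apply: mexn => j.
have [[h1 h2]|h] := pselect ((i < N)%N /\ (j < size (wd i))%N); last first.
  by rewrite (_ : [set y | _] = set0) //; apply/seteqP; split=> // y [].
apply: mand; first exact: mprop.
by apply: mor; do 3 (apply: mand; first exact: mprop); apply: mPos => //; exact: ltnW.
Qed.

Let seg_dm a c c' y : seg a c c' y -> dm a y.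
Proof.
move=> [i [j [[iN jw] [[_ [_ [<- [x Dx <-]]]]|[_ [_ [<- [x Dx <-]]]]]]]]; first exact: pos_dm.
by rewrite posS//; apply: g_dom; exact: pos_dm.
Qed.

Let seg_sym a c c' y : seg a c c' y -> seg (inv_letter a) c' c (g a y).
Proof.
move=> [i [j [h [[e1 [e2 [ea [x Dx <-]]]]|[e1 [e2 [ea [x Dx <-]]]]]]]];
  exists i, j; split=> //; have [_ jw] := h.
  by right; do 3 (split=> //); [rewrite ea|exists x => //; rewrite posS ?ea].
left; do 3 (split=> //); first by rewrite -ea inv_letterK.
by exists x => //; rewrite posS// -ea gK//; exact: pos_dm.
Qed.

Implicit Types b : T -> C -> C.

Let lab b a (p : C * C) y := exists c c', seg a c c' y /\ (b y c = p.1 /\ b (g a y) c' = p.2).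

(** The instruction (a, u, v1, v2) applies where two edges with letter [a] lead from distinct
    vertices [v1] and [v2] over [y] to the same vertex [u]; [relabel] then identifies [v2] with
    [v1]. *)
Let fold b (q : letter * C * C * C) y := q.1.2 != q.2 /\
  (lab b q.1.1.1 (q.1.2, q.1.1.2) y /\ lab b q.1.1.1 (q.2, q.1.1.2) y).

Let relabel b (q : letter * C * C * C) y c :=
  if pselect (fold b q y) then (if b y c == q.2 then q.1.2 else b y c) else b y c.

Let dec k : letter * C * C * C := decode ((0%N, true), None, None, None) k.

(* [labels k y c] names the vertex over [y] with which [c] is identified after
   [k] folds. Every instruction recurs infinitely often in [dec], so in the limit
   no fold is possible. *)
Fixpoint labels k : T -> C -> C :=
  if k is j.+1 then relabel (labels j) (dec j) else fun _ c => c.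

Arguments labels : simpl never.

Let labels_eq k : labels k.+1 = relabel (labels k) (dec k). Proof. by []. Qed.

Let mb b := forall c v, measurable [set y | b y c = v].

Let mlab b a p : mb b -> measurable [set y | lab b a p y].
Proof.
move=> m; apply: mex => c; apply: mex => c'; apply: mand; first exact: mseg.
by apply: mand; [exact: m|exact: (mset (m c' p.2) (mg a))].
Qed.

Let mfold b q : mb b -> measurable [set y | fold b q y].
Proof.
move=> m; apply: mand; first exact: mprop.
by apply: mand; exact: mlab.
Qed.

Let mlabels k : mb (labels k).
Proof.
elim: k => [|k IH] c v.
  by change (measurable [set y : T | c = v]); exact: mprop.
rewrite labels_eq.
rewrite (_ : [set y | _] = [set y |
    (fold (labels k) (dec k) y /\ ((labels k y c = (dec k).2 /\ (dec k).1.2 = v) \/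
      (labels k y c <> (dec k).2 /\ labels k y c = v))) \/
    (~ fold (labels k) (dec k) y /\ labels k y c = v)]).
  apply: mor; apply: mand.
  - exact: mfold.
  - apply: mor; apply: mand; [exact: IH|exact: mprop|apply: mnot; exact: IH|exact: IH].
  - by apply: mnot; exact: mfold.
  - exact: IH.
apply/seteqP; split=> y; rewrite /= /relabel; case: pselect => h.
- by case: eqP => e h'; left; split=> //; [left|right].
- by move=> h'; right.
- by move=> [[_ [[-> <-]|[/eqP/negPf -> ->]]]|[]//]; rewrite ?eqxx.
- by move=> [[]//|[_]].
Qed.

Let V k := \sum_(v : C) pr [set y | exists c, valid c y /\ labels k y c = v].
Let Ea k a := \sum_(p : C * C) pr [set y | lab (labels k) a p y].
Let EE k := \sum_(n < M) Ea k (n : nat, true).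
Let Fo k := [set y | fold (labels k) (dec k) y].

Let mVset k v : measurable [set y | exists c, valid c y /\ labels k y c = v].
Proof. by apply: mex => c; apply: mand; [exact: mvalid|exact: mlabels]. Qed.

Let mFo k : measurable (Fo k). Proof. exact: mfold (mlabels k). Qed.

(** Reversing the edges with letter [a] moves their base points by the measure preserving bijection
    [g a]. *)
Let Ea_inv k a : Ea k (inv_letter a) = Ea k a.
Proof.
rewrite /Ea (reindex_inj (h := fun p : C * C => (p.2, p.1))); last first.
  by move=> [? ?] [? ?] [-> ->].
apply: eq_bigr => -[u v] _ /=.
set A := [set y | lab (labels k) a (u, v) y].
have mA : measurable A by exact: mlab (mlabels k).
have inj : {in A &, injective (g a)}.
  move=> x y; rewrite !inE => -[c [c' [/seg_dm hx _]]] [c1 [c1' [/seg_dm hy _]]] e.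
  by rewrite -(gK hx) e gK.
rewrite /prm -(inj_image mA (mg a) inj (fun x _ => gR a x)).2; congr (fine (mu _)).
apply/seteqP; split=> z.
  move=> [c [c' [sg [ec ec']]]].
  have sg' := seg_sym sg; rewrite inv_letterK in sg'.
  exists (g (inv_letter a) z).
    exists c', c; split=> //; split=> //=.
    have := gK (seg_dm sg); rewrite inv_letterK => ->; exact: ec.
  by have := gK (seg_dm sg); rewrite inv_letterK.
move=> [y [c [c' [sg [ec ec']]]] <-]; exists c', c; split; first exact: seg_sym.
by split=> //=; rewrite gK//; exact: seg_dm sg.
Qed.

Let S k a y : {set C * C} := finset (fun p => `[< lab (labels k) a p y >]).
Let rho k y (v : C) : C :=
  if pselect (Fo k y) then (if v == (dec k).2 then (dec k).1.2 else v) else v.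

Let labelsS k y c : labels k.+1 y c = rho k y (labels k y c).
Proof. by []. Qed.

Let SS k a y : S k.+1 a y \subset [set (rho k y p.1, rho k (g a y) p.2) | p in S k a y]%SET.
Proof.
apply/fintype.subsetP => -[u v]; rewrite inE => /asboolP[c [c' [sg [/= ec ec']]]].
apply/imsetP; exists (labels k y c, labels k (g a y) c').
  by rewrite inE; apply/asboolP; exists c, c'.
by rewrite /= -!labelsS /= ec ec'.
Qed.

Let Ea_le k a : Ea k.+1 a <= Ea k a.
Proof.
have := @count_le K _ T mu _ _ (fun p => [set y | lab (labels k.+1) a p y])
  (fun p => [set y | lab (labels k) a p y]) set0
  (fun p => mlab a p (mlabels k.+1)) (fun p => mlab a p (mlabels k)) measurable0.
rewrite pr_set0 addr0; apply=> y.
rewrite (_ : `[< set0 y >] = false) ?addn0; last by apply/asboolP.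
rewrite !sum_asbool; apply: leq_trans (leq_imset_card _ _); exact: (subset_leq_card (SS k a y)).
Qed.

(** The edges (v1, u) and (v2, u) become equal, so an edge is lost wherever the fold applies. *)
Let Ea_fold k : Ea k.+1 (dec k).1.1.1 + pr (Fo k) <= Ea k (dec k).1.1.1.
Proof.
set a := (dec k).1.1.1; apply: (count_le mu _ _ (mFo k)) => [p|p|y].
- exact: mlab (mlabels k.+1).
- exact: mlab (mlabels k).
rewrite !sum_asbool; case: asboolP => Fy; last first.
  rewrite addn0; apply: leq_trans (leq_imset_card _ _); exact: (subset_leq_card (SS k a y)).
set v1 := (dec k).1.2; set v2 := (dec k).2; set u := (dec k).1.1.2.
have [vv [l1 l2]] : v1 != v2 /\ (lab (labels k) a (v1, u) y /\ lab (labels k) a (v2, u) y).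
  exact: Fy.
have rv1 : rho k y v1 = v1 by rewrite /rho; case: pselect => //= _; rewrite (negPf vv).
have rv2 : rho k y v2 = v1 by rewrite /rho; case: pselect => //= _; rewrite eqxx.
rewrite [leqRHS](cardsD1 (v2, u)) inE (asboolT l2) addnC leq_add2l.
apply: leq_trans (leq_imset_card (fun p => (rho k y p.1, rho k (g a y) p.2)) _).
apply: subset_leq_card; apply/fintype.subsetP => p /(fintype.subsetP (SS k a y)).
move=> /imsetP[q qS ->]; have [->|ne] := eqVneq q (v2, u).
  apply/imsetP; exists (v1, u); last by rewrite /= rv1 rv2.
  rewrite !inE (asboolT l1) andbT; apply/eqP => -[e]; by rewrite e eqxx in vv.
by apply/imsetP; exists q => //; rewrite in_setD1 ne.
Qed.

(** Only the vertex [v2] can disappear. *)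
Let V_fold k : V k <= V k.+1 + pr (Fo k).
Proof.
pose Bf (p : C + unit) := if p is inl v then
  [set y | exists c, valid c y /\ labels k.+1 y c = v] else Fo k.
have -> : V k.+1 + pr (Fo k) = \sum_p pr (Bf p).
  by rewrite big_sumType /=; congr (_ + _); rewrite big_const /= card_unit /= addr0.
have := @count_le K _ T mu _ _ (fun v => [set y | exists c, valid c y /\ labels k y c = v])
  Bf set0 (mVset k).
rewrite pr_set0 addr0; apply => [[v|[]]||y]; [exact: mVset|exact: mFo|exact: measurable0|].
rewrite (_ : `[< set0 y >] = false) ?addn0; last by apply/asboolP.
rewrite big_sumType /= big_const /= card_unit /= addn0 !sum_asbool.
set W := finset _; set W' := finset _.
have sub v : v \in W -> (Fo k y -> v != (dec k).2) -> v \in W'.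
  rewrite /W /W' !inE => -[c [vc e]] h; exists c; split=> //.
  rewrite labelsS e /rho; case: pselect => //= Fy; by rewrite (negPf (h Fy)).
case: asboolP => Fy; last first.
  by rewrite addn0; apply: subset_leq_card; apply/fintype.subsetP => v /sub; apply.
rewrite (cardsD1 (dec k).2 W) addnC leq_add ?leq_b1//.
apply: subset_leq_card; apply/fintype.subsetP => v; rewrite in_setD1 => /andP[ne vW].
exact: sub.
Qed.

Let Fo_M k : (M <= (dec k).1.1.1.1)%N -> Fo k = set0.
Proof.
move=> h; apply/seteqP; split=> // y.
move=> [_ [[c [c' [sg _]]] _]].
have [i [j [[iN jw]]]] := sg.
have al : ((lt i j).1 < M)%N by apply: (wdM iN); exact: mem_nth.
by move=> [[_ [_ [ea _]]]|[_ [_ [ea _]]]]; move: h; rewrite -ea leqNgt al.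
Qed.

(** A fold loses an edge and at most one vertex. Letters not below [M] occur in no strand, so their
    instructions have no effect. *)
Let EV_step k : EE k.+1 - V k.+1 <= EE k - V k.
Proof.
have h : EE k.+1 + pr (Fo k) <= EE k.
  have [hM|hM] := leqP M (dec k).1.1.1.1.
    by rewrite Fo_M// pr_set0 addr0; apply: ler_sum => n _; exact: Ea_le.
  have eq n j : (n, true) = (dec k).1.1.1 \/ (n, true) = inv_letter (dec k).1.1.1 ->
      Ea j (n, true) = Ea j (dec k).1.1.1.
    by move=> [->//|->]; rewrite Ea_inv.
  have e n (a : letter) : n = a.1 -> (n, true) = a \/ (n, true) = inv_letter a.
    by case: a => m [] /= ->; [left|right].
  rewrite /EE (bigD1 (Ordinal hM))//= [in leRHS](bigD1 (Ordinal hM))//=.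
  rewrite !(eq _ _ (e _ _ erefl)).
  have h1 := Ea_fold k.
  have h2 : \sum_(i < M | i != Ordinal hM) Ea k.+1 (i : nat, true) <=
     \sum_(i < M | i != Ordinal hM) Ea k (i : nat, true).
    by apply: ler_sum => n _; exact: Ea_le.
  by rewrite addrAC; exact: lerD h1 h2.
have := V_fold k; lra.
Qed.

Let EV k : EE k - V k <= EE 0%N - V 0%N.
Proof. by elim: k => // k IH; exact: le_trans (EV_step k) IH. Qed.

Let sumD := \sum_(i < N) pr (D i).

Let E0_le : EE 0%N <= \sum_(i < N) (size (wd i))%:R * pr (D i).
Proof.
pose Af (p : 'I_M * (C * C)) := [set y | lab (labels 0) (p.1 : nat, true) p.2 y].
(* Each edge of a strand is charged to the end from which its positive letter starts. *)
pose Bf (p : 'I_N * 'I_L) := if (p.2 < size (wd p.1))%N then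
   (if (lt p.1 p.2).2 then Pos p.1 p.2 else Pos p.1 p.2.+1) else set0.
have mBf p : measurable (Bf p).
  by rewrite /Bf; case: ifP => // h; case: ifP => _; apply: mPos => //; exact: ltnW.
have -> : EE 0%N = \sum_p pr (Af p) by rewrite /EE /Ea pair_bigA.
apply: (@le_trans _ _ (\sum_p pr (Bf p))); last first.
  rewrite -(pair_bigA _ (fun i j => pr (Bf (i, j)))) /=; apply: ler_sum => i _.
  apply: (@le_trans _ _ (\sum_(j < L | (j < size (wd i))%N) pr (D i))).
    rewrite big_mkcond /= [leRHS]big_mkcond; apply: ler_sum => j _; rewrite /Bf /=.
    case: ifP => [h|_]; last by rewrite pr_set0.
    by case: ifP => _; rewrite (PosP _).2// ltnW.
  rewrite sumr_const -[X in X <= _]mulr_natl ler_wpM2r ?pr_ge0// ler_nat.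
  rewrite cardE -(size_map val) -[leqRHS](size_iota 0); apply: uniq_leq_size.
    by rewrite map_inj_uniq ?enum_uniq//; exact: val_inj.
  by move=> _ /mapP[j + ->]; rewrite mem_enum unfold_in /= mem_iota add0n.
have := @count_le K _ T mu _ _ Af Bf set0 (fun p => mlab _ _ (mlabels 0)) mBf measurable0.
rewrite pr_set0 addr0; apply=> y.
rewrite (_ : `[< set0 y >] = false) ?addn0; last by apply/asboolP.
rewrite !sum_asbool.
have [[i0]|none] := pselect (exists i : 'I_M, True); last first.
  rewrite (_ : finset _ = finset.set0) ?cards0//; apply/setP => -[i p].
  by exfalso; apply: none; exists i.
move=> _; pose h (p : 'I_N * 'I_L) : 'I_M * (C * C) :=
  (insubd i0 (lt p.1 p.2).1, if (lt p.1 p.2).2 then (vtx p.1 p.2, vtx p.1 p.2.+1)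
     else (vtx p.1 p.2.+1, vtx p.1 p.2)).
apply: leq_trans (leq_imset_card h _); apply: subset_leq_card.
apply/fintype.subsetP => -[n [u v]]; rewrite inE => /asboolP[c [c' [sg [ec ec']]]].
have {}ec : c = u := ec; have {}ec' : c' = v := ec'; subst c c'.
have [i [j [[iN jw] H]]] := sg.
have jL : (j < L)%N := leq_trans jw (wdL iN).
have ltM : ((lt i j).1 < M)%N by apply: (wdM iN); exact: mem_nth.
apply/imsetP; exists (Ordinal iN, Ordinal jL).
  rewrite inE; apply/asboolP; rewrite /Bf /= jw.
  by case: H => [[_ [_ [-> Py]]]|[_ [_ [ea Py]]]] //=; move: ea; case: (lt i j) => m [] [].
rewrite /h /=; case: H => [[<- [<- [ea Py]]]|[<- [<- [ea Py]]]].
  by rewrite ea /=; congr pair; apply: val_inj; rewrite val_insubd /= ltn_ord.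
have [e1 e2] : (lt i j).1 = n /\ (lt i j).2 = false.
  by move: ea; case: (lt i j) => m [] [].
by rewrite e1 e2; congr pair; apply: val_inj; rewrite val_insubd /= ltn_ord.
Qed.

(** The 1 is the vertex [None] over every point; a strand of length [s] adds [s - 1] interior
    vertices. *)
Let V0_ge : 1 + \sum_(i < N) ((size (wd i))%:R - 1) * pr (D i) <= V 0%N.
Proof.
pose Af (p : 'I_N * 'I_L) := if (0 < p.2 < size (wd p.1))%N then Pos p.1 p.2 else set0.
have mAf p : measurable (Af p).
  by rewrite /Af; case: ifP => // /andP[_ h]; apply: mPos; exact: ltnW.
apply: (@le_trans _ _ (\sum_p pr (Af p) + pr setT)).
  rewrite pr_setT addrC lerD2r -(pair_bigA _ (fun i j => pr (Af (i, j)))) /=.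
  apply: ler_sum => i _.
  apply: (@le_trans _ _ (\sum_(j < L | (0 < j < size (wd i))%N) pr (D i))); last first.
    rewrite big_mkcond /=; apply: ler_sum => j _; rewrite /Af /=.
    case: ifP => [/andP[_ h]|_]; last exact: pr_ge0.
    by rewrite (PosP _).2// ltnW.
  rewrite sumr_const -[X in _ <= X]mulr_natl ler_wpM2r ?pr_ge0//.
  rewrite -[1]/(1%:R) -natrB ?wd0// ler_nat subn1.
  have iL := wdL (ltn_ord i); case: (size (wd i)) (wd0 i) iL => // s _ sL /=.
  have inj : injective (fun j : 'I_s => Ordinal (leq_trans (ltn_ord (lift ord0 j)) sL)).
    by move=> j1 j2 /(congr1 val)/= [] /val_inj.
  rewrite -[X in (X <= _)%N](card_ord s) -(card_imset _ inj).
  apply: subset_leq_card; apply/fintype.subsetP => _ /imsetP[j _ ->].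
  by rewrite unfold_in /= ltnS; have := ltn_ord j.
apply: (@count_le K _ T mu _ _ Af (fun v => [set y | exists c, valid c y /\ labels 0 y c = v])
  setT mAf (mVset 0) measurableT).
move=> y; rewrite (asboolT (I : [set: T] y)) !sum_asbool addnC.
set W : {set C} := finset (fun v => `[< exists c, valid c y /\ labels 0 y c = v >]).
have NW : None \in W by rewrite inE; apply/asboolP; exists None.
rewrite (cardsD1 None W) NW leq_add2l.
have inj : {in finset (fun p => `[< Af p y >]) &, injective
    (fun p : 'I_N * 'I_L => Some (inord p.1, inord p.2) : C)}.
  move=> [i j] [i' j'] _ _ /= [/(congr1 val)/= e1 /(congr1 val)/= e2].
  rewrite !inordK ?ltnS in e1; try exact: ltnW (ltn_ord _).
  rewrite !inordK ?ltnS in e2; try exact: ltnW (ltn_ord _).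
  by congr pair; apply: val_inj.
rewrite -(card_in_imset inj); apply: subset_leq_card.
apply/fintype.subsetP => _ /imsetP[[i j] + ->]; rewrite inE => /asboolP.
rewrite /Af /= in_setD1 /=; case: ifP => // hj Py.
rewrite inE; apply/asboolP; exists (Some (inord i, inord j)); split=> //=.
have e1 : (inord i : 'I_N.+1) = i :> nat by rewrite inordK// ltnS ltnW.
have e2 : (inord j : 'I_L.+1) = j :> nat by rewrite inordK// ltnS ltnW.
by rewrite e1 e2; split.
Qed.

Let EV0 : EE 0%N - V 0%N <= sumD - 1.
Proof.
have h1 := E0_le; have h2 := V0_ge.
have e : \sum_(i < N) ((size (wd i))%:R - 1) * pr (D i) =
    \sum_(i < N) (size (wd i))%:R * pr (D i) - sumD.
  by rewrite /sumD -sumrB; apply: eq_bigr => i _; rewrite mulrBl mul1r.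
by move: h2; rewrite e; lra.
Qed.

Let nval k y := #|labels k y @: [set: C]%SET|.

Let nval_step k y : (nval k.+1 y <= nval k y)%N /\ (Fo k y -> (nval k.+1 y < nval k y)%N).
Proof.
have sub : labels k.+1 y @: [set: C]%SET \subset rho k y @: (labels k y @: [set: C]%SET).
  apply/fintype.subsetP => _ /imsetP[c _ ->]; apply/imsetP; exists (labels k y c) => //.
  by apply/imsetP; exists c; rewrite ?inE.
split; first by apply: leq_trans (subset_leq_card sub) (leq_imset_card _ _).
move=> Fy; have [vv [[c1 [d1 [_ [e1 _]]]] [c2 [d2 [_ [e2 _]]]]]] := Fy.
have {}e1 : labels k y c1 = (dec k).1.2 := e1; have {}e2 : labels k y c2 = (dec k).2 := e2.
have im c : labels k y c \in labels k y @: [set: C]%SET by rewrite imset_f ?inE.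
have m2 : (dec k).2 \in labels k y @: [set: C]%SET by rewrite -e2.
rewrite /nval [ltnRHS](cardsD1 (dec k).2) m2 add1n ltnS.
apply: subset_leq_card; apply: fintype.subset_trans sub _.
apply/fintype.subsetP => _ /imsetP[_ /imsetP[c _ ->] ->].
rewrite in_setD1 /rho; case: pselect => //= _; case: (labels k y c =P (dec k).2) => e.
  by apply/andP; split; [exact: vv|rewrite -e1 im].
by rewrite im andbT; apply/eqP.
Qed.

(** The number of vertices over [y] is finite and drops with every fold at [y]. *)
Let stable y : exists k, forall j, (k <= j)%N -> ~ Fo j y.
Proof.
have ex : exists n, `[< exists k, nval k y = n >] by exists (nval 0%N y); apply/asboolP; exists 0%N.
have [n /asboolP[k <-] nmin] := ex_minnP ex.
have le j : (k <= j)%N -> (nval j y <= nval k y)%N.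
  move=> /subnK <-; elim: (j - k)%N => // i IH; rewrite addSn.
  by apply: leq_trans IH; have [] := nval_step (i + k) y.
exists k => j kj Fy; have [_ /(_ Fy)] := nval_step j y; rewrite ltnNge => /negP; apply.
by apply: leq_trans (le j kj) _; apply: nmin; apply/asboolP; exists j.+1.
Qed.

Let Bad k := [set y | exists j, (k <= j)%N /\ Fo j y].

(** The points still awaiting a fold form sets decreasing to the empty set, and [#|C|] bounds the
    number of vertices over each of them. *)
Let V_small (e : K) : 0 < e -> exists k, pr (Bad k) * #|C|%:R <= e.
Proof.
move=> e0; have mBad k : measurable (Bad k).
  by apply: mexn => j; apply: mand; [exact: mprop|exact: mFo].
have niB k : Bad k.+1 `<=` Bad k by move=> y [j [kj Fy]]; exists j; split=> //; exact: ltnW.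
have cC : 0 < (#|C|%:R : K) by rewrite ltr0n; apply/card_gt0P; exists None.
have [k] := pr_bigcap_small mu mBad niB (divr_gt0 e0 cC).
rewrite (_ : \bigcap_k _ = set0) ?pr_set0 ?add0r; last first.
  apply/seteqP; split=> // y h; have [i hk] := stable y; have [j [kj Fy]] := h i I.
  exact: hk Fy.
by rewrite ltr_pdivlMr// => h; exists k; exact: ltW.
Qed.

Let labels_stable y k j : (forall i, (k <= i)%N -> ~ Fo i y) -> (k <= j)%N ->
  labels j y = labels k y.
Proof.
move=> h /subnK <-; elim: (j - k)%N => // i IH; rewrite addSn -IH.
apply/funext => c; rewrite labelsS /rho; case: pselect => // Fy.
by case: (h (i + k)%N (leq_addl _ _)).
Qed.

Section Limit.
Variable kk : T -> nat.
Hypothesis kkP : forall y j, (kk y <= j)%N -> ~ Fo j y.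

Let B y := labels (kk y) y.

Let BE y j : (kk y <= j)%N -> labels j y = B y.
Proof. exact: labels_stable (@kkP y). Qed.

(** The instruction that would fold these two edges recurs after both [y] and its neighbour have
    become stable. *)
Let nofold a c1 d1 c2 d2 y : seg a c1 d1 y -> seg a c2 d2 y ->
  B (g a y) d1 = B (g a y) d2 -> B y c1 = B y c2.
Proof.
move=> s1 s2 e; apply: contrapT => ne.
have [k hk ek] := decode_often ((0%N, true), None, None, None) (a, B (g a y) d1, B y c1, B y c2)
  (maxn (kk y) (kk (g a y))).
have k1 : (kk y <= k)%N by apply: leq_trans hk; exact: leq_maxl.
have k2 : (kk (g a y) <= k)%N by apply: leq_trans hk; exact: leq_maxr.
apply: (kkP k1); rewrite /Fo /fold /= /dec ek /=; split; first exact/eqP.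
split; first by exists c1, d1; rewrite !BE.
by exists c2, d2; rewrite !BE.
Qed.

Fixpoint wk (w : word nat) (c : C) y (c' : C) y' : Prop :=
  if w is a :: w' then exists c1 c2, [/\ B y c = B y c1, seg a c1 c2 y & wk w' c2 (g a y) c' y']
  else y = y' /\ B y c = B y c'.

Let wk_eq w c1 c y c' y' : B y c1 = B y c -> wk w c y c' y' -> wk w c1 y c' y'.
Proof.
by case: w => [|a w] e /=; [rewrite e|move=> [c2 [c3 []]]; rewrite -e; exists c2, c3].
Qed.

Let wk_cat w1 w2 c y c' y' : wk (w1 ++ w2) c y c' y' <->
  exists c1 z, wk w1 c y c1 z /\ wk w2 c1 z c' y'.
Proof.
elim: w1 c y => [|a w1 IH] c y /=.
  by split=> [h|[c1 [z [[<- e] h]]]]; [exists c, y|exact: wk_eq h].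
split=> [[c1 [c2 [e sg /IH[c3 [z [h1 h2]]]]]]|[c3 [z [[c1 [c2 [e sg h1]]] h2]]]].
  by exists c3, z; split=> //; exists c1, c2.
by exists c1, c2; split=> //; apply/IH; exists c3, z.
Qed.

Let wk_rev w c y c' y' : wk w c y c' y' -> exists w', wk w' c' y' c y.
Proof.
elim: w c y => [|a w IH] c y /=; first by move=> [<- e]; exists [::].
move=> [c1 [c2 [e sg /IH[w' h]]]]; exists (w' ++ [:: inv_letter a]).
apply/wk_cat; exists c2, (g a y); split=> //=.
exists c2, c1; split=> //; first exact: seg_sym.
by rewrite gK; [|exact: seg_dm sg].
Qed.

Let wk_lpath w c y c' y' : wk w c y c' y' -> lpath w y y'.
Proof.
elim: w c y => [|a w IH] c y /=; first by case.
by move=> [c1 [c2 [_ sg /IH h]]]; split=> //; exact: seg_dm sg.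
Qed.

(** In the completely folded graph a walk whose letters backtrack returns to the vertex it came
    from, by [nofold], so the backtracking can be cut out. *)
Let wk_reduce w c y c' y' : wk w c y c' y' -> exists2 w', reduced w' & wk w' c y c' y'.
Proof.
have [n] := ubnP (size w); elim: n w => // n IH w sz h.
have [rw|/not_reduced_split[w1 [a [w2 e]]]] := boolP (reduced w); first by exists w.
apply: (IH (w1 ++ w2)).
  by move: sz; rewrite e !size_cat /= ltnS !addnS => /ltnW.
move: h; rewrite e => /wk_cat[c1 [z [h1 /= [c2 [d2 [e2 s2 [d3 [c3 [e3 s3 h3]]]]]]]]].
apply/wk_cat; exists c1, z; split=> //.
have dz := seg_dm s2; rewrite gK// in h3.
have s3' := seg_sym s3; rewrite inv_letterK gK// in s3'.
by apply: wk_eq h3; rewrite e2; exact: nofold s2 s3' e3.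
Qed.

Let joined c y c' y' := exists w, wk w c y c' y'.

Let joined_sym c y c' y' : joined c y c' y' -> joined c' y' c y.
Proof. by move=> [w /wk_rev]. Qed.

Let joined_trans c1 y1 c y c' y' : joined c y c1 y1 -> joined c1 y1 c' y' -> joined c y c' y'.
Proof. by move=> [w h] [w' h']; exists (w ++ w'); apply/wk_cat; exists c1, y1. Qed.

Let joined_pos i j x : (i < N)%N -> D i x -> (j <= size (wd i))%N ->
  joined None x (vtx i j) (pos i j x).
Proof.
move=> iN Dx; elim: j => [|j IH] jw; first by exists [::]; rewrite /= pos0.
apply: joined_trans (IH (ltnW jw)) _; exists [:: lt i j] => /=.
exists (vtx i j), (vtx i j.+1); split=> //; last by rewrite posS.
by exists i, j; split=> //; left; do 3 (split=> //); exists x.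
Qed.

Let joined_letter n y : (n < M)%N -> dm (n, true) y -> joined None y None (g (n, true) y).
Proof.
move=> nM dy; have := conn_letter nM dy; elim=> [u v [i [iN Du ->]]|u|u v _ h|u v z _ h1 _ h2].
- have := joined_pos iN Du (leqnn _); by rewrite /vtx eqxx orbT.
- by exists [::].
- exact: joined_sym.
- exact: joined_trans h1 h2.
Qed.

Let joined_base i j x : (i < N)%N -> D i x -> (j <= size (wd i))%N ->
  joined None x None (pos i j x).
Proof.
move=> iN Dx; elim: j => [|j IH] jw; first by exists [::]; rewrite /= pos0.
apply: joined_trans (IH (ltnW jw)) _; rewrite posS//.
have := pos_dm Dx jw; have : ((lt i j).1 < M)%N by apply: (wdM iN); exact: mem_nth.
move: (pos i j x) => z; case: (lt i j) => n [] /= nM dz; first exact: joined_letter.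
apply: joined_sym; rewrite -{2}(gK dz); apply: joined_letter => //; exact: (g_dom dz).
Qed.

(** The vertex is joined to the base vertex over the same point. A reduced walk between them
    projects to a reduced closed path of the treeing, which must be empty, so the two vertices
    coincide. *)
Let all_base c y : valid c y -> B y c = B y None.
Proof.
case: c => [[i j]|//] [iN /andP[j0 jw] [x Dx ex]].
have jo : joined (Some (i, j)) y None y.
  apply: (joined_trans (c1 := None) (y1 := x)); last first.
    by rewrite -ex; apply: joined_base => //; exact: ltnW.
  apply: joined_sym; have := joined_pos iN Dx (ltnW jw); rewrite ex /vtx.
  by rewrite (gtn_eqF j0) (ltn_eqF jw) /= !inord_val.
have [w /wk_reduce[w' rw h]] := jo.
case: w' rw h => [_ []//|a w' rw h].
have ne : a :: w' <> [::] by [].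
by case: (acyc ne rw (wk_lpath h)).
Qed.

(** A reduced walk from the base over [y] to the base over its neighbour has to start with the
    letter itself; otherwise prefixing the inverse letter would give a reduced closed path. *)
Let edge_ex n y : (n < M)%N -> dm (n, true) y -> exists c c', seg (n, true) c c' y.
Proof.
move=> nM dy; have [w /wk_reduce[w' rw h]] := joined_letter nM dy.
have gy : ~ lpath [:: (n, true)] y y by exact: acyc.
case: w' rw h => [_ [ey _]|a w' rw h]; first by case: gy.
have [ea|na] := eqVneq a (n, true).
  by move: h => /= [c1 [c2 [_ sg _]]]; exists c1, c2; rewrite -ea.
have ne : (n, false) :: a :: w' <> [::] by [].
have rw' : reduced ((n, false) :: a :: w').
  by move: rw; rewrite /reduced /= => ->; rewrite andbT.
case: (acyc (x := g (n, true) y) ne rw'); split; first exact: (g_dom dy).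
have := wk_lpath h; rewrite -{1}(gK dy); exact.
Qed.

(** In the limit a single vertex lies over each point and at least one edge over each treeing edge
    with letter below [M]. So edges minus vertices is finally at least the measure of these letters
    minus 1, while initially it was at most [sumD - 1]. *)
Lemma folded_limit : \sum_(n < M) pr (dm (n : nat, true)) <= sumD.
Proof.
have mBad k : measurable (Bad k).
  by apply: mexn => j; apply: mand; [exact: mprop|exact: mFo].
have lowE k : \sum_(n < M) pr (dm (n : nat, true)) <= EE k.
  apply: ler_sum => n _; rewrite /Ea.
  have := @count_le K _ T mu 'I_0 _ (fun _ => set0)
    (fun p => [set y | lab (labels k) (n : nat, true) p y]) (dm (n : nat, true))
    (fun _ => measurable0) (fun p => mlab _ _ (mlabels k)) (mdm _).
  rewrite big_ord0 add0r; apply=> y; rewrite big_ord0 add0n.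
  case: asboolP => // dy; have [c [c' sg]] := edge_ex (ltn_ord n) dy.
  rewrite sum_asbool; apply/card_gt0P.
  by exists (labels k y c, labels k (g (n : nat, true) y) c'); rewrite inE; apply/asboolP; exists c, c'.
have upV k : V k <= 1 + pr (Bad k) * #|C|%:R.
  (* The whole space counted once, and the unstable points [#|C|] times more. *)
  pose Bf (i : 'I_(#|C|).+1) := if i == ord0 then setT else Bad k.
  have -> : 1 + pr (Bad k) * #|C|%:R = \sum_i pr (Bf i).
    rewrite big_ord_recl /Bf eqxx pr_setT; congr (_ + _).
    rewrite (eq_bigr (fun=> pr (Bad k))) ?sumr_const ?card_ord ?mulr_natr//.
  have := @count_le K _ T mu _ _ (fun v => [set y | exists c, valid c y /\ labels k y c = v])
    Bf set0 (mVset k).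
  rewrite pr_set0 addr0; apply=> [i||y]; [by rewrite /Bf; case: eqP|exact: measurable0|].
  rewrite (_ : `[< set0 y >] = false) ?addn0; last by apply/asboolP.
  rewrite big_ord_recl {1}/Bf eqxx (asboolT (I : [set: T] y)) sum_asbool.
  rewrite (eq_bigr (fun=> `[< Bad k y >] : nat)); last by move=> i _; rewrite /Bf.
  rewrite sum_nat_const card_ord; case: asboolP => nB.
    by rewrite muln1; apply: leq_trans (max_card _) _; exact: leq_addl.
  rewrite muln0 addn0; apply: (@leq_trans #|[set B y None]%SET|); last by rewrite cards1.
  apply: subset_leq_card.
  apply/fintype.subsetP => v; rewrite inE => /asboolP[c [vc <-]]; rewrite inE.
  have nF j : (k <= j)%N -> ~ Fo j y by move=> kj Fy; apply: nB; exists j.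
  have -> : labels k y = B y.
    have [h|h] := leqP k (kk y); last by rewrite BE// ltnW.
    by rewrite /B (labels_stable nF h).
  by rewrite all_base.
apply/ler_addgt0Pr => e e0; have [k hk] := V_small e0.
have := EV k; have := EV0; have := lowE k; have := upV k; lra.
Qed.

End Limit.

Lemma folding_count : \sum_(n < M) pr (dm (n : nat, true)) <= \sum_(i < N) pr (D i).
Proof. by have [kk kkP] := choice stable; exact: folded_limit (fun y => kkP y). Qed.

End Pieces.
End Folding.

(** A detour from [a] to [b], as a reduced word, is followed by the inverse of the letter of the
    edge. The resulting closed word is still reduced, because the detour cannot end with that
    letter. *)
Lemma acyclic_bridges (T : Type) (dm : nat * bool -> set T) g :
  (forall a x, dm a x -> dm (inv_letter a) (g a x)) ->
  (forall a x, dm a x -> g (inv_letter a) (g a x) = x) ->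
  acyclic dm g -> bridges (@eq T) (step_graph dm g).
Proof.
move=> g_dom gK acyc a b [c [ca gca]] con.
(* The letters are restricted so that they never traverse the edge in either direction; reducing the
   detour then keeps it off the edge. *)
pose dm' l := [set x | dm l x /\ ~ ((x = a /\ g l x = b) \/ (x = b /\ g l x = a))].
have g_dom' l x : dm' l x -> dm' (inv_letter l) (g l x).
  move=> [lx n]; split; first exact: g_dom.
  by rewrite gK// => -[[e1 e2]|[e1 e2]]; apply: n; [right|left].
have gK' l x : dm' l x -> g (inv_letter l) (g l x) = x by move=> [/gK].
have [w] : exists w, lpath dm' g w a b.
  apply/(conn_lpath g_dom' gK'); apply: conn_sub con => u v [->|]; first exact: conn_refl.
  move=> [[l [lu <-]] n1 n2]; apply: conn_step; exists l; split=> //; split=> //.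
  by move=> [[e1 e2]|[e1 e2]]; [apply: n1|apply: n2].
move=> /(lpath_reduce gK')[{}w rw h].
have sub w' x y : lpath dm' g w' x y -> lpath dm g w' x y.
  by elim: w' x => [|l w' IH] x //= [[lx _] /IH].
case/lastP: w => [|w l] in rw h *.
  by apply: (acyc [:: c] a) => //=; rewrite gca; split=> //; exact: esym.
have hc : lpath dm g [:: inv_letter c] b a.
  by rewrite -gca /=; split; [exact: g_dom|exact: gK].
have cat w1 w2 x y z : lpath dm g w1 x y -> lpath dm g w2 y z -> lpath dm g (w1 ++ w2) x z.
  by elim: w1 x => [|l' w1 IH] x /=; [move=> ->|move=> [lx /IH h1] /h1].
have ne : rcons w l ++ [:: inv_letter c] <> [::] by case: (w).
apply: (acyc _ a ne); last exact: cat (sub _ _ _ h) hc.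
have el : l <> c.
  move=> elc; move: h; rewrite elc -cats1.
  have : forall x, lpath dm' g (w ++ [:: c]) x b -> exists z, dm' c z /\ g c z = b.
    by elim: (w) => [x /= [cx e]|l' w' IH x /= [_ /IH//]]; exists x.
  move=> /[apply] -[z [[cz n] e]]; apply: n; left; split=> //.
  by rewrite -(gK _ _ cz) e -gca gK.
rewrite cats1; move: rw; rewrite /reduced; case: w {h ne} => [|l0 w] /=.
  by move=> _; rewrite andbT; apply/eqP => /(congr1 (@inv_letter nat)); rewrite !inv_letterK => /esym.
rewrite !rcons_path last_rcons => ->; rewrite /=.
by apply/eqP => /(congr1 (@inv_letter nat)); rewrite !inv_letterK => /esym.
Qed.

(** * Graphings as systems of total maps *)

Section Graphing.
Context {K : realType} {d : measure_display} {T : measurableType d}.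
Context {mu : probability T K}.
Variable Phi : nat -> partial_iso T.

Definition iso_dom (a : nat * bool) : set T :=
  if a.2 then pi_dom (Phi a.1) else pi_im (Phi a.1).
Definition iso_fun (a : nat * bool) : T -> T :=
  if a.2 then pi_fun (Phi a.1) else pi_inv (Phi a.1).
Definition iso_tot a x := if pselect (iso_dom a x) then iso_fun a x else x.

Lemma miso_dom a : measurable (iso_dom a).
Proof.
by rewrite /iso_dom; case: ifP => _; [exact: pi_dom_measurable|exact: pi_im_measurable].
Qed.

Lemma iso_totE a x : iso_dom a x -> iso_tot a x = iso_fun a x.
Proof. by rewrite /iso_tot; case: pselect. Qed.

Lemma iso_totN a x : ~ iso_dom a x -> iso_tot a x = x.
Proof. by rewrite /iso_tot; case: pselect. Qed.

Lemma miso_tot a : measurable_fun setT (iso_tot a).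
Proof.
move=> _ A mA; rewrite setTI.
have mf : measurable_fun (iso_dom a) (iso_fun a).
  by rewrite /iso_dom /iso_fun; case: ifP => _; [exact: pi_fun_measurable|exact: pi_inv_measurable].
rewrite (_ : _ @^-1` A = (iso_dom a `&` iso_fun a @^-1` A) `|` (~` iso_dom a `&` A)).
  apply: measurableU; first by apply: mf => //; exact: miso_dom.
  by apply: measurableI => //; apply: measurableC; exact: miso_dom.
apply/seteqP; split=> x /=.
  have [h|h] := pselect (iso_dom a x); first by rewrite iso_totE//; left.
  by rewrite iso_totN//; right.
by move=> [[h]|[h]]; [rewrite iso_totE|rewrite iso_totN].
Qed.

Lemma iso_tot_dom a x : iso_dom a x -> iso_dom (inv_letter a) (iso_tot a x).
Proof.
move=> h; rewrite iso_totE//; case: a h => n [] h; rewrite /iso_dom /iso_fun /=.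
  exact: pi_fun_im.
exact: pi_inv_dom.
Qed.

Lemma iso_totK a x : iso_dom a x -> iso_tot (inv_letter a) (iso_tot a x) = x.
Proof.
move=> h; rewrite iso_totE; last exact: iso_tot_dom.
rewrite iso_totE//; case: a h => n [] h; rewrite /iso_fun /=.
  exact: pi_funK.
exact: pi_invK.
Qed.

Hypothesis iso : forall n, iso_preserving mu (Phi n).

Lemma iso_tot_image a C : measurable C -> {in C &, injective (iso_tot a)} ->
  measurable (iso_tot a @` C) /\ mu (iso_tot a @` C) = mu C.
Proof.
move=> mC inj; pose C1 := C `&` iso_dom a; pose C2 := C `\` iso_dom a.
have mC1 : measurable C1 by apply: measurableI => //; exact: miso_dom.
have mC2 : measurable C2 by apply: measurableD => //; exact: miso_dom.
have im1 : iso_tot a @` C1 = iso_dom (inv_letter a) `&` iso_tot (inv_letter a) @^-1` C1.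
  apply/seteqP; split=> y.
    move=> [x [Cx dx] <-]; split; first exact: iso_tot_dom.
    by rewrite /preimage /= iso_totK.
  move=> [dy [Cx dx]]; exists (iso_tot (inv_letter a) y) => //.
  by have := iso_totK dy; rewrite inv_letterK.
have m1 : measurable (iso_tot a @` C1).
  rewrite im1; apply: measurableI; first exact: miso_dom.
  by have := miso_tot (inv_letter a) measurableT mC1; rewrite setTI.
have e1 : mu (iso_tot a @` C1) = mu C1.
  have im (D : set T) (b : nat * bool) : D `<=` iso_dom b -> iso_tot b @` D = iso_fun b @` D.
    by move=> Db; apply/seteqP; split=> _ [x Dx <-]; exists x => //; rewrite iso_totE//; exact: Db.
  have back : iso_tot (inv_letter a) @` (iso_tot a @` C1) = C1.
    apply/seteqP; split=> x; first by move=> [_ [z [Cz dz] <-] <-]; rewrite iso_totK.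
    by move=> [Cx dx]; exists (iso_tot a x); [exists x|exact: iso_totK].
  have sub1 : C1 `<=` iso_dom a by move=> x [].
  have sub2 : iso_tot a @` C1 `<=` iso_dom (inv_letter a).
    by move=> _ [x [_ dx] <-]; exact: iso_tot_dom.
  have pres (b : nat * bool) (D : set T) : b.2 -> measurable D -> D `<=` iso_dom b -> mu (iso_fun b @` D) = mu D.
    by case: b => n [] // _; exact: iso.
  (* Invariance is assumed for [pi_fun] only; for an inverse letter it is applied from the image
     back to [C1]. *)
  have [ha|ha] := boolP a.2; first by rewrite im//; exact: pres.
  by rewrite -[in RHS]back [in RHS]im//; apply/esym; exact: pres.
have im2 : iso_tot a @` C2 = C2.
  apply/seteqP; split=> x; first by move=> [y [Cy ny] <-]; rewrite iso_totN.
  by move=> [Cx nx]; exists x => //; exact: iso_totN.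
have imC : iso_tot a @` C = iso_tot a @` C1 `|` C2.
  rewrite -{1}im2 -image_setU; congr (_ @` _); apply/seteqP; split=> x.
    by move=> Cx; have [h|h] := pselect (iso_dom a x); [left|right].
  by move=> [[]|[]].
have dis : iso_tot a @` C1 `&` C2 = set0.
  apply/seteqP; split=> // y [[x [Cx dx] e] [Cy ny]].
  have exy : x = y.
    by apply: inj; rewrite ?inE//; rewrite (iso_totN ny).
  by apply: ny; rewrite -exy.
split; first by rewrite imC; exact: measurableU.
have eU : mu (iso_tot a @` C1 `|` C2) = (mu (iso_tot a @` C1) + mu C2)%E by exact: measureU.
have eC : mu (C1 `|` C2) = (mu C1 + mu C2)%E.
  by apply: measureU => //; apply/seteqP; split=> // y [[_ h] [_ n]].
rewrite imC eU e1 -eC; congr (mu _); apply/seteqP; split=> x; first by move=> [[]|[]].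
by move=> Cx; have [h|h] := pselect (iso_dom a x); [left|right].
Qed.

Definition word_fun (w : word nat) x := foldl (fun x a => iso_tot a x) x w.

Lemma generated_letter a x : generated Phi x (iso_tot a x).
Proof.
have [h|h] := pselect (iso_dom a x); last by rewrite iso_totN//; exact: conn_refl.
rewrite iso_totE//; case: a h => n [] h; rewrite /iso_fun /=.
  by apply: conn_step; exists n.
apply: conn_sym; apply: conn_step; exists n; first exact: pi_inv_dom.
exact: pi_invK.
Qed.

Lemma generated_word w x : generated Phi x (word_fun w x).
Proof.
elim: w x => [|a w IH] x /=; first exact: conn_refl.
exact: conn_trans (generated_letter a x) (IH _).
Qed.

Lemma generated_lpath x y : generated Phi x y <-> exists w, lpath iso_dom iso_tot w x y.
Proof.
rewrite -(conn_lpath iso_tot_dom iso_totK); split; apply: conn_sub => u v.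
  by move=> [n h <-]; apply: conn_step; exists (n, true); rewrite iso_totE.
by move=> [a [_ <-]]; exact: generated_letter.
Qed.

Lemma lpath_word_fun w x y : lpath iso_dom iso_tot w x y -> y = word_fun w x.
Proof. by elim: w x => [|a w IH] x /=; [|move=> [_ /IH]]. Qed.

Lemma generatedP x y : generated Phi x y <-> exists w, word_fun w x = y.
Proof.
split=> [/generated_lpath[w /lpath_word_fun ->]|[w <-]]; first by exists w.
exact: generated_word.
Qed.

Lemma mword_fun w : measurable_fun setT (word_fun w).
Proof.
rewrite /word_fun; elim/last_ind: w => [|s a IH]; first exact: measurable_id.
rewrite (_ : (fun x => _) = iso_tot a \o (fun x => foldl (fun x a => iso_tot a x) x s)).
  by apply: measurableT_comp => //; exact: miso_tot.
by apply/funext => x /=; rewrite foldl_rcons.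
Qed.

Lemma word_fun_image w C : measurable C -> {in C &, injective (word_fun w)} ->
  measurable (word_fun w @` C) /\ mu (word_fun w @` C) = mu C.
Proof.
elim: w C => [|a w IH] C mC inj; first by rewrite /word_fun /= image_id.
have inja : {in C &, injective (iso_tot a)}.
  by move=> x y Cx Cy e; apply: inj => //=; rewrite e.
have [ma ea] := iso_tot_image mC inja.
have injw : {in iso_tot a @` C &, injective (word_fun w)}.
  move=> _ _ /set_mem[x Cx <-] /set_mem[y Cy <-] e; congr iso_tot; apply: inj => //; exact/mem_set.
have [mw ew] := IH _ ma injw.
rewrite (_ : word_fun (a :: w) @` C = word_fun w @` (iso_tot a @` C)) ?ew//.
by rewrite image_comp.
Qed.

(** Words in the letters enumerate the classes, index 0 being the empty word. So the ambient
    relation is the one generated by the graphing, and it is here that an almost everywhere equal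
    copy replaces the given relation. *)
Lemma graphing_enumrel (key : T -> K) : measurable_fun setT key -> injective key ->
  (forall x, 0 <= key x <= 1)%R ->
  exists r : enumrel mu, forall x y, rel_of r x y <-> generated Phi x y.
Proof.
move=> mk ik k01; pose wd n := if n is n'.+1 then odflt [::] (@unpickle (word nat) n') else [::].
have wdP w : exists n, wd n = w by exists (pickle w).+1; rewrite /wd pickleK.
have genP x y : generated Phi x y -> exists n, word_fun (wd n) x = y.
  by move=> /generatedP[w <-]; have [n e] := wdP w; exists n; rewrite e.
pose r := @EnumRel K d T mu key (fun n => word_fun (wd n)) mk ik k01
  (fun n => mword_fun (wd n)) (fun x => erefl)
  (fun n x => genP _ _ (conn_sym (generated_word _ _)))
  (fun n m x => genP _ _ (conn_trans (generated_word _ _) (generated_word _ _)))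
  (fun n C => @word_fun_image (wd n) C).
by exists r => x y; split=> [[n <-]|/genP]; [exact: generated_word|].
Qed.

End Graphing.

(** * The skeleton given by a treeing *)

Section Treeing.
Context {K : realType} {d : measure_display} {T : measurableType d}.
Context {mu : probability T K} (r : enumrel mu).
Local Open Scope ring_scope.
Local Notation R := (rel_of r).
Local Notation pr := (prm mu).

Lemma ae_set (P : T -> Prop) : {ae mu, forall x, P x} ->
  exists N : set T, [/\ measurable N, pr N = 0 & forall x, ~ N x -> P x].
Proof.
move=> [N [mN N0 sN]]; exists N; split=> //; first by rewrite /prm N0.
by move=> x nN; apply: contrapT => nP; apply: nN; exact: sN.
Qed.

Section Letters.
Variables (dm : nat * bool -> set T) (g : nat * bool -> T -> T).
Hypotheses (mdm : forall a, measurable (dm a)) (mg : forall a, measurable_fun setT (g a)).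

Lemma mlpath d' (U : measurableType d') w (g1 g2 : U -> T) :
  measurable_fun setT g1 -> measurable_fun setT g2 ->
  measurable [set u | lpath dm g w (g1 u) (g2 u)].
Proof.
elim: w g1 => [|a w IH] g1 m1 m2 /=; first exact: (meq r).
apply: mand; first exact: (mset (mdm a)).
by apply: IH => //; exact: measurableT_comp.
Qed.

Hypothesis gR : forall a x, R x (g a x).
Hypothesis g_dom : forall a x, dm a x -> dm (inv_letter a) (g a x).
Hypothesis gK : forall a x, dm a x -> g (inv_letter a) (g a x) = x.
Hypothesis acyc : acyclic dm g.

Lemma mstep_graph : mrel (step_graph dm g).
Proof.
apply: (mex (I := (nat * bool)%type)) => a; apply: mand; first by apply: (mset (mdm a)); mfun.
apply: (meq r); last by mfun.
by apply: measurableT_comp (mg a) _; exact: measurable_fst.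
Qed.

Lemma step_graph_rel x y : step_graph dm g x y -> R x y.
Proof. by move=> [a [_ <-]]. Qed.

Lemma letter_uniq a b x : dm a x -> dm b x -> g a x = g b x -> a = b.
Proof.
move=> ax bx e; apply: contrapT => ne.
apply: (acyc (w := [:: a; inv_letter b]) (x := x)) => //.
  by rewrite /reduced /= andbT; apply/eqP => /(can_inj (@inv_letterK nat))/esym.
by split=> //; rewrite e; split; [exact: g_dom|exact: gK].
Qed.

(** In a treeing no ordered pair is joined by two different letters, so each letter contributes its
    domain once for either orientation. *)
Lemma mass_step_graph : mass r (step_graph dm g) =
  (\sum_(n <oo) mu (dm (n, true)) + \sum_(n <oo) mu (dm (n, true)))%E.
Proof.
pose L n x y := dm (n, true) x /\ g (n, true) x = y.
have mL n : mrel (L n).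
  apply: mand; first by apply: (mset (mdm _)); mfun.
  apply: (meq r); last by mfun.
  by apply: measurableT_comp (mg _) _; exact: measurable_fst.
have LR n x y : L n x y -> R x y by move=> [_ <-].
have Luniq i j x y : L i x y -> L j x y -> i = j.
  by move=> [h1 e1] [h2 e2]; have [] : (i, true) = (j, true)
    by apply: (letter_uniq h1 h2); rewrite e1 e2.
pose LL x y := exists n, L n x y.
have mLL : mrel LL by exact: mexn.
have massLL : mass r LL = (\sum_(n <oo) mu (dm (n, true)))%E.
  rewrite mass_bigU//; apply: eq_eseriesr => n _; rewrite mass_fun//; last 2 first.
  - by move=> x y; exact: LR.
  - by move=> x y y' [_ <-] [_ <-].
  by congr (mu _); apply/seteqP; split=> x; [move=> [y []]|move=> h; exists (g (n, true) x)].
rewrite -massLL -{2}(mass_tr mLL); last by move=> x y [n /LR].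
rewrite -massU//; last 2 first.
- exact: mrel_tr.
- move=> x y [n [nx e]] [m [my e']].
  have h := g_dom nx; rewrite e in h.
  suff : inv_letter (n, true) = (m, true) by [].
  by apply: (letter_uniq h my); rewrite -e gK// e.
apply: eq_mass => x y _; split.
  move=> [[n []] [ax e]]; first by left; exists n.
  right; exists n; split; first by rewrite -e; exact: (g_dom ax).
  by rewrite -e; exact: (gK ax).
move=> [[n h]|[n [ax e]]]; first by exists (n, true).
by exists (n, false); rewrite -e; split; [exact: (g_dom ax)|exact: (gK ax)].
Qed.

Lemma step_graph_skeleton X : measurable X -> invariant_set r X -> pr (~` X) = 0 ->
  (forall x y, X x -> R x y -> exists w, lpath dm g w x y) ->
  skeleton r X id (step_graph dm g).
Proof.
move=> mX iX X0 gen; split=> //.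
- by move=> x; exact: rel_refl.
- exact: mstep_graph.
- exact: step_graph_sym.
- exact: step_graph_rel.
- move=> x y Xx /(gen _ _ Xx)/(conn_lpath g_dom gK); apply: conn_mono => u v h.
  by right.
- apply: bridges_mono (acyclic_bridges g_dom gK acyc) => x y //.
  by move=> e; apply: conn_step.
Qed.

End Letters.

(** * A treeing has the smallest cost among all graphings *)

Section Cost.
Variables (X : set T) (Phi Psi : nat -> partial_iso T).
Hypotheses (mX : measurable X) (iX : invariant_set r X) (X0 : pr (~` X) = 0).
Hypothesis Phi_rel : forall x y, R x y <-> generated Phi x y.
Hypothesis Psi_rel : forall x y, X x -> (R x y <-> generated Psi x y).
Let dm a := iso_dom Phi a `&` X.
Let g a := iso_tot Phi a.
Hypothesis acyc : acyclic dm g.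

Let mdm a : measurable (dm a). Proof. by apply: measurableI => //; exact: miso_dom. Qed.
Let mg a : measurable_fun setT (g a). Proof. exact: miso_tot. Qed.
Let gR a x : R x (g a x). Proof. by apply/Phi_rel; exact: generated_letter. Qed.
Let g_dom a x : dm a x -> dm (inv_letter a) (g a x).
Proof. by move=> [h Xx]; split; [exact: iso_tot_dom|exact: iX (gR a x) Xx]. Qed.
Let gK a x : dm a x -> g (inv_letter a) (g a x) = x.
Proof. by move=> [/iso_totK]. Qed.

Let gen_lpath x y : X x -> R x y -> exists2 w, reduced w & lpath dm g w x y.
Proof.
move=> Xx /Phi_rel/generated_lpath[w h].
have : lpath dm g w x y.
  elim: w x Xx h => [|a w IH] x Xx //= [ax h]; split=> //.
  by apply: IH h; exact: iX (gR a x) Xx.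
exact: lpath_reduce.
Qed.

Let to i x := iso_tot Psi (i, true) x.

(** On this set the map [Psi i] is subdivided into a strand spelled by the reduced word [w];
    requiring [w] to be nonempty leaves out the points fixed by [Psi i]. *)
Let cand i w x := ((X x /\ pi_dom (Psi i) x) /\ (w <> [::] /\ reduced w)) /\ lpath dm g w x (to i x).

Let toE i x : pi_dom (Psi i) x -> to i x = pi_fun (Psi i) x.
Proof. by move=> h; rewrite /to iso_totE. Qed.

Let cuts m : (nat * word nat)%type := odflt (0%N, [::]) (unpickle m).

(** At each point only the first code with a given [i] is kept. Sets with the same [i] are thus
    disjoint, and their measures add up to at most that of the domain of [Psi i]. *)
Let D m := [set x | cand (cuts m).1 (cuts m).2 x /\
  forall m', (m' < m)%N -> (cuts m').1 = (cuts m).1 -> ~ cand (cuts m').1 (cuts m').2 x].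

(** The default letter keeps every strand nonempty; it is used only where [D m] is empty. *)
Let wd m := if (cuts m).2 is [::] then [:: (0%N, true)] else (cuts m).2.

Let mcand i w : measurable [set x | cand i w x].
Proof.
apply: mand; last by apply: mlpath => //; exact: miso_tot.
apply: mand; last exact: mprop.
by apply: mand => //; exact: pi_dom_measurable.
Qed.

Let mD m : measurable (D m).
Proof.
apply: mand; first exact: mcand.
apply: malln => m'; apply: mimp; first exact: mprop.
by apply: mimp; [exact: mprop|apply: mnot; exact: mcand].
Qed.

Let Dwd m x : D m x -> lpath dm g (wd m) x (to (cuts m).1 x).
Proof. by move=> [[[_ [w0 _]] h] _]; rewrite /wd; case: ((cuts m).2) w0 h. Qed.

Let D_inj m m' x : D m x -> D m' x -> (cuts m).1 = (cuts m').1 -> m = m'.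
Proof.
move=> [h1 n1] [h2 n2] e; have [lt|lt|//] := ltngtP m m'.
  by case: (n2 m lt e).
by case: (n1 m' lt (esym e)).
Qed.

Let D_ex i x : X x -> pi_dom (Psi i) x -> pi_fun (Psi i) x <> x ->
  exists2 m, D m x & (cuts m).1 = i.
Proof.
move=> Xx ix ne; have xy : R x (to i x).
  apply/(Psi_rel _ Xx); rewrite toE//; apply: conn_step; by exists i.
have [w rw h] := gen_lpath Xx xy.
have w0 : w <> [::] by move=> e; move: h; rewrite e /= toE// => e'; exact: ne.
have ex : exists m, `[< (cuts m).1 = i /\ cand i (cuts m).2 x >].
  by exists (pickle (i, w)); apply/asboolP; rewrite /cuts pickleK.
have [m /asboolP[em cm] mmin] := ex_minnP ex; exists m => //; split; first by rewrite em.
move=> m' lt e c; have : (m <= m')%N; last by rewrite leqNgt lt.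
by apply: mmin; apply/asboolP; move: c; rewrite e em.
Qed.

Let GN N u v := exists m, [/\ (m < N)%N, D m u & v = pos g wd m (size (wd m)) u].

Let posE m x : D m x -> pos g wd m (size (wd m)) x = to (cuts m).1 x.
Proof.
move=> /Dwd; rewrite /pos take_size; elim: (wd m) x (to _ x) => [|a w IH] x y /=.
  by move=> ->.
by move=> [_ /IH].
Qed.

Let GNS N u v : GN N u v -> GN N.+1 u v.
Proof. by move=> [m [h1 h2 h3]]; exists m; split=> //; exact: leqW. Qed.

Let GN_conn x y : X x -> R x y -> exists N, conn (GN N) x y.
Proof.
move=> Xx /(Psi_rel _ Xx) h; apply: conn_lim; first exact: GNS.
suff : (X x <-> X y) /\ (X x -> conn (fun a b => exists k, GN k a b) x y).
  by move=> [_]; exact.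
elim: h {Xx} => [u v [i ui e]|u|u v _ [e h]|u v z _ [e1 h1] _ [e2 h2]].
- have iff : X u <-> X v.
    split=> Xu; last first.
      have : R v u by apply/(Psi_rel _ Xu)/conn_sym; apply: conn_step; exists i.
      by move=> /iX; apply.
    have : R u v by apply/(Psi_rel _ Xu); apply: conn_step; exists i.
    by move=> /iX; apply.
  split=> // Xu; have [euv|ne] := pselect (v = u); first by rewrite euv; exact: conn_refl.
  have [|m Dm em] := D_ex Xu ui; first by rewrite e.
  by apply: conn_step; exists m.+1, m; split=> //; rewrite posE// em toE.
- by split=> // _; exact: conn_refl.
- by split; [rewrite e|move=> Xv; apply: conn_sym; apply: h; rewrite e].
- split; first by rewrite e1.
  by move=> Xu; apply: conn_trans (h1 Xu) _; apply: h2; exact/e1.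
Qed.

Let A N n := [set x | dm (n, true) x /\ conn (GN N) x (g (n, true) x)].

Let GR N u v : GN N u v -> R u v.
Proof.
move=> [m [_ Dm ->]]; rewrite posE//; have [[[[Xu iu] _] _] _] := Dm.
by apply/(Psi_rel _ Xu); rewrite toE//; apply: conn_step; exists (cuts m).1.
Qed.

Let mA N n : measurable (A N n).
Proof.
apply: mand; first exact: mdm.
apply: mrelP; [|exact: measurable_id|exact: mg].
apply: (mrel_conn (r := r)); first exact: GR.
apply: mexn => m; rewrite (_ : [set p | _] = [set p : T * T | (m < N)%N /\ (D m p.1 /\
    p.2 = to (cuts m).1 p.1)]).
  apply: mand; first exact: mprop.
  apply: mand; first by apply: (mset (mD m)); mfun.
  apply: (meq r); first by mfun.
  by apply: measurableT_comp; [exact: miso_tot|mfun].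
apply/seteqP; split=> p /=; first by move=> [h1 h2 ->]; rewrite posE.
by move=> [h1 [h2 ->]]; rewrite posE.
Qed.

Let psi_sum N : ((\sum_(m < N) pr (D m))%:E <= graphing_cost mu Psi)%E.
Proof.
pose I := (\max_(m < N) (cuts m).1).+1.
have le : \sum_(m < N) pr (D m) <= \sum_(i < I) pr (pi_dom (Psi i)).
  have := @count_le K _ T mu _ _ (fun m : 'I_N => D m) (fun i : 'I_I => pi_dom (Psi i)) set0
    (fun m => mD m) (fun i => pi_dom_measurable (Psi i)) measurable0.
  rewrite pr_set0 addr0; apply=> y.
  rewrite (_ : `[< set0 y >] = false) ?addn0; last by apply/asboolP.
  have ltI (m : 'I_N) : ((cuts m).1 < I)%N by rewrite ltnS; exact: (leq_bigmax m).
  rewrite !sum_asbool; have inj : {in finset (fun m : 'I_N => `[< D m y >]) &,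
      injective (fun m : 'I_N => Ordinal (ltI m))}.
    move=> m m'; rewrite !inE => /asboolP h /asboolP h' /(congr1 val)/= e.
    by apply: val_inj; exact: D_inj (asboolW h) (asboolW h') e.
  rewrite -(card_in_imset inj); apply: subset_leq_card.
  apply/fintype.subsetP => _ /imsetP[m mD' ->].
  have [[[[_ h] _] _] _] : D m y by move: mD'; rewrite inE => /asboolP.
  by rewrite inE; apply/asboolP.
rewrite -lee_fin in le; apply: (le_trans le); rewrite /graphing_cost.
apply: le_trans (nneseries_lim_ge I _) => //.
rewrite big_mkord -sumEFin; apply: lee_sum => i _.
by have -> : mu (pi_dom (Psi i)) = (pr (pi_dom (Psi i)))%:E by apply: prE; exact: pi_dom_measurable.
Qed.

(** Finitely many strands need not generate the letters. The part of each letter that they fail to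
    generate is added as a strand of length one, and its measure cancels on both sides of the
    folding inequality. *)
Let tree_part N M0 : \sum_(n < M0) pr (A N n) <= \sum_(m < N) pr (D m).
Proof.
pose mx := \max_(m < N) \max_(a <- wd m) (a.1).+1.
pose M := maxn M0 mx.
pose L := (\max_(m < N) size (wd m)).+1.
(* Indices below [N] are strands of [Psi]; index [N + n] is the missing part of the letter [n]. *)
pose wd' m := if (m < N)%N then wd m else [:: ((m - N)%N, true)].
pose D' m := if (m < N)%N then D m else dm ((m - N)%N, true) `\` A N (m - N).
have mD' m : measurable (D' m).
  by rewrite /D'; case: ifP => // _; apply: measurableD.
have D'_path m x : D' m x -> exists y, lpath dm g (wd' m) x y.
  rewrite /D' /wd'; case: ifP => _; first by move=> /Dwd h; exists (to (cuts m).1 x).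
  by move=> [h _]; exists (g ((m - N)%N, true) x).
have wd'0 m : (0 < size (wd' m))%N.
  by rewrite /wd'; case: ifP => // _; rewrite /wd; case: ((cuts m).2).
have wd'L m : (m < N + M)%N -> (size (wd' m) <= L)%N.
  move=> _; rewrite /wd'; case: ifP => // h.
  by apply: leqW; exact: (leq_bigmax (Ordinal h)).
have wd'M m a : (m < N + M)%N -> a \in wd' m -> (a.1 < M)%N.
  rewrite /wd' => hm; case: ifP => h; last first.
    by rewrite inE => /eqP -> /=; rewrite ltn_subLR// leqNgt h.
  move=> ain; apply: leq_trans (leq_maxr M0 mx).
  apply: leq_trans (leq_bigmax (Ordinal h)) => /=.
  exact: (@leq_bigmax_seq _ (wd m) predT (fun a : nat * bool => (a.1).+1) a ain isT).
have conn' n x : (n < M)%N -> dm (n, true) x -> conn (piece_graph g (N + M) wd' D') x (g (n, true) x).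
  move=> nM nx; have [c|nc] := pselect (conn (GN N) x (g (n, true) x)).
    apply: conn_mono c => u v [m [mN Dm ->]]; exists m.
    rewrite /D' /wd' /pos mN; split=> //; exact: leq_trans (leq_addr _ _).
  have eN : (N + n < N)%N = false by rewrite ltnNge leq_addr.
  apply: conn_step; exists (N + n)%N.
  rewrite /D' /wd' /pos eN addKn; split=> //; first by rewrite ltn_add2l.
  by split=> // -[_].
have := folding_count mdm mg gR g_dom gK acyc mD' D'_path wd'0 wd'L wd'M conn'.
rewrite big_split_ord /=.
have -> : \sum_(i < N) pr (D' i) = \sum_(i < N) pr (D i).
  by apply: eq_bigr => i _; rewrite /D' ltn_ord.
have -> : \sum_(i < M) pr (D' (N + i)%N) = \sum_(i < M) (pr (dm (i : nat, true)) - pr (A N i)).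
  apply: eq_bigr => i _; rewrite /D' ltnNge leq_addr /= addKn prD//.
  by move=> x [].
rewrite sumrB => h; have le : \sum_(n < M) pr (A N n) <= \sum_(m < N) pr (D m).
  by move: h; lra.
apply: le_trans le; rewrite (big_ord_widen M (fun n => pr (A N n)) (leq_maxl M0 mx)).
rewrite big_mkcond /=; apply: ler_sum => i _; case: ifP => // _; exact: pr_ge0.
Qed.

(** As [N] grows the generated parts [A N n] exhaust the letters, and the bound by the cost of [Psi]
    passes to the limit. *)
Lemma treeing_cost_le : (\sum_(n <oo) mu (pi_dom (Phi n)) <= graphing_cost mu Psi)%E.
Proof.
apply: lime_le; first exact: is_cvg_nneseries.
apply: nearW => M0; rewrite big_mkord.
have eD n : mu (pi_dom (Phi n)) = (pr (dm (n, true)))%:E.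
  have m1 : measurable (pi_dom (Phi n)) := pi_dom_measurable (Phi n).
  have -> : mu (pi_dom (Phi n)) = (pr (pi_dom (Phi n)))%:E by exact: prE.
  rewrite -(prD0 m1 (measurableC mX) X0); congr (pr _)%:E.
  by rewrite setDE setCK.
under eq_bigr do rewrite eD; rewrite sumEFin.
have AS n N : A N n `<=` A N.+1 n.
  by move=> x [h c]; split=> //; apply: conn_mono c => u v; exact: GNS.
have AU n : \bigcup_N A N n = dm (n, true).
  apply/seteqP; split=> x; first by move=> [N _ []].
  by move=> h; have [N c] := GN_conn h.2 (gR (n, true) x); exists N.
have le N : ((\sum_(n < M0) pr (A N n))%:E <= graphing_cost mu Psi)%E.
  by apply: le_trans (psi_sum N); rewrite lee_fin; exact: tree_part.
have cv : (fun N => (\sum_(n < M0) pr (A N n))%:E) @ \oo --> ((\sum_(n < M0) pr (dm (n : nat, true)))%:E).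
  apply: cvg_EFin; first exact: nearW.
  elim: (M0) => [|k IH]; first by under eq_fun do rewrite big_ord0; rewrite big_ord0; exact: cvg_cst.
  under eq_fun do rewrite big_ord_recr /=; rewrite big_ord_recr /=; apply: cvgD => //.
  by rewrite -AU; apply: pr_bigcup_lim => // N; exact: mA.
rewrite -(cvg_lim _ cv)//; apply: lime_le; first by apply/cvg_ex; eexists; exact: cv.
exact: nearW.
Qed.

End Cost.
End Treeing.

(** * Treeable relations on standard Borel spaces *)

Section StandardBorelSpaces.
Context {K : realType} {d : measure_display} {T : measurableType d}.

(** A countable base of the Polish space is pulled back. It separates points because the space is
    Hausdorff, and it generates because every open set is a countable union of basic ones. *)
Lemma standard_borel_basis : standard_borel K T -> exists S : nat -> set T,
  [/\ forall i, measurable (S i), forall x y, (forall i, S i x <-> S i y) -> x = y &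
      @measurable _ T = <<s range S >>].
Proof.
move=> [P [f [hP [B /countable_injP[c cinj] [Bopen Bnbhs]] fbij fP]]].
pose W i : set P := if pselect (exists2 U, B U & c U = i) is left ex
  then projT1 (cid2 ex) else setT.
have Wopen i : open (W i).
  rewrite /W; case: pselect => [ex|_]; last exact: openT.
  by case: (cid2 ex) => U BU e /=; exact: Bopen.
have WB U : B U -> W (c U) = U.
  move=> BU; rewrite /W; case: pselect => [ex|]; last by case; exists U.
  by case: (cid2 ex) => U' BU' e /=; apply: cinj; rewrite ?inE.
have fK (V : set P) : f @` (f @^-1` V) = V.
  have [g _ gK] := fbij; apply/seteqP; split=> y; first by move=> [x Vx <-].
  by move=> Vy; exists (g y); rewrite /preimage /= gK.
exists (fun i => f @^-1` W i); split.
- by move=> i; apply/fP; rewrite fK; apply: sub_sigma_algebra; exact: Wopen.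
- move=> x y xy; apply: (bij_inj fbij); apply: contrapT => /eqP ne.
  move: hP; rewrite open_hausdorff => /(_ _ _ ne)[[A A'] /= [/set_mem fxA /set_mem fyA] [oA oA' /eqP AA]].
  have [U [BU Ux] UA] : filter_from [set U | B U /\ U (f x)] id A.
    by apply: Bnbhs; exact: open_nbhs_nbhs.
  have Uy : U (f y) by have := (xy (c U)).1; rewrite /preimage /= WB//; apply.
  have : (A `&` A') (f y) by split=> //; exact: UA.
  by rewrite AA.
- have sT : sigma_algebra setT <<s range (fun i => f @^-1` W i) >> by exact: smallest_sigma_algebra.
  have [s0 sC sU] := sT.
  apply/seteqP; split=> A.
    move=> /fP; have : <<s [set U : set P | open U] >> `<=`
        [set V | <<s range (fun i => f @^-1` W i) >> (f @^-1` V)].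
      apply: smallest_sub; first split.
      - by rewrite /= preimage_set0.
      - move=> V /= VP; rewrite setTD preimage_setC -setTD; exact: sC.
      - by move=> F FP /=; rewrite preimage_bigcup; exact: sU.
      move=> V oV /=.
      have -> : f @^-1` V = \bigcup_i (if pselect (W i `<=` V) then f @^-1` W i else set0).
        apply/seteqP; split=> x.
          move=> Vx; have [U [BU Ux] UV] : filter_from [set U | B U /\ U (f x)] id V.
            by apply: Bnbhs; exact: open_nbhs_nbhs.
          exists (c U) => //; case: pselect => [h|] /=; first by rewrite /preimage /= WB.
          by rewrite WB.
        by move=> [i _]; case: pselect => //= sub Wx; exact: sub.
      apply: sU => i; case: pselect => h /=; last exact: s0.
      by apply: sub_sigma_algebra; exists i.
    move=> /[apply] /=; congr (<<s _ >> _).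
    apply/seteqP; split=> x; last by move=> Ax; exists x.
    by move=> [y Ay /(bij_inj fbij) <-].
  apply: smallest_sub A; first split.
  - exact: measurable0.
  - by move=> A mA; exact: measurableD.
  - by move=> F mF; exact: bigcupT_measurable.
  by move=> _ [i _ <-]; apply/fP; rewrite fK; apply: sub_sigma_algebra; exact: Wopen.
Qed.

Lemma pi_system_of (S : nat -> set T) : (forall i, measurable (S i)) ->
  @measurable _ T = <<s range S >> -> exists Us : nat -> set T,
  [/\ forall n, measurable (Us n), Us 0%N = setT,
      forall n m, exists p, Us n `&` Us m = Us p & @measurable _ T = <<s range Us >>].
Proof.
move=> mS gS; pose U (s : seq nat) := foldr (fun i A => S i `&` A) setT s.
pose code n := if n is n'.+1 then odflt [::] (@unpickle (seq nat) n') else [::].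
have codeP s : exists n, code n = s by exists (pickle s).+1; rewrite /code pickleK.
have mU s : measurable (U s) by elim: s => [|i s IH] //=; exact: measurableI.
exists (fun n => U (code n)); split=> //.
- move=> n m; have [p e] := codeP (code n ++ code m); exists p; rewrite e.
  by elim: (code n) => [|i s IH] /=; [rewrite setTI|rewrite -setIA IH].
- apply/seteqP; split=> A.
    rewrite gS; apply: smallest_sub; first exact: smallest_sigma_algebra.
    move=> _ [i _ <-]; apply: sub_sigma_algebra; have [n e] := codeP [:: i].
    by exists n => //; rewrite e /= setIT.
  apply: smallest_sub A; first split.
  - exact: measurable0.
  - by move=> A mA; exact: measurableD.
  - by move=> F mF; exact: bigcupT_measurable.
  by move=> _ [n _ <-].
Qed.

Local Open Scope ring_scope.

(** The key has the indicators of the [S i] as digits in base 3. As the digits are 0 or 1, all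
    digits after a place contribute at most half a unit of that place, and the first digit in which
    two points differ decides. *)
Lemma separating_key (S : nat -> set T) : (forall i, measurable (S i)) ->
  (forall x y, (forall i, S i x <-> S i y) -> x = y) ->
  exists key : T -> K, [/\ measurable_fun setT key, injective key &
    forall x, 0 <= key x <= 1].
Proof.
move=> mS sep; pose q : K := 3^-1.
have q0 : 0 < q by rewrite invr_gt0.
pose u n (x : T) : K := \sum_(i < n) q ^+ i.+1 * \1_(S i) x.
have ind x i : 0 <= (\1_(S i) x : K) <= 1 by rewrite indicE; case: (_ \in _); rewrite ?lexx ?ler01.
have uS n x : u n.+1 x = u n x + q ^+ n.+1 * \1_(S n) x by rewrite /u big_ord_recr.
have qq n : q ^+ n.+1 * 3 = q ^+ n by rewrite exprS -mulrA mulrC -mulrA mulfV ?mulr1.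
have qn n : 0 < q ^+ n by rewrite exprn_gt0.
have le x m n : (m <= n)%N -> u m x <= u n x.
  move=> /subnK <-; elim: (n - m)%N => // j IH; rewrite addSn uS; apply: (le_trans IH).
  by rewrite lerDl mulr_ge0// ?(ltW (qn _))//; have /andP[] := ind x (j + m)%N.
have arith (a b c e : K) : a * 3 = b -> e <= a -> c + e + a / 2 <= c + b / 2.
  by move=> h1 h2; lra.
have up x m n : (m <= n)%N -> u n x + q ^+ n / 2 <= u m x + q ^+ m / 2.
  move=> /subnK <-; elim: (n - m)%N => // j IH; rewrite addSn uS; apply: le_trans IH.
  have h := qq (j + m)%N; have h1 := qn (j + m).+1; have /andP[h2 h3] := ind x (j + m)%N.
  have h4 : q ^+ (j + m).+1 * \1_(S (j + m)%N) x <= q ^+ (j + m).+1 by rewrite ler_piMr// ltW.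
  exact: arith h h4.
have up' x m n : u n x <= u m x + q ^+ m / 2.
  have [mn|nm] := leqP m n.
    by apply: le_trans (up x m n mn); rewrite lerDl divr_ge0// ltW.
  by apply: le_trans (le x _ _ (ltnW nm)) _; rewrite lerDl divr_ge0// ltW.
have cv x : cvgn (fun n => u n x).
  apply: nondecreasing_is_cvgn; first by move=> n m; exact: le.
  by exists (u 0%N x + q ^+ 0 / 2) => _ [n _ <-]; exact: up'.
pose key x := limn (fun n => u n x).
have key_ge x n : u n x <= key x.
  by apply: limr_ge; [exact: cv|exists n => // m /= nm; exact: le].
have key_le x m : key x <= u m x + q ^+ m / 2.
  by apply: limr_le; [exact: cv|apply: nearW => n; exact: up'].
have lt x y i : (forall j, (j < i)%N -> (S j x <-> S j y)) -> S i x -> ~ S i y -> key y < key x.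
  move=> eqj Sx nSy.
  have e : u i x = u i y.
    apply: eq_bigr => j _; congr (_ * _); rewrite !indicE; congr (_ %:R); congr nat_of_bool.
    by apply/idP/idP; rewrite !inE => /eqj; exact.
  apply: (le_lt_trans (key_le y i.+1)); apply: lt_le_trans (key_ge x i.+1).
  rewrite !uS !indicE (mem_set Sx) (memNset nSy) mulr1 mulr0 addr0 e.
  have := qn i.+1; move: (q ^+ i.+1) (u i y) => a b a0; lra.
exists key; split.
- apply: (measurable_fun_cvg (h := fun n x => u n x)).
    move=> n; rewrite /u; apply: measurable_sum => i.
    by apply: measurable_funM; [exact: measurable_cst|exact: measurable_indic].
  by move=> x _; exact: cv.
- move=> x y e; apply: contrapT => ne.
  have [i ni] : exists i, `[< ~ (S i x <-> S i y) >].
    apply: contrapT => nn; apply: ne; apply: sep => i; apply: contrapT => h.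
    by apply: nn; exists i; apply/asboolP.
  have ex : exists i, `[< ~ (S i x <-> S i y) >] by exists i.
  have {i ni} [i /asboolP ni imin] := ex_minnP ex.
  have eqj j : (j < i)%N -> (S j x <-> S j y).
    by move=> ji; apply: contrapT => h; move: ji; rewrite ltnNge imin//; apply/asboolP.
  have eqj' j : (j < i)%N -> (S j y <-> S j x) by move=> /eqj[? ?]; split.
  have [Sx|nSx] := pselect (S i x); have [Sy|nSy] := pselect (S i y).
  + by apply: ni; split.
  + by have := lt x y i eqj Sx nSy; rewrite e ltxx.
  + by have := lt y x i eqj' Sy nSx; rewrite e ltxx.
  + by apply: ni; split.
- move=> x; apply/andP; split.
    by apply: le_trans (key_ge x 0%N); rewrite /u big_ord0.
  apply: (le_trans (key_le x 0%N)); rewrite /u big_ord0 expr0; lra.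
Qed.

End StandardBorelSpaces.

(** * Absence of atoms *)

Section Star.
Context {K : realType} {d : measure_display} {T : measurableType d}.
Context {mu : probability T K} (r : enumrel mu).
Local Open Scope ring_scope.
Local Notation f := (enum_fun r).
Local Notation R := (rel_of r).
Local Notation pr := (prm mu).
Variable x0 : T.

Let leaf n := (0 < n)%N /\ first_at r n x0.
Let src n : set T := if pselect (leaf n) then [set x0] else set0.
Let tgt n : set T := if pselect (leaf n) then [set f n x0] else set0.

Let msrc n : measurable (src n).
Proof. by rewrite /src; case: pselect => //= h; exact: meas_point r _. Qed.
Let mtgt n : measurable (tgt n).
Proof. by rewrite /tgt; case: pselect => //= h; exact: meas_point r _. Qed.

Let star (n : nat) : partial_iso T.
Proof.
apply: (@PartialIso d T (src n) (tgt n) (fun=> f n x0) (fun=> x0)) => //.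
- by rewrite /src /tgt; case: pselect.
- by rewrite /src /tgt; case: pselect.
- by rewrite /src; case: pselect => //= h x ->.
- by rewrite /tgt; case: pselect => //= h x ->.
Defined.

Let point_image n : mu [set f n x0] = mu [set x0].
Proof.
have inj : {in [set x0] &, injective (f n)} by move=> x y; rewrite !inE => -> ->.
by have [_ <-] := enum_fun_image (meas_point r x0) inj; rewrite image_set1.
Qed.

Let star_iso n : iso_preserving mu (star n).
Proof.
move=> A mA /=; rewrite /src; case: pselect => [ln|nl] /= sA.
  have [[x Ax]|nA] := pselect (exists x, A x).
    have -> : A = [set x0].
      by apply/seteqP; split=> [y /sA//|y ->]; rewrite -(sA _ Ax).
    by rewrite image_set1.
  have -> : A = set0 by apply/seteqP; split=> // x Ax; apply: nA; exists x.
  by rewrite image_set0.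
have -> : A = set0 by apply/seteqP; split=> // x /sA.
by rewrite image_set0.
Qed.

Let star_gen x : R x0 x -> generated star x0 x.
Proof.
move=> /first_atP[[|n] <- h]; first by rewrite enum_fun0; exact: conn_refl.
have ln : leaf n.+1 by [].
by apply: conn_step; exists n.+1; rewrite //= /src; case: pselect.
Qed.

Let star_rel x y : generated star x y -> R x y.
Proof.
apply: conn_rel => {}x {}y [n /=]; rewrite /src; case: pselect => //= h -> <-.
exact: rel_fun.
Qed.

(* Joining a point [x0] to everything else bounds the cost by one minus the measure
   of [x0], which excludes point masses when the cost is at least one. *)
Lemma star_graphing (E : T -> T -> Prop) (X : set T) : measurable X -> pr (~` X) = 0 ->
  pr (~` sat r [set x0]) = 0 -> (forall x y, X x -> (E x y <-> R x y)) ->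
  0 < pr [set x0] -> (cost mu E < 1)%E.
Proof.
move=> mX X0 S0 EX p0.
have mS : measurable (sat r [set x0]) by apply: msat; exact: meas_point r _.
have gr : graphing mu E star.
  split=> //; exists (~` X `|` ~` sat r [set x0]); split.
  - by apply: measurableU; exact: measurableC.
  - have m12 : measurable (~` X `|` ~` sat r [set x0]) by apply: measurableU; exact: measurableC.
    have e : pr (~` X `|` ~` sat r [set x0]) = 0.
      apply/eqP; rewrite eq_le pr_ge0 andbT.
      apply: (le_trans (prU_le mu _ _)); try exact: measurableC.
      by rewrite X0 S0 addr0.
    by have -> := prE mu m12; rewrite e.
  move=> x nx; apply: contrapT => n; apply: nx => y; rewrite EX; last first.
    by apply: contrapT => nX; apply: n; left.
  have [z [xz /= ez]] : sat r [set x0] x by apply: contrapT => nS; apply: n; right.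
  rewrite ez in xz; split; last exact: star_rel.
  move=> xy; apply: (conn_trans (y := x0)).
    by apply: conn_sym; apply: star_gen; exact: rel_sym.
  by apply: star_gen; apply: rel_trans xy; exact: rel_sym.
apply: (@le_lt_trans _ _ (graphing_cost mu star)).
  by apply: ereal_inf_lbound; exists star.
have tt : trivIset setT tgt.
  apply/trivIsetP => i j _ _ ij; apply/seteqP; split=> // y.
  rewrite /tgt; case: pselect => [li|ni] [] //=; case: pselect => [lj|nj] //= -> e.
  have [_ hi] := li; have [_ hj] := lj.
  by move: ij; rewrite (first_at_inj hi hj e) eqxx.
have mU : measurable (\bigcup_n tgt n) by exact: bigcupT_measurable.
have -> : graphing_cost mu star = mu (\bigcup_n tgt n).
  rewrite measure_semi_bigcup//; apply: eq_eseriesr => n _ /=.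
  by rewrite /src /tgt; case: pselect => h /=; [rewrite point_image|rewrite !measure0].
have -> : mu (\bigcup_n tgt n) = (pr (\bigcup_n tgt n))%:E by exact: prE.
(* Index 0 is not a leaf, so the centre [x0] is missing from the images and the cost is at most [1 -
   pr [set x0]]. *)
rewrite lte_fin; have dis : \bigcup_n tgt n `&` [set x0] = set0.
  apply/seteqP; split=> // y [[n _]]; rewrite /tgt; case: pselect => //= ln -> e; have [n0 hn] := ln.
  by apply: (hn 0%N n0); rewrite enum_fun0; exact: esym.
have mp : measurable [set x0] by exact: meas_point r _.
have := pr_le1 mu (measurableU _ _ mU mp); rewrite prU//; lra.
Qed.

End Star.

(** * From a treeable relation to a skeleton *)

Section Setup.
Context {K : realType} {d : measure_display} {T : measurableType d}.
Context {mu : probability T K}.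
Local Open Scope ring_scope.
Local Notation pr := (prm mu).

Lemma word_path_lpath Phi w (x y : T) :
  word_path Phi w x y <-> lpath (iso_dom Phi) (iso_tot Phi) w x y.
Proof.
elim: w x => [|[n [] w] IH] x //=.
  by split=> -[nx]; rewrite ?IH iso_totE// => h; split=> //; apply/IH.
by split=> -[nx]; rewrite ?IH iso_totE// => h; split=> //; apply/IH.
Qed.

Variables (E : T -> T -> Prop) (Phi : nat -> partial_iso T).
Hypotheses (erg : ergodic mu E) (gr : graphing mu E Phi) (tr : treeing mu Phi).

Let conull_graphing (r : enumrel mu) (Psi : nat -> partial_iso T) : graphing mu E Psi ->
  exists N : set T, [/\ measurable N, pr N = 0 &
    forall x, ~ N x -> forall y, E x y <-> generated Psi x y].
Proof. by move=> [_ /ae_set]. Qed.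

(** For each nonempty reduced word the points that it fixes form a null set. Discarding the
    saturation of these countably many sets makes the treeing condition hold pointwise. *)
Lemma treeing_domain (r : enumrel mu) : (forall x y, rel_of r x y <-> generated Phi x y) ->
  exists X : set T, [/\ measurable X, invariant_set r X, pr (~` X) = 0,
    forall x y, X x -> (E x y <-> rel_of r x y) &
    acyclic (fun a => iso_dom Phi a `&` X) (iso_tot Phi)].
Proof.
move=> rP; have [N [mN N0 NE]] := conull_graphing r gr.
pose A (w : word nat) := [set x | (w <> [::] /\ reduced w) /\
   lpath (iso_dom Phi) (iso_tot Phi) w x x].
have mA w : measurable (A w).
  apply: mand; first exact: mprop.
  by apply: (mlpath r) => //; [exact: miso_dom|exact: miso_tot].
have A0 w : pr (A w) = 0.
  apply: contrapT => /eqP ne; have pA : 0 < pr (A w) by rewrite lt_neqAle eq_sym ne pr_ge0.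
  have [w0 rw] : w <> [::] /\ reduced w.
    apply: contrapT => h; move: ne; rewrite (_ : A w = set0) ?pr_set0 ?eqxx//.
    by apply/seteqP; split=> // x [].
  apply: (tr w0 rw); exists (A w); split=> //; last by move=> x [_ /word_path_lpath].
  by have -> := prE mu (mA w); rewrite lte_fin.
pose NA := \bigcup_n A (odflt [::] (unpickle n)).
have mNA : measurable NA by exact: bigcupT_measurable.
have NA0 : pr NA = 0 by exact: pr_bigcup0.
have mNN : measurable (N `|` NA) by exact: measurableU.
have NN0 : pr (N `|` NA) = 0.
  apply/eqP; rewrite eq_le pr_ge0 andbT; apply: (le_trans (prU_le mu _ _)) => //.
  by rewrite N0 NA0 addr0.
have [X [mX iX X0 XN]] := conull_invariant r mNN NN0.
exists X; split=> //.
  by move=> x y /XN nx; rewrite rP; apply: NE => Nx; apply: nx; left.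
move=> w x w0 rw h.
have [Xx h'] : X x /\ lpath (iso_dom Phi) (iso_tot Phi) w x x.
  split; first by case: w w0 {rw} h => // a w _ [[]].
  move: {2 4}x h => z; elim: (w) x => [|a w' IH] x' //= [[ax _] /IH].
  by split.
by apply: (XN _ Xx); right; exists (pickle w) => //; rewrite pickleK.
Qed.

Lemma treeing_cost (r : enumrel mu) (X : set T) :
  (forall x y, rel_of r x y <-> generated Phi x y) ->
  measurable X -> invariant_set r X -> pr (~` X) = 0 ->
  (forall x y, X x -> (E x y <-> rel_of r x y)) ->
  acyclic (fun a => iso_dom Phi a `&` X) (iso_tot Phi) ->
  cost mu E = (\sum_(n <oo) mu (pi_dom (Phi n)))%E.
Proof.
move=> rP mX iX X0 EX acyc; apply/eqP; rewrite eq_le; apply/andP; split.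
  by apply: ereal_inf_lbound; exists Phi.
apply: le_ereal_inf_tmp => _ [Psi grP <-].
have [N [mN N0 NE]] := conull_graphing r grP.
have [Y [mY iY Y0 YN]] := conull_invariant r mN N0.
apply: (@treeing_cost_le _ _ _ _ r (X `&` Y) Phi Psi).
- exact: measurableI.
- by move=> x y xy [Xx Yx]; split; [exact: iX xy Xx|exact: iY xy Yx].
- rewrite setCI; apply/eqP; rewrite eq_le pr_ge0 andbT.
  apply: (le_trans (prU_le mu _ _)); try exact: measurableC.
  by rewrite X0 Y0 addr0.
- exact: rP.
- by move=> x y [Xx Yx]; rewrite -EX//; apply: NE; exact: YN.
- move=> w x w0 rw h; apply: (acyc w x w0 rw).
  move: {2 4}x h => z; elim: (w) x => [|a w' IH] x' //= [[ax [Xx _]] /IH].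
  by split.
Qed.

Lemma treeable_skeleton : standard_borel K T -> (1 <= cost mu E)%E ->
  exists (r : enumrel mu) X E0 Us,
  [/\ [/\ forall x, pr [set x] = 0, ergodic_rel r & skeleton r X id E0],
    [/\ forall n, measurable (Us n), Us 0%N = setT,
      forall n m, exists p, Us n `&` Us m = Us p & @measurable _ T = <<s range Us >>],
    mass r E0 = (cost mu E + cost mu E)%E &
    forall x y, X x -> (E x y <-> rel_of r x y)].
Proof.
move=> sb c1; have [S [mS sepS genS]] := standard_borel_basis sb.
have [Us UsP] := pi_system_of mS genS.
have [key [mk ik k01]] := separating_key (K := K) mS sepS.
have [iso _] := gr; have [r rP] := graphing_enumrel iso mk ik k01.
have [X [mX iX X0 EX acyc]] := treeing_domain rP.
have eC := treeing_cost rP mX iX X0 EX acyc.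
pose dm a := iso_dom Phi a `&` X.
have mdm a : measurable (dm a) by apply: measurableI => //; exact: miso_dom.
have mg a : measurable_fun setT (iso_tot Phi a) by exact: miso_tot.
have gR a x : rel_of r x (iso_tot Phi a x) by apply/rP; exact: generated_letter.
have g_dom a x : dm a x -> dm (inv_letter a) (iso_tot Phi a x).
  by move=> [h Xx]; split; [exact: iso_tot_dom|exact: iX (gR a x) Xx].
have gK a x : dm a x -> iso_tot Phi (inv_letter a) (iso_tot Phi a x) = x.
  by move=> [/iso_totK].
have ergR : ergodic_rel r.
  move=> A mA iA; have mAX : measurable (A `&` X) by exact: measurableI.
  have e : pr (A `&` X) = pr A.
    by rewrite -[RHS](prD0 mA (measurableC mX) X0) setDE setCK.
  have [x y|h|h] := erg mAX.
  - move=> Exy [Ax Xx]; have xy : rel_of r x y by apply/EX.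
    by split; [exact: iA xy Ax|exact: iX xy Xx].
  - by left; rewrite -e /prm h.
  - by right; rewrite -e /prm h.
exists r, X, (step_graph dm (iso_tot Phi)), Us; split=> //.
- split=> //; last first.
    apply: step_graph_skeleton => // x y Xx /rP/generated_lpath[w h]; exists w.
    elim: w x Xx h => [|a w IH] x Xx //= [ax h]; split=> //.
    by apply: IH h; exact: iX (gR a x) Xx.
  move=> x; apply: contrapT => /eqP ne.
  have p0 : 0 < pr [set x] by rewrite lt_neqAle eq_sym ne pr_ge0.
  have mx := meas_point r x.
  have S0 : pr (~` sat r [set x]) = 0.
    rewrite prC; last exact: msat.
    have [e|->] := ergR _ (msat r mx) (sat_inv (r := r) (A := [set x])); last by rewrite subrr.
    by move: ne; rewrite (pr_null mx (msat r mx) (sub_sat r (A := [set x])) e) eqxx.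
  have := star_graphing mX X0 S0 EX p0.
  by rewrite ltNge c1.
- rewrite (mass_step_graph mdm mg gR g_dom gK acyc) eC.
  suff e : (\sum_(n <oo) mu (dm (n, true)) = \sum_(n <oo) mu (pi_dom (Phi n)))%E by rewrite e.
  apply: eq_eseriesr => n _; have m1 : measurable (pi_dom (Phi n)) := pi_dom_measurable (Phi n).
  have -> : mu (pi_dom (Phi n)) = (pr (pi_dom (Phi n)))%:E by exact: prE.
  rewrite -(prD0 m1 (measurableC mX) X0) setDE setCK; exact: prE.
Qed.

End Setup.

(** * Stable letters *)

Section Matching.
Context {K : realType} {d : measure_display} {T : measurableType d}.
Context {mu : probability T K} (r : enumrel mu).
Local Open Scope ring_scope.
Local Notation f := (enum_fun r).
Local Notation R := (rel_of r).
Local Notation pr := (prm mu).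
Variable F : T -> T -> Prop.
Hypotheses (F_equiv : equivalence T F) (mF : mrel F) (FR : forall x y, F x y -> R x y).
Hypothesis F_erg : forall A, measurable A -> (forall x y, F x y -> A x -> A y) ->
  pr A = 0 \/ pr A = 1.

Definition matches (A B : set T) (M : T -> T -> Prop) :=
  [/\ mrel M, forall a c, M a c -> [/\ A a, B c & F a c],
      (forall a c c', M a c -> M a c' -> c = c') /\ (forall a a' c, M a c -> M a' c -> a = a'),
      pr (A `\` [set a | exists c, M a c]) = 0 & pr (B `\` [set c | exists a, M a c]) = 0].

Variables (A B : set T).
Hypotheses (mA : measurable A) (mB : measurable B) (prAB : pr A = pr B).

Let free (M : T -> T -> Prop) a c := (A a /\ ~ exists c, M a c) /\ (B c /\ ~ exists a, M a c).

Fixpoint match_state k : T -> T -> Prop :=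
  if k is j.+1 then
    let: (n, m) := decode_pair j in
    runion (match_state j) (fun a c => (f n a = c /\ f m c = a) /\
      (F a c /\ free (match_state j) a c))
  else fun _ _ => False.

Let M_ := match_state.

Let MS k : M_ k.+1 = runion (M_ k) (fun a c =>
  (f (decode_pair k).1 a = c /\ f (decode_pair k).2 c = a) /\ (F a c /\ free (M_ k) a c)).
Proof. by rewrite /M_ /=; case: decode_pair. Qed.

Let M_dom k a c : M_ k a c -> [/\ A a, B c & F a c].
Proof. by elim: k => // k IH; rewrite MS => -[/IH//|[_ [? [[? _] [? _]]]]]. Qed.

Let MR k a c : M_ k a c -> R a c. Proof. by move=> /M_dom[_ _ /FR]. Qed.

Let M_le k j a c : (k <= j)%N -> M_ k a c -> M_ j a c.
Proof. by move=> /subnK <-; elim: (j - k)%N => // i IH /IH; rewrite addSn MS; left. Qed.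

Let M_fun k a c c' : M_ k a c -> M_ k a c' -> c = c'.
Proof.
elim: k => // k IH; rewrite MS => -[h|h] [h'|h'].
- exact: IH h'.
- by case: h' => _ [_ [[_ n] _]]; case: n; exists c.
- by case: h => _ [_ [[_ n] _]]; case: n; exists c'.
- by case: h => -[<- _] _; case: h' => -[<- _] _.
Qed.

Let M_inj k a a' c : M_ k a c -> M_ k a' c -> a = a'.
Proof.
elim: k => // k IH; rewrite MS => -[h|h] [h'|h'].
- exact: IH h'.
- by case: h' => _ [_ [_ [_ n]]]; case: n; exists a.
- by case: h => _ [_ [_ [_ n]]]; case: n; exists a'.
- by case: h => -[_ <-] _; case: h' => -[_ <-] _.
Qed.

Let mM k : mrel (M_ k).
Proof.
elim: k => [|k IH]; first exact: mprop.
rewrite MS; apply: mrelU => //; apply: mand.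
  by apply: mand; apply: (meq r); mfun.
apply: mand => //; apply: mand.
  apply: mand; first by apply: (mset mA); mfun.
  apply: mnot; apply: (mset (A := [set a | exists c, M_ k a c])); last by mfun.
  exact: (mrel_dom (r := r) IH (@MR k)).
apply: mand; first by apply: (mset mB); mfun.
apply: mnot; apply: (mset (A := [set c | exists a, M_ k a c])); last by mfun.
exact: (mrel_ran (r := r) IH (@MR k)).
Qed.

(** Pairs are matched greedily as their indices come up. If a set of positive measure stayed
    unmatched on one side, so would one on the other; by ergodicity some unmatched pair would be
    [F]-related, and it would have been matched at its turn. *)
Lemma matching : exists M, matches A B M.
Proof.
pose M a c := exists k, M_ k a c.
have mMM : mrel M by apply: mexn.
have Mdom a c : M a c -> [/\ A a, B c & F a c] by move=> [k /M_dom].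
have MMR a c : M a c -> R a c by move=> /Mdom[_ _ /FR].
have Mfun a c c' : M a c -> M a c' -> c = c'.
  move=> [k h] [j h']; apply: (M_fun (k := maxn k j)).
    exact: M_le (leq_maxl _ _) h.
  exact: M_le (leq_maxr _ _) h'.
have Minj a a' c : M a c -> M a' c -> a = a'.
  move=> [k h] [j h']; apply: (M_inj (k := maxn k j)).
    exact: M_le (leq_maxl _ _) h.
  exact: M_le (leq_maxr _ _) h'.
have mdom := mrel_dom (r := r) mMM MMR; have mran := mrel_ran (r := r) mMM MMR.
set dA := [set a | exists c, M a c] in mdom; set dB := [set c | exists a, M a c] in mran.
have sA : dA `<=` A by move=> a [c /Mdom[]].
have sB : dB `<=` B by move=> c [a /Mdom[]].
have eAB : pr (A `\` dA) = pr (B `\` dB).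
  rewrite !prD// prAB; congr (_ - _).
  by rewrite /prm (pbij_measure (r := r) mMM MMR Mfun Minj).
suff A0 : pr (A `\` dA) = 0 by exists M; split=> //; rewrite -eAB.
apply: contrapT => /eqP ne.
have p0 : 0 < pr (A `\` dA) by rewrite lt_neqAle eq_sym ne pr_ge0.
have mA' : measurable (A `\` dA) by exact: measurableD.
have mB' : measurable (B `\` dB) by exact: measurableD.
pose S := [set x | exists y, F x y /\ (A `\` dA) y].
have mS : measurable S.
  apply: (mexR (r := r) (g := fun x => x)); first by move=> x y [/FR].
  move=> n; apply: mand; first by apply: (mrelP mF); mfun.
  by apply: (mset mA'); mfun.
have [Fr Ft Fs] := F_equiv.
have [e|e] : pr S = 0 \/ pr S = 1.
  apply: F_erg => // x y xy [z [xz Az]]; exists z; split=> //.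
  by apply: (Ft _ x) => //; exact: Fs.
  have : pr (A `\` dA) <= pr S.
    by apply: pr_le => // x Ax; exists x; split=> //; exact: Fr.
  by rewrite e leNgt p0.
have [[x [Bx [y [xy Ay]]]]|none] := pselect (exists x, (B `\` dB) x /\ S x).
  have [n en] := FR (Fs _ _ xy); have [m em] := FR xy.
  have [k _ ek] := decode_pair_often n m 0.
  have [Bx1 nB] := Bx; have [Ay1 nA] := Ay.
  apply: nA; exists x, k.+1; rewrite MS ek /=; right; split=> //; split; first exact: Fs.
  split; split=> //.
    by move=> [c h]; case: Ay => _; apply; exists c, k.
  by move=> [c h]; apply: nB; exists c, k.
have : pr (B `\` dB) <= pr (~` S).
  by apply: pr_le; [|exact: measurableC|move=> x Bx Sx; apply: none; exists x].
by rewrite -eAB prC// e subrr leNgt p0.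
Qed.

End Matching.

Lemma sum_single (K : realType) (v : \bar K) c :
  (\sum_(q <oo) (if q == c then v else 0) = v)%E.
Proof.
apply/cvg_lim => //; apply: cvg_near_cst; exists c.+1 => // n /= cn.
rewrite -big_mkcond /= big_nat1_eq.
by rewrite leq0n /=; case: ifP => //; rewrite cn.
Qed.

(* The stable letter [s n j] commutes with [Q n] and moves every point across
   exactly one edge of the forest: [cr n j u x y v] says that it moves [u] to [v]
   across the edge [(x, y)]. *)
Record tower_action (K : realType) d (T : measurableType d) (mu : probability T K)
    (r : enumrel mu) (Q : nat -> finGroupType)
    (iota : forall n, {multiplicative Q n -> Q n.+1}) (k : nat -> nat)
    (X : set T) (F E : T -> T -> Prop) (a : forall n, Q n -> T -> T)
    (s si : forall n, 'I_(k n) -> T -> T)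
    (cr : forall n, 'I_(k n) -> T -> T -> T -> T -> Prop) : Prop := TowerAction {
  ta_meas : measurable X;
  ta_inv : invariant_set r X;
  ta_conull : prm mu (~` X) = 0%R;
  ta_equiv : equivalence T F;
  ta_edge_sym : rsym E;
  ta_gen : forall x y, X x -> rel_of r x y -> conn (runion F E) x y;
  ta_bridges : bridges F E;
  ta_a_meas : forall n q, measurable_fun setT (a n q);
  ta_a_rel : forall n q x, F x (a n q x);
  ta_F_rel : forall x y, F x y -> rel_of r x y;
  ta_E_rel : forall x y, E x y -> rel_of r x y;
  ta_a1 : forall n x, a n 1%g x = x;
  ta_aM : forall n q q' x, a n (q * q')%g x = a n q (a n q' x);
  ta_a_iota : forall n q x, a n.+1 (iota n q) x = a n q x;
  ta_a_free : forall n q x, X x -> a n q x = x -> q = 1%g;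
  ta_a_trans : forall x y, X x -> F x y -> exists n q, a n q x = y;
  ta_s_meas : forall n j, measurable_fun setT (s n j);
  ta_si_meas : forall n j, measurable_fun setT (si n j);
  ta_s_rel : forall n j x, rel_of r x (s n j x);
  ta_si_rel : forall n j x, rel_of r x (si n j x);
  ta_sK : forall n j x, si n j (s n j x) = x;
  ta_siK : forall n j x, s n j (si n j x) = x;
  ta_comm : forall n j q x, s n j (a n q x) = a n q (s n j x);
  ta_cross : forall n j x, X x -> exists q u x1 y1 v,
    [/\ cr n j u x1 y1 v, x = a n q u & s n j x = a n q v];
  ta_cr_in : forall n j u x y v, cr n j u x y v -> [/\ F u x, E x y & F y v];
  ta_cr_uniq : forall n j n' j' u x y v u' v', cr n j u x y v -> cr n' j' u' x y v' ->
    [/\ Tagged (fun n => 'I_(k n)) j = Tagged (fun n => 'I_(k n)) j', u = u' & v = v'];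
  ta_cr_asym : forall n j n' j' u x y v u' v', cr n j u x y v -> ~ cr n' j' u' y x v';
  ta_cr_edge : forall x y, X x -> E x y -> (exists n j u v, cr n j u x y v) \/
    (exists n j u v, cr n j u y x v);
  ta_cr_s : forall n j u x y v, X u -> cr n j u x y v -> s n j u = v
}.

(** * Cutting the forest into stable letters *)

Section Assembly.
Context {K : realType} {d : measure_display} {T : measurableType d}.
Context {mu : probability T K} (r : enumrel mu).
Local Open Scope ring_scope.
Local Notation h := (enum_key r).
Local Notation R := (rel_of r).
Local Notation pr := (prm mu).
Hypothesis atomless : forall x : T, pr [set x] = 0.
Variables (Q : nat -> finGroupType) (iota : forall n, {multiplicative Q n -> Q n.+1}).
Variables (X : set T) (F E : T -> T -> Prop) (act : forall n, Q n -> T -> T).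
Arguments act : clear implicits.
Hypothesis ts : tower_skeleton r iota X F E act.
Variable k : nat -> nat.
Hypothesis massE : mass r E =
  (\sum_(n <oo) ((k n)%:R / #|Q n|%:R)%:E + \sum_(n <oo) ((k n)%:R / #|Q n|%:R)%:E)%E.

Let mX := ts_meas ts.
Let FR x y : F x y -> R x y. Proof. exact: (ts_rel ts). Qed.
Let Fr x : F x x. Proof. by case: (ts_equiv ts) => h _ _; exact: h. Qed.
Let Ft x y z : F x y -> F y z -> F x z.
Proof. by case: (ts_equiv ts) => _ h _; exact: h. Qed.
Let Fs x y : F x y -> F y x. Proof. by case: (ts_equiv ts) => _ _; apply. Qed.
Let actF n q x : F x (act n q x). Proof. exact: (ts_act_rel ts). Qed.
Let XR x y : R x y -> X x -> X y. Proof. exact: (ts_inv ts). Qed.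
Let actX n q x : X x -> X (act n q x). Proof. by apply: XR; exact: FR. Qed.
Let mact n q d' (U : measurableType d') (g : U -> T) :
  measurable_fun setT g -> measurable_fun setT (fun u => act n q (g u)).
Proof. by move=> mg; apply: measurableT_comp mg; exact: (ts_act_meas ts). Qed.

Let actV n q x : X x -> act n q^-1%g (act n q x) = x.
Proof. by move=> Xx; rewrite -(ts_actM ts)// mulVg (ts_act1 ts). Qed.
Let actVK n q x : X x -> act n q (act n q^-1%g x) = x.
Proof. by move=> Xx; rewrite -(ts_actM ts)// mulgV (ts_act1 ts). Qed.

(** The point of smallest key is taken from each orbit; as the action on [X] is free, this gives a
    fundamental domain of [Q n]. *)
Definition fdom n := [set x | X x /\ forall q : Q n, ~ h (act n q x) < h x].
Let D := fdom.

Let mD n : measurable (D n).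
Proof.
apply: mand => //; apply: mall => q; apply: mnot; apply: mkeylt; last exact: measurable_id.
exact: mact.
Qed.

Let D_ex n x : X x -> exists q, D n (act n q x).
Proof.
move=> Xx; pose s q := h (act n q x).
have [q _ qmin] := @Order.TotalTheory.arg_minP _ K (Q n) 1%g xpredT s isT.
exists q; split; first exact: actX.
move=> q' lt; have := qmin (q' * q)%g isT.
by rewrite leNgt /s (ts_actM ts)// lt.
Qed.

Let D_uniq n q x : D n x -> D n (act n q x) -> q = 1%g.
Proof.
move=> [Xx h1] [_ h2]; apply: (ts_act_free ts Xx); apply: (key_eq (r := r)).
have := h1 q; have := h2 q^-1%g; rewrite actV// => /negP n1 /negP n2.
by apply/eqP; rewrite eq_le !leNgt n1 n2.
Qed.

Let cQ n : 0 < (#|Q n|%:R : K).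
Proof. by rewrite ltr0n; apply/card_gt0P; exists 1%g. Qed.

Let prD n : pr (D n) = (#|Q n|%:R)^-1.
Proof.
pose Xq q := [set x | X x /\ D n (act n q x)].
have mXq q : measurable (Xq q).
  by apply: mand => //; apply: (mset (mD n)); apply: mact; exact: measurable_id.
have eXq q : pr (Xq q) = pr (D n).
  have inj : {in Xq q &, injective (act n q)}.
    by move=> x y; rewrite !inE => -[Xx _] [Xy _] e; rewrite -(actV q Xx) e actV.
  have [_ e] := inj_image (mXq q) (ts_act_meas ts q) inj (fun x _ => FR (actF q x)).
  rewrite /prm -e; congr (fine (mu _)); apply/seteqP; split=> y.
    by move=> [x [_ Dx] <-].
  move=> Dy; have Xy := Dy.1; exists (act n q^-1%g y); last exact: actVK.
  by split; [exact: actX|rewrite actVK].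
have UX : X = \big[setU/set0]_(q <- enum (Q n)) Xq q.
  apply/seteqP; split=> x.
    move=> Xx; have [q Dq] := D_ex n Xx; rewrite -(bigcup_seq (enum (Q n))).
    by exists q => //=; rewrite mem_enum.
  by rewrite -(bigcup_seq (enum (Q n))) => -[q _ []].
have dX q q' x : Xq q x -> Xq q' x -> q = q'.
  move=> [Xx Dq] [_ Dq'].
  have : act n (q' * q^-1)%g (act n q x) = act n q' x.
    by rewrite (ts_actM ts) ?actV//; exact: actX.
  move=> e; have := @D_uniq n (q' * q^-1)%g (act n q x) Dq; rewrite e => /(_ Dq') e1.
  by rewrite -[q]mul1g -e1 mulgKV.
have : pr X = 1 by have := ts_conull ts; rewrite prC//; lra.
rewrite {1}UX (pr_bigU mu mXq dX (enum_uniq _)).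
rewrite (eq_bigr (fun=> pr (D n))); last by move=> q _; exact: eXq.
rewrite big_const_seq count_predT -cardE iter_addr_0 => e.
by apply: (mulIf (lt0r_neq0 (cQ n))); rewrite mulr_natr e mulVf ?lt0r_neq0.
Qed.

(** The key selects one orientation of every edge. *)
Let Ep x y := E x y /\ h x < h y.

Let mEp : mrel Ep.
Proof. by apply: mand; [exact: (ts_edge_meas ts)|apply: mkeylt; mfun]. Qed.

Let EpR x y : Ep x y -> R x y. Proof. by move=> [/(ts_edge_rel ts)]. Qed.

Let E_irr x y : E x y -> Ep x y \/ Ep y x.
Proof.
move=> Exy; have [lt|lt|e] := ltgtP (h x) (h y); [by left|right|].
  by split=> //; exact: (ts_edge_sym ts).
have exy := key_eq e; exfalso; rewrite exy in Exy.
by apply: (ts_bridges ts Exy); exact: conn_refl.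
Qed.

Let mass_Ep : mass r Ep = (\sum_(n <oo) ((k n)%:R / #|Q n|%:R)%:E)%E.
Proof.
have e : (mass r E = mass r Ep + mass r Ep)%E.
  rewrite -{2}(mass_tr mEp EpR) -massU//; last 2 first.
  - exact: mrel_tr.
  - by move=> x y [_ h1] [_ h2]; have := lt_trans h1 h2; rewrite ltxx.
  apply: eq_mass => x y _; split; first exact: E_irr.
  by move=> [[]//|[/(ts_edge_sym ts)]].
have p1 := mass_ge0 r Ep.
have p2 : (0 <= \sum_(n <oo) ((k n)%:R / #|Q n|%:R : K)%:E)%E.
  by apply: nneseries_ge0 => n _ _; rewrite lee_fin divr_ge0.
move: e; rewrite massE; move: p1 p2; set a := mass r Ep; set b := (\sum_(n <oo) _)%E.
case: a => [a| |] //; case: b => [b| |] //.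
by rewrite -!EFinD => _ _ [] e; congr EFin; lra.
Qed.

(** The tails of the oriented edges in the p-th partial bijection. They are to be matched with the
    family [B], which lists the fundamental domain of [Q n] once for each of its [k n] letters and
    has the same total measure. *)
Let A p := [set x | exists y, Ep x y /\ piece r p x y].
(** The test [pickle (n, j) == q] discards non-canonical codes, so that no copy is listed twice. *)
Let B q : set T := if @unpickle (nat * nat)%type q is Some (n, j) then
  (if (pickle (n, j) == q) && (j < k n)%N then D n else set0) else set0.

Let BE n j : (j < k n)%N -> B (pickle (n, j)) = D n.
Proof. by move=> jn; rewrite /B pickleK eqxx jn. Qed.

Let mEpp p : mrel (fun x y => Ep x y /\ piece r p x y).
Proof. by apply: mrelI => //; exact: mrel_piece. Qed.

Let mA p : measurable (A p).
Proof. by apply: (mrel_dom (r := r) (mEpp p)) => x y [/EpR]. Qed.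

Let mB q : measurable (B q).
Proof. by rewrite /B; case: unpickle => // -[n j]; case: ifP => // _; exact: mD. Qed.

Let sumB : (\sum_(q <oo) mu (B q) = \sum_(n <oo) ((k n)%:R / #|Q n|%:R)%:E)%E.
Proof.
pose G n j q : \bar K := if q == pickle (n, j) then (if (j < k n)%N then mu (D n) else 0%E) else 0%E.
have G0 n j q : (0 <= G n j q)%E by rewrite /G; case: ifP => // _; case: ifP.
have e q : (mu (B q) = \sum_(n <oo) \sum_(j <oo) G n j q)%E.
  rewrite /B; case eq: unpickle => [[n j]|]; last first.
    rewrite measure0 eseries0// => n _ _; rewrite eseries0// => j _ _; rewrite /G.
    by case: eqP => // eq'; move: eq; rewrite eq' pickleK.
  have [pe|pn] := eqVneq (pickle (n, j)) q; last first.
    rewrite measure0 eseries0// => n' _ _; rewrite eseries0// => j' _ _; rewrite /G.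
    case: eqP => // eq'; move: eq; rewrite eq' pickleK => -[e1 e2].
    by move: pn; rewrite eq' e1 e2 eqxx.
  under eq_eseriesr => n' _.
    under eq_eseriesr => j' _.
      rewrite (_ : G n' j' q = if j' == j then (if n' == n then
         (if (j < k n)%N then mu (D n) else 0%E) else 0%E) else 0%E); last first.
        rewrite /G -pe (inj_eq (pcan_inj pickleK)) xpair_eqE [n == n']eq_sym [j == j']eq_sym.
        by case: (n' =P n) => [->|_] /=; case: (j' =P j) => [e1|_] /=; rewrite ?e1.
      over.
    rewrite sum_single; over.
  by rewrite sum_single /=; case: ifP => // _; exact: measure0.
under eq_eseriesr => q _ do rewrite e.
rewrite nneseries_interchange; last by move=> q n; apply: nneseries_ge0.
apply: eq_eseriesr => n _; rewrite nneseries_interchange//.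
under eq_eseriesr => j _ do rewrite sum_single.
have muD : mu (D n) = ((#|Q n|%:R)^-1)%:E by rewrite -prD; exact: prE.
apply/cvg_lim => //; apply: cvg_near_cst; exists (k n) => // m /= km.
rewrite (eq_bigr (fun j => if (j < k n)%N then ((#|Q n|%:R)^-1)%:E else 0%E)); last first.
  by move=> j _; rewrite muD.
rewrite -big_mkcond /= big_nat_cond.
rewrite (eq_bigl (fun j => (0 <= j < k n)%N)); last first.
  by move=> j /=; lia.
rewrite -(big_nat_widen 0 (k n) m predT (fun=> ((#|Q n|%:R)^-1)%:E : \bar K))//.
by rewrite sumEFin sumr_const_nat subn0 mulr_natl.
Qed.

Lemma mpiecewise d' (U : measurableType d') (Y : set U) (g : U -> U) : measurable Y ->
  measurable_fun setT g ->
  measurable_fun setT (fun z => if pselect (Y z) then g z else z).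
Proof.
move=> mY mg _ V mV; rewrite setTI.
rewrite (_ : _ @^-1` V = [set z | (Y z /\ V (g z)) \/ (~ Y z /\ V z)]).
  apply: mor; apply: mand => //; first exact: (mset mV).
  exact: measurableC.
apply/seteqP; split=> z /=; case: pselect => h' /=.
- by left.
- by right.
- by move=> [[]|[]].
- by move=> [[]|[]].
Qed.

Section Refined.
Variables (A' B' : nat -> nat -> set T) (M N : nat -> nat -> T -> T -> Prop).
Hypothesis AB : forall p q, [/\ measurable (A' p q), measurable (B' p q),
  A' p q `<=` A p, B' p q `<=` B q & pr (A' p q) = pr (B' p q)].
Hypothesis Adis : forall p q q' x, A' p q x -> A' p q' x -> q = q'.
Hypothesis Bdis : forall p p' q x, B' p q x -> B' p' q x -> p = p'.
Hypothesis Acov : forall p, pr (A p `\` \bigcup_q A' p q) = 0.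
Hypothesis Bcov : forall q, pr (B q `\` \bigcup_p B' p q) = 0.

Definition shifted p q := [set y | exists x, A' p q x /\ (Ep x y /\ piece r p x y)].
Let C := shifted.

Hypothesis hM : forall p q, matches (mu := mu) F (B' p q) (A' p q) (M p q).
Hypothesis hN : forall p q, matches (mu := mu) F (C p q) (B' p q) (N p q).

(** The route of a letter: from [u] in the fundamental domain inside [F] to the tail [x], along the
    edge to [y], then inside [F] back to [v] in the fundamental domain. *)
Let cross q u x y v := exists p, M p q u x /\ ((Ep x y /\ piece r p x y) /\ N p q y v).

Let M_in p q u x : M p q u x -> [/\ B' p q u, A' p q x & F u x].
Proof. by have [_ e _ _ _] := hM p q; exact: e. Qed.
Let N_in p q y v : N p q y v -> [/\ C p q y, B' p q v & F y v].
Proof. by have [_ e _ _ _] := hN p q; exact: e. Qed.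

Let cross_in q u x y v : cross q u x y v -> [/\ F u x, E x y & F y v].
Proof. by move=> [p [/M_in[_ _ ux] [[[Exy _] _] /N_in[_ _ yv]]]]. Qed.

Let cross_B q u x y v : cross q u x y v -> B q u /\ B q v.
Proof.
move=> [p [/M_in[Bu _ _] [_ /N_in[_ Bv _]]]]; have [_ _ _ sB _] := AB p q.
by split; exact: sB.
Qed.

Let cross_fun q u x y v x' y' v' : cross q u x y v -> cross q u x' y' v' -> v = v'.
Proof.
move=> [p [m [[_ pc] n]]] [p' [m' [[_ pc'] n']]].
have [Bu _ _] := M_in m; have [Bu' _ _] := M_in m'.
have pp := Bdis Bu Bu'; subst p'.
have [_ _ [mf _] _ _] := hM p q; have [_ _ [nf _] _ _] := hN p q.
have xx := mf _ _ _ m m'; subst x'; have yy := piece_fun pc pc'; subst y'.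
exact: nf n n'.
Qed.

Let cross_inj q u x y v u' x' y' : cross q u x y v -> cross q u' x' y' v -> u = u'.
Proof.
move=> [p [m [[_ pc] n]]] [p' [m' [[_ pc'] n']]].
have [_ Bv _] := N_in n; have [_ Bv' _] := N_in n'.
have pp := Bdis Bv Bv'; subst p'.
have [_ _ [_ mi] _ _] := hM p q; have [_ _ [_ ni] _ _] := hN p q.
have yy := ni _ _ _ n n'; subst y'; have xx := piece_inj pc pc'; subst x'.
exact: mi m m'.
Qed.

Let cross_uniq q q' u x y v u' v' : cross q u x y v -> cross q' u' x y v' ->
  [/\ q = q', u = u' & v = v'].
Proof.
move=> [p [m [[_ pc] n]]] [p' [m' [[_ pc'] n']]].
have pp := piece_uniq pc pc'; subst p'.
have [_ Ax _] := M_in m; have [_ Ax' _] := M_in m'.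
have qq := Adis Ax Ax'; subst q'.
have [_ _ [_ mi] _ _] := hM p q; have [_ _ [nf _] _ _] := hN p q.
by split=> //; [exact: mi m m'|exact: nf n n'].
Qed.

Let mC p q : measurable (C p q).
Proof.
have [mA' _ _ _ _] := AB p q.
have mG : mrel (fun x y => A' p q x /\ (Ep x y /\ piece r p x y)).
  by apply: mand; [apply: (mset mA'); mfun|exact: mEpp].
by apply: (mrel_ran (r := r) mG) => x y [_ [/EpR]].
Qed.

Let MF p q u x : M p q u x -> R u x. Proof. by move=> /M_in[_ _ /FR]. Qed.
Let NF p q u x : N p q u x -> R u x. Proof. by move=> /N_in[_ _ /FR]. Qed.
Let mM p q : mrel (M p q). Proof. by have [] := hM p q. Qed.
Let mN p q : mrel (N p q). Proof. by have [] := hN p q. Qed.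

Let st q u v := exists x y, cross q u x y v.

Let stR q u v : st q u v -> R u v.
Proof.
move=> [x [y /cross_in[/FR ux /(ts_edge_rel ts) xy /FR yv]]].
exact: rel_trans ux (rel_trans xy yv).
Qed.

Let mst q : mrel (st q).
Proof.
apply: (mexR (r := r) (g := fun u : T * T => u.1)).
  by move=> u x [y /cross_in[/FR]].
move=> i; apply: (mexR (r := r) (g := fun u : T * T => u.2)).
  by move=> u y /cross_in[_ _ /FR/rel_sym].
move=> j; apply: mexn => p; apply: mand; first by apply: (mrelP (mM p q)); mfun.
apply: mand; last by apply: (mrelP (mN p q)); mfun.
by apply: mand; [apply: (mrelP mEp)|apply: (mrelP (mrel_piece r p))]; mfun.
Qed.

Section Domain.
Variable X2 : set T.
Hypotheses (mX2 : measurable X2) (iX2 : invariant_set r X2) (X20 : pr (~` X2) = 0).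
Hypotheses (X2X : X2 `<=` X)
  (X2B : forall q x, X2 x -> B q x -> exists p, B' p q x)
  (X2A : forall p x, X2 x -> A p x -> exists q, A' p q x)
  (X2M : forall p q u, X2 u -> B' p q u -> exists x, M p q u x)
  (X2M' : forall p q x, X2 x -> A' p q x -> exists u, M p q u x)
  (X2N : forall p q y, X2 y -> C p q y -> exists v, N p q y v)
  (X2N' : forall p q v, X2 v -> B' p q v -> exists y, N p q y v).

Let cross_dom q u : X2 u -> B q u -> exists v, st q u v.
Proof.
move=> Xu /(X2B Xu)[p Bu]; have [x m] := X2M Xu Bu; have [_ Ax ux] := M_in m.
have [_ _ sA _ _] := AB p q; have [y [Exy pc]] := sA _ Ax.
have Xy : X2 y by apply: iX2 (iX2 (FR ux) Xu); exact: EpR.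
have [|v n] := X2N (p := p) (q := q) Xy; first by exists x.
by exists v, x, y, p.
Qed.

Let cross_ran q v : X2 v -> B q v -> exists u, st q u v.
Proof.
move=> Xv /(X2B Xv)[p Bv]; have [y n] := X2N' Xv Bv.
have [[x [Ax [Exy pc]]] _ yv] := N_in n.
have Xx : X2 x by apply: iX2 Xv; apply: rel_sym; apply: rel_trans (EpR Exy) (FR yv).
by have [u m] := X2M' Xx Ax; exists u, x, y, p.
Qed.

Let cross_edge x y : X2 x -> Ep x y -> exists q u v, cross q u x y v.
Proof.
move=> Xx Exy; have [p pc] := pieceP (EpR Exy).
have [|q Ax] := X2A (p := p) Xx; first by exists y.
have [u m] := X2M' Xx Ax.
have [|v n] := X2N (p := p) (q := q) (iX2 (EpR Exy) Xx); first by exists x.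
by exists q, u, v, p.
Qed.

(** The [Q n]-equivariant extension: the translate of [z] in the fundamental domain is moved by [st]
    and translated back by the same group element. *)
Let ext n (j : nat) z z' := X2 z /\ exists g : Q n, st (pickle (n, j)) (act n g z) (act n g z').

Let actR n q x : R x (act n q x). Proof. exact: FR. Qed.

Let extR (n j : nat) z z' : ext n j z z' -> R z z'.
Proof.
move=> [Xz [g /stR h1]]; apply: rel_trans (actR g z) _; apply: rel_trans h1 _.
exact: rel_sym.
Qed.

Let st_D (n j : nat) u v : st (pickle (n, j)) u v -> D n u /\ D n v.
Proof.
move=> [x [y /cross_B]]; rewrite /B pickleK eqxx /=; case: ifP => // _ [].
by [].
Qed.

Let D_act n (g g' : Q n) z : X z -> D n (act n g z) -> D n (act n g' z) -> g = g'.
Proof.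
move=> Xz D1 D2; have := @D_uniq n (g' * g^-1)%g _ D1.
rewrite (ts_actM ts) ?actV//; last exact: actX.
by move=> /(_ D2) e; rewrite -[g]mul1g -e mulgKV.
Qed.

Let ext_fun (n j : nat) z z' z'' : ext n j z z' -> ext n j z z'' -> z' = z''.
Proof.
move=> h1 h2; have X1 := XR (extR h1) (X2X h1.1); have X3 := XR (extR h2) (X2X h2.1).
move: h1 h2 => [Xz [g s1]] [_ [g' s2]].
have [D1 _] := st_D s1; have [D2 _] := st_D s2.
have gg := D_act (X2X Xz) D1 D2; subst g'.
have [x [y c1]] := s1; have [x' [y' c2]] := s2.
by rewrite -(actV g X1) (cross_fun c1 c2) actV.
Qed.

Let ext_inj (n j : nat) z z' z'' : ext n j z z'' -> ext n j z' z'' -> z = z'.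
Proof.
move=> h1 h2; have X1 := X2X h1.1; have X3 := X2X h2.1.
have X4 := XR (extR h1) (X2X h1.1).
move: h1 h2 => [Xz [g s1]] [_ [g' s2]].
have [_ D1] := st_D s1; have [_ D2] := st_D s2.
have gg := D_act X4 D1 D2; subst g'.
have [x [y c1]] := s1; have [x' [y' c2]] := s2.
by rewrite -(actV g X1) (cross_inj c1 c2) actV.
Qed.

Let ext_dom (n j : nat) z : (j < k n)%N -> X2 z -> exists z', ext n j z z'.
Proof.
move=> jn Xz; have [g Dg] := D_ex n (X2X Xz).
have [||v sv] := @cross_dom (pickle (n, j)) (act n g z).
- exact: iX2 (actR g z) Xz.
- by rewrite BE.
exists (act n g^-1%g v); split=> //; exists g; rewrite actVK//.
by apply: X2X; apply: iX2 (iX2 (actR g z) Xz); exact: stR sv.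
Qed.

Let ext_ran (n j : nat) z : (j < k n)%N -> X2 z -> exists z', ext n j z' z.
Proof.
move=> jn Xz; have [g Dg] := D_ex n (X2X Xz).
have Xg : X2 (act n g z) by exact: iX2 (actR g z) Xz.
have [||v sv] := @cross_ran (pickle (n, j)) (act n g z) => //.
  by rewrite BE.
have Xv : X2 v by apply: iX2 Xg; apply: rel_sym; exact: stR sv.
exists (act n g^-1%g v); split; first exact: iX2 (actR _ _) Xv.
by exists g; rewrite actVK//; exact: X2X.
Qed.

Let ext_act n (j : nat) g z z' : ext n j z z' -> ext n j (act n g z) (act n g z').
Proof.
move=> e; have Xz' := XR (extR e) (X2X e.1); move: e => [Xz [g' s1]].
split; first exact: iX2 (actR _ _) Xz.
exists (g' * g^-1)%g; have Xz1 := X2X Xz.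
by rewrite !(ts_actM ts) ?actV//; exact: actX.
Qed.

Let mext (n j : nat) d' (U : measurableType d') (g1 g2 : U -> T) :
  measurable_fun setT g1 -> measurable_fun setT g2 ->
  measurable [set u | ext n j (g1 u) (g2 u)].
Proof.
move=> m1 m2; apply: mand; first exact: (mset mX2).
by apply: mex => g; apply: (mrelP (mst _)); exact: mact.
Qed.

(** On [X2] the relation [ext] is the graph of a bijection commuting with [Q n]. All maps are set to
    the identity off [X2], so that the action laws hold everywhere. *)
Lemma refined_action : exists a s si cr, @tower_action K d T mu r Q iota k X2 F E a s si cr.
Proof.
have /choice[s Hs] : forall nj : {n & 'I_(k n)}, exists s : T -> T,
    [/\ measurable_fun setT s, forall z, R z (s z),
      forall z, X2 z -> ext (tag nj) (tagged nj) z (s z) & forall z, ~ X2 z -> s z = z].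
  move=> [n j] /=.
  have [|u y|i|s [m1 m2 m3 m4]] := mpick (r := r) (g := fun z : T => z) (Q := ext n j).
  - exact: measurable_id.
  - exact: extR.
  - by apply: mext; mfun.
  exists s; split=> //; first by move=> z Xz; apply: m3; exact: ext_dom.
  by move=> z nX; apply: m4 => -[y []].
have /choice[si Hsi] : forall nj : {n & 'I_(k n)}, exists s : T -> T,
    [/\ measurable_fun setT s, forall z, R z (s z),
      forall z, X2 z -> ext (tag nj) (tagged nj) (s z) z & forall z, ~ X2 z -> s z = z].
  move=> [n j] /=.
  have [|u y|i|s' [m1 m2 m3 m4]] := mpick (r := r) (g := fun z : T => z)
    (Q := fun z z' => ext n j z' z).
  - exact: measurable_id.
  - by move=> /extR; exact: rel_sym.
  - by apply: mext; mfun.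
  exists s'; split=> //; first by move=> z Xz; apply: m3; exact: ext_ran.
  move=> z nX; apply: m4 => -[y e]; apply: nX; exact: iX2 (extR e) e.1.
pose tg n (j : 'I_(k n)) := Tagged (fun n => 'I_(k n)) j.
pose a n q z := if pselect (X2 z) then act n q z else z.
have aE n q z : X2 z -> a n q z = act n q z by rewrite /a; case: pselect.
have aN n q z : ~ X2 z -> a n q z = z by rewrite /a; case: pselect.
have Xact n q z : X2 z -> X2 (act n q z) by exact: iX2.
have Xs nj z : X2 z -> X2 (s nj z) by have [_ e _ _] := Hs nj; exact: iX2.
have Xsi nj z : X2 z -> X2 (si nj z) by have [_ e _ _] := Hsi nj; exact: iX2.
have sN nj z : ~ X2 z -> s nj z = z by have [_ _ _ e] := Hs nj; exact: e.
have siN nj z : ~ X2 z -> si nj z = z by have [_ _ _ e] := Hsi nj; exact: e.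
have sE (nj : {n & 'I_(k n)}) z : X2 z -> ext (tag nj) (tagged nj) z (s nj z) by have [_ _ e _] := Hs nj; exact: e.
have siE (nj : {n & 'I_(k n)}) z : X2 z -> ext (tag nj) (tagged nj) (si nj z) z by have [_ _ e _] := Hsi nj; exact: e.
have s_ext n (j : 'I_(k n)) z z' : ext n j z z' -> s (tg n j) z = z'.
  by move=> e; have e' := sE (tg n j) z e.1; exact: ext_fun e' e.
exists a, (fun n j => s (tg n j)), (fun n j => si (tg n j)), (fun n j => cross (pickle (n, j : nat))).
split=> //.
- exact: ts_edge_sym ts.
- by move=> x y /X2X; exact: (ts_gen ts).
- exact: ts_bridges ts.
- by move=> n q; apply: mpiecewise => //; exact: (ts_act_meas ts).
- by move=> n q x; rewrite /a; case: pselect => h' /=; [exact: actF|exact: Fr].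
- exact: ts_edge_rel ts.
- move=> n x; rewrite /a; case: pselect => h' //=; exact: (ts_act1 ts _ (X2X h')).
- move=> n q q' x; have [Xx|nX] := pselect (X2 x); last by rewrite !aN.
  by rewrite !aE//; [exact: (ts_actM ts _ _ (X2X Xx))|exact: Xact].
- move=> n q x; have [Xx|nX] := pselect (X2 x); last by rewrite !aN.
  by rewrite !aE//; exact: (ts_act_iota ts _ (X2X Xx)).
- by move=> n q x Xx; rewrite aE//; exact: (ts_act_free ts (X2X Xx)).
- move=> x y Xx xy; have [n [q e]] := ts_act_trans ts (X2X Xx) xy.
  by exists n, q; rewrite aE.
- by move=> n j; have [] := Hs (tg n j).
- by move=> n j; have [] := Hsi (tg n j).
- by move=> n j; have [] := Hs (tg n j).
- by move=> n j; have [] := Hsi (tg n j).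
- move=> n j x; have [Xx|nX] := pselect (X2 x); last by rewrite sN// siN.
  exact: ext_inj (siE (tg n j) _ (Xs _ _ Xx)) (sE (tg n j) _ Xx).
- move=> n j x; have [Xx|nX] := pselect (X2 x); last by rewrite siN// sN.
  exact: ext_fun (sE (tg n j) _ (Xsi _ _ Xx)) (siE (tg n j) _ Xx).
- move=> n j q x; have [Xx|nX] := pselect (X2 x); last by rewrite aN// sN// aN.
  rewrite !aE//; last exact: Xs.
  by apply: s_ext; apply: ext_act; exact: (sE (tg n j)).
- move=> n j x Xx; have e := sE (tg n j) x Xx.
  have Xs' := Xs (tg n j) x Xx; have [_ [g [x1 [y1 c]]]] := e.
  exists g^-1%g, (act n g x), x1, y1, (act n g (s (tg n j) x)); split=> //.
    by rewrite aE ?actV//; [exact: X2X|exact: Xact].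
  by rewrite aE ?actV//; [exact: X2X|exact: Xact].
- by move=> n j u x y v; exact: cross_in.
- move=> n j n' j' u x y v u' v' c c'; have [e -> ->] := cross_uniq c c'.
  split=> //; have /eqP := pcan_inj pickleK e.
  rewrite xpair_eqE => /andP[/eqP en /eqP ej]; subst n'.
  by congr existT; exact: val_inj.
- move=> n j n' j' u x y v u' v' [p [_ [[[_ lt] _] _]]] [p' [_ [[[_ lt'] _] _]]].
  by have := lt_trans lt lt'; rewrite ltxx.
- have ex x y : X2 x -> Ep x y -> exists n (j : 'I_(k n)) u v, cross (pickle (n, j : nat)) u x y v.
    move=> Xx Exy; have [q [u [v c]]] := cross_edge Xx Exy.
    have [Bu _] := cross_B c; move: Bu; rewrite /B.
    case: unpickle => // -[n j]; case: ifP => // /andP[/eqP eq jn] _.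
    by exists n, (Ordinal jn), u, v; rewrite /= eq.
  move=> x y Xx Exy; case: (E_irr Exy) => h'; [left|right]; first exact: ex.
  by apply: ex h'; exact: iX2 (ts_edge_rel ts Exy) Xx.
- move=> n j u x y v Xu c; apply: s_ext; split=> //; exists 1%g.
  have Xv : X v.
    by apply: XR (X2X Xu); apply: (stR (q := pickle (n, j : nat))); exists x, y.
  by rewrite (ts_act1 ts _ (X2X Xu)) (ts_act1 ts _ Xv); exists x, y.
Qed.

End Domain.

(** The six null sets are the places where one of the two partitions or one of the matchings is not
    total; the saturation of their union with the complement of [X] is removed. *)
Lemma refined_domain : exists X2 a s si cr, @tower_action K d T mu r Q iota k X2 F E a s si cr.
Proof.
pose Z0 := \bigcup_q (B q `\` \bigcup_p B' p q).
pose Z1 := \bigcup_p (A p `\` \bigcup_q A' p q).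
pose Z2 := \bigcup_p \bigcup_q (B' p q `\` [set u | exists x, M p q u x]).
pose Z3 := \bigcup_p \bigcup_q (A' p q `\` [set x | exists u, M p q u x]).
pose Z4 := \bigcup_p \bigcup_q (C p q `\` [set y | exists v, N p q y v]).
pose Z5 := \bigcup_p \bigcup_q (B' p q `\` [set v | exists y, N p q y v]).
have mA' p q : measurable (A' p q) by have [] := AB p q.
have mB' p q : measurable (B' p q) by have [] := AB p q.
have m0 q : measurable (B q `\` \bigcup_p B' p q).
  by apply: measurableD => //; exact: bigcupT_measurable.
have m1 p : measurable (A p `\` \bigcup_q A' p q).
  by apply: measurableD => //; exact: bigcupT_measurable.
have mdM p q : measurable [set u | exists x, M p q u x] := mrel_dom (r := r) (mM p q) (@MF p q).
have mrM p q : measurable [set x | exists u, M p q u x] := mrel_ran (r := r) (mM p q) (@MF p q).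
have mdN p q : measurable [set u | exists x, N p q u x] := mrel_dom (r := r) (mN p q) (@NF p q).
have mrN p q : measurable [set x | exists u, N p q u x] := mrel_ran (r := r) (mN p q) (@NF p q).
have two (G : nat -> nat -> set T) : (forall p q, measurable (G p q)) ->
    (forall p q, pr (G p q) = 0) -> measurable (\bigcup_p \bigcup_q G p q) /\
    pr (\bigcup_p \bigcup_q G p q) = 0.
  move=> mG G0; have mg p : measurable (\bigcup_q G p q) by exact: bigcupT_measurable.
  split; first exact: bigcupT_measurable.
  by apply: pr_bigcup0 => // p; exact: pr_bigcup0.
have [mZ2 Z20] : measurable Z2 /\ pr Z2 = 0.
  by apply: two => p q; [exact: measurableD|have [_ _ _ h' _] := hM p q].
have [mZ3 Z30] : measurable Z3 /\ pr Z3 = 0.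
  by apply: two => p q; [exact: measurableD|have [_ _ _ _ h'] := hM p q].
have [mZ4 Z40] : measurable Z4 /\ pr Z4 = 0.
  by apply: two => p q; [exact: measurableD|have [_ _ _ h' _] := hN p q].
have [mZ5 Z50] : measurable Z5 /\ pr Z5 = 0.
  by apply: two => p q; [exact: measurableD|have [_ _ _ _ h'] := hN p q].
have mZ0 : measurable Z0 by exact: bigcupT_measurable.
have mZ1 : measurable Z1 by exact: bigcupT_measurable.
have Z00 : pr Z0 = 0 by exact: pr_bigcup0.
have Z10 : pr Z1 = 0 by exact: pr_bigcup0.
have null_union (G H : set T) : measurable G /\ pr G = 0 -> measurable H /\ pr H = 0 ->
    measurable (G `|` H) /\ pr (G `|` H) = 0.
  move=> [mG G0] [mH H0]; split; first exact: measurableU.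
  apply/eqP; rewrite eq_le pr_ge0 andbT; apply: (le_trans (prU_le mu mG mH)).
  by rewrite G0 H0 addr0.
pose Z := ~` X `|` (Z0 `|` (Z1 `|` (Z2 `|` (Z3 `|` (Z4 `|` Z5))))).
have [mZ Z_0] : measurable Z /\ pr Z = 0.
  apply: (null_union _ _); first by split; [exact: measurableC|exact: (ts_conull ts)].
  apply: (null_union _ _) => //; apply: (null_union _ _) => //; apply: (null_union _ _) => //.
  by apply: (null_union _ _) => //; apply: (null_union _ _).
have [X2 [mX2 iX2 X20 X2Z]] := conull_invariant r mZ Z_0.
have out (G H : set T) x : X2 x -> (G `\` H) x -> G `\` H `<=` Z -> False.
  by move=> /X2Z nz h' sub; apply: nz; exact: sub.
exists X2; apply: refined_action => //.
- by move=> x /X2Z nz; apply: contrapT => nX; apply: nz; left.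
- move=> q x Xx Bx; apply: contrapT => n; apply: (X2Z _ Xx); right; left; exists q => //.
  by split=> // -[p _ h']; apply: n; exists p.
- move=> p x Xx Bx; apply: contrapT => n; apply: (X2Z _ Xx); right; right; left; exists p => //.
  by split=> // -[q _ h']; apply: n; exists q.
- move=> p q x Xx Bx; apply: contrapT => n; apply: (X2Z _ Xx); right; right; right; left.
  by exists p => //; exists q.
- move=> p q x Xx Bx; apply: contrapT => n; apply: (X2Z _ Xx); do 4 right; left.
  by exists p => //; exists q.
- move=> p q x Xx Bx; apply: contrapT => n; apply: (X2Z _ Xx); do 5 right; left.
  by exists p => //; exists q.
- move=> p q x Xx Bx; apply: contrapT => n; apply: (X2Z _ Xx); do 6 right.
  by exists p => //; exists q.
Qed.

End Refined.

Lemma assembly : exists X2 a s si cr, @tower_action K d T mu r Q iota k X2 F E a s si cr.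
Proof.
have eAB : (\sum_(p <oo) mu (A p) = \sum_(q <oo) mu (B q))%E.
  by rewrite sumB -mass_Ep (mass_pieces mEp EpR).
have [A' [B' [AB Adis Bdis Acov Bcov]]] := refine_partition r atomless mA mB eAB.
have mA' p q : measurable (A' p q) by have [] := AB p q.
have mB' p q : measurable (B' p q) by have [] := AB p q.
have prAB' p q : pr (B' p q) = pr (A' p q) by have [_ _ _ _ ->] := AB p q.
have mtch A1 B1 : measurable A1 -> measurable B1 -> pr A1 = pr B1 -> exists M, matches (mu := mu) F A1 B1 M.
  move=> m1 m2 e; exact: (matching (r := r) (ts_equiv ts) (ts_F_meas ts) (ts_rel ts) (ts_erg ts)).
have /choice[M hM] : forall p, exists M, forall q, matches (mu := mu) F (B' p q) (A' p q) (M q).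
  by move=> p; have [M hM] := choice (fun q => mtch _ _ (mB' p q) (mA' p q) (prAB' p q)); exists M.
have mG p q : mrel (fun x y => A' p q x /\ (Ep x y /\ piece r p x y)).
  by apply: mand; [apply: (mset (mA' p q)); mfun|exact: mEpp].
have GR p q x y : A' p q x /\ (Ep x y /\ piece r p x y) -> R x y by move=> [_ [/EpR]].
have mC p q : measurable (shifted A' p q) by exact: (mrel_ran (r := r) (mG p q) (@GR p q)).
have prC' p q : pr (shifted A' p q) = pr (B' p q).
  rewrite prAB' /prm (pbij_measure (r := r) (mG p q) (@GR p q)); last 2 first.
  - by move=> x y y' [_ [_ h1]] [_ [_]]; exact: piece_fun.
  - by move=> x x' y [_ [_ h1]] [_ [_]]; exact: piece_inj.
  congr (fine (mu _)); apply/seteqP; split=> x; first by move=> [y []].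
  move=> Ax; have [_ _ sA _ _] := AB p q; have [y hy] := sA _ Ax; by exists y.
have /choice[N hN] : forall p, exists N, forall q,
    matches (mu := mu) F (shifted A' p q) (B' p q) (N q).
  by move=> p; have [N hN] := choice (fun q => mtch _ _ (mC p q) (mB' p q) (prC' p q)); exists N.
exact: (refined_domain AB Adis Bdis Acov Bcov hM hN).
Qed.

End Assembly.

(** * Actions of the tower group *)

Section Actions.
Variable T : Type.

Definition is_act (G : groupType) (a : G -> T -> T) :=
  (forall x, a 1%g x = x) /\ (forall g h x, a (g * h)%g x = a g (a h x)).

Lemma is_actV (G : groupType) (a : G -> T -> T) g x : is_act a -> a g^-1%g (a g x) = x.
Proof. by move=> [a1 aM]; rewrite -aM mulVg a1. Qed.

Lemma is_actVK (G : groupType) (a : G -> T -> T) g x : is_act a -> a g (a g^-1%g x) = x.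
Proof. by move=> [a1 aM]; rewrite -aM mulgV a1. Qed.

(** Words act letter by letter; relations and cancellations do not change this action, so any
    representative of a group element may be used. *)
Lemma presented_act (S : choiceType) (rel : word S -> word S -> Prop) (phi psi : S -> T -> T) :
  (forall s x, psi s (phi s x) = x) -> (forall s x, phi s (psi s x) = x) ->
  let ev w x := foldr (fun l y => (if l.2 then phi l.1 else psi l.1) y) x w in
  (forall u v, rel u v -> ev u =1 ev v) ->
  exists a : presented rel -> T -> T, is_act a /\
    forall s x, a (presented_gen rel s) x = phi s x.
Proof.
move=> K1 K2 ev relE.
have ev_cat u v x : ev (u ++ v) x = ev u (ev v x) by rewrite /ev foldr_cat.
have evE u v : word_eq rel u v -> ev u =1 ev v.
  elim=> [w x //|w w' _ IH x|w w' w'' _ IH1 _ IH2 x|w w1 w' w1' _ IH1 _ IH2 x|[s []] x|w w' h x] /=.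
  - by rewrite IH.
  - by rewrite IH1 IH2.
  - by rewrite !ev_cat IH2 IH1.
  - exact: K2.
  - exact: K1.
  - exact: relE.
exists (fun g => ev (word_repr g)); split; last first.
  by move=> s x; rewrite (evE _ _ (word_eq_repr rel [:: (s, true)])).
split=> [x|g h x]; first by rewrite (evE _ _ (word_eq_repr rel [::])).
by rewrite (evE _ _ (word_eq_repr rel (word_repr g ++ word_repr h))) ev_cat.
Qed.

Lemma product_act (A B : groupType) (aA : A -> T -> T) (aB : B -> T -> T) :
  is_act aA -> is_act aB -> (forall f q x, aB f (aA q x) = aA q (aB f x)) ->
  is_act (fun (p : A * B) x => aA p.1 (aB p.2 x)).
Proof.
move=> [a1 aM] [b1 bM] comm; split=> [x|g h x] /=; first by rewrite b1 a1.
by rewrite bM aM comm.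
Qed.

Lemma amalgam_act (A B C : groupType) (f : {multiplicative A -> B}) (g : {multiplicative A -> C})
    (aB : B -> T -> T) (aC : C -> T -> T) : is_act aB -> is_act aC ->
  (forall q x, aB (f q) x = aC (g q) x) ->
  exists a : amalgam f g -> T -> T, [/\ is_act a,
    forall b x, a (amalgam_inl f g b) x = aB b x & forall c x, a (amalgam_inr f g c) x = aC c x].
Proof.
move=> hB hC e.
have [|||a [ha aE]] := @presented_act (B + C)%type (amalgam_rel f g)
  (fun s => match s with inl b => aB b | inr c => aC c end)
  (fun s => match s with inl b => aB b^-1%g | inr c => aC c^-1%g end).
- by case=> [b|c] x; exact: is_actV.
- by case=> [b|c] x; exact: is_actVK.
- by move=> u v [b b'|c c'|q] x /=; [case: hB|case: hC|].
by exists a; split=> // [b x|c x]; rewrite aE.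
Qed.

Lemma union_act (G : nat -> groupType) (emb : forall n, {multiplicative G n -> G n.+1})
    (aG : forall n, G n -> T -> T) : (forall n, is_act (@aG n)) ->
  (forall n g x, aG n.+1 (emb n g) x = aG n g x) ->
  exists a : union_group emb -> T -> T, is_act a /\
    forall n (g : G n) x, a (presented_gen (union_rel emb) (Tagged G g)) x = aG n g x.
Proof.
move=> hG e.
have [|||a [ha aE]] := @presented_act {n & G n} (union_rel emb)
  (fun s => aG (tag s) (tagged s)) (fun s => aG (tag s) (tagged s)^-1%g).
- by move=> s x; apply: is_actV; exact: hG.
- by move=> s x; apply: is_actVK; exact: hG.
- by move=> u v [n g h|n g] x /=; [case: (hG n)|].
by exists a; split.
Qed.

End Actions.

Lemma presented_ind (S : choiceType) (rel : word S -> word S -> Prop)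
    (P : presented rel -> Prop) :
  P 1%g -> (forall x y, P x -> P y -> P (x * y)%g) -> (forall x, P x -> P x^-1%g) ->
  (forall s, P (presented_gen rel s)) -> forall x, P x.
Proof.
move=> P1 PM PV Pg x; rewrite -(word_reprK x); elim: (word_repr x) => [|[s b] w IH].
  exact: P1.
rewrite -cat1s -mul_word_class; apply: PM => //; case: b; first exact: Pg.
have -> : word_class rel [:: (s, false)] = (presented_gen rel s)^-1%g.
  by apply/esym; exact: (word_class_inv rel [:: (s, true)]).
exact: PV.
Qed.

(** Dependent choice through a family of types, needed because the actions of the successive groups
    [tower_G n] have different types. *)
Lemma dependent_sequence (A : nat -> Type) (P : forall n, A n -> Prop)
    (Rl : forall n, A n -> A n.+1 -> Prop) : (exists a, P 0%N a) ->
  (forall n a, P n a -> exists a', P n.+1 a' /\ Rl n a a') ->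
  exists f : forall n, A n, (forall n, P n (f n)) /\ forall n, Rl n (f n) (f n.+1).
Proof.
move=> e0 eS; pose nxt n (a : {a | P n a}) := cid (eS n (sval a) (svalP a)).
pose F := fix F n : {a | P n a} := match n with
  | 0 => cid e0
  | n'.+1 => exist _ (sval (nxt n' (F n'))) (svalP (nxt n' (F n'))).1
  end.
exists (fun n => sval (F n)); split=> n; first exact: svalP.
exact: (svalP (nxt n (F n))).2.
Qed.

(** * Generators of the tower group and the extension of actions *)

Section TowerGroup.
Variables (Q : nat -> finGroupType) (iota : forall n, {multiplicative Q n -> Q n.+1}).
Variable k : nat -> nat.
Local Notation G := (tower_group iota k).

Definition union_in n (x : tower_G iota k n) : G :=
  presented_gen (union_rel (tower_emb iota k)) (Tagged (tower_G iota k) x).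

Definition tower_in n (x : tower_H Q k n) : G := union_in (projT2 (tower iota k n) x).

Definition base_elt n (q : Q n) : G := tower_in (n := n) (q, 1%g).
Definition stable_letter n (j : 'I_(k n)) : G := tower_in (n := n) (1%g, presented_gen _ j).

Lemma union_inM n : {morph @union_in n : x y / (x * y)%g}.
Proof.
move=> x y; rewrite /union_in /presented_gen mul_word_class.
by apply/word_classP/word_eq_sym/word_eq_rel; exact: union_mul.
Qed.

Lemma union_in_emb n x : union_in (tower_emb iota k n x) = union_in x.
Proof.
by apply/word_classP/word_eq_sym/word_eq_rel; exact: union_emb.
Qed.

Lemma tower_inM n : {morph @tower_in n : x y / (x * y)%g}.
Proof. by move=> x y; rewrite /tower_in gmulfM union_inM. Qed.

Lemma base_eltM n : {morph @base_elt n : x y / (x * y)%g}.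
Proof. by move=> x y; rewrite /base_elt -tower_inM; congr tower_in; congr pair; rewrite mulg1. Qed.

Lemma base_elt1 n : base_elt (1%g : Q n) = 1%g.
Proof. by apply: (@mulgI _ (base_elt (1%g : Q n))); rewrite -base_eltM !mulg1. Qed.

Lemma base_elt_iota n q : base_elt (iota n q) = base_elt q.
Proof.
rewrite /base_elt /tower_in -[in RHS]union_in_emb; congr union_in.
by apply/word_classP/word_eq_sym/word_eq_rel; exact: (amalgam_glue _ _ q).
Qed.

Lemma stable_letter_comm n (j : 'I_(k n)) (q : Q n) :
  (stable_letter j * base_elt q = base_elt q * stable_letter j)%g.
Proof.
rewrite /stable_letter /base_elt -!tower_inM; congr tower_in.
by congr pair; rewrite ?mul1g ?mulg1.
Qed.

Lemma tower_group_ind (P : G -> Prop) :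
  P 1%g -> (forall x y, P x -> P y -> P (x * y)%g) -> (forall x, P x -> P x^-1%g) ->
  (forall n (q : Q n), P (base_elt q)) -> (forall n (j : 'I_(k n)), P (stable_letter j)) ->
  forall x, P x.
Proof.
move=> P1 PM PV Pq Ps.
have morph1 (A : groupType) (f : A -> G) : {morph f : x y / (x * y)%g} -> f 1%g = 1%g.
  by move=> fM; apply: (@mulgI _ (f 1%g)); rewrite -fM !mulg1.
have morphV (A : groupType) (f : A -> G) x : {morph f : x y / (x * y)%g} -> f x^-1%g = (f x)^-1%g.
  by move=> fM; apply: (@mulgI _ (f x)); rewrite -fM !mulgV morph1.
have PH n (x : tower_H Q k n) : P (tower_in x).
  case: x => q f; have -> : (q, f) = ((q, 1%g) * (1%g, f))%g :> tower_H Q k n.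
    by congr pair; rewrite ?mulg1 ?mul1g.
  rewrite tower_inM; apply: (PM _ _); first exact: Pq.
  have M2 : {morph (fun f : free_group (k n) => tower_in (n := n) (1%g, f)) : x y / (x * y)%g}.
    by move=> x y; rewrite -tower_inM; congr tower_in; congr pair; rewrite mul1g.
  elim/presented_ind: f => [|x y Px Py|x Px|j].
  - by rewrite (morph1 _ _ M2).
  - by rewrite M2; exact: PM.
  - by rewrite (morphV _ _ x M2); exact: PV.
  - exact: Ps.
have PG n (x : tower_G iota k n) : P (union_in x).
  elim: n x => [x|n IH x]; first exact: (PH 0%N).
  elim/presented_ind: x => [|x y Px Py|x Px|[b|c]].
  - by rewrite (morph1 _ _ (@union_inM n.+1)).
  - by rewrite (@union_inM n.+1); exact: PM.
  - by rewrite (morphV _ _ x (@union_inM n.+1)); exact: PV.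
  - by rewrite -/(amalgam_inl _ _ b) -/(tower_emb iota k n b) union_in_emb.
  - exact: (PH n.+1 c).
by elim/presented_ind => // -[n x]; exact: PG.
Qed.

(** Universal properties of product, amalgam and union: on [H n] the two factors commute by [comm],
    in the amalgam the actions agree over [Q n] by [eQ], and each new action is chosen to extend the
    previous one. *)
Lemma tower_group_act T (aQ : forall n, Q n -> T -> T) (s si : forall n, 'I_(k n) -> T -> T) :
  (forall n, is_act (@aQ n)) -> (forall n q x, aQ n.+1 (iota n q) x = aQ n q x) ->
  (forall n j x, si n j (s n j x) = x) -> (forall n j x, s n j (si n j x) = x) ->
  (forall n j q x, s n j (aQ n q x) = aQ n q (s n j x)) ->
  exists a : G -> T -> T, [/\ is_act a, forall n q x, a (@base_elt n q) x = aQ n q x &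
    forall n j x, a (@stable_letter n j) x = s n j x].
Proof.
move=> hQ eQ K1 K2 comm.
have freeE n : exists b : free_group (k n) -> T -> T, is_act b /\
    forall j x, b (presented_gen _ j) x = s n j x.
  by apply: (presented_act (K1 n) (K2 n)).
have {freeE} HE n : exists aH : tower_H Q k n -> T -> T, [/\ is_act aH,
    forall q x, aH (Q_to_H Q k n q) x = aQ n q x &
    forall j x, aH (1%g, presented_gen _ j) x = s n j x].
  have [b [hb bE]] := freeE n.
  have bcomm f q x : b f (aQ n q x) = aQ n q (b f x).
    elim/presented_ind: f q x => [q x|f f' IH IH' q x|f IH q x|j q x].
    - by case: (hb) => b1 _; rewrite !b1.
    - by case: (hb) => _ bM; rewrite !bM IH' IH.
    - rewrite -{1}(is_actVK f x hb) -IH; exact: is_actV.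
    - by rewrite !bE comm.
  exists (fun (p : tower_H Q k n) x => aQ n p.1 (b p.2 x)); split.
  - exact: (product_act (hQ n) hb bcomm).
  - by move=> q x /=; case: hb => -> _.
  - by move=> j x /=; case: (hQ n) => -> _; exact: bE.
have [aH HH] : exists aH : forall n, tower_H Q k n -> T -> T, forall n, [/\ is_act (@aH n),
    forall q x, aH n (Q_to_H Q k n q) x = aQ n q x &
    forall j x, aH n (1%g, presented_gen _ j) x = s n j x].
  exists (fun n => sval (cid (HE n))) => n; exact: (svalP (cid (HE n))).
have [|n a [ha aE]|aG [aGP aG_emb]] := @dependent_sequence
  (fun n => tower_G iota k n -> T -> T)
  (fun n a => is_act a /\ forall p x, a (projT2 (tower iota k n) p) x = aH n p x)
  (fun n a a' => forall p x, a' (tower_emb iota k n p) x = a p x).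
- by exists (aH 0%N); split=> //; have [] := HH 0%N.
- have [h1 h2 _] := HH n; have [h3 h4 _] := HH n.+1.
  have [|a' [ha' aB aC]] := @amalgam_act T _ _ _ (projT2 (tower iota k n) \o Q_to_H Q k n)
    (Q_to_HS iota k n) _ _ ha h3.
    by move=> q x; rewrite /= aE h2 h4 eQ.
  by exists a'.
have [a [ha aE]] := union_act (fun n => (aGP n).1) aG_emb.
exists a; split=> // [n q x|n j x].
  have [_ h _] := HH n; rewrite /base_elt /tower_in /union_in aE.
  by have [_ ->] := aGP n; exact: h.
have [_ _ h] := HH n; rewrite /stable_letter /tower_in /union_in aE.
by have [_ ->] := aGP n; exact: h.
Qed.

End TowerGroup.

(** * Freeness *)

Lemma ae_conull (K : realType) d (T : measurableType d) (mu : probability T K) (X : set T)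
    (P : T -> Prop) : measurable X -> prm mu (~` X) = 0%R -> (forall x, X x -> P x) ->
  {ae mu, forall x, P x}.
Proof.
move=> mX X0 XP; exists (~` X); split; first exact: measurableC.
  by have -> := prE mu (measurableC mX); rewrite X0.
by move=> x nP Xx; apply: nP; exact: XP.
Qed.

Section TowerAction.
Context {K : realType} {d : measure_display} {T : measurableType d}.
Context {mu : probability T K} (r : enumrel mu).
Variables (Q : nat -> finGroupType) (iota : forall n, {multiplicative Q n -> Q n.+1}).
Variable k : nat -> nat.
Variables (X : set T) (F E : T -> T -> Prop) (a : forall n, Q n -> T -> T).
Variables (s si : forall n, 'I_(k n) -> T -> T).
Variable cr : forall n, 'I_(k n) -> T -> T -> T -> T -> Prop.
Hypothesis ta : tower_action r iota X F E a s si cr.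
Local Notation R := (rel_of r).
Local Notation G := (tower_group iota k).
Variable A : G -> T -> T.
Hypotheses (hA : is_act A) (AQ : forall n q x, A (base_elt iota k (n := n) q) x = a q x)
  (AS : forall n j x, A (stable_letter iota (n := n) j) x = s j x).

Let is_act_a n : is_act (@a n).
Proof. by split; [exact: (ta_a1 ta)|exact: (ta_aM ta)]. Qed.

Let inverse g (b c : T -> T) x : (forall x, A g x = b x) -> (forall x, b (c x) = x) ->
  A g^-1%g x = c x.
Proof. by move=> e bc; rewrite -{1}(bc x) -e is_actV. Qed.

Let A_facts g : [/\ measurable_fun setT (A g), measurable_fun setT (A g^-1%g) &
  forall x, R x (A g x)].
Proof.
have A1 := hA.1; have AM := hA.2.
elim/tower_group_ind: g => [|g h [m1 m2 h1] [m3 m4 h2]|g [m1 m2 h]|n q|n j].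
- have e : A 1%g = id by apply/funext.
  by rewrite invg1 e; split=> // x; exact: rel_refl.
- have e : A (g * h)%g = A g \o A h by apply/funext => x; exact: AM.
  have e' : A (g * h)^-1%g = A h^-1%g \o A g^-1%g by apply/funext => x; rewrite invMg AM.
  rewrite e e'; split; try exact: measurableT_comp.
  by move=> x; exact: rel_trans (h2 x) (h1 _).
- rewrite invgK; split=> // x; apply: rel_sym.
  by have := h (A g^-1%g x); rewrite is_actVK.
- have e : A (base_elt iota k q) = a q by apply/funext.
  have e' : A (base_elt iota k q)^-1%g = a q^-1%g.
    apply/funext => x; apply: inverse => [y|y]; first exact: AQ.
    exact: (is_actVK q y (is_act_a n)).
  rewrite e e'; split; try exact: (ta_a_meas ta).
  by move=> x; apply: (ta_F_rel ta); exact: (ta_a_rel ta).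
- have e : A (stable_letter iota j) = s j by apply/funext.
  have e' : A (stable_letter iota j)^-1%g = si j.
    apply/funext => x; apply: inverse => [y|y]; first exact: AS.
    exact: (ta_siK ta).
  by rewrite e e'; split; [exact: (ta_s_meas ta)|exact: (ta_si_meas ta)|exact: (ta_s_rel ta)].
Qed.

Let AR g x : R x (A g x). Proof. by have [] := A_facts g. Qed.
Let AX g x : X x -> X (A g x). Proof. by apply: (ta_inv ta); exact: AR. Qed.

Lemma tower_pmp_action : pmp_action mu A.
Proof.
split; [exact: hA.1|exact: hA.2|by move=> g; have [] := A_facts g|].
move=> g B mB; have [_ m _] := A_facts g.
have inj : {in B &, injective (A g^-1%g)}.
  by move=> x y _ _ e; rewrite -(is_actVK g x hA) e is_actVK.
have [_ <-] := inj_image mB m inj (fun x _ => AR g^-1%g x).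
congr (mu _); apply/seteqP; split=> x.
  by move=> Bx; exists (A g x) => //; exact: is_actV.
by move=> [y By <-]; rewrite /preimage /= is_actVK.
Qed.

Lemma tower_orbits x y : X x -> (R x y <-> orbit_relation A x y).
Proof.
move=> Xx; split=> [xy|[g <-]]; last exact: AR.
have orb_sym u v : orbit_relation A u v -> orbit_relation A v u.
  by move=> [g <-]; exists g^-1%g; exact: is_actV.
have orb_trans u v w : orbit_relation A u v -> orbit_relation A v w -> orbit_relation A u w.
  by move=> [g <-] [h <-]; exists (h * g)%g; exact: hA.2.
have orbF u v : X u -> F u v -> orbit_relation A u v.
  by move=> Xu /(ta_a_trans ta Xu)[n [q <-]]; exists (base_elt iota k q).
have orbE u v n j u' v' : X u -> cr (n := n) j u' u v v' -> orbit_relation A u v.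
  move=> Xu c; have [u'u Euv vv'] := ta_cr_in ta c.
  have Xu' : X u' by apply: (ta_inv ta) Xu; apply: rel_sym; exact: (ta_F_rel ta).
  apply: (orb_trans _ u'); first by apply: orb_sym; exact: orbF.
  apply: (orb_trans _ v'); first by exists (stable_letter iota j); rewrite AS (ta_cr_s ta Xu' c).
  apply: orb_sym; apply: orbF vv'; apply: (ta_inv ta) Xu; exact: (ta_E_rel ta).
suff : (X x <-> X y) /\ (X x -> orbit_relation A x y) by move=> [_]; exact.
have step u v : R u v -> (X u <-> X v).
  by move=> uv; split; apply: (ta_inv ta) => //; exact: rel_sym.
elim: (ta_gen ta Xx xy) => [u v [uv|uv]|u|u v _ [e h]|u v w _ [e1 h1] _ [e2 h2]].
- by split; [apply: step; exact: (ta_F_rel ta)|move=> Xu; exact: orbF].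
- have euv := step _ _ (ta_E_rel ta uv); split=> // Xu.
  have [[n [j [u' [v' c]]]]|[n [j [u' [v' c]]]]] := ta_cr_edge ta Xu uv; first exact: orbE c.
  by apply: orb_sym; apply: orbE c; rewrite -euv.
- by split=> // _; exists 1%g; exact: hA.1.
- by split; [rewrite e|move=> Xv; apply: orb_sym; apply: h; rewrite e].
- by split; [rewrite e1|move=> Xu; apply: orb_trans (h1 Xu) _; apply: h2; rewrite -e1].
Qed.

Local Notation base := {n & Q n}.
Local Notation letter := {n & 'I_(k n)}.
Local Notation syllable := (letter * bool * base)%type.

Let bs (h : base) : G := base_elt iota k (tagged h).
Let st (l : letter) (e : bool) : G :=
  if e then stable_letter iota (tagged l) else (stable_letter iota (tagged l))^-1%g.

(** Words alternating between base elements and signed stable letters. No normal form is demanded,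
    since only the number of letters will matter. *)
Fixpoint spell (h : base) (l : seq syllable) : G :=
  if l is (t, e, h') :: l' then (bs h * (st t e * spell h' l'))%g else bs h.

Let base_upto n N (q : Q n) : (n <= N)%N ->
  base_elt iota k (upto iota n N q) = base_elt iota k q.
Proof.
elim: N => [|N IH].
  by rewrite leqn0 => /eqP e; rewrite -e upto_id.
rewrite leq_eqVlt => /orP[/eqP e|nN]; first by rewrite -e upto_id.
by rewrite uptoS// base_elt_iota IH.
Qed.

Let bs_mul h h' : exists h'', (bs h * bs h')%g = bs h''.
Proof.
case: h h' => n q [m p]; pose N := maxn n m.
exists (Tagged (fun n => Q n) (upto iota n N q * upto iota m N p)%g).
rewrite /bs /= base_eltM !base_upto ?leq_maxl ?leq_maxr//.
Qed.

Let bsV n (q : Q n) : (base_elt iota k q)^-1%g = base_elt iota k q^-1%g.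
Proof.
apply: (@mulgI _ (base_elt iota k q)); rewrite mulgV -base_eltM mulgV base_elt1//.
Qed.

Let spelled m g := exists h l, (size l <= m)%N /\ spell h l = g.

Let spelled_base m h g : spelled m g -> spelled m (bs h * g)%g.
Proof.
move=> [h' [l [sl <-]]]; have [h'' e] := bs_mul h h'; exists h'', l; split=> //.
by case: l sl => [|[[t b] h1] l] _ /=; rewrite ?mulgA e.
Qed.

Let spelled_letter m t e g : spelled m g -> spelled m.+1 (st t e * g)%g.
Proof.
move=> [h [l [sl <-]]]; exists (Tagged (fun n => Q n) (1%g : Q 0%N)), ((t, e, h) :: l).
by split=> //=; rewrite /bs /= base_elt1 mul1g.
Qed.

(** Left multiplication by a generator or its inverse adds at most one letter; [P] carries both so
    that the induction passes through inverses. *)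
Let spelled_all g : exists m, spelled m g.
Proof.
pose P g := (forall g', (exists m, spelled m g') -> exists m, spelled m (g * g')%g) /\
  (forall g', (exists m, spelled m g') -> exists m, spelled m (g^-1 * g')%g).
suff Pg : P g.
  have := Pg.1 1%g; rewrite mulg1; apply; exists 0%N.
  exists (Tagged (fun n => Q n) (1%g : Q 0%N)), [::]; split=> //.
  by rewrite /= /bs base_elt1.
have Pb n (q : Q n) g' : (exists m, spelled m g') ->
    exists m, spelled m (base_elt iota k q * g')%g.
  by move=> [m h]; exists m; exact: (spelled_base (Tagged (fun n => Q n) q) h).
elim/tower_group_ind: g => [|g h [p1 p2] [p3 p4]|g [p1 p2]|n q|n j].
- by split=> g' h; rewrite ?invg1 mul1g.
- by split=> g' hg'; rewrite ?invMg -mulgA; [apply: p1; exact: p3|apply: p4; exact: p2].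
- by split=> // g'; rewrite invgK; exact: p1.
- by split=> g' h; [exact: Pb|rewrite bsV; exact: Pb].
- split=> g' [m h]; exists m.+1.
    exact: (spelled_letter (Tagged (fun n => 'I_(k n)) j) true h).
  exact: (spelled_letter (Tagged (fun n => 'I_(k n)) j) false h).
Qed.

(* [crosses t e z (p, q)]: the letter [t] with sign [e] moves [z] across the
   edge from [q] to [p]. *)
Let crosses (t : letter) (e : bool) z (pq : T * T) : Prop :=
  if e then exists g u v, [/\ cr (tagged t) u pq.2 pq.1 v, z = a (n := tag t) g u &
    A (st t true) z = a g v]
  else exists g u v, [/\ cr (tagged t) u pq.1 pq.2 v, z = a (n := tag t) g v &
    A (st t false) z = a g u].

Let crosses_ex t e z : X z -> exists pq, crosses t e z pq.
Proof.
case: e => Xz.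
  have [g [u [x1 [y1 [v [c e1 e2]]]]]] := ta_cross ta (tagged t) Xz.
  by exists (y1, x1), g, u, v; split=> //; rewrite /st AS.
have Xz' : X (A (st t false) z) by exact: AX.
have [g [u [x1 [y1 [v [c e1 e2]]]]]] := ta_cross ta (tagged t) Xz'.
exists (x1, y1), g, u, v; split=> //; rewrite -e2 -AS.
exact/esym/(is_actVK (stable_letter iota (tagged t)) z hA).
Qed.

Let crosses_conn t e z pq : crosses t e z pq ->
  [/\ conn F (A (st t e) z) pq.1, E pq.1 pq.2 & conn F pq.2 z].
Proof.
have step n (q : Q n) x y : F x y -> conn F (a q x) y.
  move=> xy; apply: (conn_trans (y := x)); last exact: conn_step.
  by apply: conn_sym; apply: conn_step; exact: (ta_a_rel ta).
case: e => -[g [u [v [c ez ->]]]]; have [ux xy yv] := ta_cr_in ta c.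
- split; [|exact: (ta_edge_sym ta)|].
    by apply: step; have [_ _ Fs] := ta_equiv ta; exact: Fs.
  by rewrite ez; apply: conn_sym; exact: step.
- split=> //; first exact: step.
  by rewrite ez; apply: conn_sym; apply: step; have [_ _ Fs] := ta_equiv ta; exact: Fs.
Qed.

(** [es] records the edge crossed by each letter in the order of spelling, that is, from the end
    point [y] back to [x]. *)
Fixpoint trace h (l : seq syllable) (es : seq (T * T)) y x : Prop :=
  match l, es with
  | [::], [::] => y = A (bs h) x
  | (t, e, h') :: l', pq :: es' => exists z,
      [/\ y = A (bs h) (A (st t e) z), crosses t e z pq & trace h' l' es' z x]
  | _, _ => False
  end.

Let trace_ex h l x : X x -> exists es, trace h l es (A (spell h l) x) x.
Proof.
move=> Xx; elim: l h => [|[[t e] h'] l IH] h; first by exists [::].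
have [es tr] := IH h'; have [pq c] := crosses_ex t e (AX (spell h' l) Xx).
exists (pq :: es); exists (A (spell h' l) x); split=> //.
by rewrite /= !hA.2.
Qed.

Let base_conn h x : conn F (A (bs h) x) x.
Proof. by apply: conn_sym; apply: conn_step; rewrite /bs AQ; exact: (ta_a_rel ta). Qed.

Let trace_chain h l es y x : trace h l es y x -> chain F E y es x.
Proof.
elim: l h es y => [|[[t e] h'] l IH] h [|pq es] y //=; first by move=> ->; exact: base_conn.
move=> [z [-> /crosses_conn[c1 c2 c3] /IH tr]]; split=> //.
  exact: conn_trans (base_conn _ _) c1.
case: es tr => [|pq' es] /=; first exact: conn_trans.
by move=> [c4 c5 c6]; split=> //; exact: conn_trans c4.
Qed.

Let trace_split h l es1 e1 e2 es2 y x : X y -> trace h l (es1 ++ e1 :: e2 :: es2) y x ->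
  exists l1 t1 b1 h1 t2 b2 h2 l2 z1 z2, l = l1 ++ (t1, b1, h1) :: (t2, b2, h2) :: l2 /\
  [/\ X z1, crosses t1 b1 z1 e1, crosses t2 b2 z2 e2 & z1 = A (bs h1) (A (st t2 b2) z2)].
Proof.
elim: es1 h l y => [|e es1 IH] h [|[[t b] h'] l] y Xy //=.
  case: l => [|[[t2 b2] h2] l] [z1 [ey c1 tr]] //.
  have [z2 [ez c2 _]] := tr; exists [::], t, b, h', t2, b2, h2, l, z1, z2; split=> //; split=> //.
  rewrite -(is_actV (st t b) z1 hA) -(is_actV (bs h) (A _ z1) hA) -ey; do 2 apply: AX.
  exact: Xy.
move=> [z [ey c tr]].
have Xz : X z.
  rewrite -(is_actV (st t b) z hA) -(is_actV (bs h) (A _ z) hA) -ey; do 2 apply: AX.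
  exact: Xy.
have [l1 [t1 [b1 [h1 [t2 [b2 [h2 [l2 [z1 [z2 [-> H]]]]]]]]]]] := IH _ _ _ Xz tr.
by exists ((t, b, h') :: l1), t1, b1, h1, t2, b2, h2, l2, z1, z2.
Qed.

Let bs_free h x : X x -> A (bs h) x = x -> bs h = 1%g.
Proof.
by case: h => n q Xx; rewrite /bs AQ /= => /(ta_a_free ta Xx) ->; exact: base_elt1.
Qed.

(* A stable letter cannot be crossed back through the same edge unless the
   element in between lies in the subgroup that commutes with it. *)
Let pinch t1 b1 z1 t2 b2 z2 h p q : X z1 -> crosses t1 b1 z1 (p, q) ->
  crosses t2 b2 z2 (q, p) -> z1 = A (bs h) (A (st t2 b2) z2) ->
  (st t1 b1 * (bs h * st t2 b2))%g = bs h.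
Proof.
have main n (j : 'I_(k n)) (g1 g2 : Q n) u : X u -> a g1 u = A (bs h) (a g2 u) ->
    (stable_letter iota j * bs h = bs h * stable_letter iota j)%g.
  move=> Xu e.
  have [h' eh'] := bs_mul h (Tagged (fun n => Q n) g2).
  have [h'' eh''] := bs_mul (Tagged (fun n => Q n) g1^-1%g) h'.
  have : A (bs h'') u = u.
    rewrite -eh'' -eh' !hA.2 (AQ g2) -e (AQ g1^-1%g).
    exact: (is_actV g1 u (is_act_a n)).
  move=> /(bs_free Xu); rewrite -eh'' -eh' /bs /= -/(bs h) -bsV => e1.
  (* [bs h] carries one [Q n]-translate of [u] to another, so by freeness it lies in [Q n], whose
     elements commute with the letter. *)
  have -> : bs h = base_elt iota k (g1 * g2^-1)%g.
    by rewrite base_eltM -bsV; apply: (canRL (mulgK _)); rewrite -[LHS](mulVKg (base_elt iota k g1)) e1 mulg1.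
  exact: stable_letter_comm.
case: t1 t2 => [n1 j1] [n2 j2].
(* Equal signs would mean that one edge serves letters in both orientations, against [ta_cr_asym];
   for opposite signs [ta_cr_uniq] gives the same letter with the same end points. *)
case: b1; case: b2 => Xz /= [g1 [u1 [v1 [c1 ez1 _]]]] [g2 [u2 [v2 [c2 ez2 ea]]]].
- by case: (ta_cr_asym ta c1 c2).
- have [ej eu _] := ta_cr_uniq ta c1 c2.
  have en : n1 = n2 := congr1 (@tag _ _) ej; subst n2.
  have {}ej : j1 = j2 by exact: eq_from_Tagged ej. subst j2 u2.
  rewrite ea ez1 => e.
  have Xu : X u1.
    by apply: (ta_inv ta) Xz; rewrite ez1; apply: rel_sym; apply: (ta_F_rel ta); exact: (ta_a_rel ta).
  by rewrite /st /= mulgA (main _ _ _ _ _ Xu e) -mulgA mulgV mulg1.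
- have [ej _ ev] := ta_cr_uniq ta c1 c2.
  have en : n1 = n2 := congr1 (@tag _ _) ej; subst n2.
  have {}ej : j1 = j2 by exact: eq_from_Tagged ej. subst j2 v2.
  rewrite ea ez1 => e.
  have Xv : X v1.
    by apply: (ta_inv ta) Xz; rewrite ez1; apply: rel_sym; apply: (ta_F_rel ta); exact: (ta_a_rel ta).
  by rewrite /st /= -(main _ _ _ _ _ Xv e) mulgA mulVg mul1g.
- by case: (ta_cr_asym ta c1 c2).
Qed.

(** Induction on the number of stable letters. The edges crossed on the way from [A g x = x] back to
    [x] form a closed chain, which backtracks; by [pinch] the two letters responsible cancel, giving
    a spelling with two letters fewer. *)
Lemma tower_free x g : X x -> A g x = x -> g = 1%g.
Proof.
move=> Xx; have [m] := spelled_all g; have [n] := ubnP m; elim: n m g => // n IH m g mn.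
move=> [h [l [sl eg]]] egx.
case: (posnP (size l)) => [/size0nil el|l0].
  by rewrite -eg el /= in egx *; exact: bs_free egx.
have [es tr] := trace_ex h l Xx; rewrite eg egx in tr.
have es0 : es <> [::].
  by case: l l0 tr {sl eg} => [//|[[t e] h'] l] _; case: es.
have [es1 [p [q [es2 ees]]]] := chain_backtrack (ta_bridges ta) (ta_edge_sym ta)
  (trace_chain tr) (conn_refl F x) es0.
rewrite ees in tr.
have [l1 [t1 [b1 [h1 [t2 [b2 [h2 [l2 [z1 [z2 [el [Xz1 c1 c2 ez]]]]]]]]]]]] := trace_split Xx tr.
have pin := pinch Xz1 c1 c2 ez.
have short h0 : spelled (size l1 + size l2) (spell h0 (l1 ++ (t1, b1, h1) :: (t2, b2, h2) :: l2)).
  elim: (l1) h0 => [|[[t e] h'] l1' IHl] h0 /=.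
    rewrite (mulgA (bs h1)) (mulgA (st t1 b1)) pin.
    by apply: spelled_base; apply: spelled_base; exists h2, l2.
  by rewrite addSn; apply: spelled_base; apply: spelled_letter; exact: IHl.
apply: (IH (size l1 + size l2)%N) => //; last by rewrite -eg el.
rewrite el size_cat /= !addnS in sl.
by apply: leq_trans (ltnW sl) _; rewrite -ltnS.
Qed.

End TowerAction.

(** * Free actions of the tower group with prescribed orbits *)

Section Main.
Variables (K : realType) (Q : nat -> finGroupType).
Variable iota : forall n, {multiplicative Q n -> Q n.+1}.
Variable k : nat -> nat.
Hypotheses (Q0 : #|Q 0%N| = 1%N) (iota_inj : forall n, injective (iota n)).
Hypothesis Q_infty : (fun n => #|Q n|) @ \oo --> \oo.
Local Open Scope ereal_scope.

Let series0 : 0 <= \sum_(0 <= r <oo) ((k r)%:R / (#|Q r|)%:R : K)%R%:E.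
Proof. by apply: nneseries_ge0 => n _ _; rewrite lee_fin divr_ge0. Qed.

Lemma tower_free_action d (T : measurableType d) (mu : probability T K) (E : T -> T -> Prop) :
  standard_borel K T -> ergodic mu E -> treeable mu E ->
  cost mu E = 1 + \sum_(0 <= r <oo) ((k r)%:R / (#|Q r|)%:R)%R%:E ->
  exists A : tower_group iota k -> T -> T,
    [/\ pmp_action mu A, free_action mu A & ae_same mu E (orbit_relation A)].
Proof.
move=> sb erg [Phi gr tr] eC.
have c1 : 1 <= cost mu E by rewrite eC leeDl.
have [r [X0 [E0 [Us [[atomless ergR sk] [mUs UsT UsI Us_gen] massE0 EX]]]]] :=
  treeable_skeleton erg gr tr sb c1.
have Qinf M : exists n0, forall n, (n0 <= n)%N -> (M <= #|Q n|)%N.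
  have [n0 _ h] := Q_infty (nbhs_infty_ge M).
  by exists n0 => n hn; exact: (h n hn).
have [X [F [E' [act [ts mE']]]]] := limit_skeleton atomless ergR Q0 iota_inj Qinf
  mUs UsT UsI Us_gen sk.
have massE : mass r E' = \sum_(n <oo) ((k n)%:R / #|Q n|%:R)%R%:E +
    \sum_(n <oo) ((k n)%:R / #|Q n|%:R)%R%:E.
  (* [mass r E' + 2] is twice [1 + S], and the 2 cancels also when the series diverges. *)
  move: mE'; rewrite massE0 eC; have := mass_ge0 r E'; move: series0.
  set S := \sum_(0 <= n <oo) _; case: (mass r E') => [m| |] //; case: S => [v| |] //.
  rewrite -!EFinD => _ _ [] e; congr EFin; move: e; lra.
have [X2 [a [s [si [cr ta]]]]] := assembly atomless ts massE.
have [A [hA AQ AS]] := tower_group_act (aQ := a) (s := s) (si := si)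
  (fun n => conj (@ta_a1 _ _ _ _ _ _ _ _ _ _ _ _ _ _ _ ta n) (@ta_aM _ _ _ _ _ _ _ _ _ _ _ _ _ _ _ ta n))
  (ta_a_iota ta) (ta_sK ta) (ta_siK ta) (ta_comm ta).
exists A; split.
- exact: (tower_pmp_action ta hA AQ AS).
- apply: (ae_conull (ta_meas ta) (ta_conull ta)) => x Xx g.
  exact: (tower_free ta hA AQ AS).
- have mXX : measurable (X2 `&` X0) by apply: measurableI; [exact: ta_meas ta|exact: sk_meas sk].
  apply: (ae_conull mXX).
    rewrite setCI; apply/eqP; rewrite eq_le pr_ge0 andbT.
    apply: (le_trans (prU_le mu _ _)); try apply: measurableC.
    + exact: (ta_meas ta).
    + exact: (sk_meas sk).
    + by rewrite (ta_conull ta) (sk_conull sk) addr0.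
  move=> x [X2x X0x] y; rewrite EX//; exact: (tower_orbits ta hA AQ AS).
Qed.

End Main.

Local Open Scope ereal_scope.

Theorem theorem3p7 (K : realType)
    (Q : nat -> finGroupType) (iota : forall n, {multiplicative Q n -> Q n.+1})
    (k : nat -> nat)
    (Q0_trivial : #|Q 0%N| = 1%N)
    (iota_inj : forall n, injective (iota n))
    (Q_infty : (fun n => #|Q n|) @ \oo --> \oo) :
  (forall (d : measure_display) (T : measurableType d) (mu : probability T K)
      (E : T -> T -> Prop),
      standard_borel K T -> pmp_equivalence mu E -> ergodic mu E ->
      treeable mu E ->
      cost mu E = 1 + \sum_(0 <= r <oo) ((k r)%:R / (#|Q r|)%:R)%R%:E ->
      exists a : tower_group iota k -> T -> T,
        pmp_action mu a /\ ae_same mu E (orbit_relation a)) /\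
  OE_free K (tower_group iota k).
Proof.
split=> [d T mu E sb _ erg tr eC|].
  have [a [pa _ ea]] := tower_free_action Q0_trivial iota_inj Q_infty sb erg tr eC.
  by exists a.
exists (1 + \sum_(0 <= r <oo) ((k r)%:R / (#|Q r|)%:R)%R%:E).
  by rewrite leeDl// nneseries_ge0// => n _ _; rewrite lee_fin divr_ge0.
move=> d T mu E sb _ erg tr eC.
exact: (tower_free_action Q0_trivial iota_inj Q_infty sb erg tr eC).
Qed.
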